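(* For every $n\ge0$ the following hold, where in each group $N_i=N(i,11,11n+m)$ and $M_i=M(i,11,11n+m)$ for the indicated residue $m$. $m=0$: $N_0+2N_1+M_1\ge 2N_2+N_4+M_0$; $N_0+2N_1+3N_2+M_1\ge 3N_3+3N_5+M_0$; $2N_2+N_3+N_5\ge 4N_4$; $N_2+5N_3+3N_4+M_0\ge N_0+2N_1+6N_5+M_1$. $m=1$: $N_0+4N_2+N_4+M_0\ge 2N_1+3N_3+N_5+M_2$; $N_0+3N_1+6N_3+M_0\ge 4N_2+6N_4+M_2$; $2N_1+6N_4\ge N_2+3N_3+4N_5$; $N_1+2N_2+3N_5+3M_2\ge N_0+N_3+4N_4+2M_0+M_1$; $3N_2+2N_3+N_4+3M_2\ge N_0+N_1+4N_5+2M_0+M_1$. $m=2$: $3N_2+N_4\ge 2N_0+2N_5$; $2N_1+2N_3+N_5+2M_0\ge 2N_2+3N_4+2M_2$; $3N_0+2N_2+M_2\ge N_1+N_3+3N_5+M_0$; $2N_0+N_1+N_3+3N_4+M_0\ge 4N_2+3N_5+M_2$; $N_0+3N_1+N_2+8N_5+3M_0\ge 8N_3+5N_4+3M_2$. $m=3$: $N_0+2N_3+M_1\ge N_1+2N_5+M_0$; $5N_1+2N_2+2N_4\ge 2N_0+4N_3+3N_5$; $2N_0+4N_3+N_5+M_0\ge N_1+3N_2+3N_4+M_1$; $6N_2+3N_5+5M_1\ge N_0+N_1+2N_3+5N_4+5M_0$; $4N_0+2N_1+4N_4+3M_0\ge 7N_2+3N_3+3M_1$. $m=4$: $4N_1+3N_3+5M_1\ge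 2N_0+3N_2+N_4+N_5+5M_0$; $4N_0+5N_2+3M_0\ge 5N_1+2N_3+N_4+N_5+3M_1$; $3N_1+N_2+M_0\ge 2N_0+2N_3+M_1$; $3N_0+N_4+N_5+M_1\ge 3N_2+2N_3+M_0$. $m=5$: $3N_0+N_2+N_5+2M_2\ge 2N_1+3N_3+2M_0$; $7N_1+N_4+3M_2\ge 3N_0+2N_2+N_3+2N_5+3M_0$; $2N_0+N_2+3N_3+N_5+4M_0\ge 3N_1+4N_4+4M_2$; $4N_2+7N_3+2N_4\ge 4N_0+2N_1+7N_5$; $4N_1+N_2+2N_4+N_5+5M_2\ge 2N_0+6N_3+5M_0$. $m=7$: $N_0+2N_4+2M_0\ge 2N_3+N_5+2M_1$; $3N_0+N_1+N_2+7N_3+4N_5\ge 5N_4+4M_0+7M_1$; $4N_1+4N_2+3N_4+4M_1\ge 4N_0+6N_3+N_5+4M_0$; $N_0+5N_3+2N_4\ge 2N_1+2N_2+4N_5$. $m=8$: $N_0+2N_2+3N_4+5M_0\ge 3N_1+3N_5+5M_1$; $2N_1+4N_3+2N_5+3M_1\ge N_0+2N_2+5N_4+3M_0$; $2N_1+5N_2+2N_5+M_1\ge 3N_0+5N_3+N_4+M_0$; $7N_0+4N_1+5N_4+4N_5\ge 8N_2+N_3+4M_0+7M_1$; $5N_0+6N_1+4N_3+2N_4\ge N_2+5N_5+6M_0+5M_1$. $m=9$: $4N_2+M_0\ge 2N_1+N_3+N_4+M_1$; $4N_1+N_3+N_4\ge N_0+3N_2+2N_5$; $4N_0+3N_3+3N_4+4M_0\ge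 2N_1+5N_2+3N_5+4M_1$; $3N_1+4N_2+7N_5+3M_1\ge 2N_0+6N_3+6N_4+3M_0$. $m=10$: $3N_1+2N_5+2M_3\ge 2N_2+2N_3+N_4+2M_0$; $3N_0+N_2+N_3+M_0\ge 3N_1+2N_4+M_3$; $2N_1+4N_4+M_3\ge N_0+N_2+N_3+3N_5+M_0$; $6N_2+6N_3+6M_0+5M_3\ge 6N_0+6N_1+3N_4+8N_5$.
   Context: The rank of a partition is its largest part minus its number of parts; $N(a,r,n)$ is the number of partitions of $n$ whose rank is $\equiv a\pmod r$. The crank of a partition $\pi$: let $\lambda(\pi)$ be its largest part, $\omega(\pi)$ its number of parts equal to $1$, $\mu(\pi)$ its number of parts larger than $\omega(\pi)$; the crank is $\lambda(\pi)$ if $\omega(\pi)=0$ and $\mu(\pi)-\omega(\pi)$ otherwise. For $n\ge 2$, $M(m,n)$ is the number of partitions of $n$ with crank $m$; for $n\le1$ set $M(0,0)=1$, $M(0,1)=-1$, $M(1,1)=M(-1,1)=1$, and $M(m,n)=0$ otherwise. $M(a,r,n):=\sum_{m\equiv a\ (\mathrm{mod}\ r)}M(m,n)$. *)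

(* Defs.v *)
From mathcomp Require Import all_boot all_order all_algebra.
Set Implicit Arguments. Unset Strict Implicit. Unset Printing Implicit Defensive.
Import Order.TTheory GRing.Theory Num.Theory.
Local Open Scope ring_scope.

(* A partition of n is encoded as an n-tuple of integers in [0, n],
   nonincreasing and summing to n: its nonzero entries are the parts
   (a partition of n has at most n parts, each at most n), the trailing
   zeros are padding.  This encoding is a bijection with partitions of n. *)
Definition tseq (n : nat) (t : n.-tuple 'I_n.+1) : seq nat := [seq val i | i <- t].

Definition is_ptuple (n : nat) (t : n.-tuple 'I_n.+1) : bool :=
  sorted geq (tseq t) && (sumn (tseq t) == n)%N.

Definition pseq (n : nat) (t : n.-tuple 'I_n.+1) : seq nat :=
  filter (fun k => 0 < k)%N (tseq t).

Definition largest (s : seq nat) : nat := foldr maxn 0%N s.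

Definition rank (s : seq nat) : int := (largest s)%:Z - (size s)%:Z.

Definition crank (s : seq nat) : int :=
  let w := count_mem 1%N s in
  if w == 0%N then (largest s)%:Z
  else (count (fun k => w < k)%N s)%:Z - w%:Z.

Definition Nrk (a : int) (r n : nat) : int :=
  (#|[set t : n.-tuple 'I_n.+1 | is_ptuple t &&
        (rank (pseq t) == a %[mod r%:Z])%Z]|)%:Z.

(* M(m, n) with the conventional values for n <= 1 *)
Definition Mcr (m : int) (n : nat) : int :=
  if (2 <= n)%N then
    (#|[set t : n.-tuple 'I_n.+1 | is_ptuple t && (crank (pseq t) == m)]|)%:Z
  else if n == 0%N then (if m == 0 then 1 else 0)
  else (if m == 0 then -1 else if (m == 1) || (m == -1) then 1 else 0).

(* M(a, r, n) = sum_{m = a (mod r)} M(m, n) *)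
Definition Mrk (a : int) (r n : nat) : int :=
  if (2 <= n)%N then
    (#|[set t : n.-tuple 'I_n.+1 | is_ptuple t &&
        (crank (pseq t) == a %[mod r%:Z])%Z]|)%:Z
  else \sum_(m <- [:: -1; 0; 1]) (if (m == a %[mod r%:Z])%Z then Mcr m n else 0).

Definition NN (n m : nat) (i : int) : int := Nrk i 11 (11 * n + m).
Definition MM (n m : nat) (i : int) : int := Mrk i 11 (11 * n + m).

(* Submission.v *)
(* Write X = q^(1/2), p_a = sum over n = a mod 11 of (-1)^n q^(n(n-11)/2+15) (a theta function in
   q^11 and q^121, with J = (q^121; q^121)), om_a = p_(2a) / p_a and W = 1 + om_1 + ... + om_5.
   The Euler product is q^5 J W.  Multiplied by it, the series of the ranks congruent to b mod 11
   become differences of the bilateral sums S_b = sum (-1)^n q^(n(3n+1)/2+bn) / (1 - q^(11n)).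
   For a suitable c, partial fractions of theta quotients show that the pieces n = c-a, c, c+a mod 11
   of S_b satisfy S(c-a) + S(c+a) = om_a S(c) + a theta quotient, so S_b is W times the mock piece
   S(c) plus an explicit theta expression G_c; the cranks give such an expression directly, through
   (q) / ((xq)(q/x)) at eleventh roots of unity.
   The p_a are division values of a Tate curve with a point of order eleven: in the Tate parameters
   r, s every homogeneous identity between them becomes an identity of polynomials in r and s modulo
   the equation of X_1(11), and J^12 is recovered from the two-division polynomial.  Hence dividing
   G_c by W and W^2 by sum p_a x^a is a finite computation, graded by the exponents of q mod 11.
   In each combination of the theorem the mock piece cancels on the progression 11n+m, and what
   remains is 11 q^(...) J / prod theta(q^(11a))^(e_a) with sum e_a = 13.  Some e_a is at least 2,
   and J / theta^2 has nonnegative coefficients since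
   (1 - uv) / ((1 - u)(1 - v)) = 1 / (1 - u) + v / (1 - v). *)

Require Import Defs.
From HB Require Import structures.
From Stdlib Require Import BinInt.
From mathcomp Require Import all_boot all_order all_algebra.
From mathcomp Require Import boolp ring zify ssrZ algC cyclotomic.
Set Implicit Arguments. Unset Strict Implicit. Unset Printing Implicit Defensive.
Import Order.TTheory GRing.Theory Num.Theory.
Delimit Scope nat_scope with N.
Delimit Scope Z_scope with ZZ.
Delimit Scope int_scope with Z.
Local Open Scope ring_scope.

(** * Formal power series *)

(** Theta functions are handled without analysis: they are elements of a valued field, and an
    identity between them is the limit of a Lagrange interpolation formula on [2 L] consecutive
    translates of each pole, justified by a dominated convergence argument for the valuation. The
    square root of $q$ is taken because the half period $q^{121/2}$ is needed to relate $J^{12}$ to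
    the discriminant. The logarithmic derivatives [ell a] in $G_c$ are not visibly rational in the
    theta values; they become so because Jacobi's identity for the cube of the Euler product gives a
    dissection of $W^3$ in which each one sits alone in a class of exponents modulo 11. The mock
    pieces are never evaluated: each is homogeneous for these classes, so on a progression it is
    either absent or must have coefficient 0 in the combination. The rank series itself comes from a
    recurrence linking the partitions of rank at least $s$ and at least $s+3$, a consequence of the
    two q-Pascal rules. The argument is carried out over any field of characteristic 0 with a
    primitive eleventh root of unity and is applied to the algebraic numbers. *)

Record fps (F : fieldType) := Fps { coefs : nat -> F }.

Section FpsRing.
Variable F : fieldType.
Local Notation S := (fps F).
Implicit Types f g h : S.

HB.instance Definition _ := gen_eqMixin S.
HB.instance Definition _ := gen_choiceMixin S.

Lemma fpsP f g : coefs f =1 coefs g -> f = g.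
Proof. by case: f g => [f] [g] /= /funext ->. Qed.

Definition fps0 : S := Fps (fun=> 0).
Definition fpsopp f : S := Fps (fun n => - coefs f n).
Definition fpsadd f g : S := Fps (fun n => coefs f n + coefs g n).
Definition fpsC (a : F) : S := Fps (fun n => if n == 0%N then a else 0).
Definition fpsmul f g : S :=
  Fps (fun n => \sum_(i < n.+1) coefs f i * coefs g (n - i)).

(** The coefficient of degree [n] of a product involves degrees at most [n] only, so the ring laws
    are inherited from polynomials by truncation at [n.+1]. *)
Let tr N f : {poly F} := \poly_(i < N) coefs f i.

Let trE N f n : (n < N)%N -> (tr N f)`_n = coefs f n.
Proof. by move=> ltnN; rewrite coef_poly ltnN. Qed.

Let trM N f g n : (n < N)%N -> (tr N f * tr N g)`_n = coefs (fpsmul f g) n.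
Proof.
move=> ltnN; rewrite coefM; apply: eq_bigr => i _; have := ltn_ord i => lti.
by rewrite !trE //; lia.
Qed.

Lemma fpsaddA : associative fpsadd.
Proof. by move=> f g h; apply: fpsP => n /=; rewrite addrA. Qed.
Lemma fpsaddC : commutative fpsadd.
Proof. by move=> f g; apply: fpsP => n /=; rewrite addrC. Qed.
Lemma fpsadd0 : left_id fps0 fpsadd.
Proof. by move=> f; apply: fpsP => n /=; rewrite add0r. Qed.
Lemma fpsaddN : left_inverse fps0 fpsopp fpsadd.
Proof. by move=> f; apply: fpsP => n /=; rewrite addNr. Qed.

HB.instance Definition _ := GRing.isZmodule.Build S fpsaddA fpsaddC fpsadd0 fpsaddN.

Lemma fpsmulC : commutative fpsmul.
Proof.
by move=> f g; apply: fpsP => n; rewrite -!(@trM n.+1) // mulrC.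
Qed.
Lemma fpsmulA : associative fpsmul.
Proof.
move=> f g h; apply: fpsP => n; rewrite -!(@trM n.+1) // !coefM.
transitivity ((tr n.+1 f * (tr n.+1 g * tr n.+1 h))`_n).
  rewrite coefM; apply: eq_bigr => i _; have := ltn_ord i => lti.
  by congr (_ * _); rewrite trE ?trM //; lia.
rewrite mulrA coefM; apply: eq_bigr => i _; have := ltn_ord i => lti.
by congr (_ * _); rewrite trE ?trM //; lia.
Qed.
Lemma fpsmul1 : left_id (fpsC 1) fpsmul.
Proof.
move=> f; apply: fpsP => n /=.
rewrite big_ord_recl /= mul1r subn0 big1 ?addr0 // => i _.
by rewrite mul0r.
Qed.
Lemma fpsmulDl : left_distributive fpsmul fpsadd.
Proof.
move=> f g h; apply: fpsP => n /=; rewrite -big_split /=.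
by apply: eq_bigr => i _; rewrite mulrDl.
Qed.
Lemma fps1_neq0 : fpsC 1 != 0.
Proof.
apply/eqP => /(congr1 (fun f => coefs f 0)) /= /eqP; exact/negP/oner_neq0.
Qed.

HB.instance Definition _ := GRing.Zmodule_isComNzRing.Build S
  fpsmulA fpsmulC fpsmul1 fpsmulDl fps1_neq0.

Lemma coefsD f g n : coefs (f + g) n = coefs f n + coefs g n. Proof. by []. Qed.
Lemma coefsN f n : coefs (- f) n = - coefs f n. Proof. by []. Qed.
Lemma coefsB f g n : coefs (f - g) n = coefs f n - coefs g n. Proof. by []. Qed.
Lemma coefs0 n : coefs (0 : S) n = 0. Proof. by []. Qed.
Lemma coefs1 n : coefs (1 : S) n = (n == 0%N)%:R.
Proof. by rewrite /= /fpsC /=; case: eqP. Qed.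
Lemma coefsM f g n : coefs (f * g) n = \sum_(i < n.+1) coefs f i * coefs g (n - i).
Proof. by []. Qed.
Lemma coefsM0 f g : coefs (f * g) 0 = coefs f 0 * coefs g 0.
Proof. by rewrite coefsM big_ord_recl big_ord0 addr0. Qed.

Definition fX : S := Fps (fun n => (n == 1%N)%:R).

Lemma coefsXM f n : coefs (fX * f) n = if n is m.+1 then coefs f m else 0.
Proof.
rewrite coefsM; case: n => [|n]; first by rewrite big_ord_recl big_ord0 mul0r addr0.
rewrite 2!big_ord_recl /= mul0r add0r mul1r big1 ?addr0; last first.
  by move=> i _; rewrite mul0r.
by rewrite /bump /= subn1.
Qed.

Lemma coefsXnM f k n : coefs (fX ^+ k * f) n = if (k <= n)%N then coefs f (n - k) else 0.
Proof.
elim: k n => [|k IHk] n; first by rewrite expr0 mul1r subn0.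
rewrite exprS -mulrA coefsXM; case: n => // n.
Qed.

Definition zbelow N f := forall n, (n < N)%N -> coefs f n = 0.

Lemma zbelowP N f : zbelow N f -> f = fX ^+ N * Fps (fun n => coefs f (n + N)).
Proof.
move=> zf; apply: fpsP => n; rewrite coefsXnM; case: leqP => [leNn|/zf->//] /=.
by rewrite subnK.
Qed.

Lemma zbelowM M N f g : zbelow M f -> zbelow N g -> zbelow (M + N) (f * g).
Proof.
move=> zf zg n ltn; rewrite coefsM big1 // => i _.
case: (ltnP i M) => [/zf->|leMi]; first by rewrite mul0r.
by rewrite zg ?mulr0 //; have := ltn_ord i; lia.
Qed.

Lemma zbelowX k f : coefs f 0 = 0 -> zbelow k (f ^+ k).
Proof.
move=> f0; elim: k => [|k IHk] //; rewrite exprS.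
have zf : zbelow 1 f by case.
exact: zbelowM zf IHk.
Qed.

(* geometric series in [1 - f / f_0] *)
Definition fpsinv f : S :=
  if coefs f 0 == 0 then f else
  fpsC (coefs f 0)^-1 * Fps (fun n =>
     coefs (\sum_(k < n.+1) (1 - fpsC (coefs f 0)^-1 * f) ^+ k) n).

Lemma fpsCM a f n : coefs (fpsC a * f) n = a * coefs f n.
Proof.
rewrite coefsM big_ord_recl /= subn0 big1 ?addr0 // => i _.
by rewrite mul0r.
Qed.

Lemma fpsmulV f : coefs f 0 != 0 -> fpsinv f * f = 1.
Proof.
move=> f0; rewrite /fpsinv (negPf f0); set a := fpsC _; set g := 1 - a * f.
have g0 : coefs g 0 = 0 by rewrite coefsB coefs1 fpsCM mulVf // subrr.
rewrite mulrAC mulrC (_ : a * f = 1 - g); last by rewrite opprB addrCA subrr addr0.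
apply: fpsP => n; set s := Fps _.
(* The diagonal series [s] agrees up to degree [n] with the geometric sum of length [n.+1], because
   [g] has no constant term and its powers have growing order. *)
have -> : s = \sum_(k < n.+1) g ^+ k + fX ^+ n.+1 *
            Fps (fun m => coefs (s - \sum_(k < n.+1) g ^+ k) (m + n.+1)).
  rewrite -[LHS](subrK (\sum_(k < n.+1) g ^+ k)) addrC; congr (_ + _).
  apply: zbelowP => m ltmn; rewrite coefsB /=.
  rewrite (_ : n.+1 = m.+1 + (n - m))%N; last by lia.
  rewrite big_split_ord /= opprD addrA subrr add0r.
  apply/eqP; rewrite oppr_eq0; apply/eqP.
  suff : zbelow m.+1 (\sum_(i < n - m) g ^+ (m.+1 + i)) by apply.
  apply: (big_ind (fun f => zbelow m.+1 f)) => [|x y zx zy k ltk|i _] //.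
    by rewrite coefsD zx // zy // addr0.
  move=> k ltk; apply: (zbelowX (k := (m.+1 + i)%N)) => //; lia.
rewrite mulrDl coefsD.
have -> : (\sum_(k < n.+1) g ^+ k) * (1 - g) = 1 - g ^+ n.+1.
  by rewrite mulrC -opprB mulNr -subrX1 opprB.
have zg : zbelow n.+1 (g ^+ n.+1) by exact: zbelowX.
rewrite -mulrA coefsXnM ltnn addr0 coefsB zg //.
by rewrite subr0.
Qed.

Definition fpsunit : pred S := fun f => coefs f 0 != 0.

Lemma fpsunitP f g : g * f = 1 -> fpsunit f.
Proof.
move=> /(congr1 (fun h => coefs h 0)); rewrite coefsM0 coefs1 => fg.
by apply/eqP => f0; move: fg => /eqP; rewrite f0 mulr0 eq_sym oner_eq0.
Qed.

Lemma fpsinv_out : {in [predC fpsunit], fpsinv =1 id}.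
Proof. by move=> f; rewrite inE /= negbK /fpsinv => ->. Qed.

HB.instance Definition _ := GRing.ComNzRing_hasMulInverse.Build S
  fpsmulV fpsunitP fpsinv_out.

Lemma fps_ord f : f != 0 -> exists k g, coefs g 0 != 0 /\ f = fX ^+ k * g.
Proof.
move=> f0; have [k fk] : exists k, coefs f k != 0.
  apply: contrapT => nf; move/eqP: f0; apply; apply: fpsP => n.
  by apply/eqP; apply/negP => fn; apply: nf; exists n; exact/negP.
have exf : exists k, coefs f k != 0 by exists k.
case: (ex_minnP exf) => m fm minm.
exists m, (Fps (fun n => coefs f (n + m))); split=> //; apply: zbelowP => n ltnm.
by apply/eqP; apply/negP => /negP /minm; rewrite leqNgt ltnm.
Qed.

Lemma fps_idom f g : f * g = 0 -> (f == 0) || (g == 0).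
Proof.
move=> fg; apply: contraTT isT; rewrite negb_or => /andP [f0 g0].
have [k [f' [f'0 fE]]] := fps_ord f0; have [l [g' [g'0 gE]]] := fps_ord g0.
move: fg => /(congr1 (fun h => coefs h (k + l))) /eqP.
rewrite fE gE mulrACA -exprD coefsXnM leqnn subnn coefsM0 mulf_eq0.
by rewrite (negPf f'0) (negPf g'0).
Qed.

HB.instance Definition _ := GRing.ComUnitRing_isIntegral.Build S fps_idom.

End FpsRing.

#[export] Hint Resolve fps1_neq0 : core.

(** * The valuation topology on the field of fractions *)

Lemma subV_factor (E : fieldType) (u l : E) : u != 0 -> l != 0 ->
  u^-1 - l^-1 = (l^-1 * l^-1) * ((u / l)^-1 * - (u - l)).
Proof. by move=> u0 l0; field; rewrite u0 l0. Qed.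

(** Laurent series are used only through these properties: power series embed, and every nonzero
    element is a power of [X] times an invertible series. The fraction field provides an instance,
    [fraclfield]. *)
Structure lfield (F : fieldType) := LField {
  lsort :> fieldType;
  liota : {rmorphism fps F -> lsort};
  liota_eq0 : forall f, liota f = 0 -> f = 0;
  liota_ord : forall x : lsort, x != 0 ->
    exists N g, coefs g 0 != 0 /\ x = liota (fX F) ^ N * liota g
}.

Section Laurent.
Variable F : fieldType.
Local Notation K := {fraction (fps F)}.
Local Notation "f %:F" := (@FracField.tofrac (fps F) f).

Lemma fX_neq0 : fX F != 0.
Proof.
apply/eqP => /(congr1 (fun f => coefs f 1)) /eqP.
by rewrite /= oner_eq0.
Qed.

Lemma frac_ord (x : K) : x != 0 ->
  exists N g, coefs g 0 != 0 /\ x = (fX F)%:F ^ N * g%:F.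
Proof.
have [n [d [d0 ->]]] : exists n d : fps F, d != 0 /\ x = n%:F / d%:F.
  elim/quotW: x => x; exists \n_x, \d_x; split; first exact: denom_ratioP.
  apply: (canRL (mulfK _)); first by rewrite tofrac_eq0 denom_ratioP.
  unlock FracField.tofrac; rewrite -[LHS]FracField.pi_mul /FracField.mulf.
  apply/eqmodP; rewrite /= equivfE.
  rewrite !numden_Ratio ?oner_eq0 ?mulr1 ?denom_ratioP //.
  by rewrite mulrC.
rewrite mulf_eq0 invr_eq0 !tofrac_eq0 negb_or => /andP [n0 _].
have [k [n' [n'0 ->]]] := fps_ord n0; have [l [d' [d'0 ->]]] := fps_ord d0.
have ud : d' \is a GRing.unit by [].
exists (k%:Z - l%:Z), (n' / d'); split.
  rewrite coefsM0 mulf_neq0 //; apply/negP => /eqP h.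
  have : (d'^-1 * d') = 1 by rewrite mulVr.
  by move/(congr1 (fun f => coefs f 0)); rewrite coefsM0 coefs1 h mul0r => /eqP;
     rewrite eq_sym oner_eq0.
have -> : (n' / d')%:F = n'%:F / d'%:F.
  apply: (canRL (mulfK _)); last by rewrite -tofracM divrK.
  by rewrite tofrac_eq0; apply: contraNneq d'0 => ->.
rewrite !tofracM !tofracXn expfzDr ?tofrac_eq0 ?fX_neq0 // -invr_expz invfM.
by rewrite -!exprnP mulrACA.
Qed.

Lemma frac_eq0 (f : fps F) : f%:F = 0 -> f = 0.
Proof. by move/eqP; rewrite tofrac_eq0 => /eqP. Qed.

Definition fraclfield : lfield F := LField frac_eq0 frac_ord.

End Laurent.

Section Valuation.
Variables (F : fieldType) (K : lfield F).
Local Notation "f %:F" := (liota K f).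
Implicit Types (x y : K) (M N : int).

Definition X : K := (fX F)%:F.

Lemma tofrac0 : 0%:F = 0. Proof. exact: rmorph0. Qed.
Lemma tofrac1 : 1%:F = 1. Proof. exact: rmorph1. Qed.
Lemma tofracN f : (- f)%:F = - f%:F. Proof. exact: rmorphN. Qed.
Lemma tofracD f g : (f + g)%:F = f%:F + g%:F. Proof. exact: rmorphD. Qed.
Lemma tofracB f g : (f - g)%:F = f%:F - g%:F. Proof. exact: rmorphB. Qed.
Lemma tofracM f g : (f * g)%:F = f%:F * g%:F. Proof. exact: rmorphM. Qed.
Lemma tofracXn f n : (f ^+ n)%:F = f%:F ^+ n. Proof. exact: rmorphXn. Qed.
Lemma tofrac_eq0 f : (f%:F == 0) = (f == 0).
Proof. by apply/eqP/eqP => [/liota_eq0|->]; rewrite ?tofrac0. Qed.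
Lemma tofrac_inj f g : f%:F = g%:F -> f = g.
Proof. by move/eqP; rewrite -subr_eq0 -tofracB tofrac_eq0 subr_eq0 => /eqP. Qed.

Lemma vge_ord x : x != 0 -> exists N g, coefs g 0 != 0 /\ x = X ^ N * g%:F.
Proof. exact: liota_ord. Qed.

Lemma X_neq0 : X != 0.
Proof. by rewrite tofrac_eq0 fX_neq0. Qed.

Lemma XD M N : X ^ (M + N) = X ^ M * X ^ N.
Proof. by rewrite expfzDr // X_neq0. Qed.

Lemma XfX (k : nat) : X ^ k%:Z = (fX F ^+ k)%:F.
Proof. by rewrite /X -exprnP -tofracXn. Qed.

Definition vge N x := exists g : fps F, x = X ^ N * g%:F.

Lemma vgeW M N x : N <= M -> vge M x -> vge N x.
Proof.
move=> leNM [g ->]; exists (fX F ^+ `|M - N|%N * g).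
rewrite tofracM -XfX mulrA -XD; congr (X ^ _ * _); lia.
Qed.

Lemma vge0 N : vge N 0.
Proof. by exists 0; rewrite tofrac0 mulr0. Qed.

Lemma vgeD N x y : vge N x -> vge N y -> vge N (x + y).
Proof. by move=> [f ->] [g ->]; exists (f + g); rewrite tofracD mulrDr. Qed.

Lemma vgeN N x : vge N x -> vge N (- x).
Proof. by move=> [f ->]; exists (- f); rewrite tofracN mulrN. Qed.

Lemma vgeB N x y : vge N x -> vge N y -> vge N (x - y).
Proof. by move=> vx vy; apply/vgeD/vgeN. Qed.

Lemma vgeM M N x y : vge M x -> vge N y -> vge (M + N) (x * y).
Proof. by move=> [f ->] [g ->]; exists (f * g); rewrite tofracM XD mulrACA. Qed.

Lemma vge_tofrac f : vge 0 f%:F.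
Proof. by exists f; rewrite expr0z mul1r. Qed.

Lemma vge1 : vge 0 1.
Proof. by rewrite -tofrac1; apply: vge_tofrac. Qed.

Lemma vge_nat n : vge 0 n%:R.
Proof. by rewrite -(rmorph_nat (liota K)); apply: vge_tofrac. Qed.

Lemma vge_X N : vge N (X ^ N).
Proof. by exists 1; rewrite tofrac1 mulr1. Qed.

Lemma vge_sum N (I : Type) (r : seq I) (P : pred I) (f : I -> K) :
  (forall i, P i -> vge N (f i)) -> vge N (\sum_(i <- r | P i) f i).
Proof. by move=> vf; elim/big_ind: _ => //; [apply: vge0|move=> x y; apply: vgeD]. Qed.

Lemma vge_exp N x n : vge N x -> vge (N *+ n) (x ^+ n).
Proof.
move=> vx; elim: n => [|n IHn]; first by rewrite expr0 mulr0n; apply: vge1.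
by rewrite exprS mulrS; apply: vgeM.
Qed.

Lemma vge_prod0 (I : Type) (r : seq I) (P : pred I) (f : I -> K) :
  (forall i, P i -> vge 0 (f i)) -> vge 0 (\prod_(i <- r | P i) f i).
Proof.
move=> vf; elim/big_ind: _ => //; first exact: vge1.
by move=> x y vx vy; rewrite -[0]addr0; apply: vgeM.
Qed.

Lemma vge_bound x : exists N, vge N x.
Proof.
have [->|/vge_ord [N [g [_ ->]]]] := eqVneq x 0; first by exists 0; apply: vge0.
by exists N, g.
Qed.

Lemma vge_coef0 g (n : nat) : vge n%:Z g%:F -> zbelow n g.
Proof.
case=> f; rewrite XfX -tofracM => /tofrac_inj -> k ltkn.
by rewrite coefsXnM leqNgt ltkn.
Qed.

Lemma coef0_vge g (n : nat) : zbelow n g -> vge n%:Z g%:F.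
Proof. by move=> /zbelowP ->; rewrite tofracM -XfX; eexists. Qed.

Lemma vge_all x : (forall N, vge N x) -> x = 0.
Proof.
move=> vx; apply/eqP; apply: contraT => /vge_ord [N [g [g0 xE]]].
have [h hE] := vx (N + 1); move: hE; rewrite xE XD -mulrA => /(mulfI _).
rewrite expfz_neq0 ?X_neq0 // => /(_ isT) gE.
have /vge_coef0 /(_ 0%N isT) /eqP : vge 1%:Z g%:F by exists h.
by rewrite (negPf g0).
Qed.

Lemma vge_unit x : vge 1 (x - 1) -> x != 0 /\ vge 0 x^-1.
Proof.
move=> [g]; rewrite (_ : 1 = 1%:Z) // XfX expr1 -tofracM => /(canRL (subrK _)).
rewrite -tofrac1 -tofracD => ->; set f := _ + 1.
have uf : f \is a GRing.unit.
  by apply/negP => /eqP; rewrite /f coefsD coefsXM add0r coefs1 /= => /eqP; rewrite oner_eq0.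
have f0 : f != 0 by apply: contraTneq uf => ->; rewrite unitr0.
split; first by rewrite tofrac_eq0.
suff -> : f%:F^-1 = (f^-1)%:F by apply: vge_tofrac.
apply: (mulfI (_ : f%:F != 0)); first by rewrite tofrac_eq0.
by rewrite mulfV ?tofrac_eq0 // -tofracM divrr ?tofrac1.
Qed.

Definition conv (u : nat -> K) (l : K) :=
  forall N, exists L0, forall L, (L0 <= L)%N -> vge N (u L - l).

Lemma conv_uniq u l l' : conv u l -> conv u l' -> l = l'.
Proof.
move=> ul ul'; apply/eqP; rewrite -subr_eq0; apply/eqP/vge_all => N.
have [L0 h] := ul N; have [L0' h'] := ul' N.
have := vgeB (h' (maxn L0 L0') (leq_maxr _ _)) (h (maxn L0 L0') (leq_maxl _ _)).
by congr (vge N _); ring.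
Qed.

Lemma conv_cst l : conv (fun=> l) l.
Proof. by move=> N; exists 0%N => L _; rewrite subrr; apply: vge0. Qed.

Lemma convD u v l m : conv u l -> conv v m -> conv (fun L => u L + v L) (l + m).
Proof.
move=> ul vm N; have [L1 h1] := ul N; have [L2 h2] := vm N.
exists (maxn L1 L2) => L; rewrite geq_max => /andP [l1 l2].
by rewrite opprD addrACA; apply: vgeD; [apply: h1|apply: h2].
Qed.

Lemma convN u l : conv u l -> conv (fun L => - u L) (- l).
Proof.
by move=> ul N; have [L1 h1] := ul N; exists L1 => L /h1 h; rewrite -opprD; apply: vgeN.
Qed.

Lemma convB u v l m : conv u l -> conv v m -> conv (fun L => u L - v L) (l - m).
Proof. by move=> ul vm; apply/convD/convN. Qed.

Lemma conv_sum (I : Type) (r : seq I) (u : I -> nat -> K) (l : I -> K) :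
  (forall i, conv (u i) (l i)) ->
  conv (fun L => \sum_(i <- r) u i L) (\sum_(i <- r) l i).
Proof.
move=> ul; elim: r => [|i r IHr].
  by under [fun L => _]funext => L do rewrite big_nil; rewrite big_nil; apply: conv_cst.
by under [fun L => _]funext => L do rewrite big_cons; rewrite big_cons; apply: convD.
Qed.

Lemma convM u v l m : conv u l -> conv v m -> conv (fun L => u L * v L) (l * m).
Proof.
move=> ul vm N; have [a va] := vge_bound l; have [b vb] := vge_bound m.
have [L1 h1] := ul (N - b); have [L2 h2] := vm (N - a); have [L3 h3] := ul a.
exists (maxn L1 (maxn L2 L3)) => L; rewrite !geq_max => /and3P [l1 l2 l3].
have -> : u L * v L - l * m = (u L - l) * m + u L * (v L - m) by ring.
apply: vgeD; first by rewrite -(subrK b N); apply: vgeM => //; apply: h1.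
rewrite -(subrK a N) addrC; apply: vgeM; last exact: h2.
by rewrite -(subrK l (u L)); apply: vgeD => //; apply: h3.
Qed.

Lemma conv_prod (I : Type) (r : seq I) (u : I -> nat -> K) (l : I -> K) :
  (forall i, conv (u i) (l i)) ->
  conv (fun L => \prod_(i <- r) u i L) (\prod_(i <- r) l i).
Proof.
move=> ul; elim: r => [|i r IHr].
  by under [fun L => _]funext => L do rewrite big_nil; rewrite big_nil; apply: conv_cst.
by under [fun L => _]funext => L do rewrite big_cons; rewrite big_cons; apply: convM.
Qed.

Lemma convV u l : l != 0 -> conv u l -> conv (fun L => (u L)^-1) l^-1.
Proof.
move=> l0 ul N; have [a va] := vge_bound l^-1.
have [L1 h1] := ul (1 - a); have [L2 h2] := ul (N - a - a).
exists (maxn L1 L2) => L; rewrite geq_max => /andP [l1 l2].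
(* Eventually [u L / l] is a series with constant term 1, so the difference of the inverses is
   [u L - l] times factors of bounded valuation. *)
have /vge_unit [r0 vr] : vge 1 (u L / l - 1).
  have -> : u L / l - 1 = (u L - l) / l by rewrite mulrBl divff.
  by rewrite -(subrK a 1); apply: vgeM => //; apply: h1.
have u0 : u L != 0 by apply: contraNneq r0 => ->; rewrite mul0r.
have -> : (u L)^-1 - l^-1 = (l^-1 * l^-1) * ((u L / l)^-1 * - (u L - l)).
  exact: subV_factor.
have -> : N = (a + a) + (0 + (N - a - a)) by ring.
by apply: vgeM; apply: vgeM => //; apply/vgeN/h2.
Qed.

Lemma conv_near u v l : (exists L0, forall L, (L0 <= L)%N -> u L = v L) ->
  conv u l -> conv v l.
Proof.
move=> [L0 uv] ul N; have [L1 h1] := ul N; exists (maxn L0 L1) => L.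
by rewrite geq_max => /andP [l0 l1]; rewrite -uv //; apply: h1.
Qed.

Lemma conv_sub u l (s : nat -> nat) :
  (forall n, exists L0, forall L, (L0 <= L)%N -> (n <= s L)%N) ->
  conv u l -> conv (fun L => u (s L)) l.
Proof.
move=> hs ul N; have [L1 h1] := ul N; have [L2 h2] := hs L1.
by exists L2 => L /h2 /h1.
Qed.

Lemma conv_vge u l N : (exists L0, forall L, (L0 <= L)%N -> vge N (u L)) ->
  conv u l -> vge N l.
Proof.
move=> [L0 vu] ul; have [L1 h1] := ul N.
have := vgeB (vu (maxn L0 L1) (leq_maxl _ _)) (h1 (maxn L0 L1) (leq_maxr _ _)).
by congr (vge N _); ring.
Qed.

Lemma conv_bound u l : conv u l -> exists N, forall L, vge N (u L).
Proof.
move=> ul; have [a va] := vge_bound l; have [L0 h0] := ul a.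
have [b hb] : exists b, forall L, (L < L0)%N -> vge b (u L).
  elim: L0 {h0} => [|n [b IHn]]; first by exists 0.
  have [c hc] := vge_bound (u n); exists (Num.min b c) => L; rewrite ltnS leq_eqVlt.
  case/orP => [/eqP ->|ltLn]; first by apply: vgeW hc; rewrite ge_min lexx orbT.
  by apply: vgeW (IHn L ltLn); rewrite ge_min lexx.
exists (Num.min a b) => L; case: (ltnP L L0) => [/hb|/h0] h.
  by apply: vgeW h; rewrite ge_min lexx orbT.
have := vgeD h va; rewrite subrK => /vgeW; apply; by rewrite ge_min lexx.
Qed.

Lemma vge_cauchy u (N : int) L0 :
  (forall L, (L0 <= L)%N -> vge N (u L.+1 - u L)) ->
  forall L, (L0 <= L)%N -> vge N (u L - u L0).
Proof.
move=> hu L /subnK <-; elim: (L - L0)%N => [|k IHk].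
  by rewrite add0n subrr; apply: vge0.
have := vgeD (hu (k + L0)%N (leq_addl _ _)) IHk.
by rewrite addrA subrK.
Qed.

Lemma conv_complete u :
  (forall N, exists L0, forall L, (L0 <= L)%N -> vge N (u L.+1 - u L)) ->
  exists l, conv u l.
Proof.
move=> hu; have {}hu N : exists L0, forall L, (L0 <= L)%N -> vge N (u L - u L0).
  by have [L0 h] := hu N; exists L0; apply: vge_cauchy.
pose d (n : nat) := projT1 (cid (hu n%:Z)).
have dP n L : (d n <= L)%N -> vge n%:Z (u L - u (d n)).
  by move: L; rewrite /d; case: cid.
have hg n : vge 0 (u (maxn (d 0%N) (d n)) - u (d 0%N)).
  exact: (dP 0%N _ (leq_maxl _ _)).
pose g n := projT1 (cid (hg n)).
have gE n : u (maxn (d 0%N) (d n)) - u (d 0%N) = (g n)%:F.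
  by rewrite /g; case: cid => f /= ->; rewrite expr0z mul1r.
(* Coefficient [n] of the limit is read off [g n.+1], an approximation already correct modulo
   $X^{n+1}$. *)
exists (u (d 0%N) + (Fps (fun n => coefs (g n.+1) n))%:F) => N.
pose n := `|N|%N; exists (maxn (d 0%N) (d n)) => L leL.
have vuL (m : nat) : (d m <= L)%N -> vge m%:Z (u L - u (d 0%N) - (g m)%:F).
  move=> lem; have := vgeB (dP m L lem) (dP m (maxn (d 0%N) (d m)) (leq_maxr _ _)).
  by rewrite -gE; congr (vge _ _); ring.
have vmm (m k : nat) : (m <= k)%N -> vge m%:Z ((g k)%:F - (g m)%:F).
  move=> lemk; pose L' := maxn (d 0%N) (maxn (d k) (d m)).
  have lek : (d k <= L')%N by rewrite /L' !leq_max leqnn !orbT.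
  have lem : (d m <= L')%N by rewrite /L' !leq_max leqnn !orbT.
  have := vgeB (dP m L' lem) (vgeW (_ : m%:Z <= k%:Z) (dP k L' lek)).
  move=> /(_ ltac:(lia)) h1.
  have h2 := vgeB (dP m (maxn (d 0%N) (d m)) (leq_maxr _ _))
     (vgeW (_ : m%:Z <= k%:Z) (dP k (maxn (d 0%N) (d k)) (leq_maxr _ _))).
  have {}h2 := h2 ltac:(lia).
  by have := vgeB h1 h2; rewrite -!gE; congr (vge _ _); ring.
apply: (vgeW (_ : N <= n%:Z)); first by rewrite /n; lia.
have -> : u L - (u (d 0%N) + (Fps (fun n => coefs (g n.+1) n))%:F) =
  (u L - u (d 0%N) - (g n)%:F) + ((g n)%:F - (Fps (fun n => coefs (g n.+1) n))%:F).
  by ring.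
apply: vgeD; first by apply: vuL; move: leL; rewrite geq_max => /andP [].
rewrite -tofracB; apply: coef0_vge => k ltkn; rewrite coefsB /=.
have := vmm k.+1 n ltkn; rewrite -tofracB => /vge_coef0 /(_ k (ltnSn k)).
by rewrite coefsB.
Qed.

End Valuation.

(** * Bilateral sums *)

Section Bilateral.
Variables (F : fieldType) (K : lfield F).
Implicit Types (f g : int -> K) (s : K).

(** The window runs from $-L$ to $L-1$. Its even length makes the window of half-width $mL$ split
    exactly into windows of half-width $L$ along the classes modulo $m$, which is what
    [hassum_split] needs. *)
Definition win f L : K := \sum_(0 <= i < L.*2) f (i%:Z - L%:Z).
Definition hassum f s := conv (win f) s.
Definition vanishing f :=
  forall N, exists B : nat, forall n : int, (B <= `|n|)%N -> vge N (f n).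

Lemma winS f L : win f L.+1 = win f L + (f (- L.+1%:Z) + f L%:Z).
Proof.
rewrite /win doubleS big_nat_recr //= big_nat_recl //=.
have -> : \sum_(0 <= i < L.*2) f (i.+1%:Z - L.+1%:Z) =
          \sum_(0 <= i < L.*2) f (i%:Z - L%:Z).
  by apply: eq_bigr => i _; congr f; lia.
have -> : 0%N%:Z - L.+1%:Z = - L.+1%:Z by lia.
have -> : L.*2.+1%:Z - L.+1%:Z = L%:Z by lia.
by ring.
Qed.

Lemma eq_hassum f g s : f =1 g -> hassum f s -> hassum g s.
Proof. by move=> /funext ->. Qed.

Lemma hassum_uniq f s s' : hassum f s -> hassum f s' -> s = s'.
Proof. exact: conv_uniq. Qed.

Lemma hassumD f g s t : hassum f s -> hassum g t -> hassum (fun n => f n + g n) (s + t).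
Proof.
move=> fs gt; apply: conv_near (convD fs gt); exists 0%N => L _.
by rewrite /win big_split.
Qed.

Lemma hassumZ a f s : hassum f s -> hassum (fun n => a * f n) (a * s).
Proof.
move=> fs; apply: conv_near (convM (conv_cst a) fs); exists 0%N => L _.
by rewrite /win big_distrr.
Qed.

Lemma hassum_fsum (I : Type) (r : seq I) (f : I -> int -> K) (s : I -> K) :
  (forall i, hassum (f i) (s i)) ->
  hassum (fun n => \sum_(i <- r) f i n) (\sum_(i <- r) s i).
Proof.
move=> fs; apply: conv_near (conv_sum r fs); exists 0%N => L _.
by rewrite /win exchange_big.
Qed.

Lemma hassum_ex f : vanishing f -> exists s, hassum f s.
Proof.
move=> vf; apply: conv_complete => N; have [B hB] := vf N; exists B => L leBL.
by rewrite winS addrC addKr; apply: vgeD; apply: hB; lia.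
Qed.

(** Dominated convergence: outside a fixed range every term is small uniformly in [L], and inside it
    finitely many terms converge. *)
Lemma tannery_diff (G : nat -> int -> K) f :
  (forall n, conv (G^~ n) (f n)) ->
  (forall N, exists B : nat, forall n : int, (B <= `|n|)%N ->
     forall L : nat, - L%:Z <= n < L%:Z -> vge N (G L n)) ->
  vanishing f /\ conv (fun L => win (G L) L - win f L) 0.
Proof.
move=> Gf Gsmall.
have vf : vanishing f.
  move=> N; have [B hB] := Gsmall N; exists B => n len.
  apply: conv_vge (Gf n); exists `|n|.+1 => L leL; apply: hB => //; lia.
split=> // N; have [B hB] := Gsmall N; have [B' hB'] := vf N.
have [L2 h2] : exists L2, forall L (n : int), (L2 <= L)%N -> (`|n| < maxn B B')%N ->
    vge N (G L n - f n).
  elim: (maxn B B') => [|m [L2 IHm]]; first by exists 0%N.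
  have [L3 h3] := Gf m%:Z N; have [L4 h4] := Gf (- m%:Z) N.
  exists (maxn L2 (maxn L3 L4)) => L n; rewrite !geq_max => /and3P [l2 l3 l4].
  rewrite ltnS leq_eqVlt => /orP [/eqP nm|ltnm]; last exact: IHm.
  have [->|->] : n = m%:Z \/ n = - m%:Z by lia.
    exact: h3.
  exact: h4.
exists L2 => L l2; rewrite subr0.
rewrite /win -sumrB big_nat; apply: vge_sum => i /andP [_ lti].
set n : int := i%:Z - L%:Z; have [/h2|] := ltnP `|n| (maxn B B'); first by apply.
rewrite geq_max => /andP [leB leB']; apply: vgeB; last exact: hB'.
by apply: hB => //; rewrite /n; lia.
Qed.

Lemma tannery (G : nat -> int -> K) f s :
  (forall n, conv (G^~ n) (f n)) ->
  (forall N, exists B : nat, forall n : int, (B <= `|n|)%N ->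
     forall L : nat, - L%:Z <= n < L%:Z -> vge N (G L n)) ->
  conv (fun L => win (G L) L) s -> vanishing f /\ hassum f s.
Proof.
move=> Gf Gsmall Gs; have [vf d0] := tannery_diff Gf Gsmall; split=> //.
have := convB Gs d0; rewrite subr0; apply: conv_near; exists 0%N => L _.
by rewrite opprB addrCA subrr addr0.
Qed.

Lemma tannery_win (G : nat -> int -> K) f s :
  (forall n, conv (G^~ n) (f n)) ->
  (forall N, exists B : nat, forall n : int, (B <= `|n|)%N ->
     forall L : nat, - L%:Z <= n < L%:Z -> vge N (G L n)) ->
  hassum f s -> conv (fun L => win (G L) L) s.
Proof.
move=> Gf Gsmall fs; have [_ d0] := tannery_diff Gf Gsmall.
have := convD d0 fs; rewrite add0r; apply: conv_near; exists 0%N => L _.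
by rewrite subrK.
Qed.

(** The shift changes the window sum by [f L - f (- L)], which tends to 0. *)
Lemma hassum_shift1 f s : vanishing f -> hassum f s -> hassum (fun n => f (n + 1)) s.
Proof.
move=> vf fs; have conv0 : conv (fun L => f L%:Z - f (- L%:Z)) 0.
  move=> N; have [B hB] := vf N; exists B => L leB; rewrite subr0.
  by apply: vgeB; apply: hB; lia.
rewrite -[s]addr0; apply: conv_near (convD fs conv0); exists 0%N => L _.
elim: L => [|L IHL]; first by rewrite /win !big_nil oppr0 subrr addr0.
rewrite !winS -IHL; set w := win f L.
have -> : - L.+1%:Z + 1 = - L%:Z by lia.
have -> : L%:Z + 1 = L.+1%:Z by lia.
by ring.
Qed.

Lemma vanishing_shift f k : vanishing f -> vanishing (fun n => f (n + k)).
Proof.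
move=> vf N; have [B hB] := vf N; exists (B + `|k|)%N => n len; apply: hB; lia.
Qed.

Lemma hassum_shift f s k : vanishing f -> hassum f s -> hassum (fun n => f (n + k)) s.
Proof.
have pos (m : nat) g : vanishing g -> hassum g s -> hassum (fun n => g (n + m%:Z)) s.
  move=> vg gs; elim: m => [|m IHm]; first by apply: eq_hassum gs => n; rewrite addr0.
  apply: eq_hassum (hassum_shift1 (vanishing_shift _ vg) IHm) => n.
  by congr g; lia.
move=> vf fs; case: (intP k) => [|m|m]; [|exact: pos|].
  by apply: eq_hassum fs => n; rewrite addr0.
(* A negative shift is undone one unit at a time by [hassum_shift1]; uniqueness of sums then
   identifies the values. *)
have vf' := vanishing_shift (- m.+1%:Z) vf.
have [t ft] := hassum_ex vf'.
suff -> : s = t by apply: eq_hassum ft => n.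
have ft' := hassum_shift1.
elim: m.+1 t f vf fs vf' ft => {m k ft'} [|m IHm] t f vf fs vf' ft.
  by apply: (hassum_uniq fs); apply: eq_hassum ft => n; rewrite oppr0 addr0.
have vg := vanishing_shift (- m%:Z) vf.
have [u gu] := hassum_ex vg.
rewrite (IHm u f vf fs vg gu); apply: (hassum_uniq gu).
by apply: eq_hassum (hassum_shift1 vf' ft) => n; congr f; lia.
Qed.

Lemma vanishing_opp f : vanishing f -> vanishing (fun n => f (- n)).
Proof. by move=> vf N; have [B hB] := vf N; exists B => n len; apply: hB; lia. Qed.

Lemma hassum_opp f s : vanishing f -> hassum f s -> hassum (fun n => f (- n)) s.
Proof.
move=> vf fs; have conv0 : conv (fun L => f L%:Z - f (- L%:Z)) 0.
  move=> N; have [B hB] := vf N; exists B => L leB; rewrite subr0.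
  by apply: vgeB; apply: hB; lia.
rewrite -[s]addr0; apply: conv_near (convD fs conv0); exists 0%N => L _.
elim: L => [|L IHL]; first by rewrite /win !big_nil oppr0 subrr addr0.
rewrite !winS -IHL; set w := win f L; rewrite opprK.
by ring.
Qed.

Lemma big_nat_mul (a m : nat) (g : nat -> K) :
  \sum_(0 <= i < a * m) g i = \sum_(0 <= r < m) \sum_(0 <= k < a) g (k * m + r)%N.
Proof.
rewrite exchange_big /=; elim: a => [|a IHa]; first by rewrite mul0n !big_nil.
rewrite big_nat_recr //= -IHa mulSn addnC (@big_cat_nat _ _ _ (a * m)) ?leq_addr //=.
congr (_ + _); rewrite -[X in \sum_(X <= _ < _) _]add0n big_addn addKn.
by apply: eq_bigr => r _; rewrite addnC.
Qed.

Lemma vanishing_comp f (m r : int) : m != 0 -> vanishing f ->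
  vanishing (fun k => f (m * k + r)).
Proof.
move=> m0 vf N; have [B hB] := vf N; exists (B + `|r|)%N => n len; apply: hB.
have : (`|n|%N <= `|(m * n)%R|%N)%N by rewrite abszM leq_pmull // lt0n absz_eq0.
by lia.
Qed.

Lemma hassum_split (m : nat) f s (t : nat -> K) : (0 < m)%N -> hassum f s ->
  (forall r, hassum (fun k => f (m%:Z * k + r%:Z)) (t r)) ->
  s = \sum_(0 <= r < m) t r.
Proof.
move=> m0 fs ft; apply: (@conv_uniq _ _ (fun L => win f (L * m))).
  apply: conv_sub fs => n; exists n => L leL; apply: leq_trans leL _.
  by rewrite leq_pmulr.
apply: conv_near (conv_sum (index_iota 0 m) ft); exists 0%N => L _.
rewrite /win doubleMl big_nat_mul; apply: eq_bigr => r _; apply: eq_bigr => k _.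
by congr f; rewrite PoszD !PoszM; lia.
Qed.

End Bilateral.

(** * Infinite products *)

Definition tri (n : int) : int := (n * (n - 1) %/ 2)%Z.

Lemma triE n : 2 * tri n = n * (n - 1).
Proof.
rewrite /tri mulrC divzK //; apply/dvdz_mod0P.
have : (n %% 2)%Z = 0 \/ (n %% 2)%Z = 1 by lia.
have := divz_eq n 2; set k := (n %/ 2)%Z => nE [] h; rewrite h in nE.
  by rewrite nE (_ : _ * _ = (k * (n - 1)) * 2) ?modzMl // nE; ring.
by rewrite nE (_ : _ * _ = (k * n) * 2) ?modzMl // nE; ring.
Qed.

Lemma tri_ge (n : int) : `|n| * (`|n| - 1) <= 2 * tri n.
Proof. rewrite triE; nia. Qed.

Lemma tri_ge0 n : 0 <= tri n.
Proof.
have := triE n; have : 0 <= n * (n - 1); last by lia.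
by case: (lerP n 0) => h; nia.
Qed.

Section Powers.
Variables (F : fieldType) (K : lfield F).
Implicit Types (x y z : K) (G : nat -> int -> K).

Lemma vge_expz x : x != 0 -> exists a, 0 <= a /\ forall n : int, vge (- a * `|n|) (x ^ n).
Proof.
move=> x0; have [a va] := vge_bound x; have [b vb] := vge_bound x^-1.
pose c := `|a| + `|b|; exists c; split=> [|n]; first by rewrite /c; lia.
have [m [->|->]] : exists m : nat, n = m%:Z \/ n = - m%:Z by exists `|n|%N; lia.
  have := vge_exp m va; rewrite -exprnP; apply: vgeW.
  rewrite -mulr_natr natz /c; nia.
have := vge_exp m vb; rewrite -exprz_inv -exprnP; apply: vgeW.
rewrite -mulr_natr natz /c; nia.
Qed.

(** The quadratic exponent [k * tri n] outgrows the loss of valuation in [z ^ n], which is at most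
    linear. This supplies the domination hypothesis of [tannery] for the theta-like families
    below. *)
Lemma small_family G z (k c : int) : z != 0 -> 0 < k ->
  (forall L n, - L%:Z <= n < L%:Z ->
     exists2 r, vge c r & G L n = z ^ n * X K ^ (k * tri n) * r) ->
  forall N, exists B : nat, forall n : int, (B <= `|n|)%N ->
     forall L : nat, - L%:Z <= n < L%:Z -> vge N (G L n).
Proof.
move=> z0 k0 hG N; have [a [a0 va]] := vge_expz z0.
exists (2 * `|a|%N + 2 * `|N|%N + 2 * `|c|%N + 2)%N => n len L lt.
have [r vr ->] := hG L n lt.
apply: (vgeW (_ : N <= - a * `|n| + k * tri n + c)).
  have h := tri_ge n; have : tri n <= k * tri n by have := tri_ge0 n; nia.
  move: len h; set m : int := `|n|; set t := tri n; move=> len h ht.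
  have m1 : 2 * a + 2 * `|N| + 2 * `|c| + 2 <= m by rewrite /m; lia.
  have : m * (2 * a + 2 * `|N| + 2 * `|c| + 1) <= m * (m - 1) by nia.
  nia.
by apply: vgeM => //; apply: vgeM => //; apply: vge_X.
Qed.

Variable M : int.
Hypothesis M_gt0 : 0 < M.
Local Notation B := (X K ^ M).

Lemma B_neq0 : B != 0. Proof. by rewrite expfz_neq0 ?X_neq0. Qed.

Lemma vge_B (i : nat) : vge (M *+ i) (B ^+ i).
Proof. by apply: vge_exp; apply: vge_X. Qed.

Definition poch x N : K := \prod_(0 <= i < N) (1 - x * B ^+ i).

Lemma poch0 x : poch x 0 = 1. Proof. by rewrite /poch big_nil. Qed.

Lemma pochS x N : poch x N.+1 = poch x N * (1 - x * B ^+ N).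
Proof. by rewrite /poch big_nat_recr. Qed.

Lemma pochD x a b : poch x (a + b) = poch x a * poch (x * B ^+ a) b.
Proof.
elim: b => [|b IHb]; first by rewrite addn0 poch0 mulr1.
by rewrite addnS !pochS IHb -mulrA -[x * _ * _]mulrA -exprD.
Qed.

Lemma poch1 x : poch x 1 = 1 - x.
Proof. by rewrite pochS poch0 expr0 mul1r mulr1. Qed.

Lemma pochSl x N : poch x N.+1 = (1 - x) * poch (x * B) N.
Proof. by rewrite -add1n pochD poch1 expr1. Qed.

Lemma vge_poch0 x N : vge 0 x -> vge 0 (poch x N).
Proof.
move=> vx; apply: vge_prod0 => i _; apply: vgeB; first exact: vge1.
rewrite -[0]addr0; apply: vgeM => //; apply: vgeW (vge_B i).
by rewrite mulrn_wge0 // ltW.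
Qed.

Lemma poch_big x N : exists k, vge N (x * B ^+ k).
Proof.
have [a va] := vge_bound x; exists `|N - a|%N.
apply: vgeW (vgeM va (vge_B _)); rewrite -mulr_natr natz; nia.
Qed.

(** Only the finitely many factors in which [x * B ^+ i] has a pole can lower the valuation. *)
Lemma poch_bound x : exists c, forall N, vge c (poch x N).
Proof.
have [k vk] := poch_big x 0; have [c hc] : exists c, forall N, (N <= k)%N -> vge c (poch x N).
  elim: k {vk} => [|k [c IHk]].
    by exists 0 => N; rewrite leqn0 => /eqP ->; rewrite poch0; apply: vge1.
  have [d vd] := vge_bound (poch x k.+1); exists (Num.min c d) => N.
  rewrite leq_eqVlt => /orP [/eqP ->|]; first by apply: vgeW vd; rewrite ge_min lexx orbT.
  by rewrite ltnS => /IHk; apply: vgeW; rewrite ge_min lexx.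
exists c => N; case: (leqP N k) => [/hc //|/ltnW/subnKC <-].
by rewrite pochD -[c]addr0; apply: vgeM; [apply: hc|apply: vge_poch0].
Qed.

Lemma poch_conv x : exists l, conv (poch x) l.
Proof.
have [c hc] := poch_bound x; apply: conv_complete => N.
have [k vk] := poch_big x (N - c); exists k => L leL.
rewrite pochS mulrBr mulr1 addrC addKr; apply: vgeN.
rewrite -(subnKC leL) exprD (mulrA x) -(subrK c N) addrC.
apply: vgeM; first exact: hc.
rewrite -[N - c]addr0; apply: vgeM => //; apply: vgeW (vge_B _).
by rewrite mulrn_wge0 // ltW.
Qed.

Definition pinf x : K := projT1 (cid (poch_conv x)).

Lemma pinfP x : conv (poch x) (pinf x).
Proof. by rewrite /pinf; case: cid. Qed.

Lemma pinfD x a : pinf x = poch x a * pinf (x * B ^+ a).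
Proof.
apply: conv_uniq (convM (conv_cst _) (pinfP _)).
apply: conv_near (conv_sub (s := addn a) _ (pinfP x)).
  by exists 0%N => L _; rewrite pochD.
by move=> n; exists n => L; lia.
Qed.

Lemma pinfS x : pinf x = (1 - x) * pinf (x * B).
Proof. by rewrite (pinfD x 1) poch1 expr1. Qed.

Lemma vge_pinf1 x : vge 1 x -> vge 1 (pinf x - 1).
Proof.
move=> vx; apply: (conv_vge (u := fun L => poch x L - 1)); last first.
  by apply: convB (pinfP x) (conv_cst 1).
exists 0%N => L _; elim: L => [|L IHL]; first by rewrite poch0 subrr; apply: vge0.
rewrite pochS mulrBr mulr1 addrAC; apply: vgeB => //.
rewrite -[1]add0r; apply: vgeM; first by apply: vge_poch0; apply: vgeW vx.
rewrite -[1]addr0; apply: vgeM => //; apply: vgeW (vge_B _).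
by rewrite mulrn_wge0 // ltW.
Qed.

Lemma pinf_neq0 x : (forall i, 1 - x * B ^+ i != 0) -> pinf x != 0.
Proof.
move=> hx; have [k vk] := poch_big x 1.
rewrite (pinfD x k) mulf_neq0 //; last by have [] := vge_unit (vge_pinf1 vk).
by rewrite /poch prodf_seq_neq0; apply/allP => i _; rewrite hx.
Qed.

Definition theta x : K := pinf x * pinf (B / x).

Lemma pinf1 : pinf 1 = 0.
Proof. by rewrite pinfS subrr mul0r. Qed.

Lemma theta1 : theta 1 = 0.
Proof. by rewrite /theta pinf1 mul0r. Qed.

Lemma thetaV x : x != 0 -> theta x^-1 = - x^-1 * theta x.
Proof.
move=> x0; rewrite /theta invrK (pinfS x^-1) (pinfS x) (mulrC _ B) (mulrC B x).
by field.
Qed.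

Lemma thetaB x : x != 0 -> theta (x * B) = - x^-1 * theta x.
Proof.
move=> x0; rewrite /theta (pinfS x).
have -> : B / (x * B) = x^-1 by field; rewrite x0 B_neq0.
by rewrite (pinfS x^-1) (mulrC x^-1 B); field.
Qed.

Lemma thetaBV x : theta (B / x) = theta x.
Proof.
rewrite /theta mulrC; congr (_ * pinf _); rewrite invf_div mulrCA divff ?mulr1 //.
exact: B_neq0.
Qed.

Lemma X_expz_inj (m n : int) : X K ^ m = X K ^ n -> m = n.
Proof.
suff h (a b : int) : a < b -> X K ^ a != X K ^ b.
  move=> e; case: (ltgtP m n) => // /h; rewrite e eqxx //.
move=> ltab; apply/eqP => e; have : X K ^ (b - a) = 1.
  by rewrite XD -e -XD subrr expr0z.
move=> e1; have /(vgeN) := vge_X K (b - a); rewrite e1 => v1.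
have : vge 1 (0 - 1 : K) by rewrite sub0r; apply: vgeW v1; lia.
by case/vge_unit; rewrite eqxx.
Qed.

Lemma theta_neq0 x : x != 0 -> (forall n : int, x != X K ^ (M * n)) -> theta x != 0.
Proof.
move=> x0 hx; rewrite mulf_neq0 //; apply: pinf_neq0 => i; rewrite subr_eq0 eq_sym.
  apply: contra (hx (- i%:Z)) => /eqP h; apply/eqP.
  rewrite mulrN -invr_expz -exprz_exp -exprnP.
  have nz : B ^+ i != 0 by rewrite expf_neq0 // B_neq0.
  by rewrite -[LHS](mulfK nz) h mul1r.
apply: contra (hx (i.+1%:Z)) => /eqP h; apply/eqP.
rewrite -exprz_exp -exprnP exprS -[LHS]mul1r -h.
by rewrite mulrAC divfK.
Qed.

End Powers.

(** * The finite q-binomial theorem and Jacobi's triple product *)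

Lemma triS (n : int) : tri (n + 1) = tri n + n.
Proof. have := triE n; have := triE (n + 1); lia. Qed.

Lemma tri_shift (m l : int) : tri m = tri (m - l) + l * m - tri (l + 1).
Proof.
apply: (@mulfI _ 2) => //; rewrite mulrBr mulrDr !triE; ring.
Qed.

(** Serves [jacobi_cube], where one factor vanishes at the evaluation point and no logarithmic
    derivative is available. *)
Lemma deriv_simple_root (E : fieldType) (p r : {poly E}) (b : E) : b != 0 ->
  ((p * (1 - b *: 'X) * r)^`()).[b^-1] = - b * (p.[b^-1] * r.[b^-1]).
Proof.
move=> b0; rewrite !derivM derivB derivC derivZ derivX.
rewrite !(hornerD, hornerN, hornerM, hornerZ, hornerX, hornerC) mulfV //.
by ring.
Qed.

Section Jacobi.
Variables (F : fieldType) (K : lfield F) (M : int).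
Hypothesis M_gt0 : 0 < M.
Local Notation B := (X K ^ M).
Local Notation poch := (@poch F K M).
Local Notation pinf := (pinf M_gt0).
Local Notation theta := (theta M_gt0).
Implicit Types x : K.

Let B0 : B != 0. Proof. exact: B_neq0. Qed.

Lemma XB (k : nat) : X K ^ (M * k%:Z) = B ^+ k.
Proof. by rewrite -exprz_exp. Qed.

Lemma vge1_B : vge 1 B.
Proof. by apply: vgeW (vge_X K M); rewrite -gtz0_ge1. Qed.

Lemma pochB_unit k : poch B k != 0 /\ vge 0 (poch B k)^-1.
Proof.
apply: vge_unit; elim: k => [|k IHk]; first by rewrite poch0 subrr; apply: vge0.
rewrite pochS mulrBr mulr1 addrAC; apply: vgeB => //.
rewrite -[1]add0r; apply: vgeM; first by apply: vge_poch0 => //; apply: vgeW vge1_B.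
rewrite -[1]addr0; apply: vgeM; first exact: vge1_B.
by apply: vgeW (vge_B K M k); rewrite mulrn_wge0 // ltW.
Qed.

Lemma pochB_neq0 k : poch B k != 0. Proof. by case: (pochB_unit k). Qed.

Lemma oneBX_neq0 k : 1 - B ^+ k.+1 != 0.
Proof.
have := pochB_neq0 k.+1; rewrite pochS -exprS; by apply: contraNneq => ->; rewrite mulr0.
Qed.

Lemma pinfB_neq0 : pinf B != 0.
Proof. by apply: pinf_neq0 => i; rewrite -exprS oneBX_neq0. Qed.

Definition qbin n k : K := if (k <= n)%N then poch B n / (poch B k * poch B (n - k)) else 0.

Lemma vge_qbin n k : vge 0 (qbin n k).
Proof.
rewrite /qbin; case: ifP => _; last exact: vge0.
rewrite invfM -[0]addr0; apply: vgeM; first by apply: vge_poch0 => //; apply: vgeW vge1_B.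
by rewrite -[0]addr0; apply: vgeM; apply: (pochB_unit _).2.
Qed.

Lemma qbinS n k : (k <= n)%N ->
  qbin n.+1 k.+1 = qbin n k.+1 + B ^+ (n - k) * qbin n k.
Proof.
move=> lekn; rewrite /qbin ltnS lekn subSS; case: ltnP => [ltkn|geqn].
  have -> : (n - k = (n - k.+1).+1)%N by lia.
  set m := (n - k.+1)%N; rewrite !pochS -!exprS.
  have -> : (n.+1 = k.+1 + m.+1)%N by rewrite /m; lia.
  have := (pochB_neq0 k, pochB_neq0 m, oneBX_neq0 k, oneBX_neq0 m); rewrite exprD.
  by move: (poch B n) => a [[[h1 h2] h3] h4]; field; rewrite h1 h2 h3 h4.
have -> : n = k by lia.
rewrite subnn poch0 add0r expr0 mul1r !mulr1 !divff ?pochB_neq0 //.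
Qed.

Lemma qbin0 n : qbin n 0 = 1.
Proof. by rewrite /qbin poch0 mul1r subn0 divff ?pochB_neq0. Qed.

Definition gpol n : {poly K} := \prod_(0 <= i < n) (1 - B ^+ i *: 'X).

Lemma gpolS n : gpol n.+1 = gpol n * (1 - B ^+ n *: 'X).
Proof. by rewrite /gpol big_nat_recr. Qed.

Lemma horner_gpol n x : (gpol n).[x] = poch x n.
Proof.
rewrite /gpol horner_prod; apply: eq_bigr => i _.
by rewrite hornerD hornerN hornerZ hornerX hornerC mulrC.
Qed.

Definition gcoef n k : K := (- 1) ^+ k * X K ^ (M * tri k) * qbin n k.

Lemma tri0 : tri 0 = 0. Proof. by []. Qed.

(** Finite q-binomial theorem; the induction on [n] is the q-Pascal rule [qbinS]. *)
Lemma coef_gpol n k : (gpol n)`_k = gcoef n k.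
Proof.
elim: n k => [|n IHn] k.
  rewrite /gpol big_nil coef1 /gcoef; case: k => [|k]; last by rewrite /qbin /= mulr0.
  by rewrite tri0 mulr0 expr0z expr0 qbin0 !mulr1.
rewrite gpolS mulrBr mulr1 coefB -scalerAr coefZ coefMX !IHn; case: k => [|k] /=.
  by rewrite mulr0 subr0 /gcoef !qbin0.
rewrite /gcoef -addn1 PoszD triS mulrDr XD XB addn1.
case: (leqP k n) => [lekn|ltnk].
  rewrite (qbinS lekn) exprS; have -> : B ^+ n = B ^+ k * B ^+ (n - k).
    by rewrite -exprD subnKC.
  by ring.
rewrite /qbin !ifN -?ltnNge ?mulr0 ?subr0 //; lia.
Qed.

Lemma size_gpol n : (size (gpol n) <= n.+1)%N.
Proof. by apply/leq_sizeP => k ltnk; rewrite coef_gpol /gcoef /qbin ifN ?mulr0 -?ltnNge. Qed.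

Lemma gpol_sum n x : poch x n = \sum_(0 <= k < n.+1) gcoef n k * x ^+ k.
Proof.
rewrite -horner_gpol (horner_coef_wide x (size_gpol n)) big_mkord.
by apply: eq_bigr => k _; rewrite coef_gpol.
Qed.

Lemma gpol_deriv_sum n x :
  x * ((gpol n)^`()).[x] = \sum_(0 <= k < n.+1) k%:R * (gcoef n k * x ^+ k).
Proof.
rewrite (@horner_coef_wide _ n); last first.
  apply/leq_sizeP => j lej; rewrite coef_deriv nth_default ?mul0rn //.
  by apply: leq_trans (size_gpol n) _; rewrite ltnS.
rewrite big_nat_recl // mul0r add0r big_mkord big_distrr; apply: eq_bigr => k _.
by rewrite /= coef_deriv coef_gpol exprS -(mulr_natr (gcoef _ _)); ring.
Qed.

Lemma gpol_deriv_log n x : (forall i, (i < n)%N -> 1 - x * B ^+ i != 0) ->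
  x * ((gpol n)^`()).[x] =
  - (poch x n * \sum_(0 <= i < n) x * B ^+ i / (1 - x * B ^+ i)).
Proof.
elim: n => [|n IHn] hx; first by rewrite /gpol !big_nil derivC horner0 !mulr0 oppr0.
rewrite gpolS derivM derivB derivC derivZ derivX !(hornerD, hornerN, hornerM, hornerZ).
rewrite !(hornerX, hornerC, horner0) horner_gpol big_nat_recr //= pochS.
have hn := hx n (ltnSn n); move: IHn; set d := _.[x]; set s := \sum_(_ <= _ < _) _ => IHn.
have {}IHn : x * d = - (poch x n * s) by apply: IHn => i lti; apply: hx; lia.
have -> : x * (d * (1 - B ^+ n * x) + poch x n * (0 - B ^+ n * 1)) =
   (x * d) * (1 - B ^+ n * x) - poch x n * (x * B ^+ n) by ring.
rewrite IHn; move: hn; rewrite (mulrC x); move: (B ^+ n) (poch x n) => b p hn.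
by field.
Qed.

Lemma poch_neg x L : x != 0 ->
  poch (x * B ^- L) L = (- x) ^+ L * X K ^ (- (M * tri (L%:Z + 1))) * poch (B / x) L.
Proof.
move=> x0; elim: L => [|L IHL].
  by rewrite !poch0 expr0 !mul1r /= mulr0 oppr0 expr0z mulr1.
have -> : L.+1%:Z + 1 = (L%:Z + 1) + 1 by lia.
rewrite pochSl triS mulrDr opprD XD pochS.
have -> : x * B ^- L.+1 * B = x * B ^- L by rewrite exprS; field; rewrite expf_neq0 B0.
rewrite IHL; have -> : X K ^ (- (M * (L%:Z + 1))) = B ^- L.+1.
  by rewrite -invr_expz -XB -addn1 PoszD.
rewrite !exprS.
have bL : B ^+ L != 0 by rewrite expf_neq0.
move: (poch _ _) (X K ^ - _) => p u; move: (X K ^ M) B0 bL => b b0 bL.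
by field; rewrite x0 bL b0.
Qed.

Definition jterm x (n : int) : K := (- x) ^ n * X K ^ (M * tri n).

(** Evaluating the polynomial of degree [L.*2] at [x * B ^- L] centres the sum: apart from the
    Gaussian binomial, the dependence on [L] is a factor common to all terms. *)
Lemma jacobi_fin x L (k : nat) : x != 0 ->
  gcoef L.*2 k * (x * B ^- L) ^+ k =
  (- x) ^+ L * X K ^ (- (M * tri (L%:Z + 1))) *
  (jterm x (k%:Z - L%:Z) * qbin L.*2 k).
Proof.
move=> x0; rewrite /gcoef /jterm.
have -> : (- x) ^ (k%:Z - L%:Z) = (- x) ^+ k * (- x) ^- L.
  by rewrite expfzDr ?oppr_eq0 // -invr_expz -!exprnP.
rewrite exprMn.
have -> : (B ^- L) ^+ k = X K ^ (- (M * (L%:Z * k%:Z))).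
  by rewrite -invr_expz -PoszM XB exprM exprVn.
have -> : M * tri k = M * tri (k%:Z - L%:Z) + M * (L%:Z * k%:Z) - M * tri (L%:Z + 1).
  by rewrite -mulrDr -mulrBr -tri_shift.
rewrite !XD (exprNn x k) -(invr_expz _ (M * (L%:Z * k%:Z))).
have := expfz_neq0 (M * (L%:Z * k%:Z)) (X_neq0 K); have : (- x) ^+ L != 0.
  by rewrite expf_neq0 // oppr_eq0.
move: ((- x) ^+ L) (X K ^ (M * (L%:Z * k%:Z))) (X K ^ (M * tri _)) (X K ^ (- _)).
by move=> a u c d a0 u0; field; rewrite u0 a0.
Qed.

Lemma jconst_neq0 x L : x != 0 -> (- x) ^+ L * X K ^ (- (M * tri (L%:Z + 1))) != 0.
Proof. by move=> x0; rewrite mulf_neq0 ?expf_neq0 ?oppr_eq0 // expfz_neq0 ?X_neq0. Qed.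

Lemma poch_dbl x L : x != 0 ->
  poch (x * B ^- L) L.*2 =
  (- x) ^+ L * X K ^ (- (M * tri (L%:Z + 1))) * (poch x L * poch (B / x) L).
Proof.
move=> x0; rewrite -addnn pochD poch_neg // divfK ?expf_neq0 //; ring.
Qed.

Lemma jacobi_poch x L : x != 0 ->
  poch x L * poch (B / x) L =
  \sum_(0 <= k < L.*2.+1) jterm x (k%:Z - L%:Z) * qbin L.*2 k.
Proof.
move=> x0; apply: (mulfI (jconst_neq0 L x0)); rewrite -poch_dbl // gpol_sum big_distrr.
by apply: eq_bigr => k _; rewrite jacobi_fin.
Qed.

Lemma jacobi_deriv x L : x != 0 ->
  x * B ^- L * ((gpol L.*2)^`()).[x * B ^- L] =
  (- x) ^+ L * X K ^ (- (M * tri (L%:Z + 1))) *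
  \sum_(0 <= k < L.*2.+1) k%:R * (jterm x (k%:Z - L%:Z) * qbin L.*2 k).
Proof.
move=> x0; rewrite gpol_deriv_sum big_distrr /=.
by apply: eq_bigr => k _; rewrite jacobi_fin // mulrCA.
Qed.

Lemma conv_qbin (n : int) :
  conv (fun L => pinf B * qbin L.*2 (absz (n + L%:Z)%R)) 1.
Proof.
have sub (f : nat -> nat) : (forall m, exists L0, forall L, (L0 <= L)%N -> (m <= f L)%N) ->
    conv (fun L => poch B (f L)) (pinf B).
  by move=> hf; apply: conv_sub hf (pinfP _ _).
have c1 : conv (fun L => poch B L.*2) (pinf B).
  by apply: (sub double) => m; exists m => L; lia.
have c2 : conv (fun L => poch B (absz (n + L%:Z)%R)) (pinf B).
  by apply: (sub (fun L => absz (n + L%:Z)%R)) => m; exists (m + `|n|)%N => L; lia.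
have c3 : conv (fun L => poch B (L.*2 - absz (n + L%:Z)%R)%N) (pinf B).
  by apply: (sub (fun L => L.*2 - absz (n + L%:Z)%R)%N) => m; exists (m + `|n|)%N => L; lia.
have nz : pinf B * pinf B != 0 by rewrite mulf_neq0 ?pinfB_neq0.
have := convM (conv_cst (pinf B)) (convM c1 (convV nz (convM c2 c3))).
rewrite mulrA divff // => h; apply: conv_near h; exists (`|n|%N) => L leL.
by rewrite /qbin ifT //; lia.
Qed.

Lemma conv_poch_theta x : conv (fun L => poch x L * poch (B / x) L) (theta x).
Proof. exact: convM (pinfP _ _) (pinfP _ _). Qed.

(** One passage to the limit for several weights: [w = 1] gives the triple product, [w n = n] its
    derivative and, at [x = 1], Jacobi's cube. The factor [pinf B] cancels the limit of the Gaussian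
    binomials. *)
Lemma hassum_jacobi_gen x (w : int -> K) s : x != 0 -> (forall n, vge 0 (w n)) ->
  conv (fun L => \sum_(0 <= k < L.*2.+1)
          w (k%:Z - L%:Z) * (jterm x (k%:Z - L%:Z) * qbin L.*2 k)) s ->
  vanishing (fun n => w n * jterm x n) /\ hassum (fun n => w n * jterm x n) (pinf B * s).
Proof.
move=> x0 vw ws.
pose G (L : nat) n := pinf B * (w n * (jterm x n * qbin L.*2 (absz (n + L%:Z)%R))).
have [c vc] := vge_bound (pinf B).
have Gsmall := @small_family F K G (- x) M (c + 0 + 0).
apply: (@tannery _ _ G).
- move=> n; rewrite -[X in conv _ X]mulr1.
  apply: conv_near (convM (conv_cst _) (conv_qbin n)); exists 0%N => L _.
  by rewrite /G; ring.
- apply: Gsmall => //; first by rewrite oppr_eq0.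
  move=> L n _; exists (pinf B * w n * qbin L.*2 (absz (n + L%:Z)%R)).
    by apply: vgeM; [apply: vgeM|apply: vge_qbin].
  by rewrite /G /jterm; ring.
(* The finite sum has [L.*2.+1] terms and the window only [L.*2]; the surplus term, at [n = L],
   tends to 0. *)
have last0 : conv (fun L => pinf B * (w L%:Z * (jterm x L%:Z * qbin L.*2 L.*2))) 0.
  move=> N; have nz : - x != 0 by rewrite oppr_eq0.
  have sm := @small_family F K (fun L n => pinf B * (w n * (jterm x n * qbin L.*2 L.*2)))
     (- x) M (c + 0 + 0) nz M_gt0.
  have [|Bd hB] := sm _ N.
    move=> L n _; exists (pinf B * w n * qbin L.*2 L.*2).
      by apply: vgeM; [apply: vgeM|apply: vge_qbin].
    by rewrite /jterm; ring.
  exists Bd => L leL; rewrite subr0.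
  (* Both binomials equal 1. Passing to level [L.+1] puts the index [n = L] inside the window in
     which the uniform bound [hB] is valid. *)
  have : qbin L.*2 L.*2 = qbin L.+1.*2 L.+1.*2.
    by rewrite /qbin !leqnn !subnn !poch0 !mulr1 !divff // pochB_neq0.
  by move=> ->; apply: (hB L%:Z _ L.+1); lia.
have := convB (convM (conv_cst (pinf B)) ws) last0; rewrite subr0 => h.
apply: conv_near h; exists 0%N => L _.
rewrite big_nat_recr //= mulrDr.
have -> : L.*2%:Z - L%:Z = L%:Z by lia.
rewrite addrK /win big_distrr /= big_nat [RHS]big_nat; apply: eq_bigr => k /andP [_ ltk].
by rewrite /G; congr (_ * (_ * (_ * qbin _ _))); lia.
Qed.

Lemma vanishing_jacobi x : x != 0 -> vanishing (jterm x).
Proof.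
move=> x0 N; have nz : - x != 0 by rewrite oppr_eq0.
have [|Bd hB] := @small_family F K (fun _ n => jterm x n) (- x) M 0 nz M_gt0 _ N.
  by move=> L n _; exists 1; [apply: vge1|rewrite /jterm mulr1].
by exists Bd => n len; apply: (hB n len `|n|.+1); lia.
Qed.

Theorem jacobi_triple x : x != 0 -> hassum (jterm x) (pinf B * theta x).
Proof.
move=> x0; have [||_ h] := @hassum_jacobi_gen x (fun=> 1) (theta x) x0.
- by move=> _; apply: vge1.
- apply: conv_near (conv_poch_theta x); exists 0%N => L _.
  by rewrite jacobi_poch //; apply: eq_bigr => k _; rewrite mul1r.
by apply: eq_hassum h => n; rewrite mul1r.
Qed.

Lemma vge_int (n : int) : vge 0 (n%:~R : K).
Proof.
have [m [->|->]] : exists m : nat, n = m%:Z \/ n = - m%:Z by exists `|n|%N; lia.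
  exact: vge_nat.
by rewrite rmorphN; apply/vgeN/vge_nat.
Qed.

(** Up to sign, [l] is the logarithmic derivative of [theta]: the summands of very negative index
    tend to $-1$, and the added [L%:R] compensates for them. *)
Lemma hassum_jacobi_deriv x l : x != 0 -> (forall n : int, x != X K ^ (M * n)) ->
  conv (fun L => L%:R + \sum_(0 <= i < L.*2) x * B ^ (i%:Z - L%:Z) / (1 - x * B ^ (i%:Z - L%:Z))) l ->
  vanishing (fun n => n%:~R * jterm x n) /\
  hassum (fun n => n%:~R * jterm x n) (- (pinf B * theta x * l)).
Proof.
move=> x0 hx hl; rewrite -mulrA -mulrN.
apply: hassum_jacobi_gen => // [n|]; first exact: vge_int.
apply: conv_near (convN (convM (conv_poch_theta x) hl)); exists 0%N => L _.
have e1 : \sum_(0 <= k < L.*2.+1) k%:R * (jterm x (k%:Z - L%:Z) * qbin L.*2 k) =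
   - (poch x L * poch (B / x) L * \sum_(0 <= i < L.*2) x * B ^ (i%:Z - L%:Z) / (1 - x * B ^ (i%:Z - L%:Z))).
  apply: (mulfI (jconst_neq0 L x0)); rewrite -jacobi_deriv // gpol_deriv_log => [|i lti].
    rewrite poch_dbl // mulrN; set S := \sum_(0 <= i < _) _; set S' := \sum_(0 <= i < _) _.
    suff -> : S = S' by ring.
    apply: eq_bigr => i _; have -> // : x * B ^- L * B ^+ i = x * B ^ (i%:Z - L%:Z).
    by rewrite expfzDr // -invr_expz -mulrA [X in _ * X]mulrC.
  rewrite subr_eq0 eq_sym; apply: contra (hx (L%:Z - i%:Z)) => /eqP h; apply/eqP.
  rewrite -exprz_exp expfzDr // -invr_expz -!exprnP.
  apply: (canRL (mulfK _)); first by rewrite expf_neq0.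
  rewrite -[RHS]mulr1 -h; have := expf_neq0 L B0.
  by move: (B ^+ L) (B ^+ i) => b c b0; field.
have -> : \sum_(0 <= k < L.*2.+1) (k%:Z - L%:Z)%:~R * (jterm x (k%:Z - L%:Z) * qbin L.*2 k) =
  \sum_(0 <= k < L.*2.+1) k%:R * (jterm x (k%:Z - L%:Z) * qbin L.*2 k) -
  L%:R * \sum_(0 <= k < L.*2.+1) (jterm x (k%:Z - L%:Z) * qbin L.*2 k).
  rewrite big_distrr -sumrB; apply: eq_bigr => k _ /=.
  by rewrite rmorphB /= mulrBl.
by rewrite e1 -jacobi_poch //; ring.
Qed.

Theorem jacobi_cube : vanishing (fun n => n%:~R * jterm 1 n) /\
  hassum (fun n => n%:~R * jterm 1 n) (- pinf B ^+ 3).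
Proof.
have -> : - pinf B ^+ 3 = pinf B * - (pinf B * pinf B) by ring.
have x0 : (1 : K) != 0 by exact: oner_neq0.
apply: hassum_jacobi_gen => // [n|]; first exact: vge_int.
have c1 := convN (convM (pinfP M_gt0 B) (pinfP M_gt0 B)).
have c2 : conv (fun L => - (poch B L.-1 * poch B L)) (- (pinf B * pinf B)).
  apply: convN; apply: convM (pinfP M_gt0 B).
  by apply: conv_sub (pinfP M_gt0 B) => m; exists m.+1 => L; lia.
apply: conv_near c2; exists 1%N => -[//|L] _; rewrite succnK.
have e1 : \sum_(0 <= k < L.+1.*2.+1) k%:R * (jterm 1 (k%:Z - L.+1%:Z) * qbin L.+1.*2 k) =
   - (poch B L * poch B L.+1).
  apply: (mulfI (jconst_neq0 L.+1 x0)); rewrite -jacobi_deriv //.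
  (* Isolates the factor that vanishes at $B^{-(L+1)}$; the derivative there is the product of the
     remaining factors up to a constant. *)
  have -> : gpol L.+1.*2 = gpol L.+1 * (1 - B ^+ L.+1 *: 'X) *
       \prod_(0 <= i < L) (1 - B ^+ (i + L.+2) *: 'X).
    rewrite -gpolS /gpol (@big_cat_nat _ _ _ L.+2) //=; last by lia.
    congr (_ * _); rewrite -{1}[L.+2]add0n big_addn.
    by have -> : (L.+1.*2 - L.+2 = L)%N by lia.
  rewrite mul1r deriv_simple_root ?expf_neq0 // horner_gpol horner_prod.
  rewrite -{2}[B ^- L.+1]mul1r poch_neg // divr1.
  have -> : \prod_(0 <= i < L) (1 - B ^+ (i + L.+2) *: 'X).[B ^- L.+1] = poch B L.
    apply: eq_bigr => i _.
    rewrite !(hornerD, hornerN, hornerM, hornerZ, hornerX, hornerC).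
    have -> : (i + L.+2 = i.+1 + L.+1)%N by lia.
    by rewrite exprD mulfK ?expf_neq0 // exprS.
  have nz := expf_neq0 L.+1 B0.
  move: (X K ^ (- _)) (B ^+ L.+1) nz (poch _ _) (poch _ _) ((-1) ^+ _) => u b b0 c d e.
  by field.
have -> : \sum_(0 <= k < L.+1.*2.+1) (k%:Z - L.+1%:Z)%:~R *
    (jterm 1 (k%:Z - L.+1%:Z) * qbin L.+1.*2 k) =
  \sum_(0 <= k < L.+1.*2.+1) k%:R * (jterm 1 (k%:Z - L.+1%:Z) * qbin L.+1.*2 k) -
  L.+1%:R * \sum_(0 <= k < L.+1.*2.+1) (jterm 1 (k%:Z - L.+1%:Z) * qbin L.+1.*2 k).
  rewrite big_distrr -sumrB; apply: eq_bigr => k _ /=.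
  by rewrite rmorphB /= mulrBl.
have p1 : poch 1 L.+1 = 0 by rewrite pochSl subrr mul0r.
by rewrite e1 -jacobi_poch // p1 mul0r mulr0 subr0.
Qed.

End Jacobi.

(** * Lagrange interpolation *)

Section Lagrange.
Variables (E : fieldType) (I : finType) (u : I -> E).
Hypotheses (u0 : forall i, u i != 0) (u_inj : injective u).
Implicit Types g : {poly E}.

Let nod i : {poly E} := \prod_(j | j != i) (1 - u j *: 'X).
Definition lagr i : E := \prod_(j | j != i) (1 - u j / u i).

Let horner_lin a t : (1 - a *: 'X : {poly E}).[t] = 1 - a * t.
Proof. by rewrite hornerD hornerN hornerZ hornerX hornerC. Qed.

Lemma lagr_neq0 i : lagr i != 0.
Proof.
apply/prodf_neq0 => j ji; rewrite subr_eq0 eq_sym; apply: contra ji => /eqP h.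
by apply/eqP/u_inj; rewrite -[LHS](divfK (u0 i)) h mul1r.
Qed.

Lemma lagrange_poly g : (size g <= #|I|)%N ->
  g = \sum_i (g.[(u i)^-1] / lagr i) *: nod i.
Proof.
move=> sg; apply/eqP; rewrite -subr_eq0; set h := g - _; apply/eqP.
pose rs := [seq (u i)^-1 | i <- enum I].
apply: (@roots_geq_poly_eq0 _ h rs).
- apply/allP => _ /mapP [i _ ->]; apply/eqP; rewrite /h hornerD hornerN horner_sum.
  rewrite (bigD1 i) //= big1 ?addr0 => [|j ji].
    rewrite hornerZ /nod horner_prod.
    under eq_bigr => j _ do rewrite horner_lin.
    by rewrite divfK ?lagr_neq0 // subrr.
  rewrite hornerZ /nod horner_prod (bigD1 i) ?horner_lin //= 1?eq_sym //.
  by rewrite divff // subrr mul0r mulr0.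
- by rewrite map_inj_uniq ?enum_uniq // => i j /invr_inj/u_inj.
- rewrite size_map -cardE; apply: leq_trans (size_polyD _ _) _.
  rewrite geq_max sg size_polyN; apply: leq_trans (size_sum _ _ _) _.
  apply/bigmax_leqP => i _; apply: leq_trans (size_scale_leq _ _) _.
  apply: leq_trans (size_prod_leq _ _) _.
  have lin j : (size (1 - u j *: 'X)%R <= 2)%N.
    apply: leq_trans (size_polyD _ _) _; rewrite size_polyN size_poly1 geq_max /=.
    by apply: leq_trans (size_scale_leq _ _) _; rewrite size_polyX.
  have hs : (\sum_(j | j != i) size (1 - u j *: 'X)%R <= \sum_(j | j != i) 2)%N.
    by apply: leq_sum.
  have ci (P : pred I) : P =1 (fun j => j != i) -> #|P| = #|I|.-1.
    by move=> hP; rewrite -(cardC1 i); apply: eq_card => j; rewrite !inE -hP.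
  move: hs; rewrite sum_nat_const ci // => hs.
  have I0 : (0 < #|I|)%N by apply/card_gt0P; exists i.
  by apply: (@leq_trans ((#|I|.-1 * 2).+1 - #|I|.-1)); [apply: leq_sub2r; rewrite ltnS|move: #|I| I0 => n; lia].
Qed.

(** Finite form of the residue theorem: it says that the residues of $g(t)/(t\prod_i(1-u_it))$ add
    up to 0, the degree bound excluding infinity. *)
Lemma lagrange_at0 g : (size g <= #|I|)%N ->
  \sum_i g.[(u i)^-1] / lagr i = g.[0].
Proof.
move=> /lagrange_poly {2}->; rewrite horner_sum; apply: eq_bigr => i _.
rewrite hornerZ /nod horner_prod big1 ?mulr1 // => j _.
by rewrite horner_lin mulr0 subr0.
Qed.

(* differentiate the interpolation formula for [t^k] at the node [u i0 = 1] *)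
Lemma lagrange_deriv (k : nat) i0 : (k < #|I|)%N -> u i0 = 1 ->
  - (\sum_(i | i != i0) (u i ^- k / lagr i) / (1 - u i)) =
  (k%:R + \sum_(j | j != i0) u j / (1 - u j)) / lagr i0.
Proof.
move=> ltk ui0; have D0 j : j != i0 -> 1 - u j != 0.
  by move=> ji; rewrite subr_eq0 -ui0; apply: contra ji => /eqP/u_inj ->.
have lag0 : lagr i0 = \prod_(j | j != i0) (1 - u j).
  by apply: eq_bigr => j _; rewrite ui0 divr1.
have sX : (size ('X^k : {poly E}) <= #|I|)%N by rewrite size_polyXn.
have := congr1 (fun p : {poly E} => p^`().[1]) (lagrange_poly sX).
rewrite derivXn hornerMn hornerXn expr1n (linear_sum (@deriv E)) horner_sum.
rewrite (bigD1 i0) //= derivZ hornerZ ui0 invr1 hornerXn expr1n mul1r.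
have dprod (r : seq I) (P : pred I) : (forall j, P j -> 1 - u j != 0) ->
    ((\prod_(j <- r | P j) (1 - u j *: 'X))^`()).[1] =
    - (\prod_(j <- r | P j) (1 - u j) * \sum_(j <- r | P j) u j / (1 - u j)).
  move=> hP; elim: r => [|j r IH].
    by rewrite !big_nil derivC horner0 mulr0 oppr0.
  rewrite !big_cons; case: ifP => // Pj.
  rewrite derivM hornerD !hornerM IH horner_prod horner_lin mulr1.
  under eq_bigr => i _ do rewrite horner_lin mulr1.
  rewrite derivB derivC derivZ derivX hornerD horner0 hornerN hornerZ hornerC.
  by have := hP j Pj; set p := \prod_(_ <- _ | _) _; set t := \sum_(_ <- _ | _) _; move=> h; field.
rewrite dprod // -lag0 => kE.
have {}kE : k%:R = - (\sum_(j | j != i0) u j / (1 - u j)) +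
   lagr i0 * (- \sum_(i | i != i0) (u i ^- k / lagr i) / (1 - u i)).
  rewrite [LHS]kE; congr (_ + _); first by field; rewrite lagr_neq0.
  rewrite mulrN big_distrr -sumrN /=; apply: eq_bigr => i ii0.
  rewrite derivZ hornerZ hornerXn exprVn /nod (bigD1 i0) /= 1?eq_sym //.
  rewrite derivM hornerD !hornerM horner_lin mulr1 ui0 subrr mul0r addr0.
  rewrite derivB derivC derivZ derivX hornerD horner0 hornerN hornerZ hornerC.
  rewrite horner_prod; under eq_bigr => j _ do rewrite horner_lin mulr1.
  have -> : lagr i0 = (1 - u i) * \prod_(j | (j != i) && (j != i0)) (1 - u j).
    rewrite lag0 (bigD1 i) //=; congr (_ * _); apply: eq_bigl => j; exact: andbC.
  have := D0 i ii0; have := lagr_neq0 i; set a := u i ^- k; set b := lagr i.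
  by move=> b0 d0; field; rewrite b0 d0.
rewrite kE; set S := \sum_(_ | _) _; set S' := \sum_(_ | _) _.
by have := lagr_neq0 i0; set b := lagr i0; move=> b0; field.
Qed.

End Lagrange.

(** * Partial fractions of theta quotients *)

Section Bounded.
Variables (F : fieldType) (K : lfield F).
Implicit Types f g : nat -> nat -> K.

Definition bdd2 f := exists c, forall a b, vge c (f a b).

Lemma bdd2M f g : bdd2 f -> bdd2 g -> bdd2 (fun a b => f a b * g a b).
Proof. by move=> [c hc] [d hd]; exists (c + d) => a b; apply: vgeM. Qed.

Lemma bdd2_prod (I : Type) (r : seq I) (P : pred I) (f : I -> nat -> nat -> K) :
  (forall i, P i -> bdd2 (f i)) -> bdd2 (fun a b => \prod_(i <- r | P i) f i a b).
Proof.
move=> hf; elim: r => [|i r [c IHr]].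
  by exists 0 => a b; rewrite big_nil; apply: vge1.
case Pi: (P i); last by exists c => a b; rewrite big_cons Pi.
have [d hd] := hf i Pi; exists (d + c) => a b; rewrite big_cons Pi.
exact: vgeM.
Qed.

Lemma bdd2l (h : nat -> K) : (exists c, forall a, vge c (h a)) -> bdd2 (fun a _ => h a).
Proof. by move=> [c hc]; exists c. Qed.

Lemma bdd2r (h : nat -> K) : (exists c, forall a, vge c (h a)) -> bdd2 (fun _ b => h b).
Proof. by move=> [c hc]; exists c. Qed.

End Bounded.

Section Engine.
Variables (F : fieldType) (K : lfield F) (M : int).
Hypothesis M_gt0 : 0 < M.
Local Notation B := (X K ^ M).
Local Notation poch := (@poch F K M).
Local Notation pinf := (pinf M_gt0).
Local Notation theta := (theta M_gt0).

Variables (s d l : nat) (x : 'I_s -> K) (al : 'I_d -> K).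
Hypotheses (l_gt0 : (0 < l)%N) (s_def : s = (l + d)%N).
Hypotheses (x0 : forall c, x c != 0) (al0 : forall j, al j != 0).
Hypothesis x_sep : forall c c' (n : int), c != c' -> x c' != x c * X K ^ (M * n).

Let B0 : B != 0. Proof. exact: B_neq0. Qed.

(** The translates of [x p.1] by the powers of [B] with exponents from $-L$ to $L-1$, indexed from
    0. *)
Definition unode L (p : 'I_s * 'I_L.*2) : K := x p.1 * (B ^- L * B ^+ p.2).

Lemma unode_neq0 L p : @unode L p != 0.
Proof. by rewrite !mulf_neq0 ?invr_eq0 ?expf_neq0. Qed.

Lemma XB_inj (i j : nat) : B ^+ i = B ^+ j -> i = j.
Proof.
rewrite -!XB => /(X_expz_inj M_gt0) h; apply/eqP; rewrite -eqz_nat; apply/eqP.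
have M0 : M != 0 by have := M_gt0; lia.
exact: (mulfI M0).
Qed.

Lemma unode_inj L : injective (@unode L).
Proof.
move=> [c i] [c' i']; rewrite /unode /= => h.
have e : x c' = x c * X K ^ (M * (i%:Z - i'%:Z)).
  rewrite mulrBr XD -(invr_expz _ (M * i'%:Z)) !XB mulrA.
  apply: (canRL (mulfK _)); first exact: expf_neq0.
  apply: (mulfI (_ : B ^- L != 0)); first by rewrite invr_eq0 expf_neq0.
  by rewrite mulrCA -h mulrCA.
have [ec|nc] := eqVneq c c'; last by have := x_sep (i%:Z - i'%:Z) nc; rewrite e eqxx.
move: h; rewrite -ec => /(mulfI (x0 c)) /mulfI h.
by have /XB_inj/val_inj -> : B ^+ i = B ^+ i' by apply: h; rewrite invr_eq0 expf_neq0.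
Qed.

Lemma winprod r i b : r != 0 ->
  poch (r * B ^- i) (i + b) =
  (- r) ^+ i * X K ^ (- (M * tri (i%:Z + 1))) * (poch (B / r) i * poch r b).
Proof. by move=> r0; rewrite pochD poch_neg // divfK ?expf_neq0 //; ring. Qed.

Lemma ownprod n (i : 'I_n) :
  \prod_(j < n | j != i) (1 - B ^+ j / B ^+ i) =
  (- 1) ^+ i * X K ^ (- (M * tri (i%:Z + 1))) * (poch B i * poch B (n - i).-1).
Proof.
case: i => i ltin /=; have [m nE] : exists m, n = (i + m.+1)%N.
  by exists (n - i.+1)%N; lia.
rewrite (eq_bigl (fun j : 'I_n => j != i :> nat)) //.
rewrite -(big_mkord (fun j => j != i) (fun j => 1 - B ^+ j / B ^+ i)) nE addKn /=.
rewrite (@big_cat_nat _ _ _ i) ?leq_addr //= big_nat_cond.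
rewrite [X in _ * X]big_ltn_cond ?eqxx /=; last by lia.
rewrite mulrA; congr (_ * _); last first.
  rewrite big_nat_cond (eq_bigl (fun j => (i.+1 <= j < i + m.+1)%N && true)); last first.
    by move=> j; rewrite andbT /=; lia.
  rewrite -big_nat_cond -[X in \prod_(X <= _ < _) _]add0n big_addn /poch.
  have -> : (i + m.+1 - i.+1 = m)%N by lia.
  apply: eq_bigr => j _.
  by rewrite addnS -addSn exprD mulfK ?expf_neq0 // exprS.
rewrite (eq_bigl (fun j => (0 <= j < i)%N && true)); last by move=> j; rewrite andbT /=; lia.
rewrite -big_nat_cond -[B in poch B i]divr1 -poch_neg ?oner_eq0 // /poch.
by apply: eq_bigr => j _; rewrite mul1r mulrC.
Qed.

Lemma big_pair_neq (R : Type) (idx : R) (op : Monoid.com_law idx)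
    (I J : finType) (p : I * J) (f : I * J -> R) :
  \big[op/idx]_(q | q != p) f q =
  op (\big[op/idx]_(j | j != p.2) f (p.1, j))
     (\big[op/idx]_(i | i != p.1) \big[op/idx]_j f (i, j)).
Proof.
rewrite (bigID (fun q => q.1 == p.1)) /=; congr (op _ _).
  transitivity (\big[op/idx]_(i | i == p.1) \big[op/idx]_(j | j != p.2) f (i, j)).
    rewrite pair_big_dep /=; apply: eq_big => [[i j]|[i j] _] //=.
    by case: p => a b /=; rewrite xpair_eqE negb_and; case: (i == a); rewrite /= ?andbF ?andbT.
  by rewrite big_pred1_eq.
rewrite pair_big_dep /=; apply: eq_big => [[i j]|[i j] _] //=.
by case: p => a b /=; rewrite xpair_eqE negb_and; case: (i == a); rewrite /= ?andbF ?andbT.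
Qed.

Lemma unode_ratio L (p q : 'I_s * 'I_L.*2) :
  unode q / unode p = x q.1 / x p.1 * B ^- p.2 * B ^+ q.2.
Proof.
rewrite /unode; have := (x0 p.1, expf_neq0 L B0, expf_neq0 p.2 B0).
move: (x p.1) (x q.1) (B ^+ L) (B ^+ p.2) (B ^+ q.2) => a b c e f [[a0 c0] e0].
by field; rewrite a0 c0 e0.
Qed.

(** The part of a Lagrange term that stays bounded. With [a] translates before the node and [b] from
    the node on, it tends to [coef c] when both grow. *)
Definition resid c a b : K :=
  \prod_j (poch (B / (al j / x c)) a * poch (al j / x c) b) /
  (poch B a * poch B b.-1 *
   \prod_(c' | c' != c) (poch (B / (x c' / x c)) a * poch (x c' / x c) b)).

Definition lam : K := (\prod_j (- al j)) / \prod_c (- x c).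

Lemma lagr_unode L (p : 'I_s * 'I_L.*2) :
  lagr (@unode L) p =
  (\prod_c (- (x c / x p.1))) ^+ p.2 * (X K ^ (- (M * tri (p.2%:Z + 1)))) ^+ s *
  (poch B p.2 * poch B (L.*2 - p.2).-1 *
   \prod_(c' | c' != p.1) (poch (B / (x c' / x p.1)) p.2 * poch (x c' / x p.1) (L.*2 - p.2))).
Proof.
rewrite /lagr big_pair_neq.
under eq_bigr => j _ do rewrite unode_ratio divff // mul1r mulrC.
rewrite ownprod.
have -> : \prod_(c | c != p.1) \prod_(j < L.*2) (1 - unode (c, j) / unode p) =
  \prod_(c | c != p.1) ((- (x c / x p.1)) ^+ p.2 * X K ^ (- (M * tri (p.2%:Z + 1))) *
    (poch (B / (x c / x p.1)) p.2 * poch (x c / x p.1) (L.*2 - p.2))).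
  apply: eq_bigr => c _; rewrite -winprod ?mulf_neq0 ?invr_eq0 //.
  rewrite subnKC; last by apply: ltnW.
  rewrite /poch big_mkord; apply: eq_bigr => j _; by rewrite unode_ratio.
rewrite !big_split /= prodr_const prodrXl.
have -> : \prod_c (- (x c / x p.1)) = - 1 * \prod_(c | c != p.1) (- (x c / x p.1)).
  by rewrite (bigD1 p.1) //= divff.
rewrite exprMn.
have -> : (X K ^ (- (M * tri (p.2%:Z + 1)))) ^+ s =
  X K ^ (- (M * tri (p.2%:Z + 1))) * (X K ^ (- (M * tri (p.2%:Z + 1)))) ^+ #|[pred c | c != p.1]|.
  rewrite -exprS; congr (_ ^+ _); rewrite (cardC1 p.1) card_ord.
  by have := leq_ltn_trans (leq0n _) (ltn_ord p.1); lia.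
by ring.
Qed.

Definition gnum L k : {poly K} :=
  'X^k * \prod_j \prod_(m < L.*2) (1 - (al j * (B ^- L * B ^+ m)) *: 'X).

Lemma gnum_at L k (p : 'I_s * 'I_L.*2) :
  (gnum L k).[(unode p)^-1] =
  unode p ^- k * ((\prod_j (- (al j / x p.1))) ^+ p.2 *
    (X K ^ (- (M * tri (p.2%:Z + 1)))) ^+ d *
   \prod_j (poch (B / (al j / x p.1)) p.2 * poch (al j / x p.1) (L.*2 - p.2))).
Proof.
rewrite /gnum hornerM hornerXn exprVn; congr (_ * _); rewrite horner_prod.
rewrite -prodrXl.
have -> : (X K ^ (- (M * tri (p.2%:Z + 1)))) ^+ d = \prod_(j < d) X K ^ (- (M * tri (p.2%:Z + 1))).
  by rewrite prodr_const card_ord.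
rewrite -!big_split /=; apply: eq_bigr => j _.
rewrite -winprod ?mulf_neq0 ?invr_eq0 // subnKC; last exact: ltnW.
rewrite horner_prod /poch big_mkord; apply: eq_bigr => m _.
rewrite hornerD hornerN hornerZ hornerX hornerC; congr (1 - _).
rewrite /unode; have := (x0 p.1, expf_neq0 L B0, expf_neq0 p.2 B0).
move: (x p.1) (al j) (B ^+ L) (B ^+ p.2) (B ^+ m) => a b c e f [[a0 c0] e0].
by field; rewrite a0 c0 e0.
Qed.

(** The multiplier of the residue of the limiting theta quotient along the translates of [x c],
    dictated by quasi-periodicity. The excess of [l] theta functions in the denominator gives the
    quadratic exponent, and [kap] is a free power of the variable. *)
Definition tterm (kap : int) c (n : int) : K :=
  (lam * x c ^+ l) ^ n * X K ^ (M * l%:Z * tri (n + 1)) * (x c * B ^ n) ^ (- kap).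

Definition cconst L : K := lam ^+ L * X K ^ (M * l%:Z * tri (L%:Z + 1)).

Lemma lam_neq0 : lam != 0.
Proof.
by rewrite mulf_neq0 ?invr_eq0 //; apply/prodf_neq0 => i _; rewrite oppr_eq0.
Qed.

Lemma cconst_neq0 L : cconst L != 0.
Proof. by rewrite mulf_neq0 ?expf_neq0 ?lam_neq0 // expfz_neq0 ?X_neq0. Qed.

Lemma lam_ratio c : \prod_j (- (al j / x c)) / \prod_c' (- (x c' / x c)) = lam * x c ^+ l.
Proof.
have xc := x0 c; rewrite /lam.
have -> : \prod_j (- (al j / x c)) = \prod_j (- al j) * x c ^- d.
  rewrite -exprVn -[d in X in _ = _ * X]card_ord -prodr_const -big_split /=.
  by apply: eq_bigr => j _; rewrite mulNr.
have -> : \prod_c' (- (x c' / x c)) = \prod_c' (- x c') * x c ^- s.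
  rewrite -exprVn -[s in X in _ = _ * X]card_ord -prodr_const -big_split /=.
  by apply: eq_bigr => j _; rewrite mulNr.
have nz : \prod_c (- x c) != 0 by apply/prodf_neq0 => i _; rewrite oppr_eq0.
have -> : x c ^- s = x c ^- l * x c ^- d by rewrite s_def exprD invfM.
have := (expf_neq0 l xc, expf_neq0 d xc).
move: (\prod_c _) nz (\prod_j _) (x c ^+ l) (x c ^+ d) => a a0 b e f [e0 f0].
by field; rewrite a0 e0 f0.
Qed.

(** With [k = l * L + kap] the powers of [B] that are bilinear in [n] and [L] cancel, so [L]
    survives only in the common factor [cconst L] and in the arguments of [resid]. *)
Lemma engine_term L k kap (p : 'I_s * 'I_L.*2) : k%:Z = l%:Z * L%:Z + kap ->
  (gnum L k).[(unode p)^-1] / lagr (@unode L) p =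
  cconst L * (tterm kap p.1 (p.2%:Z - L%:Z) * resid p.1 p.2 (L.*2 - p.2)).
Proof.
move=> kE; rewrite gnum_at lagr_unode /resid; case: p => c i /=.
set n : int := i%:Z - L%:Z.
have hu : unode (c, i) = x c * B ^ n.
  by rewrite /unode /= /n expfzDr // -invr_expz [X in _ * X]mulrC.
have mon : unode (c, i) ^- k * (\prod_j (- (al j / x c))) ^+ i / (\prod_c' (- (x c' / x c))) ^+ i *
   ((X K ^ (- (M * tri (i%:Z + 1)))) ^+ d / (X K ^ (- (M * tri (i%:Z + 1)))) ^+ s) =
   cconst L * tterm kap c n.
  rewrite -[X in X * _ = _]mulrA -expr_div_n lam_ratio.
  have -> : (X K ^ (- (M * tri (i%:Z + 1)))) ^+ d / (X K ^ (- (M * tri (i%:Z + 1)))) ^+ s =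
      X K ^ (M * l%:Z * tri (i%:Z + 1)).
    have e0 : X K ^ (- (M * tri (i%:Z + 1))) != 0 by rewrite expfz_neq0 ?X_neq0.
    rewrite s_def exprD invfM mulrCA divff ?expf_neq0 // mulr1.
    rewrite -exprVn invr_expz opprK exprnP exprz_exp; congr (_ ^ _); ring.
  have -> : unode (c, i) ^- k = (x c * B ^ n) ^ (- kap) * (x c ^- (l * L)%N * X K ^ (- (M * l%:Z * (n * L%:Z)))).
    rewrite hu; set v := x c * B ^ n.
    have v0 : v != 0 by apply: mulf_neq0; [exact: x0|exact/expfz_neq0/B0].
    have -> : v ^- k = v ^ (- k%:Z) by rewrite -invr_expz.
    rewrite kE (_ : - (l%:Z * L%:Z + kap) = - kap + - (l * L)%N%:Z); last by rewrite PoszM; ring.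
    rewrite expfzDr //; congr (_ * _).
    have -> : v ^ (- (l * L)%N%:Z) = v ^- (l * L) by rewrite -invr_expz.
    rewrite exprMn invfM; congr (_ * _).
    by rewrite exprnP !exprz_exp invr_expz; congr (_ ^ _); rewrite PoszM; ring.
  rewrite /cconst /tterm exprMn -exprM.
  have -> : X K ^ (M * l%:Z * tri (i%:Z + 1)) = X K ^ (M * l%:Z * (n * L%:Z)) *
      (X K ^ (M * l%:Z * tri (L%:Z + 1)) * X K ^ (M * l%:Z * tri (n + 1))).
    rewrite -!XD; congr (_ ^ _); rewrite -!mulrDr; congr (_ * _).
    apply: (@mulfI _ 2) => //; rewrite !mulrDr !triE /n; ring.
  have -> : (lam * x c ^+ l) ^ n = lam ^ n * x c ^ (l%:Z * n) by rewrite expfzMl exprnP exprz_exp.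
  have -> : lam ^+ i = lam ^+ L * lam ^ n.
    by rewrite !exprnP -expfzDr ?lam_neq0 // /n addrC subrK.
  have -> : x c ^+ (l * i) = x c ^+ (l * L) * x c ^ (l%:Z * n).
    by rewrite !exprnP -expfzDr // /n !PoszM; congr (_ ^ _); ring.
  rewrite -(invr_expz _ (M * l%:Z * (n * L%:Z))).
  have := (expf_neq0 (l * L) (x0 c), expfz_neq0 (M * l%:Z * (n * L%:Z)) (X_neq0 K)).
  move: (x c ^+ _) (X K ^ (M * l%:Z * (n * L%:Z))) (X K ^ (M * _ * tri (n + 1)))
    (X K ^ (M * _ * tri (L%:Z + 1))) (lam ^+ L) (lam ^ n) (x c ^ _) ((_ * _) ^ - kap).
  by move=> a b e f g h o v [a0 b0]; field; rewrite a0 b0.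
rewrite mulrA -mon !invfM; move: (\prod_c' _) => w.
by rewrite /resid; ring.
Qed.

Lemma pinf_inv_bdd y : (forall n : int, y != X K ^ (M * n)) ->
  pinf y != 0 /\ exists c, forall N, vge c (poch y N)^-1.
Proof.
move=> hy; have nz : pinf y != 0.
  apply: pinf_neq0 => i; rewrite subr_eq0 eq_sym; apply: contra (hy (- i%:Z)) => /eqP h.
  by apply/eqP; rewrite mulrN -invr_expz XB -[RHS]mul1r -h mulfK ?expf_neq0.
split=> //; have [c hc] := conv_bound (convV nz (pinfP M_gt0 y)).
by exists c.
Qed.

Lemma sepV y : y != 0 -> (forall n : int, y != X K ^ (M * n)) ->
  forall n : int, B / y != X K ^ (M * n).
Proof.
move=> y0 hy n; apply: contra (hy (1 - n)) => /eqP h; apply/eqP.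
rewrite mulrBr mulr1 XD -(invr_expz _ (M * n)) -h invf_div mulrCA divff ?mulr1 //.
Qed.

Lemma ratio_sep c c' : c' != c -> forall n : int, x c' / x c != X K ^ (M * n).
Proof.
move=> nc n; have := x_sep n (_ : c != c'); rewrite eq_sym => /(_ nc).
by apply: contra => /eqP <-; rewrite mulrC divfK.
Qed.

Definition coef c : K :=
  \prod_j theta (al j / x c) /
  (pinf B * pinf B * \prod_(c' | c' != c) theta (x c' / x c)).

Lemma resid_bdd c : bdd2 (resid c).
Proof.
apply: bdd2M.
  apply: bdd2_prod => j _.
  apply: (@bdd2M _ _ (fun a _ => poch _ a) (fun _ b => poch _ b)).
    by apply: bdd2l; apply: poch_bound.
  by apply: bdd2r; apply: poch_bound.
suff : bdd2 (fun a b => (poch B a)^-1 * (poch B b.-1)^-1 * \prod_(c' | c' != c)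
    ((poch (B / (x c' / x c)) a)^-1 * (poch (x c' / x c) b)^-1)).
  move=> [r hr]; exists r => a b; have := hr a b; congr (vge r _).
  rewrite (invfM (poch B a * _)) (invfM (poch B a)) -prodfV; congr (_ * _).
  by apply: eq_bigr => c' _; rewrite (invfM (poch _ a)).
apply: bdd2M.
  apply: (@bdd2M _ _ (fun a _ => (poch B a)^-1) (fun _ b => (poch B b.-1)^-1)).
    by apply: bdd2l; exists 0 => a; apply: (pochB_unit K M_gt0 a).2.
  by apply: bdd2r; exists 0 => b; apply: (pochB_unit K M_gt0 b.-1).2.
apply: bdd2_prod => c' nc.
apply: (@bdd2M _ _ (fun a _ => (poch _ a)^-1) (fun _ b => (poch _ b)^-1)).
  apply: bdd2l; apply: (pinf_inv_bdd _).2; apply: sepV; last exact: ratio_sep.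
  by rewrite mulf_neq0 ?invr_eq0.
by apply: bdd2r; apply: (pinf_inv_bdd _).2; apply: ratio_sep.
Qed.

Lemma resid_conv c (n : int) :
  conv (fun L => resid c (absz (n + L%:Z)%R) (absz (L%:Z - n)%R)) (coef c).
Proof.
have ca y : conv (fun L => poch y (absz (n + L%:Z)%R)) (pinf y).
  by apply: (conv_sub (s := fun L => absz (n + L%:Z)%R) _ (pinfP M_gt0 y)) => m;
     exists (m + `|n|)%N => L; lia.
have cb y : conv (fun L => poch y (absz (L%:Z - n)%R)) (pinf y).
  by apply: (conv_sub (s := fun L => absz (L%:Z - n)%R) _ (pinfP M_gt0 y)) => m;
     exists (m + `|n|)%N => L; lia.
have cb' y : conv (fun L => poch y (absz (L%:Z - n)%R).-1) (pinf y).
  by apply: (conv_sub (s := fun L => (absz (L%:Z - n)%R).-1) _ (pinfP M_gt0 y)) => m;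
     exists (m + `|n| + 1)%N => L; lia.
have th y : conv (fun L => poch (B / y) (absz (n + L%:Z)%R) * poch y (absz (L%:Z - n)%R)) (theta y).
  by rewrite /theta [X in conv _ X]mulrC; exact: convM (ca _) (cb _).
have th_neq c' : c' != c -> theta (x c' / x c) != 0.
  by move=> nc; apply: theta_neq0; [rewrite mulf_neq0 ?invr_eq0|apply: ratio_sep].
rewrite /coef /resid; apply: convM.
  by apply: conv_prod => j; apply: th.
have nz : pinf B * pinf B * \prod_(c' | c' != c) theta (x c' / x c) != 0.
  by rewrite !mulf_neq0 ?pinfB_neq0 //; apply/prodf_neq0.
apply: (convV nz); apply: convM; first exact: convM.
by rewrite -big_filter; under [fun L => _]funext => L do rewrite -big_filter; apply: conv_prod.
Qed.

Lemma tterm_geom kap c n :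
  tterm kap c n = (lam * x c ^+ l * X K ^ (M * l%:Z) * B ^ (- kap)) ^ n *
     X K ^ (M * l%:Z * tri n) * x c ^ (- kap).
Proof.
rewrite /tterm triS mulrDr XD !expfzMl !exprz_exp (mulrC n); ring.
Qed.

Lemma geom_neq0 kap c : lam * x c ^+ l * X K ^ (M * l%:Z) * B ^ (- kap) != 0.
Proof.
apply: mulf_neq0; last exact/expfz_neq0/B0.
apply: mulf_neq0; last exact/expfz_neq0/X_neq0.
by apply: mulf_neq0; [exact: lam_neq0|exact/expf_neq0/x0].
Qed.

Lemma Ml_gt0 : 0 < M * l%:Z. Proof. by rewrite mulr_gt0. Qed.

Lemma engine_conv kap c (w : int -> K) t : (exists r, forall n, vge r (w n)) ->
  hassum (fun n => w n * tterm kap c n) t ->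
  conv (fun L => \sum_(0 <= i < L.*2)
     w (i%:Z - L%:Z) * (tterm kap c (i%:Z - L%:Z) * resid c i (L.*2 - i))) (coef c * t).
Proof.
move=> [r hr] ht; have [a va] := vge_bound (x c ^ (- kap)).
have [b vb] := resid_bdd c.
pose G (L : nat) n := w n * (tterm kap c n * resid c (absz (n + L%:Z)%R) (absz (L%:Z - n)%R)).
have := @tannery_win F K G (fun n => coef c * (w n * tterm kap c n)) (coef c * t).
move=> /(_ _ _ (hassumZ _ ht)) h; apply: conv_near (h _ _); first exists 0%N => L _.
- rewrite /win big_nat [RHS]big_nat; apply: eq_bigr => i /andP [_ lti].
  by rewrite /G; congr (_ * (_ * resid _ _ _)); lia.
- move=> n; apply: conv_near (convM (resid_conv c n) (conv_cst (w n * tterm kap c n))).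
  by exists 0%N => L _; rewrite /G; ring.
apply: (@small_family F K G _ _ (r + a + b) (geom_neq0 kap c) Ml_gt0) => L n _.
exists (w n * x c ^ (- kap) * resid c (absz (n + L%:Z)%R) (absz (L%:Z - n)%R)).
  by apply: vgeM; [apply: vgeM|].
by rewrite /G tterm_geom; ring.
Qed.

Lemma size_lin_prod (E : fieldType) (I : Type) (r : seq I) (f : I -> E) :
  (size (\prod_(i <- r) (1 - f i *: 'X))%R <= (size r).+1)%N.
Proof.
elim: r => [|i r IHr]; first by rewrite big_nil size_poly1.
rewrite big_cons; apply: leq_trans (size_polyMleq _ _) _.
have : (size (1 - f i *: 'X)%R <= 2)%N.
  apply: leq_trans (size_polyD _ _) _; rewrite size_polyN size_poly1 geq_max /=.
  by apply: leq_trans (size_scale_leq _ _) _; rewrite size_polyX.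
by move: IHr => /=; lia.
Qed.

Lemma size_gnum L k : (size (gnum L k) <= k + (d * L.*2).+1)%N.
Proof.
rewrite /gnum pair_bigA /=; apply: leq_trans (size_polyMleq _ _) _.
have := size_lin_prod (index_enum ('I_d * 'I_L.*2)%type)
  (fun p : 'I_d * 'I_L.*2 => al p.1 * (B ^- L * B ^+ p.2)).
have -> : size (index_enum ('I_d * 'I_L.*2)%type) = (d * L.*2)%N.
  by rewrite -[index_enum _]enumT -cardE card_prod !card_ord.
by rewrite size_polyXn addSn /= leq_add2l.
Qed.

Lemma gnum_at0 L k : (0 < k)%N -> (gnum L k).[0] = 0.
Proof. by move=> k0; rewrite /gnum hornerM hornerXn expr0n gtn_eqF // mul0r. Qed.

(** For large [L] the exponent [k] is positive, so [gnum] vanishes at 0, and the degree of [gnum]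
    stays below the number of nodes because [k] is about half of the available [l * L.*2]. *)
Lemma engine_k kap : exists L0, forall L, (L0 <= L)%N -> exists k,
  [/\ (0 < k)%N, k%:Z = l%:Z * L%:Z + kap & (k + (d * L.*2).+1 <= s * L.*2)%N].
Proof.
exists (`|kap| + 2)%N => L leL; exists (absz (l%:Z * L%:Z + kap)).
have h : L%:Z <= l%:Z * L%:Z by rewrite -PoszM lez_nat leq_pmull.
have h2 : (s * L.*2 = d * L.*2 + (l * L).*2)%N by rewrite s_def mulnDl addnC doubleMr.
by split; rewrite ?h2; move: h; rewrite -PoszM; lia.
Qed.

Lemma sum_pairs L (f : 'I_s -> nat -> K) :
  \sum_(p : 'I_s * 'I_L.*2) f p.1 p.2 = \sum_c \sum_(0 <= i < L.*2) f c i.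
Proof.
rewrite -(pair_bigA _ (fun c (i : 'I_L.*2) => f c i)) /=.
by apply: eq_bigr => c _; rewrite big_mkord.
Qed.

(** The limit of [lagrange_at0] for [gnum], whose value at 0 is 0, after division by [cconst L]: the
    residues of a theta quotient with [s] thetas below and [d] above cancel. *)
Theorem theta_series_relation kap (t : 'I_s -> K) :
  (forall c, hassum (tterm kap c) (t c)) -> \sum_c coef c * t c = 0.
Proof.
move=> ht; have b1 : exists r, forall n : int, vge r ((fun=> 1 : K) n).
  by exists 0 => n; apply: vge1.
have ht' c : hassum (fun n => (fun=> 1 : K) n * tterm kap c n) (t c).
  by apply: eq_hassum (ht c) => n; rewrite mul1r.
have := conv_sum (index_enum _) (fun c => engine_conv b1 (ht' c)).
move=> /conv_uniq; apply; apply: conv_near (conv_cst 0).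
have [L0 hk] := engine_k kap; exists L0 => L /hk [k [k0 kE kle]].
have := lagrange_at0 (@unode_neq0 L) (@unode_inj L) (_ : (size (gnum L k) <= _)%N).
rewrite card_prod !card_ord => /(_ (leq_trans (size_gnum L k) kle)).
under eq_bigr => p _ do rewrite (engine_term p kE).
rewrite -big_distrr gnum_at0 //= => /eqP; rewrite mulf_eq0 (negPf (cconst_neq0 L)) /=.
rewrite (sum_pairs _ (fun c i => tterm kap c (i%:Z - L%:Z) * resid c i (L.*2 - i))).
move/eqP => {1}<-; apply: eq_bigr => c _; apply: eq_bigr => i _.
by rewrite mul1r.
Qed.

(** As $n$ goes to $-\infty$ the quotient $yB^n/(1-yB^n)$ tends to $-1$; adding 1 on that side gives
    $(1-yB^n)^{-1}$ and makes the family summable. *)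
Lemma pole_bdd y : y != 0 -> (forall n : int, y != X K ^ (M * n)) ->
  (exists r, forall n : int, vge r (1 - y * B ^ n)^-1) /\
  vanishing (fun n : int => if 0 <= n then y * B ^ n / (1 - y * B ^ n)
                            else (1 - y * B ^ n)^-1).
Proof.
move=> y0 hy; have hn (n : int) : 1 - y * B ^ n != 0.
  rewrite subr_eq0 eq_sym; apply: contra (hy (- n)) => /eqP h; apply/eqP.
  by rewrite mulrN -invr_expz -exprz_exp -[RHS]mul1r -h mulfK // expfz_neq0.
have [a va] := vge_bound y; have [b vb] := vge_bound y^-1.
have vB (n : nat) : vge n%:Z (B ^+ n).
  by apply: vgeW (vge_B K M n); rewrite -mulr_natr natz; have := M_gt0; nia.
have big (n : nat) : (`|a| + 1 <= n)%N ->
    vge (n%:Z + a) (y * B ^ n%:Z) /\ vge 0 (1 - y * B ^ n%:Z)^-1.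
  move=> len; have v1 : vge (n%:Z + a) (y * B ^ n%:Z).
    by rewrite -exprnP addrC; apply: vgeM.
  split=> //; apply: (vge_unit _).2.
  by rewrite addrAC subrr add0r; apply: vgeN; apply: vgeW v1; lia.
have small (n : nat) : (`|b| + 1 <= n)%N -> vge (n%:Z + b) (1 - y * B ^ (- n%:Z))^-1.
  move=> len; have v1 : vge (n%:Z + b) (y^-1 * B ^+ n) by rewrite addrC; apply: vgeM.
  have nz := expf_neq0 n B0; have hn' := hn (- n%:Z); move: hn'.
  have -> : B ^ (- n%:Z) = B ^- n by rewrite -invr_expz.
  move=> hn'; have -> : (1 - y * B ^- n)^-1 = - (y^-1 * B ^+ n) * (1 - y^-1 * B ^+ n)^-1.
    have h2 : 1 - y^-1 * B ^+ n != 0.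
      apply: contraNneq hn' => h; rewrite -(mulrI_eq0 _ (mulfI (_ : - (y^-1 * B ^+ n) != 0))).
        by rewrite mulrBr mulr1 mulNr opprK mulrACA mulVf // mul1r divff // addrC h.
      by rewrite oppr_eq0 mulf_neq0 ?invr_eq0.
    move: (B ^+ n) nz hn' h2 => c c0 hn' h2; field; rewrite y0 c0 /=.
    apply/andP; split; apply/eqP => h.
      by move/eqP: h2; apply; apply: (mulfI y0); rewrite mulr0 mulrBr mulr1 mulrA divff // mul1r.
    by move/eqP: hn'; apply; apply: (mulIf c0); rewrite mul0r mulrBl mul1r divfK.
  rewrite -[_ + b]addr0; apply: vgeM; first exact: vgeN.
  apply: (vge_unit _).2; rewrite addrAC subrr add0r; apply: vgeN; apply: vgeW v1; lia.
split.
  have [r hr] : exists r, forall n : int, (`|n| < `|a| + `|b| + 1)%N -> vge r (1 - y * B ^ n)^-1.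
    elim: (`|a| + `|b| + 1)%N => [|m [r IHm]]; first by exists 0.
    have [r1 h1] := vge_bound (1 - y * B ^ m%:Z)^-1.
    have [r2 h2] := vge_bound (1 - y * B ^ (- m%:Z))^-1.
    exists (Num.min r (Num.min r1 r2)) => n; rewrite ltnS leq_eqVlt => /orP [/eqP nm|ltnm].
      have [->|->] : n = m%:Z \/ n = - m%:Z by lia.
        by apply: vgeW h1; rewrite !ge_min lexx !orbT.
      by apply: vgeW h2; rewrite !ge_min lexx !orbT.
    by apply: vgeW (IHm n ltnm); rewrite ge_min lexx.
  exists (Num.min r 0) => n; case: (ltnP `|n| (`|a| + `|b| + 1)%N) => [/hr|len].
    by apply: vgeW; rewrite ge_min lexx.
  have [[m nE]|[m nE]] : (exists m : nat, n = m%:Z) \/ (exists m : nat, n = - m%:Z).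
  - by case: (intP n) => [|m|m]; [left; exists 0%N|left; exists m.+1|right; exists m.+1].
  - by rewrite nE; apply: (vgeW (_ : _ <= 0)); [rewrite ge_min lexx orbT|apply: (big m _).2; lia].
  rewrite nE; apply: (vgeW (_ : _ <= m%:Z + b)); last by apply: small; lia.
  by rewrite ge_min; apply/orP; right; lia.
move=> N; exists (`|N| + `|a| + `|b| + 1)%N => n len; case: ifP => n0.
  have [m nE] : exists m : nat, n = m%:Z by exists `|n|%N; lia.
  rewrite nE; have [v1 v2] := big m ltac:(lia).
  by apply: vgeW (vgeM v1 v2); lia.
have [m nE] : exists m : nat, n = - m%:Z by exists `|n|%N; lia.
by rewrite nE; apply: vgeW (small m _); lia.
Qed.

(* the logarithmic derivative of a theta function, as a Lambert series *)
Definition lambert y t := conv (fun L => L%:R + \sum_(0 <= i < L.*2)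
   y * B ^ (i%:Z - L%:Z) / (1 - y * B ^ (i%:Z - L%:Z))) t.

Lemma lambert_ex y : y != 0 -> (forall n : int, y != X K ^ (M * n)) ->
  exists t, lambert y t.
Proof.
move=> y0 hy; have [_ van] := pole_bdd y0 hy; have [t ht] := hassum_ex van.
exists t; apply: conv_near ht; exists 0%N => L _; rewrite /win.
have hn (n : int) : 1 - y * B ^ n != 0.
  rewrite subr_eq0 eq_sym; apply: contra (hy (- n)) => /eqP h; apply/eqP.
  by rewrite mulrN -invr_expz -exprz_exp -[RHS]mul1r -h mulfK // expfz_neq0.
have -> : \sum_(0 <= i < L.*2) (if 0 <= i%:Z - L%:Z then y * B ^ (i%:Z - L%:Z) /
   (1 - y * B ^ (i%:Z - L%:Z)) else (1 - y * B ^ (i%:Z - L%:Z))^-1) =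
   \sum_(0 <= i < L.*2) ((i < L)%N%:R + y * B ^ (i%:Z - L%:Z) / (1 - y * B ^ (i%:Z - L%:Z))).
  apply: eq_bigr => i _; have := hn (i%:Z - L%:Z); move: (y * _) => u hu.
  rewrite (_ : (0 <= i%:Z - L%:Z) = ~~ (i < L)%N); last by lia.
  by case: (i < L)%N => /=; [field|rewrite add0r].
rewrite big_split /=; congr (_ + _).
rewrite (@big_cat_nat _ _ _ L) //=; last by lia.
rewrite (eq_big_nat _ _ (F2 := fun=> 1)); last by move=> i /andP [_ ->].
rewrite [X in _ + X](eq_big_nat _ _ (F2 := fun=> 0)); last first.
  by move=> i /andP [h _]; rewrite ltnNge h.
by rewrite sumr_const_nat big1 ?addr0 // subn0.
Qed.

(** The point 1 joins the nodes. Its own Lagrange term becomes the theta quotient, and each other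
    term acquires the factor $1/(1-u^{-1})=-u/(1-u)$, which is the weight in the hypothesis up to
    sign. *)
Theorem partial_fractions kap (t : 'I_s -> K) :
  (forall c (n : int), x c != X K ^ (M * n)) ->
  (forall c, hassum (fun n => x c * B ^ n / (1 - x c * B ^ n) * tterm kap c n) (t c)) ->
  \sum_c coef c * t c = (\prod_j theta (al j)) / \prod_c theta (x c).
Proof.
move=> hx ht; have bw c : exists r, forall n : int, vge r (x c * B ^ n / (1 - x c * B ^ n)).
  have [[r hr] _] := pole_bdd (x0 c) (hx c).
  exists (Num.min r 0) => n; have hn : 1 - x c * B ^ n != 0.
    rewrite subr_eq0 eq_sym; apply: contra (hx c (- n)) => /eqP h; apply/eqP.
    by rewrite mulrN -invr_expz -exprz_exp -[RHS]mul1r -h mulfK // expfz_neq0.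
  have -> : x c * B ^ n / (1 - x c * B ^ n) = (1 - x c * B ^ n)^-1 - 1.
    by move: (x c * _) hn => u hu; field.
  apply: vgeB; first by apply: vgeW (hr n); rewrite ge_min lexx.
  by apply: vgeW (vge1 K); rewrite ge_min lexx orbT.
have := conv_sum (index_enum _) (fun c => engine_conv (bw c) (ht c)).
move=> /conv_uniq; apply.
have th0 : \prod_c theta (x c) != 0.
  by apply/prodf_neq0 => c _; apply: theta_neq0.
have := convM (conv_prod (index_enum _) (fun j => conv_poch_theta M_gt0 (al j)))
  (convV th0 (conv_prod (index_enum _) (fun c => conv_poch_theta M_gt0 (x c)))).
apply: conv_near; have [L0 hk] := engine_k kap; exists L0 => L /hk [k [k0 kE kle]].
pose u (q : 'I_s * 'I_L.*2 + unit) := if q is inl p then unode p else 1.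
have u0 q : u q != 0 by case: q => [p|[]]; [apply: unode_neq0|apply: oner_neq0].
have unE p : unode p = x p.1 * B ^ ((p.2 : 'I_L.*2)%:Z - L%:Z).
  by rewrite /unode expfzDr // -invr_expz [X in _ * X]mulrC.
have un1 p : @unode L p != 1.
  rewrite unE; apply: contra (hx p.1 (L%:Z - (p.2 : nat)%:Z)) => /eqP h; apply/eqP.
  rewrite -opprB mulrN -invr_expz -exprz_exp -[RHS]mul1r -h mulfK //.
  exact/expfz_neq0/B0.
have uinj : injective u.
  move=> [p|[]] [q|[]] //= h; first by rewrite (unode_inj h).
    by have := un1 p; rewrite h eqxx.
  by have := un1 q; rewrite -h eqxx.
have sg : (size (gnum L k) <= #|{: 'I_s * 'I_L.*2 + unit}|)%N.
  by rewrite card_sum card_prod !card_ord; apply: leq_trans (size_gnum L k) _; lia.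
have := lagrange_at0 u0 uinj sg; rewrite big_sumType /= gnum_at0 //.
rewrite (big_pred1 tt) /=; last by case.
(* Effect of the additional node 1 on the denominator of an old node. *)
have lin p : lagr u (inl p) = lagr (@unode L) p * (1 - (unode p)^-1).
  by rewrite /lagr big_sumType /= (big_pred1 tt) /= ?mul1r // => -[].
pose e := X K ^ (- (M * tri (L%:Z + 1))); have e0 : e != 0 by rewrite expfz_neq0 ?X_neq0.
have linr : lagr u (inr tt) = (\prod_c (- x c)) ^+ L * e ^+ s *
    \prod_c (poch (x c) L * poch (B / x c) L).
  rewrite /lagr big_sumType /= [X in _ * X]big1 ?mulr1; last by case.
  have -> : e ^+ s = \prod_(c < s) e by rewrite prodr_const card_ord.
  rewrite -prodrXl -!big_split /= -(pair_bigA _ (fun c (i : 'I_L.*2) => 1 - unode (c, i) / 1)).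
  apply: eq_bigr => c _; rewrite -poch_dbl // /poch big_mkord; apply: eq_bigr => i _.
  by rewrite /unode divr1 mulrA.
have g1 : (gnum L k).[1] = (\prod_j (- al j)) ^+ L * e ^+ d *
    \prod_j (poch (al j) L * poch (B / al j) L).
  rewrite /gnum hornerM hornerXn expr1n mul1r horner_prod.
  have -> : e ^+ d = \prod_(j < d) e by rewrite prodr_const card_ord.
  rewrite -prodrXl -!big_split /=; apply: eq_bigr => j _; rewrite -poch_dbl // horner_prod.
  rewrite /poch big_mkord; apply: eq_bigr => m _.
  by rewrite hornerD hornerN hornerZ hornerX hornerC mulr1 mulrA.
rewrite invr1 g1 linr => h.
have cE : cconst L = (\prod_j (- al j)) ^+ L / (\prod_c (- x c)) ^+ L * (e ^+ d / e ^+ s).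
  rewrite /cconst /lam expr_div_n; congr (_ * _).
  rewrite s_def exprD invfM mulrCA divff ?expf_neq0 // mulr1.
  by rewrite /e -exprVn invr_expz opprK exprnP exprz_exp; congr (_ ^ _); ring.
apply: (mulfI (cconst_neq0 L)).
have -> : cconst L * \sum_c \sum_(0 <= i < L.*2)
     x c * B ^ (i%:Z - L%:Z) / (1 - x c * B ^ (i%:Z - L%:Z)) *
     (tterm kap c (i%:Z - L%:Z) * resid c i (L.*2 - i)) =
  - \sum_p (gnum L k).[(unode p)^-1] / lagr u (inl p).
  rewrite -(sum_pairs _ (fun c i => x c * B ^ (i%:Z - L%:Z) / (1 - x c * B ^ (i%:Z - L%:Z)) *
     (tterm kap c (i%:Z - L%:Z) * resid c i (L.*2 - i)))) big_distrr -sumrN /=.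
  apply: eq_bigr => p _; rewrite lin -unE (invfM (lagr _ _)) (mulrA (gnum L k).[_]) (engine_term p kE).
  have := un1 p; have := unode_neq0 p; move: (unode p) (cconst L) (_ * resid _ _ _).
  move=> v a b v0 v1; have v2 : 1 - v != 0 by rewrite subr_eq0 eq_sym.
  have v3 : v - 1 != 0 by rewrite subr_eq0.
  by field; rewrite v0 v2 v3.
move/eqP: h; rewrite addr_eq0 => /eqP ->; rewrite opprK cE.
have nz : \prod_c (- x c) != 0 by apply/prodf_neq0 => i _; rewrite oppr_eq0.
by rewrite !invfM; ring.
Qed.

(* the double pole at 1 contributes the Lambert series *)
Theorem partial_fractions_pole kap c0 (t : 'I_s -> K) (lb : 'I_s -> K) :
  d = 0%N -> x c0 = 1 -> (forall c, c != c0 -> lambert (x c) (lb c)) ->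
  (forall c, hassum (fun n => (if (c == c0) && (n == 0) then 0 else (1 - x c * B ^ n)^-1) *
                              tterm kap c n) (t c)) ->
  - \sum_c coef c * t c = coef c0 * (kap%:~R + \sum_(c | c != c0) lb c).
Proof.
move=> d0 xc0 hlb ht.
have hxc c : c != c0 -> forall n : int, x c != X K ^ (M * n).
  by move=> nc n; have := x_sep n (_ : c0 != c); rewrite eq_sym xc0 mul1r; apply.
have hB (n : int) : n != 0 -> 1 - B ^ n != 0.
  move=> n0; rewrite subr_eq0 eq_sym exprz_exp; apply: contra n0 => /eqP h.
  have := X_expz_inj M_gt0 (h : X K ^ (M * n) = X K ^ 0).
  by have := M_gt0; nia.
have c0B (n : int) : x c0 * B ^ n = B ^ n by rewrite xc0 mul1r.
have bw c : exists r, forall n : int, vge r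
    (if (c == c0) && (n == 0) then 0 else (1 - x c * B ^ n)^-1).
  have [->|nc] := eqVneq c c0; last by have [] := pole_bdd (x0 c) (hxc c nc).
  exists 0 => n; rewrite c0B /=; case: eqVneq => [_|n0]; first exact: vge0.
  have [m [nE|nE]] : exists m : nat, n = m.+1%:Z \/ n = - m.+1%:Z.
  - by exists `|n|.-1; have : n != 0 := n0; lia.
  - rewrite nE; apply: (vge_unit _).2; rewrite addrAC subrr add0r; apply: vgeN.
    by apply: vgeW (vge_B K M m.+1); rewrite -mulr_natr natz; have := M_gt0; nia.
  have n1 : 1 - B ^+ m.+1 != 0 by apply: oneBX_neq0.
  have -> : (1 - B ^ n)^-1 = - B ^+ m.+1 * (1 - B ^+ m.+1)^-1.
    rewrite nE (_ : B ^ (- m.+1%:Z) = B ^- m.+1); last by rewrite -invr_expz.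
    have := expf_neq0 m.+1 B0; move: (B ^+ m.+1) n1 => b b1 b0.
    field; rewrite b0 b1 /=; apply: contra b1 => /eqP h.
    by rewrite -(opprB b 1) h oppr0.
  rewrite -[0]addr0; apply: vgeM; last first.
    apply: (vge_unit _).2; rewrite addrAC subrr add0r; apply: vgeN.
    by apply: vgeW (vge_B K M m.+1); rewrite -mulr_natr natz; have := M_gt0; nia.
  by apply: vgeN; apply: vgeW (vge_B K M m.+1); rewrite -mulr_natr natz; have := M_gt0; nia.
have cv := conv_sum (index_enum _) (fun c => engine_conv (bw c) (ht c)).
have cr := resid_conv c0 0.
(* Terms of opposite index add up to $-1$. The asymmetric window leaves the index $-L$ unpaired,
   whence the remainder $-B^L/(1-B^L)$. *)
have c00 : conv (fun L => L%:R + \sum_(0 <= i < L.*2 | i != L)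
    B ^ (i%:Z - L%:Z) / (1 - B ^ (i%:Z - L%:Z))) 0.
  suff h L : (0 < L)%N -> L%:R + \sum_(0 <= i < L.*2 | i != L)
      B ^ (i%:Z - L%:Z) / (1 - B ^ (i%:Z - L%:Z)) = - (B ^+ L / (1 - B ^+ L)).
    move=> N; exists (`|N| + 1)%N => L leL; rewrite subr0 h; last by lia.
    apply: vgeN; rewrite -[N]addr0; apply: vgeM.
      by apply: vgeW (vge_B K M L); rewrite -mulr_natr natz; have := M_gt0; nia.
    apply: (vge_unit _).2; rewrite addrAC subrr add0r; apply: vgeN.
    by apply: vgeW (vge_B K M L); rewrite -mulr_natr natz; have := M_gt0; nia.
  case: L => // L _; rewrite big_mkcond.
  have -> : \sum_(0 <= i < L.+1.*2) (if i != L.+1 then B ^ (i%:Z - L.+1%:Z) /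
      (1 - B ^ (i%:Z - L.+1%:Z)) else 0) =
     win (fun n => if n == 0 then 0 else B ^ n / (1 - B ^ n)) L.+1.
    by apply: eq_bigr => i _; rewrite -if_neg; congr (if _ then _ else _); lia.
  elim: L => [|L IHL].
    rewrite winS /win big_nil /= addr0 add0r -[X in 1 - X]expr1.
    have := oneBX_neq0 K M_gt0 0; rewrite expr1 -invr_expz expr1z.
    move: (B) B0 => b b0 b1; field; rewrite b0 b1 /=; apply: contra b1 => /eqP h.
    by rewrite -(opprB b 1) h oppr0.
  rewrite winS; move/(canRL (addKr _)): IHL => ->.
  have -> : - L.+2%:Z == 0 = false by lia.
  have -> : L.+1%:Z == 0 = false by lia.
  have := (oneBX_neq0 K M_gt0 L, oneBX_neq0 K M_gt0 L.+1, expf_neq0 L.+2 B0).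
  rewrite -invr_expz -!exprnP -[in L.+2%:R]addn1 natrD.
  move: (B ^+ L.+1) (B ^+ L.+2) => a b [[a1 b1] b0]; field.
  rewrite a1 b1 b0 /=; apply: contra b1 => /eqP h.
  by rewrite -(opprB b 1) h oppr0.
have cl : conv (fun L => kap%:~R + (\sum_(c | c != c0) (L%:R + \sum_(0 <= i < L.*2)
    x c * B ^ (i%:Z - L%:Z) / (1 - x c * B ^ (i%:Z - L%:Z))) +
    (L%:R + \sum_(0 <= i < L.*2 | i != L) B ^ (i%:Z - L%:Z) / (1 - B ^ (i%:Z - L%:Z)))))
    (kap%:~R + (\sum_(c | c != c0) lb c + 0)).
  apply: convD (conv_cst _) _; apply: convD c00.
  rewrite big_mkcond; under [fun L => _]funext => L do rewrite big_mkcond.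
  apply: conv_sum => c; case: ifP => [/hlb //|_]; exact: conv_cst.
rewrite addr0 in cl; apply: (conv_uniq (convN cv)).
have cm := convM cr cl; have [L0 hk] := engine_k kap.
apply: conv_near cm; exists L0.+1 => L ltL; have {hk} [k [k0 kE kle]] := hk L (ltnW ltL).
have L2 : (L < L.*2)%N by lia.
pose i0 : 'I_s * 'I_L.*2 := (c0, Ordinal L2).
have u1 : unode i0 = 1 by rewrite /unode /= xc0 mulVf ?mulr1 // expf_neq0.
have ltk : (k < #|{: 'I_s * 'I_L.*2}|)%N by rewrite card_prod !card_ord; apply: leq_trans kle; lia.
have h := lagrange_deriv (@unode_neq0 L) (@unode_inj L) ltk u1.
have gE p : unode p ^- k / lagr (@unode L) p =
    cconst L * (tterm kap p.1 (p.2%:Z - L%:Z) * resid p.1 p.2 (L.*2 - p.2)).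
  rewrite -(engine_term p kE); congr (_ / _).
  (* Since [d = 0] the numerator is a bare power of the variable, the case covered by
     [lagrange_deriv]. *)
  rewrite /gnum big1 ?mulr1 ?hornerXn ?exprVn // => -[j lj] _.
  by exfalso; move: (lj); rewrite d0.
have g0 : (lagr (@unode L) i0)^-1 = cconst L * resid c0 L L.
  have := gE i0; rewrite u1 expr1n invr1 mul1r => ->; congr (_ * _).
  rewrite /= subrr /tterm add0r xc0 !expr0z !mul1r exp1rz mulr1.
  have -> : tri 1 = 0 by [].
  rewrite mulr0 expr0z mul1r; congr (resid _ _ _); lia.
move: h; rewrite g0 => h; apply: (mulfI (cconst_neq0 L)).
have -> : absz (0 + L%:Z)%R = L by lia.
have -> : absz (L%:Z - 0)%R = L by lia.
have sumE : \sum_(j | j != i0) unode j / (1 - unode j) =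
   \sum_(0 <= i < L.*2 | i != L) B ^ (i%:Z - L%:Z) / (1 - B ^ (i%:Z - L%:Z)) +
   \sum_(c | c != c0) \sum_(0 <= i < L.*2) x c * B ^ (i%:Z - L%:Z) / (1 - x c * B ^ (i%:Z - L%:Z)).
  have uE c (i : 'I_L.*2) : unode (c, i) = x c * B ^ ((i : nat)%:Z - L%:Z).
    by rewrite /unode /= expfzDr // -invr_expz [X in _ * X]mulrC.
  rewrite big_pair_neq /=; congr (_ + _).
    by rewrite big_mkord; apply: eq_big => [i|i _]; rewrite ?uE ?xc0 ?mul1r.
  by apply: eq_bigr => c _; rewrite big_mkord; apply: eq_bigr => i _; rewrite uE.
have kR : k%:R = l%:R * L%:R + kap%:~R :> K.
  have : k%:Z%:~R = (l%:Z * L%:Z + kap)%:~R :> K by rewrite kE.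
  by rewrite rmorphD rmorphM.
have -> : cconst L * (resid c0 L L * (kap%:~R +
   (\sum_(c | c != c0) (L%:R + \sum_(0 <= i < L.*2)
       x c * B ^ (i%:Z - L%:Z) / (1 - x c * B ^ (i%:Z - L%:Z))) +
    (L%:R + \sum_(0 <= i < L.*2 | i != L) B ^ (i%:Z - L%:Z) / (1 - B ^ (i%:Z - L%:Z)))))) =
  (k%:R + \sum_(j | j != i0) unode j / (1 - unode j)) * (cconst L * resid c0 L L).
  rewrite sumE kR big_split /= sumr_const (cardC1 c0) card_ord.
  (* As [d = 0] forces [l = s], the [l * L] contained in [k] gives one [L] to each of the [s]
     classes of nodes, exactly the normalization in [lambert]. *)
  have -> : l%:R = s.-1%:R + 1 :> K.
    by rewrite -[1]/(1%:R) -natrD addn1 prednK s_def d0 ?addn0.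
  by rewrite -mulr_natr; ring.
rewrite -h mulrN; congr (- _).
rewrite -(sum_pairs _ (fun c i => (if (c == c0) && (i%:Z - L%:Z == 0) then 0
     else (1 - x c * B ^ (i%:Z - L%:Z))^-1) *
    (tterm kap c (i%:Z - L%:Z) * resid c i (L.*2 - i)))) big_distrr /=.
rewrite [RHS](bigD1 i0) //= eqxx subrr eqxx mul0r mulr0 add0r; apply: eq_bigr => -[c i] nci.
rewrite gE /= ifN; last first.
  apply: contra nci => /andP [/eqP -> /eqP e]; rewrite xpair_eqE eqxx /=.
  by apply/eqP/val_inj => /=; lia.
rewrite /unode /= expfzDr // -invr_expz -!exprnP [B ^+ i * _]mulrC.
by ring.
Qed.

End Engine.

(** * Three-term relation and the quintuple product *)

Section ThreePoints.
Variables (F : fieldType) (K : lfield F) (M : int).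
Hypothesis M_gt0 : 0 < M.
Local Notation B := (X K ^ M).
Local Notation pinf := (pinf M_gt0).
Local Notation theta := (theta M_gt0).

Definition sep (a b : K) := forall n : int, b != a * X K ^ (M * n).

Definition at3 (a b c : K) (i : 'I_3) : K := nth 0 [:: a; b; c] i.

Lemma sep_sym a b : sep a b -> sep b a.
Proof.
move=> h n; apply: contra (h (- n)) => /eqP ->.
by rewrite -mulrA -expfzDr ?X_neq0 // mulrN subrr expr0z mulr1.
Qed.

Lemma at3_sep a b c : sep a b -> sep a c -> sep b c ->
  forall i j (n : int), i != j -> at3 a b c j != at3 a b c i * X K ^ (M * n).
Proof.
by move=> hab hac hbc [[|[|[|i]]] //= hi] [[|[|[|j]]] //= hj] n;
   rewrite -?val_eqE //= => _; rewrite /at3 //=; do ?[exact: sep_sym | exact: hab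
   | exact: hac | exact: hbc]; apply: sep_sym.
Qed.

Lemma at3_neq0 a b c : a != 0 -> b != 0 -> c != 0 -> forall i, at3 a b c i != 0.
Proof. by move=> a0 b0 c0 [[|[|[|i]]]]. Qed.

Lemma sum3 (f : 'I_3 -> K) : \sum_i f i = f ord0 + f (lift ord0 ord0) + f ord_max.
Proof.
by rewrite !big_ord_recl big_ord0 addr0 addrA; congr (_ + _ + f _); apply: val_inj.
Qed.

Lemma prod3 (P : pred 'I_3) (f : 'I_3 -> K) :
  \prod_(i | P i) f i = (if P ord0 then f ord0 else 1) *
   (if P (lift ord0 ord0) then f (lift ord0 ord0) else 1) *
   (if P ord_max then f ord_max else 1).
Proof.
rewrite big_mkcond !big_ord_recl big_ord0 /= mulr1 mulrA.
by have -> : lift ord0 (lift ord0 ord0) = ord_max :> 'I_3 by apply: val_inj.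
Qed.

(** Multiplicative form of $\sigma(a+b)\sigma(a-b)$; the factor [a^-1] makes it antisymmetric. *)
Definition brk (a b : K) : K := a^-1 * (theta (a * b) * theta (a / b)).

Lemma theta_sep a b : a != 0 -> b != 0 -> sep a b -> theta (a / b) != 0.
Proof.
move=> a0 b0 h; apply: theta_neq0; first by rewrite mulf_neq0 ?invr_eq0.
move=> n; apply: contra (sep_sym h n) => /eqP e.
by rewrite -e mulrC divfK.
Qed.

(** Residue relation with nodes [a], [b], [c] and numerators [d], [d^-1]. Here [l = 1], so by the
    triple product the three series are themselves theta values at [b * c], [a * c] and [a * b]. *)
Theorem weierstrass a b c d : a != 0 -> b != 0 -> c != 0 -> d != 0 ->
  sep a b -> sep a c -> sep b c ->
  brk a d * brk b c - brk b d * brk a c + brk c d * brk a b = 0.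
Proof.
move=> a0 b0 c0 d0 hab hac hbc.
pose x := at3 a b c; pose al (j : 'I_2) : K := nth 0 [:: d; d^-1] j.
have al0 j : al j != 0 by case: j => [[|[|j]]] hj; rewrite /al /= ?invr_eq0.
have x0 := at3_neq0 a0 b0 c0 : forall i, x i != 0.
have lamE : lam x al = - (a * b * c)^-1.
  rewrite /lam prod3 !big_ord_recl big_ord0 /x /al /at3 /=; field.
  by rewrite !oppr_eq0 a0 b0 c0 d0.
have ht i : hassum (tterm M 1 x al 0 i) (pinf B * theta (a * b * c / x i)).
  have u0 : a * b * c != 0 by rewrite !mulf_neq0.
  rewrite -thetaBV; apply: eq_hassum (jacobi_triple M_gt0 _); last first.
    by rewrite !mulf_neq0 ?invr_eq0 ?mulf_neq0 ?invr_eq0 ?B_neq0.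
  move=> n; rewrite /jterm /tterm lamE oppr0 expr0z mulr1 expr1 triS.
  rewrite -[M * 1%:Z]/(M * 1) mulr1 mulrDr expfzDr ?X_neq0 // -(exprz_exp _ M n).
  rewrite [X in _ = _ * X]mulrC [RHS]mulrA -expfzMl; congr (_ ^ n * _).
  by move: (x i) (x0 i) => y y0; field; rewrite y0 a0 b0 c0.
have := @theta_series_relation F K M M_gt0 3 2 1 x al isT erefl x0 al0
  (at3_sep hab hac hbc) 0 _ ht.
rewrite sum3 /coef !prod3 !big_ord_recl !big_ord0 /= /x /al /at3 /= !mul1r !mulr1.
have J0 := pinfB_neq0 K M_gt0.
have e1 : a * b * c / a = b * c by field.
have e2 : a * b * c / b = a * c by field.
have e3 : a * b * c / c = a * b by field.
rewrite e1 e2 e3.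
have tV (u v : K) : u != 0 -> v != 0 -> theta (v / u) = - (v / u) * theta (u / v).
  move=> u0 v0; rewrite -{1}[v / u]invf_div thetaV ?mulf_neq0 ?invr_eq0 //.
  by rewrite invf_div.
have tV2 (u : K) : u != 0 -> theta (d^-1 / u) = - (u * d)^-1 * theta (u * d).
  by move=> u0; rewrite -invfM mulrC thetaV ?mulf_neq0.
have q1 := theta_sep a0 b0 hab; have q2 := theta_sep a0 c0 hac.
have q3 := theta_sep b0 c0 hbc.
rewrite !tV2 // !(tV _ d) // (tV a b) // (tV a c) // (tV b c) // /brk.
move: (theta (a / b)) (theta (a / c)) (theta (b / c)) q1 q2 q3 => A1 A2 A3 q1 q2 q3.
move: (theta (a * b)) (theta (a * c)) (theta (b * c)) => A4 A5 A6.
move: (theta (a * d)) (theta (b * d)) (theta (c * d)) => D1 D2 D3.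
move: (theta (a / d)) (theta (b / d)) (theta (c / d)) => D4 D5 D6.
move: (pinf B) J0 => J J0 /eqP.
rewrite (_ : _ + _ = ((a^-1 * (D1 * D4)) * (b^-1 * (A6 * A3)) -
   (b^-1 * (D2 * D5)) * (a^-1 * (A5 * A2)) + c^-1 * (D3 * D6) * (a^-1 * (A4 * A1))) /
   (a^-1 * c * J * A1 * A2 * A3)); last first.
  by field; rewrite !oppr_eq0 a0 b0 c0 d0 q1 q2 q3 J0.
by rewrite mulf_eq0 invr_eq0 !mulf_eq0 !invr_eq0 (negPf a0) (negPf c0) (negPf J0)
   (negPf q1) (negPf q2) (negPf q3) !orbF => /eqP.
Qed.

Lemma M3_gt0 : 0 < M * 3. Proof. by rewrite mulr_gt0. Qed.

Lemma poch_mod3 N : poch M B (N * 3) =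
  @poch F K (M * 3) (B ^+ 3) N * (@poch F K (M * 3) (B ^+ 2) N * @poch F K (M * 3) B N).
Proof.
have B3 : X K ^ (M * 3) = B ^+ 3 by rewrite -exprz_exp.
elim: N => [|N IHN]; first by rewrite !poch0 !mulr1.
rewrite mulSnr pochD IHN !pochS poch0 B3 -!exprM [(3 * N)%N]mulnC.
by move: (B ^+ (N * 3)) (poch _ _ N) (poch _ _ N) (poch _ _ N) => t u v w; ring.
Qed.

Lemma pinf_mod3 : pinf B =
  Submission.pinf M3_gt0 (B ^+ 3) * (Submission.pinf M3_gt0 (B ^+ 2) * Submission.pinf M3_gt0 B).
Proof.
apply: conv_uniq (conv_sub (s := fun N => (N * 3)%N) _ (pinfP M_gt0 B)) _.
  by move=> n; exists n => L; lia.
apply: (conv_near _ (convM (pinfP M3_gt0 (B ^+ 3))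
  (convM (pinfP M3_gt0 (B ^+ 2)) (pinfP M3_gt0 B)))).
by exists 0%N => L _; rewrite poch_mod3.
Qed.

Lemma cube_series z : z != 0 ->
  vanishing (fun n : int => (- 1) ^ n * (z ^ (3 * n) * X K ^ (M * (3 * tri n + 2 * n)))) /\
  hassum (fun n : int => (- 1) ^ n * (z ^ (3 * n) * X K ^ (M * (3 * tri n + 2 * n))))
    (Submission.pinf M3_gt0 (B ^+ 3) * Submission.theta M3_gt0 (z ^+ 3 * B ^+ 2)).
Proof.
move=> z0; have u0 : z ^+ 3 * B ^+ 2 != 0 by rewrite mulf_neq0 ?expf_neq0 ?B_neq0.
have E n : jterm (M * 3) (z ^+ 3 * B ^+ 2) n =
    (- 1) ^ n * (z ^ (3 * n) * X K ^ (M * (3 * tri n + 2 * n))).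
  rewrite /jterm -[- (z ^+ 3 * _)]mulN1r expfzMl expfzMl -!mulrA mulrDr [X K ^ (_ + _)]expfzDr ?X_neq0 //.
  rewrite -!exprz_exp; congr (_ * (_ * _)).
  by rewrite mulrC.
split; last first.
  have := jacobi_triple M3_gt0 u0; rewrite (_ : X K ^ (M * 3) = B ^+ 3); last by rewrite -exprz_exp.
  exact: eq_hassum.
by move=> N; have [b hb] := vanishing_jacobi M3_gt0 u0 N; exists b => n /hb; rewrite E.
Qed.

(** Triple product in base $B^3$ at $B^2$; [pinf_mod3] reassembles the three progressions into one
    Euler product. *)
Lemma pentagonal : hassum (fun n : int => (- 1) ^ n * X K ^ (M * (3 * tri n + 2 * n))) (pinf B).
Proof.
rewrite pinf_mod3; have [_] := cube_series (oner_neq0 K).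
rewrite expr1n mul1r /Submission.theta (_ : X K ^ (M * 3) / B ^+ 2 = B).
  by apply: eq_hassum => n; rewrite exp1rz mul1r.
by rewrite -exprz_exp -[_ ^ 3]/(B ^+ 3) exprS mulfK ?expf_neq0 ?B_neq0.
Qed.

(** Residue relation with nodes [z], 1, [z^-1], no numerator and [kap = 1]: the node 1 contributes
    the Euler product through [pentagonal], the other two the series [u] and [v]. *)
Theorem quintuple z u v : z != 0 -> sep 1 z -> sep 1 (z ^+ 2) ->
  hassum (fun n : int => (- 1) ^ n * (z ^ (3 * n) * X K ^ (M * (3 * tri n + 2 * n)))) u ->
  hassum (fun n : int => (- 1) ^ n * (z ^ (- (3 * n)) * X K ^ (M * (3 * tri n + 2 * n)))) v ->
  pinf B * (theta (z ^+ 2) / theta z) = z * u + v.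
Proof.
move=> z0 h1 h2 hu hv.
have zV0 : z^-1 != 0 by rewrite invr_eq0.
have s1 : sep z 1 := sep_sym h1.
have s2 : sep z z^-1.
  move=> n; apply: contra (sep_sym h2 n) => /eqP e.
  by rewrite expr2 -mulrA -e divff.
have s3 : sep 1 z^-1.
  move=> n; apply: contra (sep_sym h1 n) => /eqP e.
  by rewrite -[z]invrK e mul1r mulVf // expfz_neq0 ?X_neq0.
pose x := at3 z 1 z^-1; pose al (j : 'I_0) : K := 1.
have lamE : lam x al = - 1.
  by rewrite /lam prod3 big_ord0 /x /at3 /=; field; rewrite !oppr_eq0 z0 oner_neq0.
pose t i := at3 (u / z) (pinf B) (v * z) i.
have ht i : hassum (tterm M 3 x al 1 i) (t i).
  have pw (n : int) y : y != 0 -> (lam x al * y ^+ 3) ^ n * X K ^ (M * 3%:Z * tri (n + 1)) *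
     (y * B ^ n) ^ (- 1) = y^-1 * ((- 1) ^ n * (y ^ (3 * n) * X K ^ (M * (3 * tri n + 2 * n)))).
    move=> y0; rewrite lamE triS expfzMl exprnP !exprz_exp exprN1 invfM.
    rewrite (_ : M * (3 * tri n + 2 * n) = M * 3%:Z * (tri n + n) - M * n); last by ring.
    rewrite expfzDr ?X_neq0 // -invr_expz [RHS]mulrCA -!mulrA; congr (_ * _).
    by rewrite [RHS]mulrCA; congr (_ * _); apply: mulrCA.
  case: i => [[|[|[|i]]]] //= hi; rewrite /t /tterm /x /at3 /=.
  - by rewrite [u / z]mulrC; apply: eq_hassum (hassumZ z^-1 hu) => n; rewrite pw.
  - by apply: eq_hassum pentagonal => n; rewrite pw ?oner_neq0 // invr1 exp1rz !mul1r.
  rewrite [v * z]mulrC; apply: eq_hassum (hassumZ z hv) => n; rewrite pw // invrK -exprz_exp.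
  by rewrite -exprz_inv.
have := @theta_series_relation F K M M_gt0 3 0 3 x al isT erefl (at3_neq0 z0 (oner_neq0 _) zV0)
  (fun j => oner_neq0 _) (at3_sep s1 s2 s3) 1 _ ht.
rewrite sum3 /coef !prod3 !big_ord0 /= /x /t /at3 /= invr1 !mul1r !mulr1 !invrK.
rewrite thetaV // (_ : z^-1 / z = (z ^+ 2)^-1) ?thetaV ?expf_neq0 //; last first.
  by rewrite expr2 invfM.
rewrite -expr2.
have q1 : theta z != 0 by rewrite -[z]divr1 theta_sep ?oner_neq0.
have q2 : theta (z ^+ 2) != 0 by rewrite -[z ^+ 2]divr1 theta_sep ?oner_neq0 ?expf_neq0 //; exact: sep_sym.
move: (theta z) (theta (z ^+ 2)) (pinf B) (pinfB_neq0 K M_gt0) q1 q2 => a b J J0 a0 b0 /eqP.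
rewrite (_ : _ + _ + _ = (z * u + v - J * (b / a)) * (z / (J ^+ 2 * a * b))); last first.
  by field; rewrite oppr_eq0 oner_neq0 z0 a0 b0 J0.
rewrite mulf_eq0 subr_eq0 => /orP [/eqP -> //|].
by rewrite !mulf_eq0 invr_eq0 !mulf_eq0 (negPf z0) (negPf a0) (negPf b0) (negPf J0).
Qed.

End ThreePoints.

(** * Theta values at eleventh division points *)

Lemma sum11 (V : nmodType) (g : nat -> V) : \sum_(0 <= r < 11) g r =
  g 0%N + (g 1%N + (g 2%N + (g 3%N + (g 4%N + (g 5%N + (g 6%N + (g 7%N + (g 8%N + (g 9%N + g 10%N))))))))).
Proof. by rewrite unlock /= addr0. Qed.

Lemma sum5 (V : nmodType) (g : nat -> V) :
  \sum_(1 <= r < 6) g r = g 1%N + (g 2%N + (g 3%N + (g 4%N + g 5%N))).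
Proof. by rewrite unlock /= addr0. Qed.

Section Eleven.
Variables (F : fieldType) (K : lfield F) (M : int).
Hypotheses (M_gt0 : 0 < M) (ME : M = 242).
Local Notation B := (X K ^ M).
Local Notation pinf := (pinf M_gt0).
Local Notation theta := (theta M_gt0).
Local Notation J := (pinf B).

(** Signed monomials carry all prefactors below. Comparing two of them is an integer computation on
    exponents, the sign exponent counting modulo 2 ([mon_eq]). *)
Definition mon (s e : int) : K := (- 1) ^ s * X K ^ e.

Lemma N1_neq0 : - 1 != 0 :> K. Proof. by rewrite oppr_eq0 oner_neq0. Qed.

Lemma mon_neq0 s e : mon s e != 0.
Proof. by rewrite mulf_neq0 ?expfz_neq0 ?X_neq0 ?N1_neq0. Qed.

Lemma monM s e s' e' : mon s e * mon s' e' = mon (s + s') (e + e').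
Proof. by rewrite mulrACA -!expfzDr ?X_neq0 ?N1_neq0. Qed.

Lemma sgn2 (n : int) : (- 1) ^ (2 * n) = 1 :> K.
Proof. by rewrite -exprz_exp -[_ ^ 2]/((- 1) ^+ 2) sqrrN expr1n exp1rz. Qed.

Lemma mon_eq s e s' e' (k : int) : s = s' + 2 * k -> e = e' -> mon s e = mon s' e'.
Proof. by move=> -> ->; rewrite /mon expfzDr ?N1_neq0 // sgn2 mulr1. Qed.

Lemma mon0 : mon 0 0 = 1. Proof. by rewrite /mon !expr0z mulr1. Qed.

Lemma Xmon e : X K ^ e = mon 0 e. Proof. by rewrite /mon expr0z mul1r. Qed.

Lemma monV s e : (mon s e)^-1 = mon s (- e).
Proof.
apply: (mulfI (mon_neq0 s e)); rewrite divff ?mon_neq0 // monM -mon0.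
by apply/esym; apply: (@mon_eq _ _ _ _ s); ring.
Qed.

Lemma monX s e (n : int) : (mon s e) ^ n = mon (s * n) (e * n).
Proof. by rewrite /mon expfzMl !exprz_exp. Qed.

Lemma sgn_cases (n : int) : (- 1) ^ n = 1 :> K \/ (- 1) ^ n = - 1 :> K.
Proof.
have [k [->|->]] : exists k, n = 2 * k \/ n = 1 + 2 * k by exists (n %/ 2)%Z; lia.
  by left; exact: sgn2.
by right; rewrite expfzDr ?N1_neq0 // sgn2 mulr1.
Qed.

Definition zt (a : int) : K := X K ^ (22 * a).

Lemma zt_neq0 a : zt a != 0. Proof. by rewrite expfz_neq0 ?X_neq0. Qed.

Lemma zt_mon a : zt a = mon 0 (22 * a). Proof. by rewrite /mon expr0z mul1r. Qed.

Lemma ztD a b : zt (a + b) = zt a * zt b.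
Proof. by rewrite /zt mulrDr expfzDr ?X_neq0. Qed.

Lemma ztB a b : zt (a - b) = zt a / zt b.
Proof. by rewrite /zt mulrBr expfzDr ?X_neq0 // -invr_expz. Qed.

Lemma zt_sep a : ~~ (11 %| a)%Z -> forall n : int, zt a != X K ^ (M * n).
Proof.
move=> h n; apply: contra h => /eqP /(X_expz_inj M_gt0) e.
have -> : a = 11 * n by move: e; rewrite ME; lia.
exact: dvdz_mulr.
Qed.

Lemma zt_sep2 a b : ~~ (11 %| a - b)%Z -> sep M (zt b) (zt a).
Proof.
move=> h n; apply: contra (zt_sep h n) => /eqP e.
by rewrite ztB e mulrC mulKf ?zt_neq0.
Qed.

(** The exponent is $(n-5)(n-6)$: the constant 30 makes it nonnegative, with minimum 0 at [n = 5]
    and [n = 6]. *)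
Definition gt (n : int) := mon n (n * (n - 11) + 30).

Definition pt (a : int) : K := gt a * (J * theta (zt a)).

Lemma pt_neq0 a : ~~ (11 %| a)%Z -> pt a != 0.
Proof.
move=> h; apply: mulf_neq0 (mon_neq0 _ _) (mulf_neq0 (pinfB_neq0 K M_gt0) _).
exact: theta_neq0 (zt_neq0 a) (zt_sep h).
Qed.

Lemma pt0 : pt 0 = 0.
Proof. by rewrite /pt /zt mulr0 expr0z theta1 !mulr0. Qed.

Lemma ptN a : pt (- a) = - pt a.
Proof.
rewrite /pt (_ : zt (- a) = (zt a)^-1); last by rewrite /zt mulrN invr_expz.
rewrite thetaV ?zt_neq0 // (_ : gt (- a) = zt a * gt a).
  by move: (zt a) (zt_neq0 a) => z z0; field.
by rewrite zt_mon monM; apply: (@mon_eq _ _ _ _ (- a)); ring.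
Qed.

Lemma ptD11 a : pt (a + 11) = pt a.
Proof.
rewrite /pt (_ : zt (a + 11) = zt a * B); last first.
  by rewrite ztD ME; congr (_ * _).
rewrite thetaB ?zt_neq0 // (_ : gt (a + 11) = - (zt a * gt a)).
  by move: (zt a) (zt_neq0 a) => z z0; field.
rewrite -mulN1r zt_mon monM (_ : - 1 = mon 1 0) ?monM; last by rewrite /mon expr0z mulr1 expr1z.
by apply: (@mon_eq _ _ _ _ 5); ring.
Qed.

Lemma gt_jterm a k : gt (a + 11 * k) = gt a * jterm M (zt a) k.
Proof.
rewrite /jterm -mulN1r zt_mon (_ : - 1 = mon 1 0); last by rewrite /mon expr0z mulr1 expr1z.
rewrite (_ : X K ^ (M * tri k) = mon 0 (M * tri k)); last by rewrite /mon expr0z mul1r.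
rewrite monM monX !monM; apply: (@mon_eq _ _ _ _ (5 * k)); first by ring.
have := triE k; rewrite ME; move: (tri k) => t; nia.
Qed.

Lemma pt_series a : vanishing (fun k => gt (a + 11 * k)) /\
  hassum (fun k => gt (a + 11 * k)) (pt a).
Proof.
have h := jacobi_triple M_gt0 (zt_neq0 a); split; last first.
  by apply: eq_hassum (hassumZ (gt a) h) => k; rewrite gt_jterm.
have [c hc] := vge_bound (gt a) => N.
have [b hb] := vanishing_jacobi M_gt0 (zt_neq0 a) (N - c); exists b => n /hb h'.
by rewrite gt_jterm; have := vgeM hc h'; rewrite addrC subrK.
Qed.

Lemma pt_brk u v : pt (u + v) * pt (u - v) =
  mon 0 (2 * u ^+ 2 + 2 * v ^+ 2 + 60) * J ^+ 2 * brk M_gt0 (zt u) (zt v).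
Proof.
rewrite /pt /brk ztD ztB zt_mon monV [_ * (J * _) * _]mulrACA monM.
rewrite (_ : mon _ _ = mon 0 (2 * u ^+ 2 + 2 * v ^+ 2 + 60) * mon 0 (- (22 * u))).
  by move: (mon _ _) (mon _ _) (theta _) (theta _) (J) => x y z t j; ring.
by rewrite monM; apply: (@mon_eq _ _ _ _ u); ring.
Qed.

(** [weierstrass] at the division points. The monomial prefactor of [pt_brk] splits into factors
    depending on one index each, hence all three products carry the same one. *)
Lemma pt_plucker a b c d : ~~ (11 %| a - b)%Z -> ~~ (11 %| a - c)%Z -> ~~ (11 %| b - c)%Z ->
  pt (a + d) * pt (a - d) * (pt (b + c) * pt (b - c)) -
  pt (b + d) * pt (b - d) * (pt (a + c) * pt (a - c)) +
  pt (c + d) * pt (c - d) * (pt (a + b) * pt (a - b)) = 0.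
Proof.
move=> hab hac hbc.
have := weierstrass M_gt0 (zt_neq0 a) (zt_neq0 b) (zt_neq0 c) (zt_neq0 d).
rewrite !pt_brk => /(_ (sep_sym (zt_sep2 hab)) (sep_sym (zt_sep2 hac)) (sep_sym (zt_sep2 hbc))) h.
have mm x y : mon 0 (2 * x ^+ 2 + 2 * y ^+ 2 + 60) = mon 0 (2 * x ^+ 2 + 30) * mon 0 (2 * y ^+ 2 + 30).
  by rewrite monM; apply: (@mon_eq _ _ _ _ 0); ring.
rewrite !mm; move: h; move: (brk _ _ _) (brk _ _ _) (brk _ _ _) (brk _ _ _) (brk _ _ _) (brk _ _ _).
move=> b1 b2 b3 b4 b5 b6 h.
move: (mon 0 _) (mon 0 _) (mon 0 _) (mon 0 _) (J) => m1 m2 m3 m4 j.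
rewrite (_ : _ + _ = m1 * m2 * m3 * m4 * j ^+ 4 * (b6 * b5 - b4 * b3 + b2 * b1)); last by ring.
by rewrite h mulr0.
Qed.

Definition om a := pt (2 * a) / pt a.

Definition WW := 1 + \sum_(1 <= a < 6) om a%:Z.

Lemma omE a : ~~ (11 %| a)%Z -> om a = mon a (a * (3 * a - 11)) * (theta (zt a ^+ 2) / theta (zt a)).
Proof.
move=> ha; have t0 : theta (zt a) != 0 by rewrite theta_neq0 ?zt_neq0 //; apply: zt_sep.
rewrite /om /pt (_ : zt (2 * a) = zt a ^+ 2); last by rewrite mulrDl !mul1r ztD.
rewrite (_ : gt (2 * a) = mon a (a * (3 * a - 11)) * gt a); last first.
  by rewrite monM; apply: (@mon_eq _ _ _ _ 0); ring.
by move: (theta _) t0 (J) (pinfB_neq0 K M_gt0) (gt a) (mon_neq0 a (a * (a - 11) + 30) : gt a != 0)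
  => t t0 j j0 g g0; field; rewrite t0 j0 g0.
Qed.

Lemma two_gt0 : (0 < 2 :> int). Proof. by []. Qed.

Definition pent_term a (k : int) : K :=
  (- 1) ^ k * (zt a ^ (3 * k) * X K ^ (M * (3 * tri k + 2 * k))).

Lemma pent_term_opp a : hassum (pent_term (- a)) =
  hassum (fun k => (- 1) ^ k * (zt a ^ (- (3 * k)) * X K ^ (M * (3 * tri k + 2 * k)))).
Proof.
congr hassum; apply/funext => k; rewrite /pent_term; congr (_ * (_ * _)).
by rewrite /zt !exprz_exp; congr (_ ^ _); ring.
Qed.

(** Quintuple product at [zt a]: two opposite residue classes of the pentagonal series combine into
    one quotient [om a]. *)
Lemma pair_terms a u v : ~~ (11 %| a)%Z -> ~~ (11 %| 2 * a)%Z ->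
  hassum (pent_term a) u -> hassum (pent_term (- a)) v ->
  mon a ((a + 2) * (3 * a + 5)) * u + mon (- a) ((2 - a) * (5 - 3 * a)) * v =
  X K ^ 10 * J * om a.
Proof.
move=> ha h2a hu; rewrite pent_term_opp => hv.
have z2 : zt a ^+ 2 = zt (2 * a) by rewrite mulrDl !mul1r ztD.
have s1 : sep M 1 (zt a) by move=> n; rewrite mul1r zt_sep.
have s2 : sep M 1 (zt a ^+ 2) by move=> n; rewrite mul1r z2 zt_sep.
rewrite omE // [RHS]mulrCA -[X K ^ 10 * J * _]mulrA (quintuple M_gt0 (zt_neq0 a) s1 s2 hu hv).
have -> : mon (- a) ((2 - a) * (5 - 3 * a)) = mon 0 10 * mon a (a * (3 * a - 11)).
  by rewrite monM; apply: (@mon_eq _ _ _ _ (- a)); ring.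
have -> : mon a ((a + 2) * (3 * a + 5)) = mon 0 10 * mon a (a * (3 * a - 11)) * zt a.
  by rewrite zt_mon !monM; apply: (@mon_eq _ _ _ _ 0); ring.
rewrite {1}/mon expr0z mul1r {2}/mon expr0z mul1r.
by move: (X K ^ 10) (mon _ _) (zt a) => x y z; ring.
Qed.

Theorem euler_dissection : Submission.pinf two_gt0 (X K ^ 2) = X K ^ 10 * J * WW.
Proof.
pose f (n : int) : K := (- 1) ^ n * X K ^ (2 * (3 * tri n + 2 * n)).
have vf : vanishing f.
  have [h _] := cube_series two_gt0 (oner_neq0 K); move=> N; have [b hb] := h N.
  by exists b => n /hb; rewrite exp1rz mul1r.
(* With [n = 11 k + r] and [a = r - 5] the pentagonal index is [- (a + 2 + 11 k)]. For [a = 0] this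
   is the class of $-2$, whose least exponent gives $q^5J$, and opposite values of [a] are paired by
   [pair_terms]. *)
have hf : hassum (fun n => f (- (n - 3))) (Submission.pinf two_gt0 (X K ^ 2)).
  apply: (@hassum_shift F K (fun n => f (- n)) _ (- 3)); first exact: vanishing_opp.
  have hp : hassum f (Submission.pinf two_gt0 (X K ^ 2)).
    exact: pentagonal.
  exact: hassum_opp vf hp.
have /choice [q hq] (a : int) : exists q, hassum (pent_term a) q.
  by have [_ h] := cube_series M_gt0 (zt_neq0 a); eexists; exact: h.
pose t (r : nat) := mon (r%:Z - 5) ((r%:Z - 3) * (3 * r%:Z - 10)) * q (r%:Z - 5).
have ht r : hassum (fun k => f (- (11%:Z * k + r%:Z - 3))) (t r).
  apply: eq_hassum (hassumZ _ (hq _)) => k; rewrite /pent_term /f.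
  set a := r%:Z - 5; have -> : - (11%:Z * k + r%:Z - 3) = - (a + 2 + 11 * k) by rewrite /a; ring.
  rewrite -[(- 1) ^ _ * X K ^ (2 * _)]/(mon _ _).
  rewrite -[(- 1) ^ k]mulr1 -(expr0z (X K)) -[_ * X K ^ 0]/(mon k 0) zt_mon monX.
  rewrite [X K ^ (M * _)]Xmon !monM; apply: (@mon_eq _ _ _ _ (a + 1 + 6 * k)); first by rewrite /a; ring.
  have := triE k; have := triE (- (a + 2 + 11 * k)); rewrite ME (_ : r%:Z = a + 5); last by rewrite /a; ring.
  by move: (tri k) (tri _) => u v; clear; nia.
rewrite (hassum_split (isT : (0 < 11)%N) hf ht) /WW mulrDr mulr1 big_distrr /=.
rewrite sum11 sum5 /t.
have q0 : q 0 = J.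
  apply: hassum_uniq (hq 0) _; apply: eq_hassum (pentagonal K M_gt0) => k.
  by rewrite /pent_term /zt mulr0 expr0z exp1rz mul1r.
rewrite -(pair_terms (isT : ~~ (11 %| 1)%Z) isT (hq 1) (hq (- 1))).
rewrite -(pair_terms (isT : ~~ (11 %| 2)%Z) isT (hq 2) (hq (- 2))).
rewrite -(pair_terms (isT : ~~ (11 %| 3)%Z) isT (hq 3) (hq (- 3))).
rewrite -(pair_terms (isT : ~~ (11 %| 4)%Z) isT (hq 4) (hq (- 4))).
rewrite -(pair_terms (isT : ~~ (11 %| 5)%Z) isT (hq 5) (hq (- 5))).
have -> : X K ^ 10 * J = mon 0 10 * q 0 by rewrite q0 /mon expr0z mul1r.
pose T (a : int) := mon a ((a + 2) * (3 * a + 5)) * q a.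
have TL (r : nat) (a : int) : r%:Z - 5 = a ->
    mon (r%:Z - 5) ((r%:Z - 3) * (3 * r%:Z - 10)) * q (r%:Z - 5) = T a.
  by move=> <-; rewrite /T; congr (mon _ _ * _); ring.
have TR a : mon (- a) ((2 - a) * (5 - 3 * a)) * q (- a) = T (- a).
  by rewrite /T; congr (mon _ _ * _); ring.
rewrite (TL 0%N (- 5%:Z)) // (TL 1%N (- 4%:Z)) // (TL 2%N (- 3%:Z)) // (TL 3%N (- 2%:Z)) //.
rewrite (TL 4%N (- 1%:Z)) // (TL 5%N 0) // (TL 6%N 1%:Z) // (TL 7%N 2%:Z) // (TL 8%N 3%:Z) //.
rewrite (TL 9%N 4%:Z) // (TL 10%N 5%:Z) // ?TR -?/(T 4%:Z) -?/(T 5%:Z) ?TR.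
move: (T 0) (T _) (T _) (T _) (T _) (T _) (T _) (T _) (T _) (T _) (T _).
by move=> t0 t1 t2 t3 t4 t5 t6 t7 t8 t9 t10; ring.
Qed.

(** The default 0 stands for the indices where the Lambert series has no limit; [lbzP] covers those
    prime to 11. *)
Definition lbz a : K := if pselect (exists l, lambert M (zt a) l) is left h then projT1 (cid h) else 0.

Lemma lbzP a : ~~ (11 %| a)%Z -> lambert M (zt a) (lbz a).
Proof.
move=> ha; rewrite /lbz; case: pselect => [h|[]]; first exact: (projT2 (cid h)).
exact: (@lambert_ex F K M M_gt0 1 0 1 isT erefl _ (zt_neq0 a) (zt_sep ha)).
Qed.

(** Logarithmic derivative of [pt a], normalized so that differentiating [gt n] multiplies it by
    [2 * n - 11]; along $n=a+11k$ this weight is $2a-11+22k$, which explains the 22. *)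
Definition ell a : K := (2 * a - 11)%:~R - 22%:R * lbz a.

Definition gd (n : int) : K := (2 * n - 11)%:~R * gt n.

Lemma gd_jterm a k : gd (a + 11 * k) = gt a * ((2 * a - 11)%:~R * jterm M (zt a) k +
   22%:R * (k%:~R * jterm M (zt a) k)).
Proof.
rewrite /gd gt_jterm (_ : 2 * (a + 11 * k) - 11 = 2 * a - 11 + 22%:Z * k); last by ring.
by rewrite rmorphD rmorphM /=; move: (_%:~R) (k%:~R) => x y; ring.
Qed.

Lemma pd_series a : ~~ (11 %| a)%Z -> hassum (fun k => gd (a + 11 * k)) (ell a * pt a).
Proof.
move=> ha; have [_ h] := hassum_jacobi_deriv M_gt0 (zt_neq0 a) (zt_sep ha) (lbzP ha).
have := hassumZ (gt a) (hassumD (hassumZ (2 * a - 11)%:~R (jacobi_triple M_gt0 (zt_neq0 a)))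
  (hassumZ 22%:R h)).
rewrite (_ : gt a * _ = ell a * pt a).
  by apply: eq_hassum => k; rewrite gd_jterm.
rewrite /ell /pt; move: (_%:~R) (lbz a) (theta _) (gt a) (J) => x y z u v; ring.
Qed.

Lemma pd_series0 : hassum (fun k => gd (11 * k)) (- (22%:R * (X K ^ 30 * J ^+ 3))).
Proof.
have [_ h] := jacobi_cube K M_gt0.
have := hassumZ (gt 0) (hassumD (hassumZ (2 * 0 - 11)%:~R (jacobi_triple M_gt0 (zt_neq0 0)))
  (hassumZ 22%:R h)).
have z0 : zt 0 = 1 by rewrite /zt mulr0 expr0z.
rewrite z0 theta1 !mulr0 add0r (_ : gt 0 = X K ^ 30); last by rewrite /gt /mon expr0z mul1r.
rewrite add0r mulrN mulrN mulrCA; apply: eq_hassum => k.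
by have := gd_jterm 0 k; rewrite add0r z0 => ->; rewrite /gt /mon expr0z mul1r.
Qed.

Lemma gd_refl n : gd (11 - n) = gd n.
Proof.
rewrite /gd (_ : 2 * (11 - n) - 11 = - (2 * n - 11)); last by ring.
rewrite rmorphN mulNr -mulrN; congr (_ * _).
rewrite -mulN1r (_ : - 1 = mon 1 0); last by rewrite /mon expr0z mulr1 expr1z.
by rewrite monM; apply: (@mon_eq _ _ _ _ (6 - n)); ring.
Qed.

Lemma vanishing_gd : vanishing gd.
Proof.
move=> N; exists (`|N| + 22)%N => n hn.
have le : N <= 0 + (0 + (n * (n - 11) + 30)) by nia.
apply: vgeW le _; have h2 : vge 0 ((- 1) ^ n : K).
  by have [->|->] := sgn_cases n; [exact: vge1 | apply: vgeN; exact: vge1].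
exact: (vgeM (vge_int K M_gt0 (2 * n - 11)) (vgeM h2 (@vge_X F K _))).
Qed.

Lemma ellN a : ~~ (11 %| a)%Z -> ell (- a) = - ell a.
Proof.
move=> ha; have hna : ~~ (11 %| - a)%Z by lia.
have p0 := pt_neq0 ha; suff : ell (- a) * pt (- a) = ell a * pt a.
  by rewrite ptN mulrN -mulNr => /(mulIf p0) <-; rewrite opprK.
apply: hassum_uniq (pd_series hna) _.
have va : vanishing (fun k => gd (a + 11 * k)).
  move=> N; have [b hb] := @vanishing_comp F K gd 11 a isT vanishing_gd N.
  by exists b => n /hb; rewrite addrC.
apply: eq_hassum (hassum_shift (- 1) (vanishing_opp va) (hassum_opp va (pd_series ha))) => k.
by rewrite -gd_refl; congr gd; ring.
Qed.

Lemma ellD11 a : ~~ (11 %| a)%Z -> ell (a + 11) = ell a.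
Proof.
move=> ha; have hna : ~~ (11 %| a + 11)%Z by lia.
have p0 := pt_neq0 ha; apply: (mulIf p0); rewrite -{1}(ptD11 a).
apply: hassum_uniq (pd_series hna) _.
have va : vanishing (fun k => gd (a + 11 * k)).
  move=> N; have [b hb] := @vanishing_comp F K gd 11 a isT vanishing_gd N.
  by exists b => n /hb; rewrite addrC.
apply: eq_hassum (hassum_shift 1 va (pd_series ha)) => k.
by congr gd; ring.
Qed.

(** Jacobi's identity for the cube of the Euler product in $q$, cut modulo 11. The class of
    multiples of 11 gives the same identity for [J], the other classes the products [ell a * pt a],
    equal for opposite [a]. On the left stands the cube of [euler_dissection]. *)
Theorem cube_dissection : X K ^ 30 * J ^+ 3 * WW ^+ 3 *+ 2 =
  - (22%:R * (X K ^ 30 * J ^+ 3)) + \sum_(1 <= a < 6) (ell a%:Z * pt a%:Z) *+ 2.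
Proof.
have [_ h] := jacobi_cube K two_gt0.
have h0 := jacobi_triple two_gt0 (oner_neq0 K).
(* The shift by 5 turns $(n-5)(n-6)$ into $m(m-1)$. The weight $2m-1$ is a combination of
   [jacobi_cube] and of the triple product at 1, which vanishes. *)
have hg : hassum (fun m => gd (m + 5)) (Submission.pinf two_gt0 (X K ^ 2) ^+ 3 *+ 2).
  have := hassumD (hassumZ (- 2%:R) h) h0; rewrite theta1 mulr0 addr0 mulrNN mulr_natl.
  apply: eq_hassum => m; rewrite /gd [_ * (m%:~R * _)]mulrA -[X in _ + X = _]mul1r -mulrDl.
  rewrite (_ : - 2%:R * m%:~R + 1 = - (2 * (m + 5) - 11)%:~R :> K); last first.
    by rewrite rmorphB rmorphM rmorphD /=; ring.
  rewrite mulNr -mulrN; congr (_ * _); rewrite /jterm -mulN1r (_ : - 1 * _ = mon (m + 1) (m ^+ 2 - m)).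
    by apply: (@mon_eq _ _ _ _ (- 2)); ring.
  by rewrite /mon expfzDr ?N1_neq0 // expr1z mulrN1 !mulNr mul1r; congr (- (_ * X K ^ _)); rewrite triE; ring.
have /choice [q hq] (r : nat) : exists q, hassum (fun k => gd (11%:Z * k + r%:Z + 5)) q.
  have := vanishing_comp (r%:Z + 5) (isT : 11%:Z != 0) vanishing_gd.
  by move=> /hassum_ex [q hq]; exists q; apply: eq_hassum hq => k; rewrite addrA.
have qE (r : nat) (a : int) (j : int) : ~~ (11 %| a)%Z -> r%:Z + 5 = a + 11 * j -> q r = ell a * pt a.
  move=> ha e; apply: hassum_uniq (hq r) _.
  have va : vanishing (fun k => gd (a + 11 * k)).
    move=> N; have [b hb] := @vanishing_comp F K gd 11 a isT vanishing_gd N.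
    by exists b => n /hb; rewrite addrC.
  apply: eq_hassum (hassum_shift j va (pd_series ha)) => k.
  by congr gd; rewrite -addrA e; ring.
have q6 : q 6 = - (22%:R * (X K ^ 30 * J ^+ 3)).
  apply: hassum_uniq (hq 6) _.
  have va := vanishing_comp 0 (isT : 11%:Z != 0) vanishing_gd.
  have hh : hassum (fun k => gd (11%:Z * k + 0)) (- (22%:R * (X K ^ 30 * J ^+ 3))).
    by apply: eq_hassum pd_series0 => k; rewrite addr0.
  by apply: eq_hassum (hassum_shift 1 va hh) => k; congr gd; ring.
have := hassum_split (isT : (0 < 11)%N) hg hq.
rewrite euler_dissection sum11 sum5 q6.
have ev a : ~~ (11 %| a)%Z -> ell (- a) * pt (- a) = ell a * pt a.
  by move=> ha; rewrite ellN // ptN mulrNN.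
rewrite (qE 0%N 5 0) // (qE 1%N (- 5) 1) // (qE 2%N (- 4) 1) // (qE 3%N (- 3) 1) //.
rewrite (qE 4%N (- 2) 1) // (qE 5%N (- 1) 1) // (qE 7%N 1 1) // (qE 8%N 2 1) // (qE 9%N 3 1) //.
rewrite (qE 10%N 4 1) // !ev //.
have -> : X K ^ 30 = (X K ^ 10) ^+ 3 by rewrite exprnP exprz_exp.
by rewrite -!exprMn => ->; ring.
Qed.

End Eleven.

(** * Dissection of the rank series *)

Section RankSeries.
Variables (F : fieldType) (K : lfield F) (M : int).
Hypotheses (M_gt0 : 0 < M) (ME : M = 242).
Local Notation B := (X K ^ M).
Local Notation theta := (theta M_gt0).
Local Notation J := (pinf M_gt0 B).
Local Notation mon := (@mon F K).
Local Notation zt := (@zt F K).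
Local Notation pt := (pt K M_gt0).
Local Notation om := (om K M_gt0).
Local Notation ell := (ell K M).
Local Notation lbz := (lbz K M).

(** The singular term [n = 0] is dropped; its effect reappears in [Sp_relation_pole]. *)
Definition st (b n : int) : K :=
  if n == 0 then 0 else mon n (n * (3 * n + 1) + 2 * b * n) / (1 - zt n).

Lemma zt_neq1 n : n != 0 -> 1 - zt n != 0.
Proof.
move=> n0; rewrite subr_eq0 eq_sym /Submission.zt; apply: contra n0 => /eqP h.
have : X K ^ (22 * n) = X K ^ 0 by rewrite expr0z.
by move/(X_expz_inj M_gt0) => e; lia.
Qed.

Lemma vge_geom (n : int) : n != 0 -> vge 0 ((1 - zt n)^-1).
Proof.
move=> n0; have pos (m : int) : 0 < m -> vge 0 ((1 - zt m)^-1).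
  move=> m0; apply: (vge_unit _).2; rewrite addrAC subrr add0r; apply: vgeN.
  by apply: vgeW (vge_X _ _); lia.
have [lt|le] := ltrP 0 n; first exact: pos.
have lt : 0 < - n by lia.
have -> : (1 - zt n)^-1 = - zt (- n) * (1 - zt (- n))^-1.
  have := zt_neq1 n0; have : 1 - zt (- n) != 0 by apply: zt_neq1; lia.
  have -> : zt (- n) = (zt n)^-1 by rewrite /Submission.zt mulrN invr_expz.
  move: (zt n) (zt_neq0 K n) => z z0 h1 h2; field; rewrite z0 h2 /=.
  by rewrite andbT; apply: contra h2 => /eqP h; rewrite -(opprB z 1) h oppr0.
rewrite -[0]addr0; apply: vgeM (pos _ lt).
by apply: vgeN; apply: vgeW (vge_X _ _); lia.
Qed.

Lemma vge_mon s e : vge e (mon s e).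
Proof.
rewrite -[e in vge e]add0r; apply: vgeM (vge_X _ _).
by have [->|->] := sgn_cases K M_gt0 ME s; [exact: vge1 | apply: vgeN; exact: vge1].
Qed.

Lemma vanishing_st b : vanishing (st b).
Proof.
move=> N; exists (`|N| + `|b| + `|b| + 2)%N => n hn.
have n0 : n != 0 by lia.
have le : N <= (n * (3 * n + 1) + 2 * b * n) + 0 by nia.
rewrite /st (negPf n0); apply: vgeW le _.
by apply: vgeM (vge_mon _ _) (vge_geom n0).
Qed.

Lemma vanishing_st_res b c : vanishing (fun k => st b (c + 11 * k)).
Proof.
move=> N; have [B hB] := @vanishing_comp F K (st b) 11 c isT (@vanishing_st b) N.
by exists B => n /hB; rewrite addrC.
Qed.

Definition Sp b c : K := projT1 (cid (hassum_ex (@vanishing_st_res b c))).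

Lemma SpP b c : hassum (fun k => st b (c + 11 * k)) (Sp b c).
Proof. exact: (projT2 (cid (hassum_ex (@vanishing_st_res b c)))). Qed.

Lemma SpD b c (j : int) : Sp b (c + 11 * j) = Sp b c.
Proof.
apply: hassum_uniq (SpP b _) _.
apply: eq_hassum (hassum_shift j (@vanishing_st_res b c) (SpP b c)) => k.
by congr st; ring.
Qed.

Definition SS b : K := projT1 (cid (hassum_ex (@vanishing_st b))).

Lemma SSP b : hassum (st b) (SS b).
Proof. exact: (projT2 (cid (hassum_ex (@vanishing_st b)))). Qed.

Lemma SS_split b : SS b = \sum_(0 <= r < 11) Sp b r%:Z.
Proof.
apply: (hassum_split (isT : (0 < 11)%N) (SSP b)) => r.
by apply: eq_hassum (SpP b r) => k; rewrite addrC.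
Qed.

Lemma theta_pt m : theta (zt m) = mon m (- (m * (m - 11) + 30)) * (pt m / J).
Proof.
have J0 := pinfB_neq0 K M_gt0.
rewrite -monV /Submission.pt /gt; move: (Submission.mon _ _ _) (mon_neq0 K m (m * (m - 11) + 30)) => g g0.
by field; rewrite J0 g0.
Qed.

Definition tx c a := at3 (zt (c - a)) (zt c) (zt (c + a)).
Definition ti (c a : int) (i : 'I_3) : int := nth 0 [:: c - a; c; c + a] i.
(** Empty family of numerators: the quotients expanded here have three theta functions below and
    none above. *)
Definition al0 (j : 'I_0) : K := 1.

Lemma txE c a i : tx c a i = zt (ti c a i).
Proof. by case: i => [[|[|[|i]]]]. Qed.

Lemma tx_neq0 c a i : tx c a i != 0.
Proof. by rewrite txE zt_neq0. Qed.

Lemma tx_sep c a : ~~ (11 %| a)%Z -> ~~ (11 %| 2 * a)%Z -> forall i j (n : int),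
  i != j -> tx c a j != tx c a i * X K ^ (M * n).
Proof.
move=> ha h2a; apply: at3_sep; apply: (zt_sep2 K M_gt0 ME).
- by rewrite (_ : c - (c - a) = a) //; ring.
- by rewrite (_ : c + a - (c - a) = 2 * a) //; ring.
- by rewrite (_ : c + a - c = a) //; ring.
Qed.

Lemma tx_lam c a : lam (tx c a) al0 = mon 1 (- (66 * c)).
Proof.
have N (x : K) : - x = mon 1 0 * x by rewrite /Submission.mon expr0z mulr1 expr1z mulN1r.
rewrite /lam prod3 big_ord0 /tx /at3 /= !N.
by rewrite !zt_mon !monM monV mul1r; apply: (@mon_eq _ _ _ _ _ _ 1); ring.
Qed.

(** Both sides are signed monomials with quadratic exponent in [k]. Comparing the coefficients
    linear in [k] gives [b = 27 - 3 * c - 11 * kap], so the centre [c] is tied to [b] by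
    $3c\equiv5-b$ modulo 11. *)
Lemma tx_core c a i (kap b k : int) : b = 27 - 3 * c - 11 * kap ->
  (lam (tx c a) al0 * tx c a i ^+ 3) ^ k * X K ^ (M * 3%:Z * tri (k + 1)) *
    (zt (ti c a i + 11 * k)) ^ (1 - kap) =
  mon (ti c a i) (- (3 * ti c a i ^+ 2 + 33 * ti c a i - 6 * c * ti c a i)) *
  mon (ti c a i + 11 * k) ((ti c a i + 11 * k) * (3 * (ti c a i + 11 * k) + 1) + 2 * b * (ti c a i + 11 * k)).
Proof.
move=> ->; rewrite tx_lam txE; move: (ti c a i) => m.
rewrite exprnP !zt_mon [X K ^ (M * _ * _)]Xmon !monX !(monM, monX).
apply: (@mon_eq _ _ _ _ _ _ (- m - 5 * k)); first by ring.
by have := triE (k + 1); rewrite ME; move: (tri _) => t; nia.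
Qed.

Lemma ztB11 c k : zt (c + 11 * k) = zt c * B ^ k.
Proof. by rewrite ztD /Submission.zt ME exprz_exp; congr (_ * X K ^ _); ring. Qed.

Lemma tx_hassum c a i (kap b : int) : b = 27 - 3 * c - 11 * kap -> ~~ (11 %| ti c a i)%Z ->
  hassum (fun n => tx c a i * B ^ n / (1 - tx c a i * B ^ n) * tterm M 3 (tx c a) al0 kap i n)
   (mon (ti c a i) (- (3 * ti c a i ^+ 2 + 33 * ti c a i - 6 * c * ti c a i)) * Sp b (ti c a i)).
Proof.
move=> hb hi; apply: eq_hassum (hassumZ _ (SpP b _)) => k.
have n0 : ti c a i + 11 * k != 0.
  by apply: contra hi => /eqP e; rewrite (_ : ti c a i = 11 * - k) ?dvdz_mulr //; lia.
have z0 := zt_neq0 K (ti c a i + 11 * k).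
rewrite /st (negPf n0) mulrA -(tx_core a i k hb) /tterm txE -ztB11.
rewrite expfzDr // expr1z.
by move: (_^-1) (_ ^ - kap) (_ ^ k) (X K ^ _) => u v w r; ring.
Qed.

Lemma tx_hassum_pole c a i (kap b : int) : b = 27 - 3 * c - 11 * kap ->
  ti c a i = 0 \/ ~~ (11 %| ti c a i)%Z ->
  hassum (fun n => (if (ti c a i == 0) && (n == 0) then 0 else (1 - tx c a i * B ^ n)^-1) *
     tterm M 3 (tx c a) al0 (kap - 1) i n)
   (mon (ti c a i) (- (3 * ti c a i ^+ 2 + 33 * ti c a i - 6 * c * ti c a i)) * Sp b (ti c a i)).
Proof.
move=> hb hi; apply: eq_hassum (hassumZ _ (SpP b _)) => k.
have n0 : (ti c a i + 11 * k == 0) = (ti c a i == 0) && (k == 0).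
  have [e|h] := hi; first by rewrite e; lia.
  apply/idP/idP => [/eqP e|/andP [/eqP -> /eqP ->] //].
  by move: h; rewrite (_ : ti c a i = 11 * - k) ?dvdz_mulr //; lia.
rewrite /st n0; case: ifP => _; first by rewrite mul0r mulr0.
rewrite mulrA -(tx_core a i k hb) /tterm txE -ztB11 opprB.
by move: (_^-1) (_ ^ (1 - kap)) (_ ^ k) (X K ^ _) => u v w r; ring.
Qed.

(** The field algebra of [Sp_relation]: the monomials attached to the three nodes have the common
    value [D], and dividing by it leaves [pb / pa], the quotient [om a]. *)
Lemma three_term_solve (E : fieldType) (m1 m2 m3 n1 n2 n3 t1 t2 t3 D G j pa pb q1 q2 q3 S1 S2 S3 : E) :
  m1 * n1 = D -> m2 * n2 = D -> m3 * n3 = D -> t1 * t2 * t3 = (D * G)^-1 ->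
  D != 0 -> G != 0 -> j != 0 -> pa != 0 -> pb != 0 -> q1 != 0 -> q2 != 0 -> q3 != 0 ->
  m1 / (pa * pb) * (n1 * S1) + - m2 / pa ^+ 2 * (n2 * S2) + m3 / (pa * pb) * (n3 * S3) =
    1 / (t1 * (q1 / j) * (t2 * (q2 / j)) * (t3 * (q3 / j))) ->
  S1 + S3 = pb / pa * S2 + G * j ^+ 3 * (pa * pb) / (q1 * q2 * q3).
Proof.
move=> h1 h2 h3 ht D0 G0 j0 a0 b0 q10 q20 q30.
have -> : t1 * (q1 / j) * (t2 * (q2 / j)) * (t3 * (q3 / j)) = t1 * t2 * t3 * (q1 * q2 * q3 / j ^+ 3).
  by field.
rewrite ht (_ : _ + _ + _ = (m1 * n1 * S1 + m3 * n3 * S3 - pb / pa * (m2 * n2) * S2) / (pa * pb)); last first.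
  by field; rewrite a0 b0.
rewrite h1 h2 h3 => h.
have e : S1 + S3 - pb / pa * S2 = D^-1 * (pa * pb) * ((D * S1 + D * S3 - pb / pa * D * S2) / (pa * pb)).
  by field; rewrite D0 a0 b0.
rewrite -[LHS](subrK (pb / pa * S2)) e h addrC; congr (_ + _).
by field; rewrite ?D0 ?G0 ?j0 ?q10 ?q20 ?q30.
Qed.

Lemma pole_solve (E : fieldType) (m1 m2 m3 n1 n2 n3 pa pb S1 S2 S3 Q : E) :
  - (m1 / (pa * pb) * (n1 * S1) + - m2 / pa ^+ 2 * (n2 * S2) + m3 / (pa * pb) * (n3 * S3)) =
    m1 / (pa * pb) * Q ->
  m1 * n1 = m1 -> m2 * n2 = m1 -> m3 * n3 = m1 -> m1 != 0 -> pa != 0 -> pb != 0 ->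
  S1 + S3 - pb / pa * S2 = - Q.
Proof.
move=> h h1 h2 h3 m0 a0 b0.
have -> : - Q = - (m1^-1 * (pa * pb) * (m1 / (pa * pb) * Q)) by field; rewrite m0 a0 b0.
rewrite -h (_ : _ + _ + _ = (m1 * n1 * S1 + m3 * n3 * S3 - pb / pa * (m2 * n2) * S2) / (pa * pb)); last first.
  by field; rewrite a0 b0.
by rewrite h1 h2 h3; field; rewrite m0 a0 b0.
Qed.

Definition Vt c a : K := X K ^ 30 * J ^+ 3 * (pt a * pt (2 * a)) / (pt (c - a) * pt c * pt (c + a)).

Lemma tx_coef c a : ~~ (11 %| a)%Z -> ~~ (11 %| 2 * a)%Z ->
  [/\ coef M_gt0 (tx c a) al0 ord0 = mon a (5 * a ^+ 2 - 33 * a + 60) / (pt a * pt (2 * a)),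
   coef M_gt0 (tx c a) al0 (lift ord0 ord0) = - mon 0 (2 * a ^+ 2 + 60) / (pt a) ^+ 2 &
   coef M_gt0 (tx c a) al0 ord_max = mon a (5 * a ^+ 2 + 33 * a + 60) / (pt a * pt (2 * a))].
Proof.
move=> ha h2a; have p1 := pt_neq0 K M_gt0 ME ha; have p2 := pt_neq0 K M_gt0 ME h2a.
have J0 := pinfB_neq0 K M_gt0.
rewrite /coef !prod3 !big_ord0 /= /tx /at3 /= -!ztB !mul1r !mulr1.
have e1 : c - (c - a) = a by ring.
have e2 : c + a - (c - a) = 2 * a by ring.
have e3 : c - a - c = - a by ring.
have e4 : c + a - c = a by ring.
have e5 : c - a - (c + a) = - (2 * a) by ring.
have e6 : c - (c + a) = - a by ring.
rewrite e1 e2 e3 e4 e5 e6 !theta_pt !ptN //; split.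
- have -> : mon a (5 * a ^+ 2 - 33 * a + 60) = (mon a (- (a * (a - 11) + 30)))^-1 *
     (mon (2 * a) (- (2 * a * (2 * a - 11) + 30)))^-1.
    by rewrite !monV monM; apply: (@mon_eq _ _ _ _ _ _ (- a)); ring.
  move: (mon a _) (mon_neq0 K a (- (a * (a - 11) + 30))) => g1 h1.
  move: (mon (2 * a) _) (mon_neq0 K (2 * a) (- (2 * a * (2 * a - 11) + 30))) => g2 h2.
  by field; rewrite h1 h2 J0 p1 p2.
- have -> : mon 0 (2 * a ^+ 2 + 60) = (mon a (- (a * (a - 11) + 30)))^-1 *
     (mon (- a) (- (- a * (- a - 11) + 30)))^-1.
    by rewrite !monV monM; apply: (@mon_eq _ _ _ _ _ _ 0); ring.
  move: (mon a _) (mon_neq0 K a (- (a * (a - 11) + 30))) => g1 h1.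
  move: (mon (- a) _) (mon_neq0 K (- a) (- (- a * (- a - 11) + 30))) => g2 h2.
  by field; rewrite ?oppr_eq0 ?oner_neq0 ?h1 ?h2 ?J0 ?p1.
have -> : mon a (5 * a ^+ 2 + 33 * a + 60) = (mon (- a) (- (- a * (- a - 11) + 30)))^-1 *
     (mon (- (2 * a)) (- (- (2 * a) * (- (2 * a) - 11) + 30)))^-1.
  by rewrite !monV monM; apply: (@mon_eq _ _ _ _ _ _ (2 * a)); ring.
move: (mon (- a) _) (mon_neq0 K (- a) (- (- a * (- a - 11) + 30))) => g1 h1.
move: (mon (- (2 * a)) _) (mon_neq0 K (- (2 * a)) (- (- (2 * a) * (- (2 * a) - 11) + 30))) => g2 h2.
by field; rewrite ?oppr_eq0 ?oner_neq0 ?h1 ?h2 ?J0 ?p1 ?p2.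
Qed.

(** Partial fractions of the reciprocal of three theta functions with nodes [zt (c - a)], [zt c],
    [zt (c + a)]. The symmetry of the nodes gives the outer residues the same theta part, and the
    ratio to the middle one is [om a]. *)
Theorem Sp_relation c a (kap b : int) : b = 27 - 3 * c - 11 * kap ->
  ~~ (11 %| a)%Z -> ~~ (11 %| 2 * a)%Z -> ~~ (11 %| c)%Z -> ~~ (11 %| c - a)%Z ->
  ~~ (11 %| c + a)%Z ->
  Sp b (c - a) + Sp b (c + a) = om a * Sp b c + Vt c a.
Proof.
move=> hb ha h2a hc hca hca'.
have tsep i n : tx c a i != X K ^ (M * n).
  by rewrite txE; apply: (zt_sep K M_gt0 ME); case: i => [[|[|[|i]]]].
have hi i : ~~ (11 %| ti c a i)%Z by case: i => [[|[|[|i]]]].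
have := @partial_fractions F K M M_gt0 3 0 3 (tx c a) al0 isT erefl (@tx_neq0 c a)
  (fun j => oner_neq0 K) (tx_sep c ha h2a) kap _ tsep (fun i => tx_hassum hb (hi i)).
have [e1 e2 e3] := tx_coef c ha h2a; rewrite sum3 prod3 big_ord0 e1 e2 e3.
rewrite /tx /ti /at3 /= !theta_pt /Vt (_ : X K ^ 30 = mon 0 30); last by rewrite /Submission.mon expr0z mul1r.
have p1 := pt_neq0 K M_gt0 ME ha; have p2 := pt_neq0 K M_gt0 ME h2a.
have p3 := pt_neq0 K M_gt0 ME hc; have p4 := pt_neq0 K M_gt0 ME hca.
have p5 := pt_neq0 K M_gt0 ME hca'; have J0 := pinfB_neq0 K M_gt0.
apply: (@three_term_solve _ _ _ _ _ _ _ _ _ _ (mon c (2 * a ^+ 2 + 60 + 3 * c ^+ 2 - 33 * c))).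
- by rewrite monM; apply: (@mon_eq _ _ _ _ _ _ 0); ring.
- by rewrite monM; apply: (@mon_eq _ _ _ _ _ _ 0); ring.
- by rewrite monM; apply: (@mon_eq _ _ _ _ _ _ a); ring.
- by rewrite !monM monV; apply: (@mon_eq _ _ _ _ _ _ c); ring.
all: by rewrite ?mon_neq0.
Qed.

(** For [a = c] the first node is 1 and the theta quotient of [Sp_relation] is infinite; the double
    pole replaces it by the Lambert series of the two other nodes. The factor 22 matches the
    normalization of [ell]. *)
Theorem Sp_relation_pole c (kap b : int) : b = 27 - 3 * c - 11 * kap ->
  ~~ (11 %| c)%Z -> ~~ (11 %| 2 * c)%Z ->
  22%:R * (Sp b 0 + Sp b (2 * c) - om c * Sp b c) + (2 * (5 - b))%:~R = ell c + ell (2 * c).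
Proof.
move=> hb ha h2a.
have t0 : tx c c ord0 = 1 by rewrite txE /ti /= subrr /Submission.zt mulr0 expr0z.
have hi i : ti c c i = 0 \/ ~~ (11 %| ti c c i)%Z.
  case: i => [[|[|[|i]]]] //= hi; rewrite /ti /=; [left|right|right] => //; first by rewrite subrr.
  by move: h2a; rewrite mulrDl !mul1r.
have hl i : i != ord0 -> lambert M (tx c c i) (lbz (ti c c i)).
  rewrite txE => i0; apply: (lbzP K M_gt0 ME).
  case: (hi i) => // e; exfalso; move: i0 e ha h2a.
  case: i => [[|[|[|i]]]] //= hj _; rewrite /ti /=; first by move=> ->.
  by lia.
have hs i : hassum (fun n => (if (i == ord0) && (n == 0) then 0 else (1 - tx c c i * B ^ n)^-1) *
     tterm M 3 (tx c c) al0 (kap - 1) i n)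
   (mon (ti c c i) (- (3 * ti c c i ^+ 2 + 33 * ti c c i - 6 * c * ti c c i)) * Sp b (ti c c i)).
  have -> : (i == ord0) = (ti c c i == 0).
    by move: ha h2a; case: i => [[|[|[|i]]]] //= hj; rewrite -?val_eqE /ti /=; lia.
  exact: tx_hassum_pole hb (hi i).
have := @partial_fractions_pole F K M M_gt0 3 0 3 (tx c c) al0 isT erefl (@tx_neq0 c c)
  (fun j => oner_neq0 K) (tx_sep c ha h2a) (kap - 1) ord0 _ _ erefl t0 hl hs.
have [e1 e2 e3] := tx_coef c ha h2a; rewrite sum3 big_mkcond sum3 /= e1 e2 e3 /ti /=.
rewrite subrr (_ : c + c = 2 * c); last by ring.
move=> /pole_solve; rewrite -/(om c) => h; rewrite h.
- rewrite /Submission.ell !(rmorphB, rmorphM, rmorphD) hb /= !(rmorphB, rmorphM, rmorphD) /=.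
  by move: (c%:~R) (kap%:~R) (lbz c) (lbz _) => u v x y; ring.
- by rewrite monM; apply: (@mon_eq _ _ _ _ _ _ 0); ring.
- by rewrite monM; apply: (@mon_eq _ _ _ _ _ _ 0); ring.
- by rewrite monM; apply: (@mon_eq _ _ _ _ _ _ c); ring.
all: by rewrite ?mon_neq0 ?(pt_neq0 K M_gt0 ME).
Qed.

Lemma omN a : om (- a) = om a.
Proof. by rewrite /Submission.om mulrN !ptN invrN mulrNN. Qed.

Lemma ptM11 a (j : int) : pt (a + 11 * j) = pt a.
Proof.
have h (n : nat) x : pt (x + 11 * n%:Z) = pt x.
  elim: n x => [|n IHn] x; first by rewrite mulr0 addr0.
  by rewrite -[RHS](ptD11 K M_gt0 ME) -(IHn (x + 11)); congr pt; lia.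
case: j => n; first exact: h.
by rewrite -(h n.+1); congr pt; rewrite NegzE; lia.
Qed.

Lemma omD a (j : int) : om (a + 11 * j) = om a.
Proof.
by rewrite /Submission.om ptM11 (_ : 2 * (a + 11 * j) = 2 * a + 11 * (2 * j)) ?ptM11 //; ring.
Qed.

Lemma sum_reindex (V : nmodType) (g : int -> V) (f : int -> int) (s t : seq int) :
  (forall z, g (f z) = g z) -> perm_eq (map f s) t -> \sum_(z <- s) g z = \sum_(z <- t) g z.
Proof.
by move=> hf hp; rewrite -(perm_big _ hp) big_map; apply: eq_bigr => z _; rewrite hf.
Qed.

Definition half11 (z : int) : int :=
  if ((z %% 11)%Z <= 5) then (z %% 11)%Z else 11 - (z %% 11)%Z.

Lemma om_half z : om (half11 z) = om z.
Proof.
have e := divz_eq z 11; rewrite /half11; case: ifP => _.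
  by rewrite [in RHS]e addrC mulrC omD.
by rewrite -[RHS]omN -[RHS](omD _ ((z %/ 11)%Z + 1)); congr om; lia.
Qed.

(** Entry [b], for [b] from 0 to 4, is a solution [c] of $3c\equiv5-b$ modulo 11. *)
Definition multipliers : seq int := [:: 9; 5; 1; 8; 4].

(** Multiplication by [c] permutes the nonzero residues up to sign, and [om] depends on nothing
    else. *)
Lemma om_sum c : c \in multipliers -> WW K M_gt0 = 1 + \sum_(1 <= a < 6) om (c * a%:Z).
Proof.
move=> hc; rewrite /WW; congr (1 + _); rewrite !sum5.
have h := @sum_reindex K om half11 [:: c * 1%:Z; c * 2%:Z; c * 3%:Z; c * 4%:Z; c * 5%:Z]
  [:: 1%:Z; 2%:Z; 3%:Z; 4%:Z; 5%:Z] om_half.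
rewrite !big_cons !big_nil !addr0 in h; rewrite h //; move: hc.
by rewrite !inE => /or4P [/eqP ->|/eqP ->|/eqP ->|/orP [] /eqP ->].
Qed.

Lemma SS_sum b c : c \in multipliers ->
  SS b = Sp b c + \sum_(1 <= a < 6) (Sp b (c - c * a%:Z) + Sp b (c + c * a%:Z)).
Proof.
move=> hc; rewrite SS_split sum11 sum5.
have hm z : Sp b (z %% 11)%Z = Sp b z.
  by rewrite [in RHS](divz_eq z 11) addrC mulrC SpD.
have h := @sum_reindex K (Sp b) (fun z => (z %% 11)%Z)
  [:: c; c - c * 1%:Z; c + c * 1%:Z; c - c * 2%:Z; c + c * 2%:Z; c - c * 3%:Z; c + c * 3%:Z;
    c - c * 4%:Z; c + c * 4%:Z; c - c * 5%:Z; c + c * 5%:Z]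
  [:: 0%:Z; 1%:Z; 2%:Z; 3%:Z; 4%:Z; 5%:Z; 6%:Z; 7%:Z; 8%:Z; 9%:Z; 10%:Z] hm.
rewrite !big_cons !big_nil !addr0 in h; rewrite -h; first by rewrite !addrA.
move: hc; rewrite !inE => /or4P [/eqP ->|/eqP ->|/eqP ->|/orP [] /eqP ->]; by [].
Qed.

Definition Gt c : K := ell c + ell (2 * c) + 22%:R * \sum_(2 <= a < 6) Vt c (c * a%:Z).

Theorem rank_dissection c (kap b : int) : c \in multipliers -> b = 27 - 3 * c - 11 * kap ->
  22%:R * SS b + (2 * (5 - b))%:~R = 22%:R * (Sp b c * WW K M_gt0) + Gt c.
Proof.
move=> hc hb; rewrite (SS_sum b hc) (om_sum hc) /Gt.
have cb : ~~ (11 %| c)%Z.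
  by move: hc; rewrite !inE => /or4P [/eqP ->|/eqP ->|/eqP ->|/orP [] /eqP ->].
have hn (z : int) : ~~ (11 %| z)%Z -> ~~ (11 %| c * z)%Z.
  by move: hc; rewrite !inE => /or4P [/eqP ->|/eqP ->|/eqP ->|/orP [] /eqP ->]; lia.
have rel (a : nat) : (1 < a < 6)%N ->
    Sp b (c - c * a%:Z) + Sp b (c + c * a%:Z) = om (c * a%:Z) * Sp b c + Vt c (c * a%:Z).
  move=> ha; apply: Sp_relation hb _ _ cb _ _.
  - by apply: hn; lia.
  - by rewrite mulrCA; apply: hn; lia.
  - by rewrite (_ : c - c * a%:Z = c * (1 - a%:Z)); [apply: hn; lia | ring].
  - by rewrite (_ : c + c * a%:Z = c * (1 + a%:Z)); [apply: hn; lia | ring].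
have h2c : ~~ (11 %| 2 * c)%Z by rewrite mulrC; apply: hn.
(* The pair with [a = 1] contains the class 0 and is the one that needs the relation with a pole. *)
have := Sp_relation_pole hb cb h2c.
rewrite !sum5 (_ : \sum_(2 <= a < 6) Vt c (c * a%:Z) =
  Vt c (c * 2%:Z) + (Vt c (c * 3%:Z) + (Vt c (c * 4%:Z) + Vt c (c * 5%:Z)))); last first.
  by rewrite unlock /= addr0.
rewrite (rel 2%N) // (rel 3%N) // (rel 4%N) // (rel 5%N) //.
have E2 : c * 1%:Z = c by rewrite mulr1.
have E1 : c + c = 2 * c by ring.
rewrite E2 subrr E1.
move=> <-; move: (_%:~R) (Vt _ _) (Vt _ _) (Vt _ _) (Vt _ _) (om _) (om _) (om _) (om _) (om _).
by move: (Sp b 0) (Sp b (2 * c)) (Sp b c) => s0 s1 s2 t v1 v2 v3 v4 w1 w2 w3 w4 w5; ring.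
Qed.

End RankSeries.

(** * Deciding homogeneous identities on the curve *)

Section ZPoly.
Variable E : fieldType.

Definition ZE (z : Z) : E := (int_of_Z z)%:~R.

Lemma ZED a b : ZE (Z.add a b) = ZE a + ZE b.
Proof. by rewrite /ZE -[Z.add a b]/(a + b) !rmorphD. Qed.

Lemma ZEM a b : ZE (Z.mul a b) = ZE a * ZE b.
Proof. by rewrite /ZE -[Z.mul a b]/(a * b) !rmorphM. Qed.

Definition zpoly := seq Z.

Fixpoint zadd (p q : zpoly) : zpoly :=
  match p, q with
  | [::], _ => q
  | _, [::] => p
  | a :: p', b :: q' => Z.add a b :: zadd p' q'
  end.

Definition zscale (c : Z) (p : zpoly) : zpoly := map (Z.mul c) p.

Definition zshift (p : zpoly) : zpoly := if p is [::] then [::] else Z0 :: p.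

Definition rpoly := (zpoly * zpoly)%type.

Definition radd (P Q : rpoly) : rpoly := (zadd P.1 Q.1, zadd P.2 Q.2).
Definition rscale c (P : rpoly) : rpoly := (zscale c P.1, zscale c P.2).
Definition rmuls (P : rpoly) : rpoly := (zshift P.1, zshift P.2).

(* [A + B r] stands for a function on the curve [r^2 = (4s - 3s^2 + s^3) r - s]. *)
Definition rmulr (P : rpoly) : rpoly :=
  let B1 := zshift P.2 in let B2 := zshift B1 in let B3 := zshift B2 in
  (zscale (-1) B1, zadd P.1 (zadd (zscale 4 B1) (zadd (zscale (-3) B2) B3))).
Definition rmulu (P : rpoly) : rpoly := radd (rmulr P) (rscale (-1) P).
Definition rmulv (P : rpoly) : rpoly := radd P (rscale (-1) (rmuls P)).
Definition rmulc (P : rpoly) : rpoly := rmuls (rmulu P).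
Definition rdisc (P : rpoly) : rpoly :=
  let P1 := rmulc P in let P2 := rmulc P1 in let P3 := rmulc P2 in let R1 := rmulr P1 in
  radd (rscale 16 (rmulr R1)) (radd (rscale (-8) (rmulr P2)) (radd (rscale (-20) R1)
    (radd (rmulr P) (radd (rscale (-1) P) (radd (rscale 3 P1) (radd (rscale (-3) P2) P3)))))).

Definition zterm := (Z * seq nat)%type.

(** Horner scheme on sparse terms: those without the first variable go to [sub], the others lose one
    power of it and are multiplied by [m] afterwards. The fuel bounds the exponent. *)
Fixpoint horner_step (sub : seq zterm -> rpoly) (m : rpoly -> rpoly) (fuel : nat)
    (L : seq zterm) : rpoly :=
  if fuel is f.+1 then
    if L is [::] then ([::], [::]) else
    radd (sub [seq (t.1, behead t.2) | t <- L & head 0%N t.2 == 0%N])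
      (m (horner_step sub m f
         [seq (t.1, (head 0%N t.2).-1 :: behead t.2) | t <- L & head 0%N t.2 != 0%N]))
  else ([::], [::]).

Fixpoint zhorner (zfuel : nat) (ms : seq (rpoly -> rpoly)) (L : seq zterm) : rpoly :=
  if ms is m :: ms' then horner_step (zhorner zfuel ms') m zfuel L
  else ([:: foldr (fun t a => Z.add t.1 a) Z0 L], [::]).

Variables (r s : E).
Hypothesis curve : r ^+ 2 = (4%:R * s - 3%:R * s ^+ 2 + s ^+ 3) * r - s.

Definition peval (p : zpoly) : E := foldr (fun a acc => ZE a + s * acc) 0 p.

Lemma peval_add p q : peval (zadd p q) = peval p + peval q.
Proof.
elim: p q => [|a p IHp] [|b q] //=; rewrite ?add0r ?addr0 //.
by rewrite IHp ZED mulrDr addrACA.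
Qed.

Lemma peval_scale c p : peval (zscale c p) = ZE c * peval p.
Proof. by elim: p => [|a p IHp] /=; rewrite ?mulr0 // IHp ZEM mulrDr mulrCA. Qed.

Lemma peval_shift p : peval (zshift p) = s * peval p.
Proof. by case: p => [|a p] /=; rewrite ?mulr0 // /ZE rmorph0 add0r. Qed.

Definition reval (P : rpoly) : E := peval P.1 + peval P.2 * r.

Lemma reval_add P Q : reval (radd P Q) = reval P + reval Q.
Proof. by rewrite /reval /= !peval_add mulrDl addrACA. Qed.

Lemma reval_scale c P : reval (rscale c P) = ZE c * reval P.
Proof. by rewrite /reval /= !peval_scale mulrDr mulrA. Qed.

Lemma reval_s P : reval (rmuls P) = s * reval P.
Proof. by rewrite /reval /= !peval_shift mulrDr mulrA. Qed.

Lemma reval_r P : reval (rmulr P) = r * reval P.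
Proof.
rewrite /reval /= !(peval_add, peval_scale, peval_shift).
rewrite (_ : r * _ = peval P.1 * r + peval P.2 * r ^+ 2); last by ring.
have [-> -> ->] : [/\ ZE (-1) = - 1, ZE 4 = 4%:R & ZE (-3) = - 3%:R] by split.
by rewrite curve; ring.
Qed.

Lemma reval_u P : reval (rmulu P) = (r - 1) * reval P.
Proof. by rewrite reval_add reval_scale reval_r /ZE /=; ring. Qed.

Lemma reval_v P : reval (rmulv P) = (1 - s) * reval P.
Proof. by rewrite reval_add reval_scale reval_s /ZE /=; ring. Qed.

Lemma reval_c P : reval (rmulc P) = s * (r - 1) * reval P.
Proof. by rewrite reval_s reval_u mulrA. Qed.

(** With $c=s(r-1)$ and $b=rc$, the discriminant of the Tate curve is $b^3c$ times this element. *)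
Definition disc_factor : E :=
  let c := s * (r - 1) in
  16%:R * r ^+ 2 * c - 8%:R * r * c ^+ 2 - 20%:R * r * c + r - (1 - c) ^+ 3.

Lemma reval_disc P : reval (rdisc P) = disc_factor * reval P.
Proof.
rewrite !(reval_add, reval_scale, reval_r, reval_c) /disc_factor.
have [-> -> ->] : [/\ ZE (-1) = - 1, ZE 16 = 16%:R & ZE (-3) = - 3%:R] by split.
have [-> -> ->] : [/\ ZE (-8) = - 8%:R, ZE (-20) = - 20%:R & ZE 3 = 3%:R] by split.
by move: (s * (r - 1)) (reval P) => c x; ring.
Qed.

Fixpoint mprod (xs : seq E) (k : seq nat) : E :=
  if xs is x :: xs' then x ^+ head 0%N k * mprod xs' (behead k) else 1.

Definition tval xs (t : zterm) : E := ZE t.1 * mprod xs t.2.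

Lemma zhorner_val zfuel (ms : seq (rpoly -> rpoly)) (xs : seq E) L :
  (0 < zfuel)%N -> size ms = size xs -> (forall i, (i < size ms)%N -> forall P,
    reval (nth id ms i P) = nth 0 xs i * reval P) ->
  all (fun t : zterm => all (fun e => e < zfuel)%N t.2) L ->
  reval (zhorner zfuel ms L) = \sum_(t <- L) tval xs t.
Proof.
move=> f0; elim: ms xs L => [|m ms IHms] [|x xs] L //= hs hm hL.
  rewrite /reval /= mulr0 mul0r !addr0; elim: L {hL} => [|t L IHL] /=.
    by rewrite big_nil /ZE rmorph0.
  by rewrite big_cons ZED IHL /tval /= mulr1.
have {IHms} sub := IHms xs _ (eq_add_S _ _ hs) (fun i hi => hm i.+1 hi).
have {hm} hmx := hm 0%N isT.
suff step f : forall L, all (fun t : zterm => (head 0%N t.2 < f)%N &&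
    all (fun e => e < zfuel)%N (behead t.2)) L ->
    reval (horner_step (zhorner zfuel ms) m f L) = \sum_(t <- L) tval (x :: xs) t.
  by apply: step; apply: sub_all hL => -[c [|e k]] //=; rewrite f0.
elim: f => [|f IHf] {hL}L hb.
  by case: L hb => [|t L] //= _; rewrite big_nil /reval /= mul0r addr0.
rewrite /=; case: L hb => [|t L] hb; first by rewrite big_nil /reval /= mul0r addr0.
rewrite reval_add hmx sub ?IHf; first last.
- rewrite all_map all_filter; apply: sub_all hb => -[c k] /andP [_ h].
  by apply/implyP => _.
- rewrite all_map all_filter; apply: sub_all hb => -[c [|e k]] //= /andP [h1 h2].
  by apply/implyP => e0; rewrite h2 andbT; lia.
rewrite !big_map !big_filter [RHS](bigID (fun t => head 0%N t.2 == 0%N)) /=; congr (_ + _).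
  by apply: eq_bigr => t1 /eqP e; rewrite /tval /= e expr0 mul1r.
rewrite big_distrr /=; apply: eq_bigr => t1 e.
by rewrite /tval /= -[in RHS](prednK (_ : 0 < head 0%N t1.2)%N) ?lt0n // exprS -!mulrA [x * _]mulrCA.
Qed.

(** Monomials [z * p1^k1 * ... * p5^k5 * D^j] are encoded as [(z, k, j)]. *)
Definition mitem := (Z * seq Z * bool)%type.

Definition kth (k : seq Z) i := nth Z0 k i.

Definition item_deg (t : mitem) : Z :=
  let k := kth t.1.2 in
  (k 0%N + k 1%N + k 2%N + k 3%N + k 4%N + (if t.2 then 12 else 0))%ZZ.

(** Exponent of [del] once the variables are expressed through [pi], [del], [r], [s]. Modulo 11,
    [item_grade] is the degree plus three times the twist, so in a list of one degree and one grade
    the twists agree modulo 11, and the 11th power of [del] is a function on the curve. *)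
Definition item_twist (t : mitem) : Z :=
  let k := kth t.1.2 in
  (k 1%N - k 2%N + 5 * k 3%N + 8 * k 4%N - (if t.2 then 4 else 0))%ZZ.

Definition item_shift (N : Z) (t : mitem) : Z := Z.div (item_twist t - N)%ZZ 11.

Definition item_units (N : Z) (t : mitem) : seq Z :=
  let e := item_shift N t in let k := kth t.1.2 in
  [:: ((if t.2 then 1 else 0) - e)%ZZ; (k 3%N + 2 * k 4%N - e)%ZZ;
      (- k 2%N - 3 * e)%ZZ; (k 3%N + k 4%N - e)%ZZ].

Definition item_coef (N : Z) (t : mitem) : Z :=
  if Z.odd (kth t.1.2 1 + item_shift N t)%ZZ then Z.opp t.1.1 else t.1.1.

(** Least exponent of each unit over the list: factoring these out leaves nonnegative exponents,
    hence polynomials. *)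
Definition zmin4 (L : seq (seq Z)) : seq Z :=
  foldr (fun a m => [seq Z.min ab.1 ab.2 | ab <- zip a m]) (head [::] L) L.

Definition to_zterm N (mn : seq Z) (t : mitem) : zterm :=
  (item_coef N t, [seq Z.to_nat (ab.1 - ab.2)%ZZ | ab <- zip (item_units N t) mn]).

Definition item_ok N d (mn : seq Z) (t : mitem) : bool :=
  [&& Z.eqb (item_deg t) d, Z.eqb (11 * item_shift N t)%ZZ (item_twist t - N)%ZZ &
    all (fun ab : Z * Z => Z.leb ab.2 ab.1) (zip (item_units N t) mn)].

Definition zvanish (P : rpoly) : bool := all (Z.eqb Z0) P.1 && all (Z.eqb Z0) P.2.

Definition rmults := [:: rmulr; rmulu; rmulv; rmuls].

(** By [discE] a term with [D] carries the inverse of [disc_factor], so the terms without [D] are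
    multiplied by it before comparison. The test is sufficient only: after reduction to [A + B r]
    all integer coefficients must be 0. The bound 50 is the fuel of the Horner scheme. *)
Definition curve_check (L : seq mitem) : bool :=
  if L is t0 :: _ then
    let N := item_twist t0 in let d := item_deg t0 in
    let mn := zmin4 (map (item_units N) L) in
    let ok := all (item_ok N d mn) L in
    let LD := [seq to_zterm N mn t | t <- L & t.2] in
    let L0 := [seq to_zterm N mn t | t <- L & ~~ t.2] in
    [&& size mn == 4, ok, all (fun t : zterm => all (fun e => e < 50)%N t.2) (LD ++ L0) &
     zvanish (radd (zhorner 50 rmults LD) (rdisc (zhorner 50 rmults L0)))]
  else true.

Variables (p : nat -> E) (pi del D : E).
Hypotheses (pi0 : pi != 0) (del0 : del != 0) (r0 : r != 0) (s0 : s != 0)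
  (u0 : r - 1 != 0) (v0 : 1 - s != 0).
Hypotheses (p1E : p 0%N = pi) (p2E : p 1%N = - (del * pi)) (p3E : p 2%N = (del * (1 - s))^-1 * pi)
  (p4E : p 3%N = s * (r - 1) * del ^+ 5 * pi) (p5E : p 4%N = s * (r - 1) ^+ 2 * del ^+ 8 * pi)
  (del11 : del ^+ 11 = - ((1 - s) ^+ 3 * r * s * (r - 1))^-1)
  (discE : pi ^+ 12 * r = del ^+ 4 * disc_factor * D).

Definition zexp (x : E) (k : Z) : E := x ^ (int_of_Z k).

Definition ival (t : mitem) : E :=
  ZE t.1.1 * \prod_(0 <= i < 5) zexp (p i) (kth t.1.2 i) * (if t.2 then D else 1).

Definition mval (xs : seq E) (k : seq Z) : E := \prod_(ab <- zip xs k) zexp ab.1 ab.2.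

Lemma zexpD x k l : x != 0 -> zexp x (Z.add k l) = zexp x k * zexp x l.
Proof. by move=> x0; rewrite /zexp -[Z.add k l]/(k + l) rmorphD expfzDr. Qed.

Lemma zexpM x k l : zexp (zexp x k) l = zexp x (Z.mul k l).
Proof. by rewrite /zexp exprz_exp -[Z.mul k l]/(k * l) rmorphM. Qed.

Lemma zexpMl x y k : zexp (x * y) k = zexp x k * zexp y k.
Proof. exact: expfzMl. Qed.

Lemma zexpV x k : zexp x^-1 k = zexp x (Z.opp k).
Proof. by rewrite /zexp exprz_inv -[Z.opp k]/(- k) rmorphN. Qed.

Lemma zexp_nat x n : zexp x (Z.of_nat n) = x ^+ n.
Proof. by rewrite /zexp (_ : int_of_Z (Z.of_nat n) = n%:Z) //; lia. Qed.

Lemma zexp_sign k : zexp (- 1) k = if Z.odd k then - 1 else 1.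
Proof.
have [[l ->]|[l ->]] := Z.Even_or_Odd k.
  rewrite -zexpM (_ : zexp (- 1) 2 = (- 1) ^+ 2) // sqrrN expr1n.
  by rewrite /zexp exp1rz Z.odd_mul.
rewrite zexpD ?oppr_eq0 ?oner_neq0 // -zexpM (_ : zexp (- 1) 2 = (- 1) ^+ 2) // sqrrN expr1n.
by rewrite {1}/zexp exp1rz mul1r Z.odd_add Z.odd_mul.
Qed.

Let x4 := [:: r; r - 1; 1 - s; s].

Lemma mval4 a b c d :
  mval x4 [:: a; b; c; d] = zexp r a * (zexp (r - 1) b * (zexp (1 - s) c * zexp s d)).
Proof. by rewrite /mval /= !big_cons big_nil mulr1. Qed.

Lemma mval_shift (a mn : seq Z) : size a = 4%N -> size mn = 4%N ->
  all (fun ab : Z * Z => Z.leb ab.2 ab.1) (zip a mn) ->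
  mval x4 a = mval x4 mn * mprod x4 [seq Z.to_nat (ab.1 - ab.2)%ZZ | ab <- zip a mn].
Proof.
have split x y z : x != 0 -> Z.le z y -> zexp x y = zexp x z * x ^+ Z.to_nat (y - z).
  by move=> x0 le; rewrite -zexp_nat -zexpD //; congr zexp; lia.
case: a => [|a1 [|a2 [|a3 [|a4 [|]]]]] // _; case: mn => [|b1 [|b2 [|b3 [|b4 [|]]]]] // _.
move=> /and5P [/Z.leb_le h1 /Z.leb_le h2 /Z.leb_le h3 /Z.leb_le h4 _].
rewrite /mval /= !big_cons !big_nil (split _ _ _ r0 h1) (split _ _ _ u0 h2).
by rewrite (split _ _ _ v0 h3) (split _ _ _ s0 h4) /=; ring.
Qed.

Lemma item_val N (t : mitem) : Z.eqb (11 * item_shift N t)%ZZ (item_twist t - N)%ZZ ->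
  ival t * disc_factor = zexp pi (item_deg t) * zexp del N *
    (ZE (item_coef N t) * mval x4 (item_units N t) * (if t.2 then 1 else disc_factor)).
Proof.
move=> /Z.eqb_eq; rewrite /item_units /item_coef; move: (item_shift N t) => e.
case: t => [[z k] j]; rewrite /ival /item_twist /item_deg.
rewrite -[(z, k, j).1.2]/k -[(z, k, j).1.1]/z -[(z, k, j).2]/j.
rewrite (_ : \prod_(0 <= i < 5) _ = zexp (p 0%N) (kth k 0) * (zexp (p 1%N) (kth k 1) *
  (zexp (p 2%N) (kth k 2) * (zexp (p 3%N) (kth k 3) * zexp (p 4%N) (kth k 4))))); last first.
  by rewrite unlock /= mulr1.
move: (kth k 0) (kth k 1) (kth k 2) (kth k 3) (kth k 4) => a1 a2 a3 a4 a5 hN.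
have n0 : - 1 != 0 :> E by rewrite oppr_eq0 oner_neq0.
(* Here the divisibility by 11 is used: the surplus power of [del] is the [11 * e]-th, which [del11]
   turns into units and a sign. *)
have hd : zexp del a2 * zexp del (- a3)%ZZ * zexp del (5 * a4)%ZZ * zexp del (8 * a5)%ZZ =
  zexp del N * (zexp (- 1) e * zexp (1 - s) (- (3 * e))%ZZ * zexp r (- e)%ZZ * zexp s (- e)%ZZ *
   zexp (r - 1) (- e)%ZZ) * (if j then zexp del 4 else 1).
  have -> : zexp (- 1) e * zexp (1 - s) (- (3 * e))%ZZ * zexp r (- e)%ZZ * zexp s (- e)%ZZ *
     zexp (r - 1) (- e)%ZZ = zexp del (11 * e)%ZZ.
    rewrite -zexpM (_ : zexp del 11 = del ^+ 11) // del11 -[- _^-1]mulN1r.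
    rewrite zexpMl zexpV 3!zexpMl -(zexp_nat (1 - s) 3) zexpM /=.
    by rewrite (_ : (- (3 * e))%ZZ = (3 * - e)%ZZ) ?mulrA //; lia.
  rewrite (_ : (if j then _ else _) = zexp del (if j then 4 else 0)%ZZ); last by case: (j).
  by rewrite -!zexpD //; congr zexp; lia.
have es : ZE (if Z.odd (a2 + e) then (- z)%ZZ else z) = ZE z * (zexp (- 1) a2 * zexp (- 1) e).
  rewrite -zexpD // zexp_sign; case: ifP => _; last by rewrite mulr1.
  by rewrite mulrN1 /ZE -[Z.opp z]/(- z) !rmorphN.
have hj : (if j then D else 1) * disc_factor * (if j then zexp del 4 else 1) =
   (if j then zexp pi 12 * r else 1) * (if j then 1 else disc_factor).
  case: (j); last by rewrite !mul1r mulr1.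
  rewrite (_ : zexp del 4 = del ^+ 4) // (_ : zexp pi 12 = pi ^+ 12) // discE mulr1.
  by move: (disc_factor) => x; ring.
have q n x a : zexp x (Z.of_nat n * a)%ZZ = zexp x a ^+ n by rewrite Z.mul_comm -zexpM zexp_nat.
have hp : zexp pi (if j then 12 else 0)%ZZ * zexp r (if j then 1 else 0)%ZZ =
    (if j then zexp pi 12 * r else 1) by case: (j); rewrite ?mulr1.
rewrite es mval4 !zexpD // p1E p2E p3E p4E p5E -[- (del * pi)]mulN1r.
rewrite (_ : zexp ((del * (1 - s))^-1 * pi) a3 = zexp del (- a3)%ZZ * zexp (1 - s) (- a3)%ZZ * zexp pi a3); last first.
  by rewrite zexpMl zexpV zexpMl.
rewrite (_ : zexp (r - 1) (2 * a5)%ZZ = zexp (r - 1) a5 ^+ 2); last exact: (q 2%N).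
move: hd; rewrite (_ : zexp del (5 * a4)%ZZ = zexp del a4 ^+ 5); last exact: (q 5%N).
rewrite (_ : zexp del (8 * a5)%ZZ = zexp del a5 ^+ 8); last exact: (q 8%N).
move: hj hp; rewrite !zexpMl.
move: (if j then D else 1) (if j then zexp del 4 else 1) (if j then zexp pi 12 * r else 1)
  (if j then 1 else disc_factor) => d1 d2 d3 d4.
move: disc_factor (zexp pi (if _ then _ else _)) (zexp r (if _ then _ else _)) => d5 d6 d7 hj hp hd.
move: (zexp pi a1) (zexp pi a2) (zexp pi a3) (zexp pi a4) (zexp pi a5) => f1 f2 f3 f4 f5.
move: hd; move: (zexp del a2) (zexp del (- a3)%ZZ) (zexp del a4) (zexp del a5) => g1 g2 g3 g4 hd.
move: hd; move: (zexp del N) (zexp (- 1) e) (zexp (1 - s) (- (3 * e))%ZZ) (zexp r (- e)%ZZ)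
  (zexp s (- e)%ZZ) (zexp (r - 1) (- e)%ZZ) => h1 h2 h3 h4 h5 h6 hd.
move: (zexp (- 1) a2) (zexp (1 - s) (- a3)%ZZ) (zexp s a4) (zexp (r - 1) a4) (zexp s a5)
  (zexp (r - 1) a5) (ZE z) => k1 k2 k3 k4 k5 k6 k7.
transitivity (k7 * (f1 * f2 * f3 * f4 * f5) * k1 * k2 * (k3 * k4) * (k5 * k6 ^+ 2) *
   (g1 * g2 * g3 ^+ 5 * g4 ^+ 8) * (d1 * d5)); first by ring.
rewrite hd; transitivity (k7 * (f1 * f2 * f3 * f4 * f5) * k1 * k2 * (k3 * k4) * (k5 * k6 ^+ 2) *
   (h1 * (h2 * h3 * h4 * h5 * h6)) * (d1 * d5 * d2)); first by ring.
by rewrite hj -hp; ring.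
Qed.

Theorem curve_check_sound L : disc_factor != 0 -> curve_check L -> \sum_(t <- L) ival t = 0.
Proof.
move=> D0; case: L => [|t0 L']; first by rewrite big_nil.
rewrite /curve_check; set N := item_twist t0; set d := item_deg t0; set L := t0 :: L'.
set mn := zmin4 _ => /and4P [/eqP hmn /allP ok hb /andP [/allP z1 /allP z2]].
apply: (mulIf D0); rewrite mul0r big_distrl /=.
have unit_val (t : mitem) : item_ok N d mn t ->
    mval x4 (item_units N t) = mval x4 mn * mprod x4 (to_zterm N mn t).2.
  by move=> /and3P [_ _]; apply: mval_shift.
have tv t : t \in L -> ival t * disc_factor = zexp pi d * zexp del N * mval x4 mn *
    (tval x4 (to_zterm N mn t) * (if t.2 then 1 else disc_factor)).
  move=> /ok okt; have /and3P [/Z.eqb_eq dE hN _] := okt.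
  rewrite (item_val hN) dE (unit_val _ okt).
  rewrite (_ : tval x4 _ = ZE (item_coef N t) * mprod x4 (to_zterm N mn t).2) //.
  move: (mprod _ _) (ZE _) (mval _ _) (zexp _ _) (zexp _ _) (if _ then _ else _) => a b c e f g.
  by ring.
rewrite (eq_big_seq _ tv) -big_distrr /= (bigID (fun t : mitem => t.2)) /=.
have hm i : (i < 4)%N -> forall P, reval (nth id rmults i P) = nth 0 x4 i * reval P.
  case: i => [|[|[|[|i]]]] // _ P.
  - exact: reval_r.
  - exact: reval_u.
  - exact: reval_v.
  - exact: reval_s.
move: hb; rewrite all_cat => /andP [hbD hb0].
have hv := zhorner_val (isT : (0 < 50)%N) (erefl : size rmults = size x4) hm.
have e1 : \sum_(t <- L | t.2) tval x4 (to_zterm N mn t) * (if t.2 then 1 else disc_factor) =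
   reval (zhorner 50 rmults [seq to_zterm N mn t | t <- L & t.2]).
  by rewrite (hv _ hbD) big_map big_filter; apply: eq_bigr => t ->; rewrite mulr1.
have e2 : \sum_(t <- L | ~~ t.2) tval x4 (to_zterm N mn t) * (if t.2 then 1 else disc_factor) =
   disc_factor * reval (zhorner 50 rmults [seq to_zterm N mn t | t <- L & ~~ t.2]).
  rewrite (hv _ hb0) big_map big_filter big_distrr; apply: eq_bigr => t /negPf ->.
  by rewrite mulrC.
rewrite e1 e2 -reval_disc -reval_add.
have pz q : {in q, forall x, Z.eqb Z0 x} -> peval q = 0.
  elim: q => [|a q IHq] //= hq; rewrite IHq => [|x xq]; last by apply: hq; rewrite inE xq orbT.
  have /Z.eqb_eq <- : Z.eqb Z0 a by apply: hq; rewrite mem_head.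
  by rewrite /ZE rmorph0 mulr0 addr0.
by rewrite /reval !pz // mul0r addr0 mulr0.
Qed.

End ZPoly.

(** * Parametrization of the curve *)

Ltac nonzero := repeat first [ assumption | exact: oner_neq0 | apply/andP; split
  | rewrite oppr_eq0 | apply: mulf_neq0 | apply: expf_neq0 | rewrite invr_eq0 ].

Section Parametrization.
Variables (E : fieldType) (p1 p2 p3 p4 p5 : E).
Hypotheses (n1 : p1 != 0) (n2 : p2 != 0) (n3 : p3 != 0) (n4 : p4 != 0) (n5 : p5 != 0).
Hypotheses (R1 : p3 ^+ 3 * p1 - p2 ^+ 3 * p4 + p1 ^+ 3 * p5 = 0)
  (R2 : p4 ^+ 2 * p3 * p1 - p2 ^+ 2 * p5 * p3 - p1 ^+ 2 * p5 * p2 = 0)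
  (R3 : p4 ^+ 3 * p2 - p3 ^+ 3 * p5 - p1 ^+ 3 * p4 = 0).

(** These three quotients invert the parametrization of the $p_a$ by Tate parameters; [par_p3],
    [par_p4] and [par_p5] recover the variables from them. *)
Definition par_del := - (p2 / p1).
Definition par_s := 1 + p1 ^+ 2 / (p2 * p3).
Definition par_r := 1 - p1 ^+ 3 * p5 / (p2 ^+ 3 * p4).

Lemma par_v : 1 - par_s = - (p1 ^+ 2 / (p2 * p3)). Proof. by rewrite /par_s; ring. Qed.
Lemma par_u : par_r - 1 = - (p1 ^+ 3 * p5 / (p2 ^+ 3 * p4)). Proof. by rewrite /par_r; ring. Qed.

Lemma par_sE : par_s = p4 ^+ 2 * p1 / (p5 * p2 ^+ 2).
Proof.
have e : p4 ^+ 2 * p1 = (p2 ^+ 2 * p5 * p3 + p1 ^+ 2 * p5 * p2) / p3.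
  by apply: (mulfI n3); rewrite [RHS]mulrC divfK // -[RHS]addr0 -R2; ring.
by rewrite e /par_s; field; rewrite ?oppr_eq0 ?oner_neq0 n2 n3 n5.
Qed.

Lemma par_rE : par_r = p3 ^+ 3 * p1 / (p2 ^+ 3 * p4).
Proof.
have e : p3 ^+ 3 * p1 = p2 ^+ 3 * p4 - p1 ^+ 3 * p5 by rewrite -[RHS]addr0 -R1; ring.
by rewrite e /par_r; field; rewrite ?oppr_eq0 ?oner_neq0 n2 n4.
Qed.

Lemma par_neq0 : [/\ par_del != 0, par_r != 0, par_s != 0, par_r - 1 != 0 & 1 - par_s != 0].
Proof.
by rewrite par_u par_v par_sE par_rE /par_del !oppr_eq0 !mulf_neq0 ?invr_eq0 ?mulf_neq0 ?expf_neq0.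
Qed.

Lemma par_curve : par_r ^+ 2 = (4%:R * par_s - 3%:R * par_s ^+ 2 + par_s ^+ 3) * par_r - par_s.
Proof.
(* An equivalent form of the equation of the curve in which each factor is a monomial in the $p_a$
   after one of the three relations. *)
have e : par_r * ((par_r - 1) + (1 - par_s) ^+ 3) = par_s * (par_r - 1).
  rewrite par_u par_v par_sE par_rE.
  have -> : - (p1 ^+ 3 * p5 / (p2 ^+ 3 * p4)) + (- (p1 ^+ 2 / (p2 * p3))) ^+ 3 =
    - (p1 ^+ 3 * (p3 ^+ 3 * p5 + p1 ^+ 3 * p4) / (p4 * p2 ^+ 3 * p3 ^+ 3)).
    by field; rewrite ?oppr_eq0 ?oner_neq0 n2 n3 n4.
  have -> : p3 ^+ 3 * p5 + p1 ^+ 3 * p4 = p4 ^+ 3 * p2 by rewrite -[LHS]addr0 -R3; ring.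
  by field; rewrite ?oppr_eq0 ?oner_neq0 n2 n3 n4 n5.
by move: e; move: par_r par_s => r s /eqP; rewrite -subr_eq0 => /eqP e; rewrite -[LHS]subr0 -e; ring.
Qed.

Lemma par_p3 : p3 = (par_del * (1 - par_s))^-1 * p1.
Proof. by rewrite par_v /par_del; field; nonzero. Qed.

Lemma par_p4 : p4 = par_s * (par_r - 1) * par_del ^+ 5 * p1.
Proof. by rewrite par_u par_sE /par_del; field; rewrite ?oppr_eq0 ?oner_neq0 n1 n2 n4 n5. Qed.

Lemma par_p5 : p5 = par_s * (par_r - 1) ^+ 2 * par_del ^+ 8 * p1.
Proof. by rewrite par_u par_sE /par_del; field; rewrite ?oppr_eq0 ?oner_neq0 n1 n2 n4 n5. Qed.

Lemma par_del11 : par_del ^+ 11 = - ((1 - par_s) ^+ 3 * par_r * par_s * (par_r - 1))^-1.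
Proof. by rewrite par_u par_v par_sE par_rE /par_del; field; nonzero. Qed.

End Parametrization.

(* With [b = r s (r - 1)] and [c = s (r - 1)], the [e_i] are, up to scaling, the roots of
   the 2-division polynomial of the Tate curve [y^2 + (1-c)xy - by = x^3 - bx^2]. *)
Lemma two_division_disc (E : fieldType) (p1 del r s D e1 e2 e3 : E) :
  2%:R != 0 :> E -> p1 != 0 -> del != 0 -> r != 0 -> s != 0 -> r - 1 != 0 -> 1 - s != 0 ->
  del ^+ 11 = - ((1 - s) ^+ 3 * r * s * (r - 1))^-1 ->
  let p2 := - (del * p1) in let p3 := (del * (1 - s))^-1 * p1 in
  let p4 := s * (r - 1) * del ^+ 5 * p1 in let p5 := s * (r - 1) ^+ 2 * del ^+ 8 * p1 in
  (0 - e1) * (0 - e2) * (0 - e3) = - (p2 ^+ 2 / (4%:R * p1 ^+ 8)) ->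
  (p3 * p1 / (p2 ^+ 2 * p1 ^+ 2) - e1) * (p3 * p1 / (p2 ^+ 2 * p1 ^+ 2) - e2) *
    (p3 * p1 / (p2 ^+ 2 * p1 ^+ 2) - e3) = - (p4 ^+ 2 / (4%:R * p2 ^+ 8)) ->
  (p4 * p2 / (p3 ^+ 2 * p1 ^+ 2) - e1) * (p4 * p2 / (p3 ^+ 2 * p1 ^+ 2) - e2) *
    (p4 * p2 / (p3 ^+ 2 * p1 ^+ 2) - e3) = - (p5 ^+ 2 / (4%:R * p3 ^+ 8)) ->
  16%:R * ((e1 - e2) * (e1 - e3) * (e2 - e3)) ^+ 2 * D = 1 ->
  p1 ^+ 12 * r = del ^+ 4 * disc_factor r s * D.
Proof.
move=> t0 p10 del0 r0 s0 u0 v0 d11 /=; set u := r - 1 in u0 d11 *; set v := 1 - s in v0 d11 *.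
have f0 : 4%:R != 0 :> E by rewrite (natrM _ 2 2) mulf_neq0.
(* Square of the scale between the ratios and abscissas on the Tate curve. It sends the three
   arguments to 0, $-b$, $-c$, the negatives of the abscissas of $P$, $2P$, $3P$. *)
pose al2 := p1 ^+ 2 / (v ^+ 2 * del ^+ 8); pose b := r * s * u; pose c := s * u.
have al0 : al2 != 0 by rewrite !mulf_neq0 ?invr_eq0 ?mulf_neq0 ?expf_neq0.
have b0 : b != 0 by rewrite !mulf_neq0.
have c0 : c != 0 by rewrite mulf_neq0.
have vd : v ^+ 3 * del ^+ 11 = - b^-1.
  by rewrite d11 /b; field; rewrite ?oppr_eq0 r0 s0 u0 v0.
have dE : del ^+ 11 = - (v ^+ 3 * b)^-1 by rewrite d11 /b; congr (- _^-1); ring.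
have R2 : al2 * ((del * v)^-1 * p1 * p1 / ((- (del * p1)) ^+ 2 * p1 ^+ 2)) = - b.
  rewrite -[b]invrK -[RHS]invrN -vd /al2.
  by field; nonzero.
have R3 : al2 * (s * u * del ^+ 5 * p1 * - (del * p1) / (((del * v)^-1 * p1) ^+ 2 * p1 ^+ 2)) = - c.
  by rewrite /al2 /c; field; nonzero.
have bb : b ^+ 2 = (v ^+ 3 * del ^+ 11) ^- 2 by rewrite vd sqrrN -exprVn invrK.
have V1 : al2 ^+ 3 * ((- (del * p1)) ^+ 2 / (4%:R * p1 ^+ 8)) = b ^+ 2 / 4%:R.
  by rewrite bb /al2; field; rewrite ?f0 ?p10 ?del0 ?v0.
have V2 : al2 ^+ 3 * ((s * u * del ^+ 5 * p1) ^+ 2 / (4%:R * (- (del * p1)) ^+ 8)) =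
    c ^+ 2 * b ^+ 2 / 4%:R.
  by rewrite bb /al2 /c; field; nonzero.
have V3 : al2 ^+ 3 * ((s * u ^+ 2 * del ^+ 8 * p1) ^+ 2 / (4%:R * ((del * v)^-1 * p1) ^+ 8)) =
    (c ^+ 2 + c - b) ^+ 2 / 4%:R.
  have -> : c ^+ 2 + c - b = - (c * u * v) by rewrite /c /b /u /v; ring.
  by rewrite /al2 /c; field; nonzero.
move: R2 R3 V1 V2 V3; set x2 := _ / (_ * _); set x3 := _ / (_ * _).
set w1 := _ / _; set w2 := _ / _; set w3 := _ / _ => R2 R3 V1 V2 V3 h1 h2 h3 hd.
pose f1 := al2 * e1; pose f2 := al2 * e2; pose f3 := al2 * e3.
have g x w y : (x - e1) * (x - e2) * (x - e3) = - w -> al2 ^+ 3 * w = y ->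
    (al2 * x - f1) * (al2 * x - f2) * (al2 * x - f3) = - y.
  by move=> h <-; rewrite -[RHS]mulrN -h /f1 /f2 /f3; ring.
have {h1} := g _ _ _ h1 V1; have {h2} := g _ _ _ h2 V2; have {h3} := g _ _ _ h3 V3.
rewrite R2 R3 mulr0 => h3 h2 h1.
(* The values of the cubic at 0, $-b$ and $-c$ determine its three elementary symmetric
   functions. *)
pose S1 := f1 + f2 + f3; pose S2 := f1 * f2 + f1 * f3 + f2 * f3; pose S3 := f1 * f2 * f3.
have eS3 : S3 = b ^+ 2 / 4%:R by apply: oppr_inj; rewrite -h1 /S3; ring.
have q2 : b ^+ 3 + S1 * b ^+ 2 + S2 * b + S3 - c ^+ 2 * b ^+ 2 / 4%:R = 0.
  by rewrite -[X in - X]opprK -h2 /S1 /S2 /S3; ring.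
have q3 : c ^+ 3 + S1 * c ^+ 2 + S2 * c + S3 - (c ^+ 2 + c - b) ^+ 2 / 4%:R = 0.
  by rewrite -[X in - X]opprK -h3 /S1 /S2 /S3; ring.
have bc : b - c = c * u by rewrite /b /c /u; ring.
have eS1 : S1 = (1 - c) ^+ 2 / 4%:R - b.
  apply/eqP; rewrite -subr_eq0; apply/eqP.
  apply: (mulfI (mulf_neq0 (mulf_neq0 b0 c0) (_ : b - c != 0))); first by rewrite bc mulf_neq0.
  transitivity (c * (b ^+ 3 + S1 * b ^+ 2 + S2 * b + S3 - c ^+ 2 * b ^+ 2 / 4%:R) -
    b * (c ^+ 3 + S1 * c ^+ 2 + S2 * c + S3 - (c ^+ 2 + c - b) ^+ 2 / 4%:R)).
    by rewrite eS3; field.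
  by rewrite q2 q3; ring.
have eS2 : S2 = - ((1 - c) * b / 2%:R).
  apply: (mulfI b0); apply/eqP; rewrite -subr_eq0; apply/eqP; rewrite -q2 eS1 eS3.
  by field; rewrite ?t0 ?f0.
have ed : 16%:R * ((f1 - f2) * (f1 - f3) * (f2 - f3)) ^+ 2 = b ^+ 3 * c * disc_factor r s.
  have -> : ((f1 - f2) * (f1 - f3) * (f2 - f3)) ^+ 2 =
    S1 ^+ 2 * S2 ^+ 2 - 4%:R * S2 ^+ 3 - 4%:R * S1 ^+ 3 * S3 + 18%:R * S1 * S2 * S3 - 27%:R * S3 ^+ 2.
    by rewrite /S1 /S2 /S3; ring.
  rewrite eS1 eS2 eS3 /disc_factor -/u -/c (_ : b = r * c); last by rewrite /b /c; ring.
  by field; rewrite ?t0 ?f0.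
have e12 : al2 ^+ 6 = b ^+ 3 * c * disc_factor r s * D.
  rewrite -ed; transitivity (al2 ^+ 6 * (16%:R * ((e1 - e2) * (e1 - e3) * (e2 - e3)) ^+ 2 * D)).
    by rewrite hd mulr1.
  by rewrite /f1 /f2 /f3; ring.
have -> : p1 ^+ 12 = al2 ^+ 6 * (v ^+ 12 * del ^+ 48).
  by rewrite /al2; field; rewrite ?del0 ?v0.
have -> : v ^+ 12 * del ^+ 48 = del ^+ 4 * (v ^+ 3 * del ^+ 11) ^+ 4 by ring.
rewrite vd e12 (_ : c = b / r); last by rewrite /b /c; field.
by field; rewrite b0 r0.
Qed.

(** * Half periods *)

Section HalfPeriods.
Variables (F : fieldType) (K : lfield F) (M : int).
Hypotheses (M_gt0 : 0 < M) (ME : M = 242) (two0 : 2%:R != 0 :> F).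
Local Notation B := (X K ^ M).
Local Notation pinf := (pinf M_gt0).
Local Notation theta := (@theta F K M M_gt0).
Local Notation J := (pinf B).
Local Notation mon := (@mon F K).
Local Notation zt := (@zt F K).
Local Notation pt := (pt K M_gt0).
Local Notation brk := (@brk F K M M_gt0).

Lemma coefs_nat n : coefs (n%:R : fps F) 0 = n%:R.
Proof. by elim: n => [|n IHn]; rewrite ?coefs0 // -!natr1 coefsD IHn coefs1. Qed.

Lemma K_nat_neq0 n : n%:R != 0 :> F -> n%:R != 0 :> K.
Proof.
move=> n0; rewrite -(rmorph_nat (liota K)); apply: contra n0 => /eqP /liota_eq0 h.
by rewrite -coefs_nat h coefs0.
Qed.

Lemma mon_exp_inj s e s' e' : mon s e = mon s' e' -> e = e'.
Proof.
move=> h; have : mon s e * mon s e = mon s' e' * mon s' e' by rewrite h.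
rewrite !monM (@mon_eq _ _ (s + s) _ 0 (e + e) s) //; last by ring.
rewrite (@mon_eq _ _ (s' + s') _ 0 (e' + e') s') //; last by ring.
by rewrite -!Xmon => /(X_expz_inj M_gt0); lia.
Qed.

Lemma mon_sep s e s' e' : (forall n : int, e' != e + M * n) -> sep M (mon s e) (mon s' e').
Proof.
move=> h n; rewrite Xmon monM; apply: contra (h n) => /eqP /mon_exp_inj ->.
by rewrite eqxx.
Qed.

Lemma mon_sep_sign e : sep M (mon 0 e) (mon 1 e).
Proof.
move=> n; rewrite Xmon monM; apply/eqP => h; have := mon_exp_inj h => /eqP.
rewrite -[X in X == _]addr0 (inj_eq (addrI _)) => /eqP n0.
move: h; rewrite -n0 !addr0 /Submission.mon expr1z expr0z => /(mulIf (expfz_neq0 _ (X_neq0 K))) /eqP.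
rewrite -subr_eq0 -opprD oppr_eq0 -[1 + 1]/(2%:R); apply/negP; exact: K_nat_neq0.
Qed.

Definition hp : K := mon 0 121.

Lemma hp2 : hp * hp = B.
Proof. by rewrite monM ME Xmon. Qed.

Lemma hp0 : hp != 0. Proof. exact: mon_neq0. Qed.

Lemma pinf_sq x : pinf (x ^+ 2) = pinf x * (pinf (- x) * (pinf (x * hp) * pinf (- x * hp))).
Proof.
apply: conv_uniq (conv_sub (s := fun N => (N * 2)%N) _ (pinfP M_gt0 (x ^+ 2))) _.
  by move=> n; exists n => L; lia.
apply: (conv_near _ (convM (pinfP M_gt0 x) (convM (pinfP M_gt0 (- x))
  (convM (pinfP M_gt0 (x * hp)) (pinfP M_gt0 (- x * hp)))))).
exists 0%N => L _; elim: L => [|L IHL]; first by rewrite !poch0 !mulr1.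
have e1 : B ^+ (L * 2) = (B ^+ L) ^+ 2 by rewrite exprM.
have e2 : B ^+ (L * 2).+1 = (hp * B ^+ L) ^+ 2 by rewrite exprS exprM exprMn [in RHS]expr2 hp2.
rewrite mulSnr addn2 !pochS -IHL e1 e2.
by ring.
Qed.

(** Duplication formula: the zeros of $\theta(x^2)$ are those of [theta] translated by the half
    periods $-1$, [hp], [- hp]. *)
Lemma theta_sq x : x != 0 ->
  theta (x ^+ 2) = theta x * (theta (- x) * (theta (x * hp) * theta (- x * hp))).
Proof.
move=> x0; rewrite /Submission.theta (_ : B / x ^+ 2 = (hp / x) ^+ 2); last first.
  by rewrite -hp2; field.
rewrite !pinf_sq (_ : hp / x * hp = B / x); last by rewrite -hp2; field.
rewrite (_ : B / - x = - (hp / x) * hp); last by rewrite -hp2; field; rewrite oppr_eq0 x0.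
rewrite (_ : B / (x * hp) = hp / x); last by rewrite -hp2; field; rewrite x0 hp0.
rewrite (_ : B / (- x * hp) = - (hp / x)); last by rewrite -hp2; field; rewrite ?oppr_eq0 x0 hp0.
by ring.
Qed.

(** [pinf_sq] at [hp] gives Euler's relation [e], and the factor 2 is the first factor $1-(-1)$ of
    [pinf (- 1)]. *)
Lemma theta_half_prod : theta (- 1) * (theta hp * theta (- hp)) = 2%:R.
Proof.
have J0 := pinfB_neq0 K M_gt0.
have e : pinf hp * pinf (- hp) * pinf (- B) = 1.
  apply: (mulfI J0); rewrite mulr1 -[in RHS]hp2 -expr2 pinf_sq mulNr hp2; ring.
rewrite /Submission.theta (_ : B / hp = hp); last by rewrite -hp2 mulfK ?hp0.
rewrite (_ : B / - hp = - hp); last by rewrite -hp2; field; rewrite ?oppr_eq0 hp0.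
rewrite (_ : B / -1 = - B); last by rewrite invrN1 mulrN1.
rewrite (pinfS M_gt0 (-1)) mulN1r opprK -[1 + 1]/(2%:R) -[RHS]mulr1 -(expr1n K 2) -e.
by ring.
Qed.

(** Up to scale, the difference of the values of the Weierstrass function at [u] and [v]; its
    additivity [wp_add] is the three-term relation. *)
Definition wp (u v : K) : K := brk u v / (brk u 1 * brk v 1).

Lemma brk1 (u : K) : brk u 1 = u^-1 * theta u ^+ 2.
Proof. by rewrite /Submission.brk mulr1 divr1. Qed.

Definition nonlattice (u : K) := u != 0 /\ forall n : int, u != X K ^ (M * n).

Lemma brk1_neq0 (u : K) : nonlattice u -> brk u 1 != 0.
Proof.
by case=> u0 hu; rewrite brk1 mulf_neq0 ?invr_eq0 ?expf_neq0 //; apply: theta_neq0.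
Qed.

Lemma wp_add (u v w : K) : nonlattice u -> nonlattice v -> nonlattice w ->
  sep M u v -> sep M u w -> sep M v w -> wp u w - wp v w = wp u v.
Proof.
move=> hu hv hw huv huw hvw.
have := weierstrass M_gt0 hu.1 hv.1 hw.1 (oner_neq0 K) huv huw hvw.
have := brk1_neq0 hu; have := brk1_neq0 hv; have := brk1_neq0 hw; rewrite /wp.
move: (brk u 1) (brk v 1) (brk w 1) (brk v w) (brk u w) (brk u v) => a b c x y z c0 b0 a0 h.
have -> : y = (a * x + c * z) / b by apply: (mulfI b0); rewrite [RHS]mulrC divfK // -[LHS]addr0 -h; ring.
by field; rewrite a0 b0 c0.
Qed.

Lemma brk_anti (u v : K) : u != 0 -> v != 0 -> brk u v = - brk v u.
Proof.
move=> u0 v0; rewrite /Submission.brk (mulrC v u) -(invf_div v u) thetaV ?mulf_neq0 ?invr_eq0 //.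
by rewrite invf_div; field; rewrite u0 v0.
Qed.

Lemma theta_half (u : K) : u != 0 -> theta (u / hp) = - (u / hp) * theta (u * hp).
Proof.
move=> u0; have h0 := hp0; have e : u * hp = u / hp * B by rewrite -hp2; field.
have w0 : u / hp != 0 by rewrite mulf_neq0 ?invr_eq0.
by rewrite e thetaB //; field; rewrite u0 h0.
Qed.

Lemma theta_half_neq0 : [/\ theta (- 1) != 0, theta hp != 0 & theta (- hp) != 0].
Proof.
have := K_nat_neq0 two0; rewrite -theta_half_prod !mulf_eq0 !negb_or.
by move=> /andP [? /andP [? ?]].
Qed.

Lemma wp_two (u : K) : u != 0 -> theta u != 0 ->
  wp u (- 1) = - (theta (- u) ^+ 2 / (theta u ^+ 2 * theta (- 1) ^+ 2)).
Proof.
move=> u0 t0; have h := theta_half_prod; rewrite /wp !brk1 /Submission.brk invrN1 !mulrN1.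
have [q0 _ _] := theta_half_neq0.
by field; nonzero.
Qed.

Lemma wp_half (u : K) : u != 0 -> theta u != 0 ->
  wp u hp = - (u * theta (u * hp) ^+ 2 / (theta u ^+ 2 * theta hp ^+ 2)).
Proof.
move=> u0 t0; have h := theta_half_prod; have h0 := hp0.
rewrite /wp !brk1 /Submission.brk theta_half //.
have [_ q0 _] := theta_half_neq0.
by field; nonzero.
Qed.

Lemma wp_half' (u : K) : u != 0 -> theta u != 0 ->
  wp u (- hp) = - (u * theta (- (u * hp)) ^+ 2 / (theta u ^+ 2 * theta (- hp) ^+ 2)).
Proof.
move=> u0 t0; have h := theta_half_prod; have h0 := hp0.
have e : u / - hp = (- u) / hp by field; nonzero.
rewrite /wp !brk1 /Submission.brk e theta_half ?oppr_eq0 // mulrN [- u * hp]mulNr.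
have [_ _ q0] := theta_half_neq0.
by field; nonzero.
Qed.

(** The Weierstrass equation: the product of the differences to the three half-period values is a
    quarter of the squared derivative, here a theta quotient by [theta_sq]. *)
Lemma wp_prod (u : K) : u != 0 -> theta u != 0 ->
  wp u (- 1) * wp u hp * wp u (- hp) = - (u ^+ 2 * theta (u ^+ 2) ^+ 2 / (4%:R * theta u ^+ 8)).
Proof.
move=> u0 t0; rewrite wp_two // wp_half // wp_half' // theta_sq // [- u * hp]mulNr.
have [q1 q2 q3] := theta_half_neq0.
have -> : 4%:R = (theta (- 1) * (theta hp * theta (- hp))) ^+ 2 by rewrite theta_half_prod -natrX.
by field; nonzero.
Qed.

Lemma hp_opp : - hp = mon 1 121.
Proof. by rewrite /hp -Xmon /Submission.mon expr1z mulN1r. Qed.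

Lemma N1_mon : - 1 = mon 1 0.
Proof. by rewrite /Submission.mon expr1z expr0z mulr1. Qed.

Lemma mon_nonlattice s e : (forall n : int, e != 242 * n) -> nonlattice (mon s e).
Proof.
move=> h; split=> [|n]; first exact: mon_neq0.
by rewrite Xmon; apply: contra (h n) => /eqP /mon_exp_inj ->; rewrite ME.
Qed.

Lemma N1_nonlattice : nonlattice (- 1).
Proof.
split=> [|n]; first by rewrite oppr_eq0 oner_neq0.
by have := mon_sep_sign 0 n; rewrite -N1_mon mon0 mul1r.
Qed.

Definition wscale : K := mon 0 60 * J ^+ 2.

Definition ratio (a : int) := pt (a + 1) * pt (a - 1) / (pt a ^+ 2 * pt 1 ^+ 2).

Lemma wp_ratio a : ~~ (11 %| a)%Z -> wp (zt a) (zt 1) = wscale * ratio a.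
Proof.
move=> ha; have p0 := pt_neq0 K M_gt0 ME ha; have p1 := pt_neq0 K M_gt0 ME (isT : ~~ (11 %| 1)%Z).
have J0 := pinfB_neq0 K M_gt0.
have sq b : pt b ^+ 2 = mon 0 (2 * b ^+ 2 + 60) * J ^+ 2 * brk (zt b) 1.
  have := pt_brk K M_gt0 b 0; rewrite addr0 subr0 -expr2 => ->.
  by rewrite (_ : zt 0 = 1) ?/Submission.zt ?mulr0 ?expr0z // expr0n /= mulr0 addr0.
rewrite /ratio pt_brk !sq /wp /wscale.
have b0 b : ~~ (11 %| b)%Z -> brk (zt b) 1 != 0.
  by move=> hb; apply: brk1_neq0; split; [exact: zt_neq0 | exact: zt_sep].
rewrite (_ : mon 0 (2 * a ^+ 2 + 2 * 1 ^+ 2 + 60) = mon 0 (2 * a ^+ 2 + 60) * mon 0 (2 * 1 ^+ 2 + 60) / mon 0 60).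
  move: (mon_neq0 K 0 (2 * a ^+ 2 + 60)) (mon_neq0 K 0 (2 * 1 ^+ 2 + 60)) (mon_neq0 K 0 60).
  have := b0 _ ha; have := b0 1 isT.
  move: (mon 0 _) (mon 0 _) (mon 0 _) (brk _ 1) (brk _ 1) => m1 m2 m3 x y x0 y0 h1 h2 h3.
  by field; nonzero.
by rewrite monV !monM; apply: (@mon_eq _ _ _ _ _ _ 0); ring.
Qed.

Lemma theta_zt_neq0 a : ~~ (11 %| a)%Z -> theta (zt a) != 0.
Proof. by move=> ha; apply: theta_neq0 (zt_neq0 K a) (zt_sep K M_gt0 ME ha). Qed.

Lemma wp_prod_pt a : ~~ (11 %| a)%Z -> wp (zt a) (- 1) * wp (zt a) hp * wp (zt a) (- hp) =
  - (wscale ^+ 3 * (pt (2 * a) ^+ 2 / (4%:R * pt a ^+ 8))).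
Proof.
move=> ha; have t0 := theta_zt_neq0 ha; rewrite wp_prod ?zt_neq0 //; congr (- _).
have J0 := pinfB_neq0 K M_gt0; have f0 : 4%:R != 0 :> K.
  by rewrite (natrM _ 2 2) mulf_neq0 ?K_nat_neq0.
rewrite /Submission.pt (_ : zt (2 * a) = zt a ^+ 2); last by rewrite mulrDl !mul1r ztD.
have g0 : gt K a != 0 := mon_neq0 K _ _.
have -> : wscale ^+ 3 * ((gt K (2 * a) * (J * theta (zt a ^+ 2))) ^+ 2 / (4%:R * (gt K a * (J * theta (zt a))) ^+ 8)) =
   (mon 0 60 ^+ 3 * gt K (2 * a) ^+ 2 / gt K a ^+ 8) * (theta (zt a ^+ 2) ^+ 2 / (4%:R * theta (zt a) ^+ 8)).
  by rewrite /wscale; field; nonzero.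
rewrite -[LHS]mulrA; congr (_ * _).
have -> : zt a ^+ 2 = mon 0 (44 * a).
  by rewrite zt_mon expr2 monM; apply: (@mon_eq _ _ _ _ _ _ 0); ring.
rewrite /gt !exprnP !monX monV !monM; apply: (@mon_eq _ _ _ _ _ _ (- 6 * a)); last by ring.
by ring.
Qed.

Lemma half_sep e : (forall n : int, e != 242 * n) -> (forall n : int, e != 121 + 242 * n) ->
  [/\ sep M (mon 0 e) (- 1), sep M (mon 0 e) hp & sep M (mon 0 e) (- hp)].
Proof.
move=> h1 h2; rewrite N1_mon hp_opp; split; apply: mon_sep => n; rewrite ME; apply/eqP => h.
- by move/eqP: (h1 (- n)); apply; lia.
- by move/eqP: (h2 (- n)); apply; lia.
by move/eqP: (h2 (- n)); apply; lia.
Qed.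

(** The $e_i$ are half-period values measured from the value at [zt 1]. Their differences are theta
    constants, and [theta_half_prod] collapses the product of these to a power of 2, so that only
    the scale $J^{12}$ is left in the discriminant. *)
Theorem disc_relation : exists e1 e2 e3,
  [/\ forall a, a \in [:: 1; 2; 3] -> (ratio a - e1) * (ratio a - e2) * (ratio a - e3) =
        - (pt (2 * a) ^+ 2 / (4%:R * pt a ^+ 8)) &
      16%:R * ((e1 - e2) * (e1 - e3) * (e2 - e3)) ^+ 2 * (X K ^ 118 * J ^+ 12) = 1].
Proof.
have J0 := pinfB_neq0 K M_gt0; have k0 : wscale != 0 by rewrite mulf_neq0 ?expf_neq0 ?mon_neq0.
have nz a : a \in [:: 1; 2; 3] -> ~~ (11 %| a)%Z by rewrite !inE => /or3P [] /eqP ->.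
have nl a : a \in [:: 1; 2; 3] -> nonlattice (zt a).
  by move=> /nz ha; split; [exact: zt_neq0 | exact: zt_sep].
have hl : nonlattice hp by apply: mon_nonlattice => n; lia.
have hl' : nonlattice (- hp) by rewrite hp_opp; apply: mon_nonlattice => n; lia.
have nl1 := N1_nonlattice.
have hs a : a \in [:: 1; 2; 3] -> [/\ sep M (zt a) (- 1), sep M (zt a) hp & sep M (zt a) (- hp)].
  by rewrite zt_mon => ha; apply: half_sep; move: ha; rewrite !inE => /or3P [] /eqP -> n; lia.
have m1 : (1 : int) \in [:: 1; 2; 3] by [].
have key (h : K) a : nonlattice h -> sep M (zt a) h -> sep M (zt 1) h -> a \in [:: 1; 2; 3] ->
   wscale * ratio a - wp h (zt 1) = wp (zt a) h.
  move=> hh sa s1 ha; rewrite -wp_ratio ?nz //.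
  have [->|a1] := eqVneq a 1.
    have -> : wp (zt 1) (zt 1) = 0.
      by rewrite /wp /Submission.brk divff ?zt_neq0 // theta1 !mulr0 mul0r.
    rewrite sub0r /wp (brk_anti (zt_neq0 K 1) hh.1) [brk h 1 * _]mulrC mulNr //.
  apply: wp_add => //; [exact: nl|exact: nl| |exact: sep_sym].
  apply: (zt_sep2 K M_gt0 ME); move: ha a1; rewrite !inE => /or3P [] /eqP -> //.
have kdiff (g h : K) : nonlattice g -> nonlattice h -> sep M g h -> sep M (zt 1) g -> sep M (zt 1) h ->
   wp g (zt 1) - wp h (zt 1) = wp g h.
  by move=> ng nh s1 s2 s3; apply: wp_add => //; [exact: nl | exact: sep_sym | exact: sep_sym].
have [s1 s2 s3] := hs 1 m1.
exists (wp (- 1) (zt 1) / wscale), (wp hp (zt 1) / wscale), (wp (- hp) (zt 1) / wscale); split.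
  move=> a ha; have [t1 t2 t3] := hs a ha.
  apply: (mulfI (expf_neq0 3 k0)); rewrite mulrN -(wp_prod_pt (nz a ha)).
  rewrite -!key //; move: (ratio a) (wp (- 1) _) (wp hp _) (wp (- hp) _) => x y z w.
  by field.
have sh1 : sep M (- 1) hp by rewrite N1_mon; apply: mon_sep => n; rewrite ME; lia.
have sh2 : sep M (- 1) (- hp) by rewrite N1_mon hp_opp; apply: mon_sep => n; rewrite ME; lia.
have sh3 : sep M hp (- hp) by rewrite hp_opp; exact: mon_sep_sign.
have tl (u : K) : nonlattice u -> theta u != 0 by case=> u0 hu; exact: theta_neq0.
have [q1 q2 q3] := theta_half_neq0.
have d1 : wp (- 1) (zt 1) - wp hp (zt 1) = theta (- hp) ^+ 2 / (theta hp ^+ 2 * theta (- 1) ^+ 2).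
  by rewrite -[LHS]opprB kdiff ?wp_two ?opprK ?hp0 //; exact: sep_sym.
have d2 : wp (- 1) (zt 1) - wp (- hp) (zt 1) = theta hp ^+ 2 / (theta (- hp) ^+ 2 * theta (- 1) ^+ 2).
  by rewrite -[LHS]opprB kdiff ?wp_two ?opprK ?oppr_eq0 ?hp0 //; exact: sep_sym.
have d3 : wp hp (zt 1) - wp (- hp) (zt 1) = - (hp * theta (- 1) ^+ 2 / (theta (- hp) ^+ 2 * theta hp ^+ 2)).
  rewrite -[LHS]opprB kdiff ?wp_half ?oppr_eq0 ?hp0 //; last exact: sep_sym.
  have -> : theta (- hp * hp) = theta (- 1).
    by rewrite mulNr hp2 -mulN1r thetaB ?oppr_eq0 ?oner_neq0 // invrN1 opprK mul1r.
  by rewrite opprK !mulNr.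
have -> : ((wp (- 1) (zt 1) / wscale - wp hp (zt 1) / wscale) *
   (wp (- 1) (zt 1) / wscale - wp (- hp) (zt 1) / wscale) *
   (wp hp (zt 1) / wscale - wp (- hp) (zt 1) / wscale)) ^+ 2 =
   B / ((theta (- 1) * (theta hp * theta (- hp))) ^+ 4 * wscale ^+ 6).
  rewrite -!mulrBl d1 d2 d3 -hp2; move: hp0 => h0; by field; nonzero.
rewrite theta_half_prod (_ : 16%:R = 2%:R ^+ 4); last by rewrite -natrX.
(* The exponent is $118=6\cdot60-242$: sixth power of the scale, divided by the [B] coming from
   [hp]. *)
have -> : X K ^ 118 = mon 0 60 ^+ 6 / B.
  rewrite exprnP monX ME [X in _ / X]Xmon monV monM Xmon; apply: (@mon_eq _ _ _ _ _ _ 0) => //.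
have t0 := K_nat_neq0 two0; have b0 : B != 0 := expfz_neq0 _ (X_neq0 K).
rewrite /wscale; move: (mon 0 60) (mon_neq0 K 0 60) (J) J0 (2%:R : K) t0 => m m0 j j0 t t0.
by move: (B) b0 => b b0; field; nonzero.
Qed.

End HalfPeriods.

(** * Homogeneous elements *)

Section Hom.
Variables (F : fieldType) (K : lfield F).
Local Notation mon := (@mon F K).

(** Exponents of [X] modulo 22 are exponents of $q$ modulo 11, half-integers included. *)
Definition supp (c : int) (f : fps F) := forall n : nat, coefs f n != 0 -> (22 %| n%:Z - c)%Z.

Lemma supp0 c : supp c 0. Proof. by move=> n; rewrite coefs0 eqxx. Qed.

Lemma suppD c f g : supp c f -> supp c g -> supp c (f + g).
Proof.
move=> hf hg n; rewrite coefsD => h; have [e|] := eqVneq (coefs f n) 0; last exact: hf.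
by apply: hg; rewrite e add0r in h.
Qed.

Lemma suppN c f : supp c f -> supp c (- f).
Proof. by move=> hf n; rewrite coefsN oppr_eq0; exact: hf. Qed.

Lemma suppM c d f g : supp c f -> supp d g -> supp (c + d) (f * g).
Proof.
move=> hf hg n; rewrite coefsM => h.
have /existsP [i /andP [hi hj]] : [exists i : 'I_n.+1, (coefs f i != 0) && (coefs g (n - i) != 0)].
  apply: contraNT h => /existsPn h; rewrite big1 // => i _; have := h i; rewrite negb_and !negbK.
  by move=> /orP [] /eqP ->; rewrite ?mul0r ?mulr0.
have := hf _ hi; have := hg _ hj; have := ltn_ord i; lia.
Qed.

Lemma supp_eqc c d f : (22 %| c - d)%Z -> supp c f -> supp d f.
Proof. by move=> h hf n /hf; lia. Qed.

Lemma suppXn e : supp e%:Z (fX F ^+ e).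
Proof.
move=> n; rewrite -[fX F ^+ e]mulr1 coefsXnM coefs1; case: leqP => h; last by rewrite eqxx.
by case: ((n - e)%N =P 0%N) => [e0 _|_]; [lia | rewrite eqxx].
Qed.

(** Quotients are allowed so that inverses of theta values are graded too. *)
Definition hom (c : int) (z : K) := exists f g a b,
  [/\ supp a f, supp b g, g != 0, (22 %| a - b - c)%Z & z = liota K f / liota K g].

Lemma liota_neq0 (f : fps F) : f != 0 -> liota K f != 0.
Proof. by apply: contra => /eqP /liota_eq0 ->. Qed.

Lemma supp1 : supp 0 1. Proof. by have := @suppXn 0; rewrite expr0. Qed.

Lemma hom_supp c f : supp c f -> hom c (liota K f).
Proof.
move=> hf; exists f, 1, c, 0; split; rewrite ?oner_neq0 ?rmorph1 ?divr1 //; first exact: supp1.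
by rewrite subr0 subrr.
Qed.

Lemma hom_eqc c d z : (22 %| c - d)%Z -> hom c z -> hom d z.
Proof. by move=> h [f [g [a [b [? ? ? ? ?]]]]]; exists f, g, a, b; split => //; lia. Qed.

Lemma hom0 c : hom c 0.
Proof. by rewrite -(rmorph0 (liota K)); apply: hom_supp; exact: supp0. Qed.

Lemma homM c d z w : hom c z -> hom d w -> hom (c + d) (z * w).
Proof.
move=> [f [g [a [b [hf hg g0 hc ->]]]]] [f' [g' [a' [b' [hf' hg' g0' hc' ->]]]]].
exists (f * f'), (g * g'), (a + a'), (b + b'); split; try exact: suppM.
- by rewrite mulf_neq0.
- by lia.
by rewrite !rmorphM invfM mulrACA.
Qed.

Lemma homV c z : hom c z -> hom (- c) z^-1.
Proof.
move=> [f [g [a [b [hf hg g0 hc ->]]]]]; have [->|f0] := eqVneq f 0.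
  by rewrite rmorph0 mul0r invr0; exact: hom0.
by exists g, f, b, a; split => //; [lia | rewrite invf_div].
Qed.

Lemma homN c z : hom c z -> hom c (- z).
Proof.
move=> [f [g [a [b [hf hg g0 hc ->]]]]]; exists (- f), g, a, b; split => //; first exact: suppN.
by rewrite rmorphN mulNr.
Qed.

Lemma homD c z w : hom c z -> hom c w -> hom c (z + w).
Proof.
move=> [f [g [a [b [hf hg g0 hc ->]]]]] [f' [g' [a' [b' [hf' hg' g0' hc' ->]]]]].
exists (f * g' + f' * g), (g * g'), (a + b'), (b + b'); split.
- by apply: suppD; [exact: suppM | apply: (supp_eqc _ (suppM hf' hg)); lia].
- exact: suppM.
- by rewrite mulf_neq0.
- by lia.
by rewrite addf_div ?liota_neq0 // !rmorphD !rmorphM.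
Qed.

Lemma hom_sum c (I : Type) (r : seq I) (P : pred I) (f : I -> K) :
  (forall i, P i -> hom c (f i)) -> hom c (\sum_(i <- r | P i) f i).
Proof. by move=> h; apply: (big_ind (hom c)) => //; [exact: hom0 | exact: homD]. Qed.

Lemma homX_nat c z n : hom c z -> hom (c * n%:Z) (z ^+ n).
Proof.
move=> hz; elim: n => [|n IHn].
  by rewrite mulr0 expr0 -(rmorph1 (liota K)); apply: hom_supp; exact: supp1.
by rewrite exprS; apply: hom_eqc (homM hz IHn); rewrite -[n.+1]addn1; lia.
Qed.

Lemma homX c z (n : int) : hom c z -> hom (c * n) (z ^ n).
Proof.
move=> hz; case: n => n; first exact: homX_nat.
by rewrite NegzE mulrN -invr_expz; apply: homV; exact: homX_nat.
Qed.

Lemma hom_nat n : hom 0 (n%:R).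
Proof.
elim: n => [|n IHn]; first exact: hom0.
by rewrite -natr1; apply: homD IHn _; rewrite -(rmorph1 (liota K)); apply: hom_supp; exact: supp1.
Qed.

Lemma hom_int (n : int) : hom 0 (n%:~R).
Proof. by case: n => n; [exact: hom_nat | rewrite NegzE rmorphN; apply: homN; exact: hom_nat]. Qed.

Lemma hom_X e : hom e (X K ^ e).
Proof.
have h : hom 1 (X K) by have := hom_supp (@suppXn 1); rewrite expr1.
by have := homX e h; rewrite mul1r.
Qed.

Lemma hom_common (s : seq nat) (z : nat -> K) : (forall r, r \in s -> hom r%:Z (z r)) ->
  exists g b, [/\ g != 0, supp b g &
    forall r, r \in s -> exists h, supp (r%:Z + b) h /\ z r * liota K g = liota K h].
Proof.
elim: s => [|r s IHs] hz; first by exists 1, 0; split; rewrite ?oner_neq0 //; exact: supp1.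
have [g [b [g0 hg hs]]] := IHs (fun i hi => hz i (@mem_behead _ (r :: s) i hi)).
have [f' [g' [a' [b' [hf' hg' g0' hc' zE]]]]] := hz r (mem_head r s).
exists (g * g'), (b + b'); split; [by rewrite mulf_neq0 | exact: suppM |] => i.
rewrite inE => /orP [/eqP -> | /hs [h [hh e]]].
  exists (f' * g); split; first by apply: (supp_eqc _ (suppM hf' hg)); lia.
  by rewrite zE !rmorphM [liota K g * _]mulrC mulrA divfK ?liota_neq0.
exists (h * g'); split; first by apply: (supp_eqc _ (suppM hh hg')); lia.
by rewrite !rmorphM mulrA e.
Qed.

(** Over a common denominator the numerators have disjoint supports, so a vanishing sum forces each
    of them to vanish. *)
Theorem hom_indep (z : nat -> K) : (forall r, (r < 22)%N -> hom r%:Z (z r)) ->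
  \sum_(0 <= r < 22) z r = 0 -> forall r, (r < 22)%N -> z r = 0.
Proof.
move=> hz hs; have [r|g [b [g0 hg hh]]] := @hom_common (iota 0 22) z.
  by rewrite mem_iota => hr; exact: hz.
have hh' r : exists h, (r < 22)%N -> supp (r%:Z + b) h /\ z r * liota K g = liota K h.
  have [hr|hr] := boolP (r < 22)%N; last by exists 0 => hr'; case/negP: hr.
  by have [|h hP] := hh r; [rewrite mem_iota | exists h].
have {hh hh'} [h hP] := choice hh'.
have hsum : \sum_(0 <= r < 22) h r = 0.
  apply: (@tofrac_inj _ K); rewrite rmorph_sum rmorph0 /=.
  transitivity ((\sum_(0 <= r < 22) z r) * liota K g); last by rewrite hs mul0r.
  by rewrite big_distrl /=; apply: eq_big_nat => r hr; rewrite (hP r hr).2.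
move=> r hr; suff h0 : h r = 0.
  by apply: (mulIf (liota_neq0 g0)); rewrite (hP r hr).2 h0 rmorph0 mul0r.
apply/fpsP => n; rewrite coefs0; apply/eqP; apply: contraT => hn.
have := congr1 (fun f => coefs f n) hsum; rewrite coefs0.
have -> : coefs (\sum_(0 <= i < 22) h i) n = \sum_(0 <= i < 22) coefs (h i) n.
  by apply: (big_morph (fun f => coefs f n)) => [f f'|]; rewrite ?coefsD ?coefs0.
rewrite (bigD1_seq r) ?mem_iota ?iota_uniq //= big1_seq ?addr0 => [e|i /andP [ir]]; first by rewrite e eqxx in hn.
rewrite mem_iota => hi; apply/eqP; apply: contraT => hni.
have := (hP r hr).1 _ hn; have := (hP i hi).1 _ hni; have := ir; lia.
Qed.

(** A grading with a fixed bound on the pole. Having no varying denominators it passes to limits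
    ([conv_slice]), and [slice_hom] then gives [hom]. *)
Definition slice (N c : int) (z : K) := exists f, supp c f /\ z = X K ^ N * liota K f.

Lemma slice_hom N c z : slice N c z -> hom (N + c) z.
Proof. by move=> [f [hf ->]]; apply: homM (hom_X _) (hom_supp hf). Qed.

Lemma slice0 N c : slice N c 0.
Proof. by exists 0; rewrite rmorph0 mulr0; split => //; exact: supp0. Qed.

Lemma sliceD N c z w : slice N c z -> slice N c w -> slice N c (z + w).
Proof.
move=> [f [hf ->]] [g [hg ->]]; exists (f + g); split; first exact: suppD.
by rewrite rmorphD mulrDr.
Qed.

Lemma sliceM N c N' c' z w : slice N c z -> slice N' c' w -> slice (N + N') (c + c') (z * w).
Proof.
move=> [f [hf ->]] [g [hg ->]]; exists (f * g); split; first exact: suppM.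
by rewrite rmorphM expfzDr ?X_neq0 // mulrACA.
Qed.

Lemma sliceN N c z : slice N c z -> slice N c (- z).
Proof. by move=> [f [hf ->]]; exists (- f); split; [exact: suppN | rewrite rmorphN mulrN]. Qed.

Lemma slice_X N c e : N <= e -> (22 %| e - N - c)%Z -> slice N c (X K ^ e).
Proof.
move=> le h; exists (fX F ^+ absz (e - N)); split.
  by apply: supp_eqc (@suppXn _); lia.
rewrite -XfX -expfzDr ?X_neq0 //; congr (_ ^ _); lia.
Qed.

Lemma slice1 : slice 0 0 1.
Proof. by rewrite -(expr0z (X K)); apply: slice_X. Qed.

Lemma slice_int (n : int) : slice 0 0 (n%:~R).
Proof.
have h (m : nat) : slice 0 0 (m%:R).
  elim: m => [|m IHm]; first exact: slice0.
  by rewrite -natr1; apply: sliceD => //; exact: slice1.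
by case: n => n; [exact: h | rewrite NegzE rmorphN; apply: sliceN; exact: h].
Qed.

Lemma conv_slice N c u l : (forall L, slice N c (u L)) -> conv u l -> slice N c l.
Proof.
move=> hu hl; have X0 := expfz_neq0 N (X_neq0 K).
have [f hf] := choice hu.
have cf : conv (fun L => liota K (f L)) ((X K ^ N)^-1 * l).
  apply: conv_near (convM (conv_cst (X K ^ N)^-1) hl); exists 0%N => L _.
  by rewrite (hf L).2 mulKf.
have [|g hg] := @conv_vge F K _ _ 0 _ cf; first by exists 0%N => L _; exact: vge_tofrac.
rewrite expr0z mul1r in hg; exists g; split; last by rewrite -hg mulVKf.
move=> n; have [L0 /(_ L0 (leqnn _))] := cf n.+1%:Z; rewrite hg -rmorphB => /vge_coef0 z1.
have := z1 n (leqnn _); rewrite coefsB => /eqP; rewrite subr_eq0 => /eqP <-.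
exact: (hf L0).1.
Qed.

Lemma win_slice N c f L : (forall n, slice N c (f n)) -> slice N c (win f L).
Proof. by move=> h; apply: (big_ind (slice N c)) => //; [exact: slice0 | exact: sliceD]. Qed.

Lemma hassum_slice N c f s : (forall n, slice N c (f n)) -> hassum f s -> slice N c s.
Proof. by move=> h; apply: conv_slice => L; exact: win_slice. Qed.

Lemma slice_sgn (s : int) : slice 0 0 ((- 1) ^ s : K).
Proof.
have [k [->|->]] : exists k, s = 2 * k \/ s = 1 + 2 * k by exists (s %/ 2)%Z; lia.
  by rewrite sgn2; exact: slice1.
by rewrite expfzDr ?N1_neq0 // sgn2 mulr1; apply: sliceN; exact: slice1.
Qed.

Lemma slice_mon N c s e : N <= e -> (22 %| e - N - c)%Z -> slice N c (mon s e).
Proof.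
move=> le h; have := sliceM (slice_sgn s) (slice_X le h).
by rewrite !add0r.
Qed.

Lemma slice_inv_pos x : vge 1 x -> slice 0 0 x -> slice 0 0 (1 - x)^-1.
Proof.
move=> vx sx; have /vge_unit [x1 vi] : vge 1 ((1 - x) - 1).
  by rewrite addrAC subrr add0r; exact: vgeN.
apply: (@conv_slice _ _ (fun L => \sum_(0 <= j < L) x ^+ j)) => [L|N].
  apply: (big_ind (slice 0 0)) => [|a b|i _]; [exact: slice0 | exact: sliceD |].
  elim: i => [|i IHi]; first exact: slice1.
  by rewrite exprS -[0]addr0; exact: sliceM.
exists (absz N) => L le.
have -> : \sum_(0 <= j < L) x ^+ j - (1 - x)^-1 = - (x ^+ L * (1 - x)^-1).
  apply: (mulfI x1); rewrite mulrBr divff // mulrN mulrCA divff // mulr1 big_mkord.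
  by rewrite -[1 - x]opprB mulNr -subrX1; ring.
apply: vgeN; rewrite -[N]addr0; apply: vgeM vi.
by apply: vgeW (vge_exp L vx); rewrite -mulr_natr mul1r natz; lia.
Qed.

End Hom.

(** * Homogeneous pieces of the rank series *)

(* [coefficients c] expands [G_c / W] grade by grade on the monomials of [basis]; it was found by
   linear algebra on q-expansions, as was [crank_table], and is certified by [check_rank_true]. *)
Definition basis : seq (seq (seq Z * bool)) :=
  [:: [:: ([:: -2; -2; -2; -3; -4], true); ([:: -3; -2; -2; -4; -2], true); ([:: -2; -4; -2; -2; -3], true); ([:: -2; -3; -4; -2; -2], true); ([:: -4; -2; -3; -2; -2], true)];
      [:: ([:: -1; -4; -3; -3; -2], true); ([:: -1; -5; -5; -2; 0], true); ([:: -1; -3; -5; -3; -1], true); ([:: -1; -2; -3; -4; -3], true); ([:: -2; -3; -2; -2; -4], true); ([:: 0; -1; -1; 0; 1], false)];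
      [:: ([:: -1; -3; -3; -3; -3], true); ([:: -1; -4; -5; -2; -1], true); ([:: -1; -2; -5; -3; -2], true); ([:: -1; -1; -3; -4; -4], true); ([:: 0; 0; -1; 0; 0], false)];
      [:: ([:: -1; -2; -3; -3; -4], true); ([:: -1; -4; -3; -2; -3], true); ([:: -2; -4; -3; -3; -1], true); ([:: -2; -2; -3; -4; -2], true); ([:: -2; -1; -1; -5; -4], true); ([:: -1; 0; 1; -1; 0], false)];
      [:: ([:: 0; -3; -2; -4; -4], true); ([:: 0; -4; -4; -3; -2], true); ([:: 0; -2; -4; -4; -3], true); ([:: 0; -1; -2; -5; -5], true); ([:: -3; -3; -3; -4; 0], true); ([:: 1; 0; 0; -1; -1], false)];
      [:: ([:: -2; -2; -3; -3; -3], true); ([:: -2; -3; -5; -2; -1], true); ([:: 0; -3; -4; -3; -3], true); ([:: -1; -3; -4; -4; -1], true); ([:: -2; 0; -3; -4; -4], true); ([:: -1; 1; -1; 0; 0], false)];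
      [:: ([:: -1; -3; -2; -4; -3], true); ([:: -1; -4; -4; -3; -1], true); ([:: -1; -2; -4; -4; -2], true); ([:: -1; -1; -2; -5; -4], true); ([:: 0; 0; 0; -1; 0], false)];
      [:: ([:: -1; -4; -2; -3; -3], true); ([:: -1; -5; -4; -2; -1], true); ([:: -1; -3; -4; -3; -2], true); ([:: -1; -2; -2; -4; -4], true); ([:: 0; -1; 0; 0; 0], false)];
      [:: ([:: -1; -3; -2; -3; -4], true); ([:: -1; -4; -4; -2; -2], true); ([:: -1; -2; -4; -3; -3], true); ([:: -1; -1; -2; -4; -5], true); ([:: 0; 0; 0; 0; -1], false)];
      [:: ([:: -1; -4; -2; -2; -4], true); ([:: -1; -5; -4; -1; -2], true); ([:: -1; -3; -4; -2; -3], true); ([:: -1; -2; -2; -3; -5], true); ([:: -1; -1; -4; -3; -4], true); ([:: 0; -1; 0; 1; -1], false)];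
      [:: ([:: -2; -3; -2; -3; -3], true); ([:: -2; -4; -4; -2; -1], true); ([:: -2; -2; -4; -3; -2], true); ([:: -2; -1; -2; -4; -4], true); ([:: -1; 0; 0; 0; 0], false)]]%ZZ.

Definition coefficients (c : int) : seq (seq Z) :=
  if c == 9 then [:: [:: 0; -22; -22; -22; 0]; [:: 44; 22; 0; 22; -22; 10]; [:: -66; -22; 0; 0; -18]; [:: -22; 0; 22; 0; 0; -2]; [:: 154; 110; -66; -44; 0; 38]; [:: 44; 0; 0; 22; -22; 8]; [:: 44; 22; -44; -22; 14]; [:: 22; 22; 0; -22; 6]; [:: -22; -44; 22; 0; -2]; [:: -44; -22; 0; 0; 22; -4]; [::]]%ZZ
  else if c == 5 then [:: [:: -22; 0; 22; 0; -22]; [:: 44; 44; -44; -22; -22; 8]; [::]; [:: 44; -44; 22; -44; -22; 16]; [:: 44; 44; -44; -22; 22; 4]; [:: 22; 44; -44; 22; -22; 2]; [:: 88; 88; -66; -44; 20]; [:: 66; 44; -44; -44; 18]; [:: -132; -88; 66; 22; -28]; [:: -66; -66; 22; 0; 22; -12]; [:: -66; -22; 0; 0; -8]]%ZZ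
  else if c == 1 then [:: [:: 0; 22; -22; 0; -22]; [:: 66; 44; -44; -44; 0; 6]; [:: -132; -88; 66; 22; -24]; [:: 66; -44; 44; -22; -22; 12]; [:: 176; 132; -110; -44; 22; 36]; [:: 66; 44; -22; 44; -22; 18]; [:: 154; 110; -66; -44; 26]; [:: 66; 66; -66; -22; 8]; [::]; [:: -88; -66; 66; 22; -22; -20]; [:: -22; -44; 22; 0; -6]]%ZZ
  else if c == 8 then [:: [:: 22; 0; 0; -22; -22]; [:: 44; 44; -22; -22; 22; 4]; [:: -88; -88; 66; 44; -16]; [:: 44; -66; 44; 0; 0; 8]; [:: 132; 110; -66; -22; 22; 24]; [:: 66; 44; -44; 22; 0; 12]; [::]; [:: 88; 66; -22; 0; 20]; [:: -154; -110; 66; 44; -36]; [:: -66; -66; 66; 22; 0; -6]; [:: -44; -22; 44; 22; -4]]%ZZ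
  else [:: [:: 22; -22; 0; 22; 0]; [:: 22; 22; -22; 0; 22; 2]; [:: -66; -44; 44; 44; -8]; [:: 44; -22; 22; -22; 0; 4]; [:: -44; -44; 22; 22; 22; -10]; [:: 66; 22; 0; 0; 0; 6]; [:: 88; 66; -22; 0; 16]; [::]; [:: -66; -66; 66; 22; -18]; [:: -66; -44; 0; 22; 22; -14]; [:: -22; -22; 0; 22; -2]]%ZZ.

(** Each entry is a monomial of degree $-1$ in the $p_a$, preceded by its coefficients in the series
    for the residues 0 to 5; six columns suffice because cranks $b$ and $-b$ have the same
    series. *)
Definition crank_table : seq (seq Z * seq Z) :=
  [:: ([:: -10; 1; 1; 1; 1; 1], [:: -1; 0; 0; 0; 0]);
      ([:: -12; 10; -1; -1; -1; -1], [:: 0; -1; -1; 0; 1]);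
      ([:: -2; -2; 9; -2; -2; -2], [:: -1; 0; 1; -1; 0]);
      ([:: 8; -3; -3; 8; -3; -3], [:: -1; 1; -1; 0; 0]);
      ([:: 6; -5; 6; -5; 6; -5], [:: 0; -1; 0; 0; 0]);
      ([:: -4; -4; 7; -4; 7; -4], [:: 0; -1; 0; 1; -1]);
      ([:: 4; -7; 4; 4; -7; 4], [:: 0; 0; -1; 0; 0]);
      ([:: -6; 5; -6; 5; 5; -6], [:: 1; 0; 0; -1; -1]);
      ([:: -8; 3; 3; 3; -8; 3], [:: 0; 0; 0; -1; 0]);
      ([:: -2; -2; -2; 9; -2; -2], [:: 0; 0; 0; 0; -1])]%ZZ.

(* One entry per inequality: the residue [m], the coefficients of the [N_i] and of the [M_i], and
   the exponents [e_a] of the theta functions in the denominator of the resulting product. *)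
Definition rows : seq (nat * seq int * seq int * seq nat) :=
  [:: (0%N, [:: 1; 2; -2; 0; -1; 0], [:: -1; 1; 0; 0; 0; 0], [:: 2; 3; 2; 3; 3]%N);
      (0%N, [:: 1; 2; 3; -3; 0; -3], [:: -1; 1; 0; 0; 0; 0], [:: 2; 4; 4; 2; 1]%N);
      (0%N, [:: 0; 0; 2; 1; -4; 1], [:: 0; 0; 0; 0; 0; 0], [:: 2; 2; 4; 3; 2]%N);
      (0%N, [:: -1; -2; 1; 5; 3; -6], [:: 1; -1; 0; 0; 0; 0], [:: 2; 1; 2; 4; 4]%N);
      (1%N, [:: 1; -2; 4; -3; 1; -1], [:: 1; 0; -1; 0; 0; 0], [:: 1; 4; 3; 3; 2]%N);
      (1%N, [:: 1; 3; -4; 6; -6; 0], [:: 1; 0; -1; 0; 0; 0], [:: 1; 5; 5; 2; 0]%N);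
      (1%N, [:: 0; 2; -1; -3; 6; -4], [:: 0; 0; 0; 0; 0; 0], [:: 1; 3; 5; 3; 1]%N);
      (1%N, [:: -1; 1; 2; -1; -4; 3], [:: -2; -1; 3; 0; 0; 0], [:: 1; 2; 3; 4; 3]%N);
      (1%N, [:: -1; -1; 3; 2; 1; -4], [:: -2; -1; 3; 0; 0; 0], [:: 2; 3; 2; 2; 4]%N);
      (2%N, [:: -2; 0; 3; 0; 1; -2], [:: 0; 0; 0; 0; 0; 0], [:: 1; 2; 3; 3; 4]%N);
      (2%N, [:: 0; 2; -2; 2; -3; 1], [:: 2; 0; -2; 0; 0; 0], [:: 1; 4; 3; 2; 3]%N);
      (2%N, [:: 3; -1; 2; -1; 0; -3], [:: -1; 0; 1; 0; 0; 0], [:: 2; 4; 3; 3; 1]%N);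
      (2%N, [:: 2; 1; -4; 1; 3; -3], [:: 1; 0; -1; 0; 0; 0], [:: 2; 2; 3; 4; 2]%N);
      (2%N, [:: 1; 3; 1; -8; -5; 8], [:: 3; 0; -3; 0; 0; 0], [:: 2; 1; 1; 5; 4]%N);
      (3%N, [:: 1; -1; 0; 2; 0; -2], [:: -1; 1; 0; 0; 0; 0], [:: 2; 2; 3; 3; 3]%N);
      (3%N, [:: -2; 5; 2; -4; 2; -3], [:: 0; 0; 0; 0; 0; 0], [:: 2; 3; 5; 2; 1]%N);
      (3%N, [:: 2; -1; -3; 4; -3; 1], [:: 1; -1; 0; 0; 0; 0], [:: 0; 3; 4; 3; 3]%N);
      (3%N, [:: -1; -1; 6; -2; -5; 3], [:: -5; 5; 0; 0; 0; 0], [:: 1; 3; 4; 4; 1]%N);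
      (3%N, [:: 4; 2; -7; -3; 4; 0], [:: 3; -3; 0; 0; 0; 0], [:: 2; 0; 3; 4; 4]%N);
      (4%N, [:: -2; 4; -3; 3; -1; -1], [:: -5; 5; 0; 0; 0; 0], [:: 1; 4; 2; 3; 3]%N);
      (4%N, [:: 4; -5; 5; -2; -1; -1], [:: 3; -3; 0; 0; 0; 0], [:: 1; 5; 4; 2; 1]%N);
      (4%N, [:: -2; 3; 1; -2; 0; 0], [:: 1; -1; 0; 0; 0; 0], [:: 1; 3; 4; 3; 2]%N);
      (4%N, [:: 3; 0; -3; -2; 1; 1], [:: -1; 1; 0; 0; 0; 0], [:: 1; 2; 2; 4; 4]%N);
      (5%N, [:: 3; -2; 1; -3; 0; 1], [:: -2; 0; 2; 0; 0; 0], [:: 1; 4; 2; 2; 4]%N);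
      (5%N, [:: -3; 7; -2; -1; 1; -2], [:: -3; 0; 3; 0; 0; 0], [:: 1; 5; 4; 1; 2]%N);
      (5%N, [:: 2; -3; 1; 3; -4; 1], [:: 4; 0; -4; 0; 0; 0], [:: 1; 3; 4; 2; 3]%N);
      (5%N, [:: -4; -2; 4; 7; 2; -7], [:: 0; 0; 0; 0; 0; 0], [:: 1; 2; 2; 3; 5]%N);
      (5%N, [:: -2; 4; 1; -6; 2; 1], [:: -5; 0; 5; 0; 0; 0], [:: 1; 1; 4; 3; 4]%N);
      (7%N, [:: 1; 0; 0; -2; 2; -1], [:: 2; -2; 0; 0; 0; 0], [:: 1; 3; 3; 3; 3]%N);
      (7%N, [:: 3; 1; 1; 7; -5; 4], [:: -4; -7; 0; 0; 0; 0], [:: 1; 4; 5; 2; 1]%N);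
      (7%N, [:: -4; 4; 4; -6; 3; -1], [:: -4; 4; 0; 0; 0; 0], [:: 1; 2; 5; 3; 2]%N);
      (7%N, [:: 1; -2; -2; 5; 2; -4], [:: 0; 0; 0; 0; 0; 0], [:: 1; 1; 3; 4; 4]%N);
      (8%N, [:: 1; -3; 2; 0; 3; -3], [:: 5; -5; 0; 0; 0; 0], [:: 0; 3; 2; 4; 4]%N);
      (8%N, [:: -1; 2; -2; 4; -5; 2], [:: -3; 3; 0; 0; 0; 0], [:: 0; 4; 4; 3; 2]%N);
      (8%N, [:: -3; 2; 5; -5; -1; 2], [:: -1; 1; 0; 0; 0; 0], [:: 0; 2; 4; 4; 3]%N);
      (8%N, [:: 7; 4; -8; -1; 5; 4], [:: -4; -7; 0; 0; 0; 0], [:: 0; 1; 2; 5; 5]%N);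
      (8%N, [:: 5; 6; -1; 4; 2; -5], [:: -6; -5; 0; 0; 0; 0], [:: 3; 3; 3; 4; 0]%N);
      (9%N, [:: 0; -2; 4; -1; -1; 0], [:: 1; -1; 0; 0; 0; 0], [:: 1; 3; 2; 4; 3]%N);
      (9%N, [:: -1; 4; -3; 1; 1; -2], [:: 0; 0; 0; 0; 0; 0], [:: 1; 4; 4; 3; 1]%N);
      (9%N, [:: 4; -2; -5; 3; 3; -3], [:: 4; -4; 0; 0; 0; 0], [:: 1; 2; 4; 4; 2]%N);
      (9%N, [:: -2; 3; 4; -6; -6; 7], [:: -3; 3; 0; 0; 0; 0], [:: 1; 1; 2; 5; 4]%N);
      (10%N, [:: 0; 3; -2; -2; -1; 2], [:: -2; 0; 0; 2; 0; 0], [:: 1; 3; 2; 3; 4]%N);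
      (10%N, [:: 3; -3; 1; 1; -2; 0], [:: 1; 0; 0; -1; 0; 0], [:: 1; 4; 4; 2; 2]%N);
      (10%N, [:: -1; 2; -1; -1; 4; -3], [:: -1; 0; 0; 1; 0; 0], [:: 1; 2; 4; 3; 3]%N);
      (10%N, [:: -6; -6; 6; 6; -3; -8], [:: 6; 0; 0; 5; 0; 0], [:: 1; 1; 2; 4; 5]%N)].

(** * Symbolic lists of monomials and their finite certificates *)

Definition mul_item (t u : mitem) : mitem :=
  (Z.mul t.1.1 u.1.1, [seq Z.add (kth t.1.2 i) (kth u.1.2 i) | i <- iota 0 5], t.2 || u.2).

Definition mul_list (L L' : seq mitem) : seq mitem := [seq mul_item t u | t <- L, u <- L'].

Definition scale_list (z : Z) (L : seq mitem) : seq mitem := [seq (Z.mul z t.1.1, t.1.2, t.2) | t <- L].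

Fixpoint insert_item (t : mitem) (L : seq mitem) : seq mitem :=
  if L is u :: L' then
    if (t.1.2 == u.1.2) && (t.2 == u.2) then (Z.add t.1.1 u.1.1, u.1.2, u.2) :: L'
    else u :: insert_item t L'
  else [:: t].

Definition collect (L : seq mitem) : seq mitem :=
  [seq t <- foldr insert_item [::] L | ~~ Z.eqb t.1.1 0%ZZ].

(** [pt] is odd and has period 11, so an index prime to 11 reduces to one of 1 to 5 with a sign. *)
Definition reduce_index (n : int) : bool * nat :=
  let m := absz (n %% 11)%Z in if (m <= 5)%N then (false, m) else (true, 11 - m)%N.

Definition var_item (n : int) (e : Z) : mitem :=
  let bi := reduce_index n in
  (if bi.1 then (-1)%ZZ else 1%ZZ, [seq if i.+1 == bi.2 then e else 0%ZZ | i <- iota 0 5], false).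

Definition one_item : mitem := (1, [:: 0; 0; 0; 0; 0], false)%ZZ.

Definition monomial (num den : seq int) : mitem :=
  foldr mul_item one_item ([seq var_item n 1 | n <- num] ++ [seq var_item n (-1) | n <- den]).

(** [pt a] lies in the class of $12a^2+8$ modulo 22 ([hom_pt]), so the class of a monomial is fixed
    by its degree and by the sum of the $a^2k_a$ modulo 11. *)
Definition item_grade (t : mitem) : nat :=
  absz (int_of_Z (Z.modulo (kth t.1.2 0 + 4 * kth t.1.2 1 + 9 * kth t.1.2 2 + 16 * kth t.1.2 3
    + 25 * kth t.1.2 4) 11)%ZZ).

Definition grade_part (g : nat) (L : seq mitem) := [seq t <- L | item_grade t == g].

Definition residue (n : int) : nat := absz (n %% 11)%Z.

Definition listW : seq mitem := one_item :: [seq monomial [:: 2 * a%:Z] [:: a%:Z] | a <- iota 1 5].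

Definition listW3 : seq mitem := collect (mul_list listW (collect (mul_list listW listW))).

(** Represents $G_c/(X^{30}J^3)$; [ellptE] justifies replacing the two logarithmic derivatives by
    graded parts of $W^3$ divided by a theta value. *)
Definition listG (c : int) : seq mitem :=
  collect (mul_list (grade_part (residue (c ^+ 2)) listW3) [:: monomial [::] [:: c]] ++
    mul_list (grade_part (residue ((2 * c) ^+ 2)) listW3) [:: monomial [::] [:: 2 * c]] ++
    scale_list 22 [seq monomial [:: c * a%:Z; 2 * (c * a%:Z)] [:: c - c * a%:Z; c; c + c * a%:Z] | a <- iota 2 4]).

Definition listT (c : int) : seq mitem :=
  [seq t <- flatten [seq [seq (zk.1, zk.2.1, zk.2.2) | zk <- zip bs.1 bs.2] | bs <- zip (coefficients c) basis]
    | ~~ Z.eqb t.1.1 0%ZZ].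

(** The exponent $c(3c+1)+2bc$ of the mock piece is $8c^2$ modulo 11 when $b\equiv5-3c$. *)
Definition mock_grade (c : int) : nat := residue (8 * c ^+ 2).

Definition listR (c : int) : seq mitem :=
  collect (listG c ++ scale_list (-1) (mul_list listW (listT c))).

(** The component of $G_c/W$ in the mock grade, which [coefficients] leaves empty. If the quotient
    is $T+M$ with $M$ of that grade, then $G_c-WT=WM$, and the part of $WM$ in that grade is $M$
    itself because the [om a] have nonzero grade in $W=1+\cdots$. *)
Definition listM (c : int) : seq mitem := grade_part (mock_grade c) (listR c).

Definition listZ (c : int) : seq mitem :=
  collect (listG c ++ scale_list (-1) (mul_list listW (listT c ++ listM c))).

Definition check_rank : bool := all (fun c => all (fun g => curve_check (grade_part g (listZ c))) (iota 0 11)) multipliers.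

(** Certifies $G_c=W(T+M)$ for the five centres, grade by grade since [curve_check] compares only
    terms whose twists agree modulo 11. *)
Lemma check_rank_true : check_rank.
Proof. by vm_compute. Qed.

Lemma multipliers_mock : all (fun c => all (fun t => item_grade t != mock_grade c) (listT c) &&
  all (fun t => item_deg t == (-1)%ZZ) (listT c ++ listM c)) multipliers.
Proof. by vm_compute. Qed.

Definition listE (b : int) : seq mitem :=
  let r := residue b in let i := if (r <= 5)%N then r else (11 - r)%N in
  [seq (nth 0%ZZ vk.1 i, vk.2, false) | vk <- crank_table].

(** Cyclic convolution of the $p_a$ with the crank expressions. It must give $-11W^2$ at $j=5$,
    $11W^2$ at $j=6$ and 0 elsewhere; the index 0 is omitted because $p_0=0$. *)
Definition listC (j : int) : seq mitem :=
  collect (flatten [seq mul_list [:: monomial [:: a%:Z] [::]] (listE (j - a%:Z)) | a <- iota 1 10] ++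
    (if j == 5 then scale_list 11 (mul_list listW listW) else
     if j == 6 then scale_list (-11) (mul_list listW listW) else [::])).

Lemma check_crank : all (fun j => all (fun g => curve_check (grade_part g (listC j))) (iota 0 11))
  [:: 0; 1; 2; 3; 4; 5; 6; 7; 8; 9; 10].
Proof. by vm_compute. Qed.

(** Summation by parts: after normalization the rank series are the differences [QQ b - QQ b.-1],
    with [2 * QQ 0] and [- QQ 4] at the ends, and these are the resulting coefficients of the
    [QQ b]. *)
Definition row_A (lam : seq int) : seq int :=
  [:: 2 * lam`_0 - lam`_1; lam`_1 - lam`_2; lam`_2 - lam`_3; lam`_3 - lam`_4; lam`_4 - lam`_5].

(** Cancels the signs of [gt a] for odd [a] in the target monomial. *)
Definition row_sign (e : seq nat) : Z := if odd (nth 0 e 0 + nth 0 e 2 + nth 0 e 4)%N then (-1)%ZZ else 1%ZZ.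

(** The constant is $242=22\cdot11$: the combination is scaled by 22 and equals 11 times a product.
    With [D] of degree 12 and exponents summing to 13 the degree is $-1$, like that of all the
    series. *)
Definition row_target (e : seq nat) : mitem :=
  ((242 * row_sign e)%ZZ, [seq Z.opp (Z.of_nat i) | i <- e], true).

Definition row_list (row : nat * seq int * seq int * seq nat) : seq mitem :=
  let: (m, lam, mu, e) := row in
  grade_part (2 * (m + 5) %% 11)%N
   (flatten [seq scale_list (Z_of_int al.1) (listT al.2) | al <- zip (row_A lam) multipliers] ++
    flatten [seq scale_list (Z_of_int (2 * ib.1)) (listE ib.2%:Z) | ib <- zip mu (iota 0 6)]).

(** The grade [2 * (m + 5)] corresponds to the progression $11n+m$: $12g+12\equiv2m$ modulo 22. The
    conditions include that a mock piece in this grade has coefficient 0 and that all coefficients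
    sum to 0, which removes the partition series. *)
Definition row_ok (row : nat * seq int * seq int * seq nat) : bool :=
  let: (m, lam, mu, e) := row in
  [&& collect (scale_list (-1) [:: row_target e] ++ row_list row) == [::],
      all (fun al => (mock_grade al.2 == (2 * (m + 5) %% 11)%N) ==> (al.1 == 0)) (zip (row_A lam) multipliers),
      foldr +%R 0 (lam ++ mu) == 0, (size lam == 6), (size mu == 6), (size e == 5),
      (sumn e == 13)%N, (m < 11)%N & item_grade (row_target e) == (2 * (m + 5) %% 11)%N].

Lemma rows_ok : all row_ok rows.
Proof. by vm_compute. Qed.

Lemma sum_pick (V : nmodType) (n c : nat) (x : V) : (c < n)%N -> \sum_(0 <= i < n | c == i) x = x.
Proof.
move=> hc; rewrite big_mkcond (bigD1_seq c) ?iota_uniq ?mem_iota ?subn0 //= eqxx big1 ?addr0 // => i.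
by rewrite eq_sym => /negPf ->.
Qed.

Lemma sum_classes (V : zmodType) (f h : nat -> V) (x : V) (cl : nat -> nat) :
  (forall i, (0 < i < 6)%N -> (cl i < 11)%N) ->
  \sum_(0 <= g < 11) (f g *+ 2 + (if g == 0%N then x else 0) - \sum_(1 <= i < 6 | cl i == g) h i *+ 2) =
  (\sum_(0 <= g < 11) f g) *+ 2 + x - \sum_(1 <= i < 6) h i *+ 2.
Proof.
move=> hcl; rewrite sumrB big_split /= sumrMnl (exchange_big_dep_nat xpredT) //=; congr (_ + _ - _).
  by rewrite unlock /= !addr0.
by apply: eq_big_nat => i hi; rewrite sum_pick ?hcl.
Qed.

(** * Values of symbolic lists in the Laurent field *)

Section Values.
Variables (F : fieldType) (K : lfield F) (M : int).
Hypotheses (M_gt0 : 0 < M) (ME : M = 242) (two0 : 2%:R != 0 :> F).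
Local Notation B := (X K ^ M).
Local Notation hom := (@hom F K).
Local Notation slice := (@slice F K).
Local Notation J := (Submission.pinf M_gt0 B).
Local Notation mon := (@mon F K).
Local Notation zt := (@zt F K).
Local Notation pt := (pt K M_gt0).
Local Notation om := (om K M_gt0).
Local Notation WW := (WW K M_gt0).
Local Notation ell := (ell K M).

Definition D12 : K := X K ^ 118 * J ^+ 12.
Definition iv (t : mitem) : K := ival (fun i => pt i.+1%:Z) D12 t.
Definition vl (L : seq mitem) : K := \sum_(t <- L) iv t.

Lemma iv5 t : iv t = ZE K t.1.1 * (zexp (pt 1) (kth t.1.2 0) * (zexp (pt 2) (kth t.1.2 1) *
  (zexp (pt 3) (kth t.1.2 2) * (zexp (pt 4) (kth t.1.2 3) * zexp (pt 5) (kth t.1.2 4))))) *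
  (if t.2 then D12 else 1).
Proof.
rewrite /iv /ival; congr (_ * _ * _).
by rewrite unlock /= mulr1.
Qed.

Lemma iv_mul t u : ~~ (t.2 && u.2) -> iv (mul_item t u) = iv t * iv u.
Proof.
move=> h; have e1 : (mul_item t u).1.1 = Z.mul t.1.1 u.1.1 by [].
have e2 i : (i < 5)%N -> kth (mul_item t u).1.2 i = Z.add (kth t.1.2 i) (kth u.1.2 i).
  by case: i => [|[|[|[|[|i]]]]].
have e3 : (mul_item t u).2 = t.2 || u.2 by [].
rewrite !iv5 e1 e3 !e2 // ZEM.
have [q1 q2 q3 q4 q5] : [/\ pt 1 != 0, pt 2 != 0, pt 3 != 0, pt 4 != 0 & pt 5 != 0].
  by split; apply: (pt_neq0 K M_gt0 ME).
rewrite !zexpD //; have -> : (if t.2 || u.2 then D12 else 1) = (if t.2 then D12 else 1) * (if u.2 then D12 else 1).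
  by move: h; case: (t.2); case: (u.2); rewrite ?mul1r ?mulr1.
by ring.
Qed.

Lemma vl_cat L L' : vl (L ++ L') = vl L + vl L'. Proof. by rewrite /vl big_cat. Qed.

Lemma vl_nil : vl [::] = 0. Proof. by rewrite /vl big_nil. Qed.

Lemma vl_cons t L : vl (t :: L) = iv t + vl L. Proof. by rewrite /vl big_cons. Qed.

Lemma vl_mul L L' : all (fun t : mitem => ~~ t.2) L -> vl (mul_list L L') = vl L * vl L'.
Proof.
move=> hL; rewrite /vl big_allpairs_dep /= big_distrl big_seq [RHS]big_seq.
apply: eq_bigr => t ht; rewrite big_distrr /=; apply: eq_bigr => u _.
by rewrite iv_mul // negb_and (allP hL _ ht).
Qed.

Lemma iv_scale z t : iv (Z.mul z t.1.1, t.1.2, t.2) = ZE K z * iv t.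
Proof. by rewrite !iv5 /= ZEM -!mulrA. Qed.

Lemma vl_scale z L : vl (scale_list z L) = ZE K z * vl L.
Proof. by rewrite /vl big_map big_distrr; apply: eq_bigr => t _; rewrite iv_scale. Qed.

Lemma vl_insert t L : vl (insert_item t L) = iv t + vl L.
Proof.
elim: L => [|u L IHL] /=; first by rewrite vl_cons.
case: ifP => [/andP [/eqP e1 /eqP e2]|_]; rewrite !vl_cons ?IHL; last by rewrite addrCA.
rewrite addrA; congr (_ + _); rewrite !iv5 e1 e2 -[(_, _, _).1.1]/(Z.add t.1.1 u.1.1).
by rewrite -[(_, _, _).1.2]/(u.1.2) -[(_, _, _).2]/(u.2) ZED -!mulrDl.
Qed.

Lemma vl_collect L : vl (collect L) = vl L.
Proof.
have e : vl (foldr insert_item [::] L) = vl L.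
  by elim: L => //= t L IHL; rewrite vl_insert IHL vl_cons.
rewrite -e /collect; elim: (foldr _ _ _) => //= t L' IHL; case: Z.eqb_spec => [h|_] /=.
  by rewrite IHL vl_cons iv5 h /ZE rmorph0 !mul0r add0r.
by rewrite !vl_cons IHL.
Qed.

Lemma vl_grade L : vl L = \sum_(0 <= g < 11) vl (grade_part g L).
Proof.
elim: L => [|t L IHL]; first by rewrite big1 ?vl_nil // => g _; rewrite /grade_part vl_nil.
have hg : (item_grade t < 11)%N.
  rewrite /item_grade; set z := (_ + _)%ZZ; have := Z.mod_pos_bound z 11 erefl; lia.
rewrite vl_cons IHL.
have -> : iv t = \sum_(0 <= g < 11) (if item_grade t == g then iv t else 0).
  rewrite (bigD1_seq (item_grade t)) ?mem_iota ?iota_uniq //= eqxx big1 ?addr0 // => g ng.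
  by rewrite eq_sym (negPf ng).
rewrite -big_split; apply: eq_bigr => g _ /=; case: ifP => _; first by rewrite vl_cons.
by rewrite add0r.
Qed.

Lemma iv_unit (z : Z) (i : nat) (e : Z) : (0 < i < 6)%N ->
  iv (z, [seq if j.+1 == i then e else 0%ZZ | j <- iota 0 5], false) = ZE K z * zexp (pt i%:Z) e.
Proof.
move=> hi; rewrite iv5 mulr1; congr (_ * _).
have z0 (x : K) : zexp x 0 = 1 by rewrite /zexp expr0z.
by case: i hi => [|[|[|[|[|[|i]]]]]] // _; rewrite /kth /= !z0 ?mul1r ?mulr1.
Qed.

Lemma ival_var n (e : Z) : ~~ (11 %| n)%Z -> e = 1%ZZ \/ e = (-1)%ZZ -> iv (var_item n e) = zexp (pt n) e.
Proof.
move=> hn he; have := divz_eq n 11; rewrite /var_item /reduce_index.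
have : 0 < (n %% 11)%Z < 11 by lia.
case: (n %% 11)%Z => // r hr nE; rewrite absz_nat.
have ptE : pt n = pt r%:Z by rewrite nE addrC mulrC (ptM11 K M_gt0 ME).
case: leqP => h /=; first by rewrite iv_unit ?mul1r ?ptE //; lia.
have ptO : pt n = - pt (11 - r)%N%:Z.
  by rewrite -ptN ptE -[RHS](ptM11 K M_gt0 ME _ 1); congr pt; lia.
rewrite iv_unit ?ptO; last by lia.
have -> : ZE K (-1)%ZZ = - 1 by [].
by case: he => ->; rewrite mulN1r /zexp ?expr1z // !exprN1 invrN.
Qed.

Lemma vl_seq1 t : vl [:: t] = iv t. Proof. by rewrite vl_cons vl_nil addr0. Qed.

Lemma iv_one : iv one_item = 1.
Proof. by rewrite iv5 /one_item /kth /= /zexp !expr0z /ZE !mulr1. Qed.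

Lemma iv_monomial num den : all (fun n : int => ~~ (11 %| n)%Z) (num ++ den) ->
  iv (monomial num den) = (\prod_(n <- num) pt n) / \prod_(n <- den) pt n.
Proof.
move=> h; rewrite /monomial; have nj s e : all (fun t : mitem => ~~ t.2) [seq var_item n e | n <- s].
  by rewrite all_map; apply/allP.
have fE L : all (fun t : mitem => ~~ t.2) L -> iv (foldr mul_item one_item L) = \prod_(t <- L) iv t.
  elim: L => [|t L IHL] /= h'; first by rewrite big_nil iv_one.
  by case/andP: h' => tj hL; rewrite big_cons -IHL // iv_mul // negb_and tj.
rewrite fE; last by rewrite all_cat !nj.
rewrite big_cat !big_map /=; move: h; rewrite all_cat => /andP [/allP h1 /allP h2]; congr (_ * _).
  rewrite big_seq [RHS]big_seq; apply: eq_bigr => n hn; rewrite ival_var ?h1 //.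
  by left.
rewrite -prodfV big_seq [RHS]big_seq; apply: eq_bigr => n hn; rewrite ival_var ?h2 //.
by right.
Qed.

Lemma hom_zexp c z k : hom c z -> hom (c * int_of_Z k) (zexp z k).
Proof. exact: homX. Qed.

Lemma slice_J : slice 0 0 J.
Proof.
apply: conv_slice (pinfP M_gt0 B) => L; rewrite /poch.
apply: (big_ind (slice 0 0)) => [|a b ha hb|i _]; first exact: slice1.
  by have := sliceM ha hb; rewrite !addr0.
apply: sliceD; first exact: slice1.
rewrite -exprS -XB; apply: sliceN; apply: slice_X; rewrite ME; lia.
Qed.

Lemma hom_J : hom 0 J. Proof. exact: (slice_hom slice_J). Qed.

Lemma class_pt a : (22 %| 0 + (a * (a - 11) + 30) - (12 * a ^+ 2 + 8))%Z.
Proof.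
have e := triE (a + 1).
have -> : 0 + (a * (a - 11) + 30) - (12 * a ^+ 2 + 8) = 22 * (1 - tri (a + 1)); last exact: dvdz_mulr.
by transitivity (22 - 11 * (2 * tri (a + 1))); [rewrite e; ring | ring].
Qed.

Lemma slice_gt a k : slice 0 (a * (a - 11) + 30) (gt K (a + 11 * k)).
Proof.
apply: slice_mon.
  by move: (a + 11 * k) => n; have [le|le] := lerP n 5; nia.
have -> : (a + 11 * k) * (a + 11 * k - 11) + 30 - 0 - (a * (a - 11) + 30) = 22 * (a * k + 11 * tri k).
  by transitivity (22 * (a * k) + 121 * (2 * tri k)); [rewrite triE; ring | ring].
exact: dvdz_mulr.
Qed.

Lemma hom_pt a : hom (12 * a ^+ 2 + 8) (pt a).
Proof.
have [_ h] := pt_series K M_gt0 ME a.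
apply: (hom_eqc _ (slice_hom (hassum_slice (N := 0) (c := a * (a - 11) + 30) _ h))); first exact: class_pt.
by move=> k; exact: slice_gt.
Qed.

Lemma hom_D12 : hom 118 D12.
Proof. by have := homM (hom_X K 118) (homX_nat 12 hom_J); rewrite mul0r addr0. Qed.

Lemma hom_iv t : hom (12 * (item_grade t)%:Z + 8 * int_of_Z (item_deg t)) (iv t).
Proof.
have hz : hom 0 (ZE K t.1.1) := hom_int K _.
have hD : hom (if t.2 then 118 else 0) (if t.2 then D12 else 1).
  by case: (t.2); [exact: hom_D12 | exact: (hom_nat K 1)].
have h := homM (homM hz (homM (hom_zexp (kth t.1.2 0) (hom_pt 1)) (homM (hom_zexp (kth t.1.2 1) (hom_pt 2))
  (homM (hom_zexp (kth t.1.2 2) (hom_pt 3)) (homM (hom_zexp (kth t.1.2 3) (hom_pt 4))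
  (hom_zexp (kth t.1.2 4) (hom_pt 5))))))) hD.
rewrite iv5; apply: hom_eqc h; rewrite /item_grade /item_deg.
set z := (kth _ 0 + 4 * _ + _ + _ + _)%ZZ; have := Z.mod_pos_bound z 11 erefl.
have := Z.div_mod z 11 (fun e => match e with end).
move: (Z.modulo z 11) (Z.div z 11) => m q; rewrite /z.
move: (kth _ 0) (kth _ 1) (kth _ 2) (kth _ 3) (kth _ 4) => k1 k2 k3 k4 k5 {z}.
by case: (t.2); lia.
Qed.

Lemma hom_vl (g : nat) (d : Z) L : all (fun t => item_deg t == d) L ->
  hom (12 * g%:Z + 8 * int_of_Z d) (vl (grade_part g L)).
Proof.
move=> /allP h; rewrite /vl /grade_part big_filter big_seq_cond; apply: hom_sum => t /andP [ht /eqP <-].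
by rewrite -(eqP (h t ht)); exact: hom_iv.
Qed.

(** The eleven classes $12g+2d$ are distinct modulo 22, so this is [hom_indep] after reindexing. *)
Lemma hom_indep11 d (w : nat -> K) : (forall g, (g < 11)%N -> hom (12 * g%:Z + 2 * d) (w g)) ->
  \sum_(0 <= g < 11) w g = 0 -> forall g, (g < 11)%N -> w g = 0.
Proof.
move=> hw hs g hg; pose cl (i : nat) := absz ((12 * i%:Z + 2 * d) %% 22)%Z.
have clP i : (cl i < 22)%N by rewrite /cl; lia.
have clI i j : (i < 11)%N -> (j < 11)%N -> cl i = cl j -> i = j by rewrite /cl; lia.
pose z (r : nat) : K := \sum_(0 <= i < 11 | cl i == r) w i.
have hz r : (r < 22)%N -> hom r%:Z (z r).
  move=> hr; rewrite /z big_nat_cond; apply: hom_sum => i /andP [hi /eqP e].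
  by apply: hom_eqc (hw i hi); rewrite -e /cl; lia.
have zs : \sum_(0 <= r < 22) z r = 0.
  transitivity (\sum_(0 <= i < 11) w i); last exact: hs.
  rewrite /z (exchange_big_dep_nat xpredT) //=; apply: eq_big_nat => i hi.
  by rewrite sum_pick.
have := hom_indep hz zs (clP g); suff -> : z (cl g) = w g by [].
rewrite /z -[RHS](sum_pick (w g) hg) big_nat_cond [RHS]big_nat_cond.
apply: eq_big => [i|i /andP [hi /eqP e]]; last by rewrite (clI i g).
case hi: (0 <= i < 11)%N => //=; apply/eqP/eqP => [/clI h|-> //].
by rewrite h.
Qed.

Lemma vl_listW : vl listW = WW.
Proof.
rewrite /listW vl_cons iv_one /Submission.WW; congr (_ + _); rewrite sum5 /=.
by rewrite !vl_cons vl_nil addr0 !iv_monomial //= !big_cons !big_nil !mulr1 /Submission.om.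
Qed.

Lemma listW_nj : all (fun t : mitem => ~~ t.2) listW. Proof. by vm_compute. Qed.

Lemma vl_listW3 : vl listW3 = WW ^+ 3.
Proof. by rewrite /listW3 vl_collect vl_mul ?listW_nj // vl_collect vl_mul ?listW_nj // !vl_listW. Qed.

Lemma listW3_deg : all (fun t => item_deg t == 0%ZZ) listW3. Proof. by vm_compute. Qed.

Definition W3 (n : int) : K := vl (grade_part (residue (n ^+ 2)) listW3).

Lemma hom_ellpt a : ~~ (11 %| a)%Z -> hom (12 * a ^+ 2 + 8) (ell a * pt a).
Proof.
move=> ha; have h := pd_series K M_gt0 ME ha.
apply: (hom_eqc _ (slice_hom (hassum_slice (N := 0) (c := a * (a - 11) + 30) _ h))); first exact: class_pt.
move=> k; have := sliceM (slice_int K (2 * (a + 11 * k) - 11)) (slice_gt a k).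
by rewrite !add0r.
Qed.

(** In [cube_dissection] the squares of 1 to 5 are distinct and nonzero modulo 11, so each product
    [ell a * pt a] is alone in its class and equals the part of $W^3$ there; the remaining $J^3$
    term lies in class 0. *)
Lemma ellpt_small (a : nat) : (0 < a < 6)%N -> ell a%:Z * pt a%:Z = X K ^ 30 * J ^+ 3 * W3 a%:Z.
Proof.
move=> ha; have K2 := K_nat_neq0 K two0.
pose w (g : nat) : K := (X K ^ 30 * J ^+ 3 * vl (grade_part g listW3)) *+ 2 +
  (if g == 0%N then 22%:R * (X K ^ 30 * J ^+ 3) else 0) -
  \sum_(1 <= i < 6 | residue (i%:Z ^+ 2) == g) (ell i%:Z * pt i%:Z) *+ 2.
have h3 : hom 30 (X K ^ 30 * J ^+ 3).
  by have := homM (hom_X K 30) (homX_nat 3 hom_J); rewrite mul0r addr0.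
have h2 c z : hom c z -> hom c (z *+ 2) by move=> h; rewrite mulr2n; exact: homD.
have hw g : (g < 11)%N -> hom (12 * g%:Z + 2 * 4) (w g).
  move=> hg; apply: homD; first apply: homD.
  - apply: h2; apply: hom_eqc (homM h3 (hom_vl g listW3_deg)); rewrite /=; lia.
  - case: eqP => [->|_]; last exact: hom0.
    by apply: hom_eqc (homM (hom_nat K 22) h3).
  apply: homN; rewrite big_nat_cond; apply: hom_sum => i /andP [hi /eqP e]; apply: h2.
  by apply: hom_eqc (hom_ellpt (_ : ~~ (11 %| i%:Z)%Z)); rewrite -?e /residue; lia.
have ws : \sum_(0 <= g < 11) w g = 0.
  rewrite /w sum_classes => [|i hi]; last by rewrite /residue; lia.
  by rewrite -big_distrr -vl_grade vl_listW3 cube_dissection // addrAC addrK addNr.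
have hr : (residue (a%:Z ^+ 2) < 11)%N by rewrite /residue; lia.
have := hom_indep11 hw ws hr; rewrite /w /W3.
have -> : (residue (a%:Z ^+ 2) == 0%N) = false.
  by move: (a) ha => b; rewrite /residue; case: b => [|[|[|[|[|[|]]]]]].
have inj i : (0 < i < 6)%N -> (residue (i%:Z ^+ 2) == residue (a%:Z ^+ 2)) = (a == i).
  by move: (a) ha => b; rewrite /residue; case: b => [|[|[|[|[|[|]]]]]] //; case: i => [|[|[|[|[|[|]]]]]].
rewrite addr0 big_nat_cond (eq_bigl (fun i => (0 < i < 6)%N && (a == i))); last first.
  by move=> i; case hi: (0 < i < 6)%N => //=; rewrite inj.
rewrite -big_nat_cond.
have -> : \sum_(1 <= i < 6 | a == i) (ell i%:Z * pt i%:Z) *+ 2 = (ell a%:Z * pt a%:Z) *+ 2.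
  rewrite big_mkcond (bigD1_seq a) ?iota_uniq ?mem_iota //= eqxx big1 ?addr0 // => i.
  by rewrite eq_sym => /negPf ->.
by move=> /eqP; rewrite subr_eq0 -mulr_natr -[X in _ == X]mulr_natr => /eqP /(mulIf K2).
Qed.

Lemma ellpt_refl a : ~~ (11 %| a)%Z -> ell (11 - a) * pt (11 - a) = ell a * pt a.
Proof.
move=> ha; have e : 11 - a = - a + 11 by ring.
by rewrite e ptD11 // ellD11 // ?ellN ?ptN ?mulrNN //; lia.
Qed.

Lemma ellpt_add a : ~~ (11 %| a)%Z -> ell (a + 11) * pt (a + 11) = ell a * pt a.
Proof. by move=> ha; rewrite ptD11 // ellD11. Qed.

(** The list consists of [c] and [2 * c] for [c] in [multipliers], the arguments occurring in
    [Gt]. *)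
Lemma ellptE a : a \in [:: 1; 2; 4; 5; 8; 9; 10; 16; 18] ->
  ell a * pt a = X K ^ 30 * J ^+ 3 * W3 a.
Proof.
rewrite !inE => /or4P [/eqP ->|/eqP ->|/eqP ->|]; [exact: (@ellpt_small 1)|exact: (@ellpt_small 2)|exact: (@ellpt_small 4)|].
move=> /or4P [/eqP ->|/eqP ->|/eqP ->|].
- exact: (@ellpt_small 5).
- by rewrite (ellpt_refl (isT : ~~ (11 %| 3)%Z)) (@ellpt_small 3).
- by rewrite (ellpt_refl (isT : ~~ (11 %| 2)%Z)) (@ellpt_small 2).
move=> /or3P [] /eqP ->.
- by rewrite (ellpt_refl (isT : ~~ (11 %| 1)%Z)) (@ellpt_small 1).
- by rewrite (ellpt_add (isT : ~~ (11 %| 5)%Z)) (@ellpt_small 5).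
rewrite (ellpt_add (isT : ~~ (11 %| 7)%Z)) (ellpt_refl (isT : ~~ (11 %| 4)%Z)).
by rewrite (@ellpt_small 4).
Qed.

Definition crv_r := par_r (pt 1) (pt 2) (pt 4) (pt 5).
Definition crv_s := par_s (pt 1) (pt 2) (pt 3).
Definition crv_del := par_del (pt 1) (pt 2).

Lemma pt_reflect a : pt (11 - a) = - pt a.
Proof. by rewrite -ptN -[RHS](ptD11 K M_gt0 ME); congr pt; ring. Qed.

(** Instances of [pt_plucker] with [d = 0], the indices 6 and 7 being folded back by reflection;
    they are the input of the parametrization. *)
Lemma pt_relations :
  [/\ pt 3 ^+ 3 * pt 1 - pt 2 ^+ 3 * pt 4 + pt 1 ^+ 3 * pt 5 = 0,
     pt 4 ^+ 2 * pt 3 * pt 1 - pt 2 ^+ 2 * pt 5 * pt 3 - pt 1 ^+ 2 * pt 5 * pt 2 = 0 &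
     pt 4 ^+ 3 * pt 2 - pt 3 ^+ 3 * pt 5 - pt 1 ^+ 3 * pt 4 = 0].
Proof.
have p6 : pt 6 = - pt 5 := pt_reflect 5; have p7 : pt 7 = - pt 4 := pt_reflect 4.
split.
- by rewrite -(pt_plucker K M_gt0 ME (a := 3) (b := 2) (c := 1) 0) //; ring.
- have h : pt 4 * pt 4 * (pt 3 * pt 1) - pt 2 * pt 2 * (pt 5 * pt 3) + pt 1 * pt 1 * (pt 6 * pt 2) = 0
    := @pt_plucker F K M M_gt0 ME 4 2 1 0 isT isT isT.
  by rewrite -h p6; ring.
have h : pt 4 * pt 4 * (pt 4 * pt 2) - pt 3 * pt 3 * (pt 5 * pt 3) + pt 1 * pt 1 * (pt 7 * pt 1) = 0
  := @pt_plucker F K M M_gt0 ME 4 3 1 0 isT isT isT.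
by rewrite -h p7; ring.
Qed.

Lemma curve_check_vl L : curve_check L -> vl L = 0.
Proof.
have n i : ~~ (11 %| i)%Z -> pt i != 0 by exact: (pt_neq0 K M_gt0 ME).
have [n1 n2 n3 n4 n5] := And5 (n 1 isT) (n 2 isT) (n 3 isT) (n 4 isT) (n 5 isT).
have [R1 R2 R3] := pt_relations.
have [d0 r0 s0 u0 v0] := par_neq0 n1 n2 n3 n4 n5 R1 R2.
have cv := par_curve n2 n3 n4 n5 R1 R2 R3.
have p2E : pt 2 = - (crv_del * pt 1) by rewrite /crv_del /par_del mulNr opprK divfK.
have p3E := par_p3 n1 n2 n3; have p4E := par_p4 n1 n2 n3 n4 n5 R2; have p5E := par_p5 n1 n2 n3 n4 n5 R2.
have d11 := par_del11 n1 n2 n3 n4 n5 R1 R2.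
have [e1 [e2 [e3 [he hd]]]] := disc_relation K M_gt0 ME two0.
have p6 : pt 6 ^+ 2 = pt 5 ^+ 2 by rewrite (pt_reflect 5) sqrrN.
have h1 : (ratio K M_gt0 1 - e1) * (ratio K M_gt0 1 - e2) * (ratio K M_gt0 1 - e3) =
    - (pt 2 ^+ 2 / (4%:R * pt 1 ^+ 8)) := he 1 isT.
have h2 : (pt 3 * pt 1 / (pt 2 ^+ 2 * pt 1 ^+ 2) - e1) * (pt 3 * pt 1 / (pt 2 ^+ 2 * pt 1 ^+ 2) - e2) *
    (pt 3 * pt 1 / (pt 2 ^+ 2 * pt 1 ^+ 2) - e3) = - (pt 4 ^+ 2 / (4%:R * pt 2 ^+ 8)) := he 2 isT.
have h3 : (pt 4 * pt 2 / (pt 3 ^+ 2 * pt 1 ^+ 2) - e1) * (pt 4 * pt 2 / (pt 3 ^+ 2 * pt 1 ^+ 2) - e2) *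
    (pt 4 * pt 2 / (pt 3 ^+ 2 * pt 1 ^+ 2) - e3) = - (pt 6 ^+ 2 / (4%:R * pt 3 ^+ 8)) := he 3 isT.
rewrite p6 in h3.
rewrite /ratio subrr pt0 mulr0 mul0r in h1.
move: d0 r0 s0 u0 v0 cv p2E p3E p4E p5E d11; rewrite -/crv_del -/crv_r -/crv_s.
move: crv_del crv_r crv_s => d r s d0 r0 s0 u0 v0 cv p2E p3E p4E p5E d11.
have dE : pt 1 ^+ 12 * r = d ^+ 4 * disc_factor r s * D12.
  apply: (two_division_disc (K_nat_neq0 K two0) n1 d0 r0 s0 u0 v0 d11 _ _ _ hd).
  - by rewrite -p2E.
  - by rewrite -p2E -p3E -p4E.
  by rewrite -p2E -p3E -p4E -p5E.
(* Nonvanishing comes for free from the discriminant relation, whose other side is a product of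
   nonzero theta values. *)
have D0 : disc_factor r s != 0.
  have : pt 1 ^+ 12 * r != 0 by rewrite mulf_neq0 ?expf_neq0.
  by rewrite dE; apply: contraNneq => ->; rewrite mulr0 mul0r.
move=> hL; exact: (curve_check_sound cv (p := fun i => pt i.+1%:Z) n1 d0 r0 s0 u0 v0 erefl p2E p3E p4E p5E d11 dE D0 hL).
Qed.

Definition listG1 (c : int) := mul_list (grade_part (residue (c ^+ 2)) listW3) [:: monomial [::] [:: c]].
Definition listG3 (c : int) : seq mitem :=
  [seq monomial [:: c * a%:Z; 2 * (c * a%:Z)] [:: c - c * a%:Z; c; c + c * a%:Z] | a <- iota 2 4].

Lemma vl_listG c : vl (listG c) = vl (listG1 c) + (vl (listG1 (2 * c)) + ZE K 22 * vl (listG3 c)).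
Proof.
rewrite -vl_scale -!vl_cat -[RHS]vl_collect; congr vl.
Qed.

Lemma gradeW3_nj n : all (fun t : mitem => ~~ t.2) (grade_part (residue n) listW3).
Proof.
have nj : all (fun g => all (fun t : mitem => ~~ t.2) (grade_part g listW3)) (iota 0 11) by vm_compute.
by have /allP := nj; apply; rewrite mem_iota /residue; lia.
Qed.

Opaque listW3 listR listM listT.

Lemma vl_listG1 c : ~~ (11 %| c)%Z -> vl (listG1 c) = W3 c / pt c.
Proof.
move=> hc; rewrite /listG1 vl_mul ?gradeW3_nj // vl_seq1 iv_monomial /= ?hc //.
by rewrite big_nil big_cons big_nil mulr1 div1r.
Qed.

Lemma iv_nj_basis c : c \in multipliers -> vl (listG c) = WW * (vl (listT c) + vl (listM c)).
Proof.
move=> hc; have h0 : vl (listZ c) = 0.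
  rewrite vl_grade big1_seq // => g; rewrite mem_iota => /andP [_ hg].
  have /allP /(_ _ hc) /allP := check_rank_true.
  by move=> /(_ g); rewrite mem_iota => /(_ hg) /curve_check_vl.
move: h0; rewrite /listZ vl_collect vl_cat vl_scale vl_mul ?listW_nj // vl_listW vl_cat.
by have -> : ZE K (-1)%ZZ = - 1 by []; move=> /eqP; rewrite mulN1r subr_eq0 => /eqP.
Qed.

Theorem Gt_factor c : c \in multipliers ->
  Gt K M_gt0 c = X K ^ 30 * J ^+ 3 * WW * (vl (listT c) + vl (listM c)).
Proof.
move=> hc.
have [n1 n2] : ~~ (11 %| c)%Z /\ ~~ (11 %| 2 * c)%Z.
  by move: hc; rewrite !inE => /or4P [/eqP ->|/eqP ->|/eqP ->|/orP [] /eqP ->].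
have [m1 m2] : c \in [:: 1; 2; 4; 5; 8; 9; 10; 16; 18] /\ 2 * c \in [:: 1; 2; 4; 5; 8; 9; 10; 16; 18].
  by move: hc; rewrite !inE => /or4P [/eqP ->|/eqP ->|/eqP ->|/orP [] /eqP ->].
transitivity (X K ^ 30 * J ^+ 3 * vl (listG c)); last by rewrite (iv_nj_basis hc) [LHS]mulrA.
rewrite vl_listG (vl_listG1 n1) (vl_listG1 n2).
have -> : ZE K 22 = 22%:R by [].
have e (a : int) : ~~ (11 %| a)%Z -> a \in [:: 1; 2; 4; 5; 8; 9; 10; 16; 18] ->
    ell a = X K ^ 30 * J ^+ 3 * (W3 a / pt a).
  by move=> ha ha'; rewrite mulrA -(ellptE ha') mulfK // (pt_neq0 K M_gt0 ME).
rewrite /Gt (e c n1 m1) (e (2 * c) n2 m2).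
have vE (a : nat) : (1 < a < 6)%N -> Vt K M_gt0 c (c * a%:Z) = X K ^ 30 * J ^+ 3 *
    iv (monomial [:: c * a%:Z; 2 * (c * a%:Z)] [:: c - c * a%:Z; c; c + c * a%:Z]).
  move=> ha; rewrite iv_monomial.
    by rewrite !big_cons !big_nil !mulr1 /Vt !mulrA.
  by rewrite /=; move: hc; rewrite !inE => /or4P [/eqP ->|/eqP ->|/eqP ->|/orP [] /eqP ->];
     case: a ha => [|[|[|[|[|[|]]]]]].
have -> : \sum_(2 <= a < 6) Vt K M_gt0 c (c * a%:Z) = X K ^ 30 * J ^+ 3 * vl (listG3 c).
  rewrite /vl /listG3 big_map big_distrr /=; apply: eq_big_seq => a.
  by rewrite mem_iota => ha; exact: vE.
by ring.
Qed.

End Values.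

(** * Partitions as lists *)

Definition ispart (s : seq nat) : bool := sorted geq s && all (leq 1) s.

Lemma geq_trans : transitive geq. Proof. by move=> y x z h1 h2; apply: leq_trans h2 h1. Qed.

Lemma ispart_cons a s : ispart (a :: s) = [&& (0 < a)%N, all (geq a) s & ispart s].
Proof.
rewrite /ispart /= (path_sortedE geq_trans).
by case: (0 < a)%N; rewrite ?andbF //= -!andbA.
Qed.

Lemma sorted_pad s : sorted geq s ->
  s = filter (fun k => 0 < k)%N s ++ nseq (size s - size (filter (fun k => 0 < k)%N s)) 0%N.
Proof.
elim: s => [|a s IHs] // hp; have hs := path_sorted hp; rewrite [filter _ (a :: s)]/=.
case: (posnP a) => [a0|a1]; last by rewrite [size (_ :: _)]/= [size (_ :: _)]/= subSS cat_cons -IHs.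
have z : s = nseq (size s) 0%N.
  by apply/all_pred1P; move: hp; rewrite a0 /sorted (path_sortedE geq_trans) => /andP [h _];
     apply: sub_all h => x /=; rewrite leqn0.
have f0 : [seq k <- s | (0 < k)%N] = [::] by rewrite z filter_nseq.
by rewrite a0 /= f0 [size [::]]/= subn0 /= -z.
Qed.

Lemma pseq_inj n (t u : n.-tuple 'I_n.+1) : is_ptuple t -> is_ptuple u -> pseq t = pseq u -> t = u.
Proof.
move=> /andP [ht _] /andP [hu _] e; apply/val_inj/(inj_map val_inj); rewrite -!/(tseq _).
by rewrite (sorted_pad ht) (sorted_pad hu) -!/(pseq _) e !size_map !size_tuple.
Qed.

Lemma ispart_size s : ispart s -> (size s <= sumn s)%N.
Proof. by elim: s => //= a s IHs; rewrite ispart_cons => /and3P [a0 _ /IHs]; lia. Qed.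

Lemma part_le s i : i \in s -> (i <= sumn s)%N.
Proof. by elim: s => //= a s IHs; rewrite inE => /orP [/eqP -> |/IHs]; lia. Qed.

Lemma pseq_part n (t : n.-tuple 'I_n.+1) : is_ptuple t -> ispart (pseq t) && (sumn (pseq t) == n).
Proof.
move=> /andP [hs /eqP hn]; rewrite /ispart (sorted_filter geq_trans) // filter_all.
rewrite -[X in _ == X]hn; apply/eqP; rewrite /pseq; elim: (tseq t) => //= a s IHs.
by case: (posnP a) => [->|a0] /=; rewrite ?IHs.
Qed.

Lemma part_pseq n s : ispart s -> sumn s = n -> exists2 t : n.-tuple 'I_n.+1, is_ptuple t & pseq t = s.
Proof.
move=> hs hn; have sz : (size s <= n)%N by rewrite -hn ispart_size.
pose v := s ++ nseq (n - size s) 0%N.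
have szv : size [seq inord i : 'I_n.+1 | i <- v] == n by rewrite size_map size_cat size_nseq subnKC.
have vE : tseq (Tuple szv) = v.
  rewrite /tseq /= -map_comp -[RHS]map_id; apply/eq_in_map => i hi /=; apply: inordK.
  rewrite ltnS -hn; move: hi; rewrite mem_cat => /orP [/part_le //|]; rewrite mem_nseq => /andP [_ /eqP ->] //.
case/andP: (hs) => hsort hpos; exists (Tuple szv); rewrite /is_ptuple /pseq vE /v.
  rewrite sumn_cat sumn_nseq mul0n addn0 hn eqxx andbT.
  rewrite (sorted_pairwise geq_trans) pairwise_cat -!(sorted_pairwise geq_trans) hsort andTb.
  apply/andP; split; first by apply/allrelP => x y _; rewrite mem_nseq => /andP [_ /eqP ->].
  by elim: (n - size s)%N => //= k; case: k.
by rewrite filter_cat filter_nseq /= cats0; apply/all_filterP.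
Qed.

Definition parts (n : nat) : seq (seq nat) :=
  [seq pseq t | t <- enum [set t : n.-tuple 'I_n.+1 | is_ptuple t]].

Lemma mem_parts n s : (s \in parts n) = ispart s && (sumn s == n).
Proof.
apply/mapP/andP => [[t]|[hs /eqP hn]].
  by rewrite mem_enum inE => /pseq_part /andP [h1 h2] ->.
by have [t ht e] := part_pseq hs hn; exists t; rewrite ?e // mem_enum inE.
Qed.

Lemma uniq_parts n : uniq (parts n).
Proof.
rewrite map_inj_in_uniq ?enum_uniq // => t u; rewrite !mem_enum !inE; exact: pseq_inj.
Qed.

Lemma card_ptuple (P : pred (seq nat)) n :
  #|[set t : n.-tuple 'I_n.+1 | is_ptuple t && P (pseq t)]| = count P (parts n).
Proof.
rewrite count_map -size_filter cardE; apply/perm_size/uniq_perm.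
- exact: enum_uniq.
- exact/filter_uniq/enum_uniq.
by move=> t; rewrite mem_enum [RHS]mem_filter mem_enum !inE andbC.
Qed.

(** * Weighted generating functions of partitions *)

Section GenFun.
Variables (F : fieldType) (K : lfield F).

Definition cst (x : F) : K := liota K (fpsC x).

Lemma cstM x y : cst (x * y) = cst x * cst y.
Proof. by rewrite -rmorphM; congr (liota K _); apply/fpsP => n; rewrite fpsCM /=; case: eqP => // _; rewrite mulr0. Qed.

Lemma cstD x y : cst (x + y) = cst x + cst y.
Proof. by rewrite -rmorphD; congr (liota K _); apply/fpsP => n; rewrite coefsD /=; case: eqP => // _; rewrite addr0. Qed.

Lemma cst1 : cst 1 = 1. Proof. by rewrite -(rmorph1 (liota K)). Qed.

Lemma cst0 : cst 0 = 0.
Proof. by rewrite -(rmorph0 (liota K)); congr (liota K _); apply/fpsP => n /=; case: eqP. Qed.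

Lemma vge_cst x : vge 0 (cst x). Proof. exact: vge_tofrac. Qed.

(** Series in $q=X^2$, hence supported on even exponents. *)
Definition gfun (c : nat -> F) : fps F := Fps (fun n => if odd n then 0 else c n./2).

Definition gfw (w : seq nat -> F) : K := liota K (gfun (fun n => \sum_(s <- parts n) w s)).

Lemma gfunP c d (N : nat) : (forall n, (n < N)%N -> c n = d n) ->
  vge (2 * N%:Z) (liota K (gfun c) - liota K (gfun d)).
Proof.
move=> h; rewrite -rmorphB; apply: (@coef0_vge F K _ (2 * N)%N) => n hn.
by rewrite coefsB /=; case: odd; rewrite ?subrr // h ?subrr //; lia.
Qed.

Lemma gfunD c d : gfun (fun n => c n + d n) = gfun c + gfun d.
Proof. by apply/fpsP => n; rewrite coefsD /=; case: odd; rewrite ?addr0. Qed.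

Lemma gfun_mono (a : F) (n : nat) : liota K (gfun (fun k => if k == n then a else 0)) = cst a * X K ^ (2 * n%:Z).
Proof.
have -> : 2 * n%:Z = (2 * n)%N%:Z by lia.
rewrite XfX -rmorphM mulrC; congr (liota K _); apply/fpsP => k; rewrite coefsXnM /=.
case: leqP => hk; last by case: ifP => // ok; case: eqP => // e; lia.
case: (boolP (odd k)) => ok; first by case: eqP => // e; lia.
by case: eqP => e1; case: eqP => e2 //; lia.
Qed.

Lemma gfw_ext w w' : (forall s, ispart s -> w s = w' s) -> gfw w = gfw w'.
Proof.
move=> h; congr (liota K (gfun _)); apply/funext => n; rewrite big_seq [RHS]big_seq.
by apply: eq_bigr => s; rewrite mem_parts => /andP [/h].
Qed.

Lemma gfwD w w' : gfw (fun s => w s + w' s) = gfw w + gfw w'.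
Proof.
by rewrite -rmorphD -gfunD; congr (liota K (gfun _)); apply/funext => n; rewrite big_split.
Qed.

Lemma gfw0 : gfw (fun=> 0) = 0.
Proof.
rewrite -(rmorph0 (liota K)); congr (liota K _); apply/fpsP => n /=.
by rewrite big1 //; case: odd.
Qed.

Lemma gfw_sum (I : Type) (r : seq I) (w : I -> seq nat -> F) :
  gfw (fun s => \sum_(i <- r) w i s) = \sum_(i <- r) gfw (w i).
Proof.
elim: r => [|i r IHr].
  by rewrite big_nil -gfw0; apply: gfw_ext => s _; rewrite big_nil.
by rewrite big_cons -IHr -gfwD; apply: gfw_ext => s _; rewrite big_cons.
Qed.

Lemma gfwZ a w : gfw (fun s => a * w s) = cst a * gfw w.
Proof.
rewrite -rmorphM; congr (liota K _); apply/fpsP => n; rewrite fpsCM /= -mulr_sumr.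
by case: odd; rewrite ?mulr0.
Qed.

Lemma gfw_nil a : gfw (fun s => if s == [::] then a else 0) = cst a.
Proof.
rewrite -[RHS]mulr1 -[1]/(X K ^ (2 * 0%N%:Z)) -gfun_mono.
congr (liota K (gfun _)); apply/funext => n; case: eqP => [->|hn].
  rewrite (perm_big [:: [::]]) ?big_seq1 ?eqxx //; apply: uniq_perm; rewrite ?uniq_parts // => s.
  rewrite mem_parts inE; case: s => [|b s] //; rewrite ispart_cons /=.
  by case: b => [|b] //; rewrite addSn andbF.
rewrite big_seq big1 // => s; rewrite mem_parts => /andP [_ /eqP hs].
by case: eqP => // e; move: hs hn; rewrite e /= => <-.
Qed.

Lemma gfw_head m w : (0 < m)%N ->
  gfw (fun s => if ohead s == Some m then w (behead s) else 0) =
  X K ^ (2 * m%:Z) * gfw (fun s => if all (geq m) s then w s else 0).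
Proof.
move=> m0; have -> : 2 * m%:Z = (2 * m)%N%:Z by lia.
rewrite XfX -rmorphM; congr (liota K _); apply/fpsP => n; rewrite coefsXnM /=.
case: leqP => hn; last first.
  case: ifP => // on; rewrite big_seq big1 // => s; rewrite mem_parts => /andP [_ /eqP hs].
  case: eqP => // e; case: s e hs => //= b s [->] hs.
  by have := odd_double_half n; rewrite on; lia.
have -> : odd (n - 2 * m) = odd n by rewrite oddB // mul2n odd_double addbF.
have -> : ((n - 2 * m)./2 = n./2 - m)%N by lia.
case: ifP => // on; have hm : (m <= n./2)%N by have := odd_double_half n; lia.
rewrite -!big_mkcond -big_filter -[RHS]big_filter.
rewrite (perm_big [seq m :: s | s <- [seq s <- parts (n./2 - m) | all (geq m) s]]) ?big_map //.
apply: uniq_perm; first exact/filter_uniq/uniq_parts.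
  by rewrite map_inj_uniq ?filter_uniq ?uniq_parts // => x y [].
move=> s; rewrite mem_filter mem_parts; apply/andP/mapP => [[/eqP e /andP [hs /eqP en]]|[s']].
  case: s e hs en => // b s [->]; rewrite ispart_cons => /and3P [_ h1 h2] /= en.
  by exists s => //; rewrite mem_filter h1 mem_parts h2 /=; apply/eqP; lia.
rewrite mem_filter mem_parts => /and3P [h1 h2 /eqP h3] ->; rewrite ispart_cons m0 h1 h2 /= h3 eqxx.
by rewrite subnKC ?eqxx.
Qed.

Lemma gfw_near w w' (N : nat) : (forall s, ispart s -> (sumn s < N)%N -> w s = w' s) ->
  vge (2 * N%:Z) (gfw w - gfw w').
Proof.
move=> h; apply: gfunP => n hn; rewrite big_seq [RHS]big_seq; apply: eq_bigr => s.
by rewrite mem_parts => /andP [hs /eqP e]; apply: h; rewrite ?e.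
Qed.

(** Sorting by a statistic: if [R L] contains its values on all weighted partitions of size below
    [L], the partial sums agree with the full series up to $q^L$. *)
Lemma gfw_stat (I : eqType) (w : seq nat -> F) (st : seq nat -> I) (R : nat -> seq I) :
  (forall L, uniq (R L)) ->
  (forall L s, ispart s -> (sumn s < L)%N -> w s != 0 -> st s \in R L) ->
  conv (fun L => \sum_(r <- R L) gfw (fun s => if st s == r then w s else 0)) (gfw w).
Proof.
move=> hu hst N; exists (absz N) => L le; rewrite -gfw_sum.
have le2 : N <= 2 * L%:Z by lia.
apply: (vgeW le2); apply: gfw_near => s hs hL; rewrite -big_mkcond /=.
have [-> | w0] := eqVneq (w s) 0; first by rewrite big1.
rewrite (big_rem (st s)) ?hst //= eqxx big_seq_cond big1 ?addr0 // => r /andP [hr /eqP e].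
by move: hr; rewrite -e mem_rem_uniqF.
Qed.

Lemma gfw_lim w : conv (fun m => gfw (fun s => if all (geq m) s then w s else 0)) (gfw w).
Proof.
move=> N; exists (absz N) => L le.
have le2 : N <= 2 * L%:Z by lia.
apply: (vgeW le2); apply: gfw_near => s hs hL; case: allP => // h; case: h => i /part_le hi /=; lia.
Qed.

End GenFun.

Lemma part_head s m : ispart s -> all (geq m.+1) s = all (geq m) s || (ohead s == Some m.+1).
Proof.
case: s => [|a s] //; rewrite ispart_cons => /and3P [_ h _] /=.
rewrite -[Some a == _]/(a == m.+1); case: (ltngtP a m.+1) => /= ha; rewrite ?orbF ?orbT.
- rewrite -ltnS ha; have -> : all (geq m.+1) s; last by have -> : all (geq m) s by apply: sub_all h => i /=; lia.
  by apply: sub_all h => i /=; lia.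
- by rewrite leqNgt (ltn_trans (ltnSn m) ha).
by rewrite -ha.
Qed.

Lemma largestE s : ispart s -> largest s = head 0%N s.
Proof.
case: s => [|a s] //; rewrite ispart_cons /largest /= => /and3P [_ h _]; apply/maxn_idPl.
by elim: s h => //= b s IHs /andP [h1 h2]; rewrite geq_max h1 IHs.
Qed.

(** * The rank generating function *)

Section GenFunMul.
Variables (F : fieldType) (K : lfield F).
Local Notation gfw := (gfw K).

Definition leparts (m : nat) (w : seq nat -> F) s := if all (geq m) s then w s else 0.

(** A partition with parts at most [m.+1] either has parts at most [m] or starts with [m.+1]; in the
    second case deleting that part divides the weight by [y]. *)
Lemma gfw_leparts_S w m y : (forall s, ispart (m.+1 :: s) -> w (m.+1 :: s) = y * w s) ->
  gfw (leparts m.+1 w) * (1 - cst K y * X K ^ (2 * m.+1%:Z)) = gfw (leparts m w).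
Proof.
move=> hw; set G := gfw (leparts m.+1 w).
suff e : G = gfw (leparts m w) + X K ^ (2 * m.+1%:Z) * (cst K y * G) by rewrite mulrBr mulr1 {1}e; ring.
rewrite -gfwZ.
have -> : gfw (fun s => y * leparts m.+1 w s) =
  gfw (fun s => if all (geq m.+1) s then y * w s else 0).
  by apply: gfw_ext => s _; rewrite /leparts; case: ifP; rewrite ?mulr0.
rewrite -(gfw_head K (fun s => y * w s)) // -gfwD; apply: gfw_ext => s hs.
rewrite /leparts part_head //; case: s hs => [|a s] hs //=; first by rewrite addr0.
have [e|ne] := eqVneq a m.+1; last by rewrite -[Some a == _]/(a == m.+1) (negPf ne) orbF addr0.
by move: hs; rewrite e => hs; rewrite eqxx ltnn /= add0r hw.
Qed.

Lemma gfw_leparts0 w : gfw (leparts 0 w) = cst K (w [::]).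
Proof.
rewrite -gfw_nil; apply: gfw_ext => s; case: s => [|a s] //; rewrite ispart_cons /leparts /=.
by case: a.
Qed.

Lemma hassum_delta (a : K) : hassum (fun n : int => if n == 0 then a else 0) a.
Proof.
apply: (@conv_near F K (fun=> a)) (conv_cst a); exists 1%N => L hL; rewrite /win.
rewrite (eq_bigr (fun i : nat => if L == i then a else 0)); last first.
  by move=> i _; congr (if _ then _ else _); lia.
by rewrite -big_mkcond sum_pick //; lia.
Qed.

Lemma hassum_vge f (s : K) N : (forall n, vge N (f n)) -> hassum f s -> vge N s.
Proof.
move=> hf; apply: conv_vge; exists 0%N => L _; by apply: vge_sum => i _.
Qed.

End GenFunMul.

Section RankSeries.
Variables (F : fieldType) (K : lfield F).
Local Notation gfw := (gfw K).
Local Notation B := (X K ^ 2).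
Local Notation qq := (pinf two_gt0 B).
Local Notation qbin := (qbin K 2).
Local Notation mon := (@mon F K).
Local Notation zt := (@zt F K).

Definition PF : K := gfw (fun=> 1).

Lemma PF_qq : PF * qq = 1.
Proof.
apply: (conv_uniq (u := fun m => gfw (leparts m (fun=> 1)) * poch 2 B m)).
  by apply: convM (pinfP _ _); apply: gfw_lim.
apply: conv_near (conv_cst 1); exists 0%N => m _; elim: m => [|m IHm].
  by rewrite gfw_leparts0 cst1 poch0 mulr1.
rewrite [LHS]IHm pochS -exprS [poch 2 B m * _]mulrC mulrA; congr (_ * _).
rewrite -(@gfw_leparts_S F K (fun=> 1) m 1) => [|s _]; last by rewrite mulr1.
by rewrite cst1 mul1r -XB.
Qed.

Definition HH k m : K := gfw (fun s => if (size s == k) && all (geq m) s then 1 else 0).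

Lemma HH0 m : HH 0 m = 1.
Proof. by rewrite -[RHS](cst1 K) -gfw_nil; apply: gfw_ext => s _; case: s. Qed.

Lemma HHk0 k : HH k.+1 0 = 0.
Proof.
rewrite -[RHS](gfw0 K); apply: gfw_ext => s; case: s => [|a s] //; rewrite ispart_cons => /and3P [a0 _ _].
by rewrite /= leqNgt a0 andbF.
Qed.

Lemma HHS k m : HH k.+1 m.+1 = HH k.+1 m + B ^+ m.+1 * HH k m.+1.
Proof.
rewrite -XB; have -> : HH k m.+1 = gfw (fun s => if all (geq m.+1) s then (size s == k)%:R else 0).
  by apply: gfw_ext => s _; case: eqP; case: all.
rewrite -(gfw_head K (fun s => (size s == k)%:R)) // -gfwD; apply: gfw_ext => s hs.
rewrite part_head //; case: s hs => [|a s] hs /=; first by rewrite addr0.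
rewrite eqSS -[Some a == _]/(a == m.+1).
have [->|ne] := eqVneq a m.+1; last by rewrite orbF addr0.
by rewrite ltnn; case: eqP => _; rewrite /= ?orbT ?add0r ?addr0.
Qed.

(** Taking 1 from each of the [k] parts leaves a partition in a [k] by [m] box, which the Gaussian
    binomial counts; the bound [m.+1] makes this exact. *)
Lemma HHE k m : HH k m.+1 = B ^+ k * qbin (k + m) k.
Proof.
elim: k m => [|k IHk] m; first by rewrite HH0 add0n qbin0 // mulr1.
elim: m => [|m IHm].
  have q1 n : qbin n n = 1.
    by rewrite /qbin leqnn subnn poch0 mulr1 divff //; apply: pochB_neq0.
  by rewrite HHS HHk0 add0r IHk !addn0 !q1 expr1 exprS !mulr1.
have a2 := IHk m.+1; rewrite addSn in IHm; rewrite addnS in a2.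
have h := @qbinS F K 2 two_gt0 (k + m).+1 k (leqW (leq_addr m k)).
have e : ((k + m).+1 - k = m.+1)%N by lia.
rewrite HHS IHm a2 addSn addnS h e !exprS.
by move: (qbin _ _) (qbin _ _) => u v; ring.
Qed.

Lemma qbin_sym n k : (k <= n)%N -> qbin n (n - k) = qbin n k.
Proof. by move=> h; rewrite /qbin leq_subr h subKn // [poch _ _ (n - k) * _]mulrC. Qed.

Lemma qbin_out n k : (n < k)%N -> qbin n k = 0.
Proof. by rewrite /qbin ltnNge => /negPf ->. Qed.

Lemma qbinSr n k : (k <= n)%N -> qbin n.+1 k.+1 = qbin n k + B ^+ k.+1 * qbin n k.+1.
Proof.
rewrite leq_eqVlt => /orP [/eqP <-|lt].
  by rewrite (qbin_out (ltnSn k)) mulr0 addr0 -(qbin_sym (leqnn _)) -(qbin_sym (leqnn k)) !subnn !qbin0.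
have e : qbin n.+1 (n - k) = qbin n.+1 k.+1 by apply: (@qbin_sym n.+1 k.+1); rewrite ltnS ltnW.
rewrite -e; have -> : (n - k = (n - k.+1).+1)%N by lia.
rewrite (@qbinS F K 2 two_gt0); last by lia.
have -> : ((n - k.+1).+1 = n - k)%N by lia.
rewrite (@qbin_sym n k) ?(ltnW lt) // (@qbin_sym n k.+1) //.
by have -> : (n - (n - k.+1) = k.+1)%N by lia.
Qed.

Lemma gf_head_size m k :
  gfw (fun s => if (ohead s == Some m.+1) && (size s == k.+1) then 1 else 0) =
  B ^+ (m.+1 + k) * qbin (k + m) k.
Proof.
transitivity (X K ^ (2 * m.+1%:Z) * HH k m.+1); last by rewrite HHE XB mulrA -exprD.
have -> : HH k m.+1 = gfw (fun s => if all (geq m.+1) s then (size s == k)%:R else 0).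
  by apply: gfw_ext => s _; case: eqP; case: all.
rewrite -(gfw_head K (fun s => (size s == k)%:R)) //; apply: gfw_ext => s _.
by case: s => [|a s] //=; rewrite eqSS; case: eqP; case: eqP.
Qed.

Definition Nr (r : int) : K := gfw (fun s => if (s != [::]) && (rank s == r) then 1 else 0).

Lemma rank_cons a s : ispart (a :: s) -> rank (a :: s) = a%:Z - (size s).+1%:Z.
Proof. by move=> h; rewrite /rank (largestE h). Qed.

(** Rank [r] is sorted by the number [l.+1] of parts, rank [- r] by the largest part [l.+1]. Both
    give the same series, so the conjugation symmetry needs no bijection. *)
Lemma NrP (r : nat) :
  conv (fun L => \sum_(l <- iota 0 L) B ^+ (l + l + r.+1) * qbin (l + l + r) l) (Nr r%:Z) /\
  conv (fun L => \sum_(l <- iota 0 L) B ^+ (l + l + r.+1) * qbin (l + l + r) l) (Nr (- r%:Z)).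
Proof.
split.
- refine (conv_near _ (@gfw_stat F K nat (fun s => if (s != [::]) && (rank s == r%:Z) then 1 else 0)
    (fun s => (size s).-1) (fun L => iota 0 L) (iota_uniq 0) _)).
    exists 0%N => L _; apply: eq_bigr => l _; symmetry.
    transitivity (B ^+ ((l + r).+1 + l) * qbin (l + (l + r)) l); first by congr (B ^+ _ * qbin _ _); lia.
    rewrite -gf_head_size; apply: gfw_ext => s; case: s => [|a s] hs; first by rewrite /= if_same.
    rewrite (rank_cons hs) /= eqSS -[Some a == _]/(a == (l + r).+1).
    case: (size s =P l) => e; rewrite ?andbF //= andbT.
    by congr (if _ then _ else _); lia.
  move=> L s hs hL _; rewrite mem_iota /= add0n; have := ispart_size hs.
  by case: s hs hL => [|a s] /=; case: L => //; lia.
refine (conv_near _ (@gfw_stat F K nat (fun s => if (s != [::]) && (rank s == - r%:Z) then 1 else 0)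
  (fun s => (largest s).-1) (fun L => iota 0 L) (iota_uniq 0) _)).
  exists 0%N => L _; apply: eq_bigr => l _; symmetry.
  transitivity (B ^+ (l.+1 + (l + r)) * qbin (l + r + l) (l + r)).
    have -> : (l + r + l = l + l + r)%N by lia.
    rewrite -(@qbin_sym (l + l + r) l); last by lia.
    by congr (B ^+ _ * qbin _ _); lia.
  rewrite -gf_head_size; apply: gfw_ext => s; case: s => [|a s] hs; first by rewrite /= if_same.
  rewrite (rank_cons hs) (largestE hs) /= eqSS -[Some a == _]/(a == l.+1).
  move: hs; rewrite ispart_cons => /and3P [a0 _ _].
  case: (a =P l.+1) => e; last by rewrite /=; case: eqP => // e2; lia.
  rewrite e eqxx /=; congr (if _ then _ else _); lia.
move=> L s hs hL; case: s hs hL => [|a s] hs hL; first by rewrite eqxx.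
move=> _; rewrite (largestE hs) mem_iota /=; move: hs; rewrite ispart_cons => /and3P [a0 _ _].
move: hL => /=; lia.
Qed.

(** * Recurrences for the partitions of rank at least s *)

Definition aa r L : K := \sum_(l <- iota 0 L) B ^+ l * qbin (l + l + r) l.
Definition bb r L : K := \sum_(l <- iota 0 L) B ^+ (l + l + r.+1) * qbin (l + l + r) l.

Lemma sum_iotaS (G : nat -> K) L :
  \sum_(l <- iota 0 L.+1) G l = \sum_(l <- iota 0 L) G l + G L.
Proof. by rewrite -addn1 iotaD big_cat /= big_seq1 add0n. Qed.

Lemma sum_iota0 (G : nat -> K) : \sum_(l <- iota 0 0) G l = 0. Proof. exact: big_nil. Qed.
Lemma sum_iota1 (G : nat -> K) : \sum_(l <- iota 0 1) G l = G 0%N. Proof. exact: big_seq1. Qed.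

Lemma aaS r L : aa r L.+1 = aa r L + B ^+ L * qbin (L + L + r) L. Proof. exact: sum_iotaS. Qed.
Lemma bbS r L : bb r L.+1 = bb r L + B ^+ (L + L + r.+1) * qbin (L + L + r) L. Proof. exact: sum_iotaS. Qed.

(** The two q-Pascal rules, [qbinS] here and [qbinSr] in [aa_step], express rank series as two
    different combinations of the auxiliary sums [aa]; comparing them yields [AA_const]. *)
Lemma aa_diff r L : aa r.+1 L.+1 - aa r L.+1 = bb r.+2 L.
Proof.
elim: L => [|L IHL]; first by rewrite /aa /bb !sum_iota1 !sum_iota0 !qbin0 // !expr0; ring.
have h := @qbinS F K 2 two_gt0 (L.+1 + L.+1 + r) L ltac:(lia).
rewrite (aaS r.+1 L.+1) (aaS r L.+1) bbS -IHL (_ : (L.+1 + L.+1 + r.+1 = (L.+1 + L.+1 + r).+1)%N); last by lia.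
rewrite h (_ : (L.+1 + L.+1 + r - L = L + r.+2)%N); last by lia.
rewrite (_ : (L + L + r.+2 = L.+1 + L.+1 + r)%N); last by lia.
rewrite (_ : (L + L + r.+3 = L.+1 + (L + r.+2))%N); last by lia.
rewrite (exprD B L.+1 (L + r.+2)); move: (aa _ _) (aa _ _) (qbin _ _) (qbin _ _) => u v w x; ring.
Qed.

Lemma aa_step r L : B ^+ r.+1 * aa r.+1 L.+1 - B ^+ r.+2 * aa r.+2 L = bb r L.+1.
Proof.
elim: L => [|L IHL]; first by rewrite /aa /bb !sum_iota1 !sum_iota0 !qbin0 // expr0 !mulr1 mulr0 subr0.
have h := @qbinSr (L.+1 + L.+1 + r) L ltac:(lia).
rewrite (aaS r.+1 L.+1) (aaS r.+2 L) bbS -IHL (_ : (L.+1 + L.+1 + r.+1 = (L.+1 + L.+1 + r).+1)%N); last by lia.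
rewrite h (_ : (L + L + r.+2 = L.+1 + L.+1 + r)%N); last by lia.
rewrite (_ : ((L.+1 + L.+1 + r).+1 = L.+1 + (L.+1 + r.+1))%N); last by lia.
rewrite !exprD [B ^+ L.+1]exprS [B ^+ r.+2]exprS.
by move: (aa _ _) (aa _ _) (qbin _ _) (qbin _ _) => u v w x; ring.
Qed.

Lemma aa0 L : aa 0 L.+1 = 1 + B * aa 1 L + bb 1 L.
Proof.
elim: L => [|L IHL]; first by rewrite /aa /bb !sum_iota1 !sum_iota0 !qbin0 // !expr0; ring.
have h := @qbinSr (L + L + 1) L ltac:(lia).
have h2 := @qbin_sym (L + L + 1) L.+1 ltac:(lia).
rewrite (_ : (L + L + 1 - L.+1 = L)%N) in h2; last by lia.
rewrite (aaS 0 L.+1) IHL (aaS 1 L) bbS (_ : (L.+1 + L.+1 + 0 = (L + L + 1).+1)%N); last by lia.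
rewrite h -h2 (_ : (L + L + 2 = L.+1 + L.+1)%N); last by lia.
rewrite exprD [B ^+ L.+1]exprS; move: (aa _ _) (bb _ _) (qbin _ _) => u v w; ring.
Qed.

Lemma vge_aaT r l : vge (2 * l%:Z) (B ^+ l * qbin (l + l + r) l).
Proof. by rewrite -[2 * _]addr0 -XB; apply: vgeM (vge_X _ _) (@vge_qbin F K 2 two_gt0 _ _). Qed.

Lemma aa_ex r : exists l, conv (aa r) l.
Proof.
apply: conv_complete => N; exists (absz N) => L le; rewrite /aa sum_iotaS addrAC subrr add0r.
by apply: vgeW (vge_aaT _ _); lia.
Qed.

Definition AA r := projT1 (cid (aa_ex r)).
Lemma AAP r : conv (aa r) (AA r). Proof. exact: projT2 (cid (aa_ex r)). Qed.

Lemma vge_AA r : vge 0 (AA r).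
Proof.
apply: conv_vge (AAP r); exists 0%N => L _; apply: vge_sum => l _; apply: vgeW (vge_aaT r l); lia.
Qed.

Lemma convS u (l : K) : conv u l -> conv (fun L => u L.+1) l.
Proof. by move=> h N; have [L0 hL] := h N; exists L0 => L le; apply: hL; rewrite leqW. Qed.

Lemma AA_diff r : AA r.+1 - AA r = Nr r.+2%:Z.
Proof.
apply: (conv_uniq (u := bb r.+2)); last exact: (NrP _).1.
apply: conv_near (convB (convS (AAP _)) (convS (AAP _))).
by exists 0%N => L _; rewrite aa_diff.
Qed.

Lemma AA_step r : B ^+ r.+1 * AA r.+1 - B ^+ r.+2 * AA r.+2 = Nr r%:Z.
Proof.
apply: (conv_uniq (u := fun L => bb r L.+1)); last exact: convS (NrP _).1.
apply: conv_near (convB (convM (conv_cst _) (convS (AAP _))) (convM (conv_cst _) (AAP _))).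
by exists 0%N => L _; rewrite aa_step.
Qed.

Lemma NrN r : Nr (- r%:Z) = Nr r%:Z.
Proof. exact: conv_uniq (NrP r).2 (NrP r).1. Qed.

Lemma AA0 : AA 0 = 1 + B * AA 1 + Nr 1.
Proof.
apply: (conv_uniq (convS (AAP 0))).
apply: conv_near (convD (convD (conv_cst 1) (convM (conv_cst B) (AAP 1))) (NrP 1).1).
by exists 0%N => L _; rewrite aa0.
Qed.

(** Since consecutive differences are the rank series ([CC_Nr]) and [CC s] tends to 0, this is the
    series of nonempty partitions of rank at least [s]. *)
Definition CC s := B ^+ s.+1 * AA s.+1.

Lemma CC_Nr s : Nr s%:Z = CC s - CC s.+1. Proof. by rewrite -AA_step. Qed.

(** The expression does not depend on [r]: the increments in [AA_diff] and [AA_step] are the same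
    rank series. By [PF_CC] the constant is the partition series. *)
Lemma AA_const r : AA r + B ^+ r.+3 * AA r.+3 = 1 + CC 0 + CC 1.
Proof.
elim: r => [|r IHr]; first by rewrite AA0 -(AA_step 1) /CC expr1; ring.
by rewrite -IHr -[AA r.+1](subrK (AA r)) AA_diff -AA_step; ring.
Qed.

Lemma vge_CC s : vge (2 * s.+1%:Z) (CC s).
Proof. by rewrite -[2 * _]addr0 /CC -XB; apply: vgeM (vge_X _ _) (vge_AA _). Qed.

Lemma PF_CC : PF = 1 + CC 0 + CC 1.
Proof.
have e1 : PF = 1 + gfw (fun s => if s != [::] then 1 else 0).
  by rewrite -[1 in RHS](cst1 K) -gfw_nil -gfwD; apply: gfw_ext => s _; case: eqP => _; rewrite ?addr0 ?add0r.
rewrite e1 -addrA; congr (_ + _).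
pose R L := [seq l%:Z | l <- iota 0 L] ++ [seq - l.+1%:Z | l <- iota 0 L].
have h := @gfw_stat F K _ (fun s => if s != [::] then 1 else 0) rank R _ _.
apply: conv_uniq (h _ _) _ => {h}.
- move=> L; rewrite cat_uniq !map_inj_uniq ?iota_uniq //; try by [move=> x y; lia].
  by rewrite andbT; apply/hasPn => r /mapP [l _ ->]; apply/mapP => -[l' _]; lia.
- move=> L s hs hL _; have h1 := ispart_size hs.
  have h2 : (largest s <= sumn s)%N.
    by rewrite largestE //; case: s {hs hL h1} => //= a s; lia.
  rewrite mem_cat; have [h|h] := lerP 0 (rank s); apply/orP; [left|right]; apply/mapP.
    by exists (absz (rank s)); rewrite ?mem_iota /=; move: h; rewrite /rank; lia.
  by exists (absz (rank s)).-1; rewrite ?mem_iota /=; move: h; rewrite /rank; lia.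
have t L : \sum_(r <- R L) gfw (fun s => if rank s == r then if s != [::] then 1 else 0 else 0) =
   (CC 0 - CC L) + (CC 1 - CC L.+1).
  have -> : \sum_(r <- R L) gfw (fun s => if rank s == r then if s != [::] then 1 else 0 else 0) =
     \sum_(r <- R L) Nr r.
    by apply: eq_bigr => r _; apply: gfw_ext => s _; case: eqP; case: eqP.
  rewrite big_cat !big_map; congr (_ + _).
    elim: L => [|L IHL]; first by rewrite big_nil subrr.
    by rewrite sum_iotaS IHL CC_Nr; ring.
  elim: L => [|L IHL]; first by rewrite big_nil subrr.
  by rewrite sum_iotaS IHL NrN CC_Nr; ring.
have c0 : conv CC 0.
  move=> N; exists (absz N) => L le; rewrite subr0; apply: vgeW (vge_CC L); lia.
have c1 := convD (convB (conv_cst (CC 0)) c0) (convB (conv_cst (CC 1)) (convS c0)).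
rewrite !subr0 in c1; by apply: conv_near c1; exists 0%N => L _; rewrite t.
Qed.

(** Unfolding this recurrence produces the alternating series with terms [rterm]. *)
Lemma CC_rec s : CC s = B ^+ s.+1 * (PF - CC s.+3).
Proof. by rewrite PF_CC -(AA_const s.+1) /CC; ring. Qed.

Definition rterm (s n : int) : K := if 0 < n then - mon n (n * (3 * n - 1) + 2 * n * s) else 0.

Lemma vge_rterm s n : 0 <= s -> vge `|n| (rterm s n).
Proof.
move=> s0; rewrite /rterm; case: ifP => h; last exact: vge0.
have le : `|n| <= n * (3 * n - 1) + 2 * n * s by nia.
apply: vgeN; apply: vgeW le _.
rewrite -[X in vge X _]add0r /Submission.mon; apply: vgeM (vge_X _ _).
have [->|->] := @sgn_cases F K 242 isT erefl n; [exact: vge1 | apply: vgeN; exact: vge1].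
Qed.

Lemma vanishing_rterm (s : nat) : vanishing (rterm s%:Z).
Proof. by move=> N; exists (absz N) => n hn; apply: vgeW (vge_rterm _ _); lia. Qed.

Definition TT (s : nat) := projT1 (cid (hassum_ex (@vanishing_rterm s))).
Lemma TTP s : hassum (rterm s%:Z) (TT s). Proof. exact: projT2 (cid (hassum_ex (@vanishing_rterm s))). Qed.

Lemma vge_TT s : vge 0 (TT s).
Proof. by apply: hassum_vge (TTP s) => n; apply: vgeW (vge_rterm _ _); lia. Qed.

Lemma TT_rec s : TT s = B ^+ s.+1 * (1 - TT s.+3).
Proof.
have h1 := hassum_shift 1 (@vanishing_rterm s) (TTP s).
have h2 := hassumD (hassum_delta (B ^+ s.+1)) (hassumZ (- B ^+ s.+1) (TTP s.+3)).
rewrite mulrBr mulr1 -mulNr; apply: hassum_uniq h1 _; apply: eq_hassum h2 => n /=.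
rewrite /rterm -XB Xmon; case: eqP => [->|n0].
  rewrite /= mulr0 addr0 /Submission.mon add0r expr1z expr0z mulN1r opprK mul1r.
  by congr (X K ^ _); lia.
rewrite add0r; have -> : (0 < n + 1) = (0 < n) by lia.
case: ifP => _; last by rewrite mulr0.
rewrite mulrNN monM; have -> : mon (0 + n) (2 * s.+1%:Z + (n * (3 * n - 1) + 2 * n * s.+3%:Z)) =
  mon n ((n + 1) * (3 * (n + 1) - 1) + 2 * (n + 1) * s%:Z) by congr (mon _ _); lia.
rewrite /Submission.mon exprzDr ?expr1z ?mulrN1 ?mulNr ?opprK //; exact: unitrN1.
Qed.

(** Both sides obey the same recurrence, each use of which raises the valuation of their
    difference. *)
Lemma CC_TT s : qq * CC s = TT s.
Proof.
apply/eqP; rewrite -subr_eq0; apply/eqP; apply: vge_all => N.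
suff h (n s' : nat) : vge n%:Z (qq * CC s' - TT s') by apply: vgeW (h (absz N) s); lia.
elim: n s' => [|n IHn] s'.
  apply: vgeB (vge_TT _); rewrite -[0]addr0; apply: vgeM.
    apply: conv_vge (pinfP two_gt0 B); exists 0%N => L _; apply: vge_poch0 => //.
    by apply: vgeW (vge_X _ _).
  by apply: vgeW (vge_CC _); lia.
have -> : qq * CC s' - TT s' = - (B ^+ s'.+1 * (qq * CC s'.+3 - TT s'.+3)).
  by rewrite CC_rec TT_rec mulrCA mulrBr [qq * PF]mulrC PF_qq; ring.
apply: vgeN; have le : n.+1%:Z <= 2 * s'.+1%:Z + n%:Z by lia.
by apply: vgeW le _; apply: vgeM (IHn _); rewrite -XB; exact: vge_X.
Qed.

(** The factor [1 / (1 - zt n)] sums the series for the bounds $b$, $b+11$, $b+22$ and so on,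
    because raising the bound by 11 multiplies [rterm] by [zt n]. *)
Definition vterm (b n : int) : K := rterm b n / (1 - zt n).

Lemma vge_vterm b n : 0 <= b -> vge `|n| (vterm b n).
Proof.
move=> b0; rewrite /vterm; have [->|n0] := eqVneq n 0; first by rewrite /rterm mul0r; exact: vge0.
rewrite -[X in vge X _]addr0; apply: vgeM (vge_rterm _ b0) _; exact: (@vge_geom F K 242 isT erefl).
Qed.

Lemma vanishing_vterm (b : nat) : vanishing (vterm b%:Z).
Proof. by move=> N; exists (absz N) => n hn; apply: vgeW (vge_vterm _ _); lia. Qed.

Definition VV (s : nat) := projT1 (cid (hassum_ex (@vanishing_vterm s))).
Lemma VVP s : hassum (vterm s%:Z) (VV s). Proof. exact: projT2 (cid (hassum_ex (@vanishing_vterm s))). Qed.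

Lemma rtermD b (k : nat) n : rterm (b + 11 * k%:Z) n = rterm b n * zt n ^+ k.
Proof.
rewrite /rterm; case: ifP => _; last by rewrite mul0r.
rewrite mulNr; congr (- _); rewrite zt_mon -[_ ^+ k]/(_ ^ k%:Z) monX monM; congr (mon _ _); lia.
Qed.

#[local] Opaque TT VV SS.

Lemma VV_lim (b : nat) : conv (fun L => \sum_(k <- iota 0 L) TT (b + 11 * k)) (VV b).
Proof.
suff h L : vge L%:Z (\sum_(k <- iota 0 L) TT (b + 11 * k) - VV b).
  by move=> N; exists (absz N) => L le; apply: vgeW (h L); lia.
have h1 := @hassum_fsum F K _ (iota 0 L) (fun k => rterm (b + 11 * k)%N%:Z) _ (fun k => TTP _).
have h2 := hassumD h1 (hassumZ (-1) (VVP b)).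
rewrite mulN1r in h2; apply: hassum_vge h2 => n.
have [n0|n0] := lerP n 0.
  rewrite big1 => [|k _]; rewrite /vterm /rterm ltNge n0 //=.
  by rewrite mul0r mulr0 addr0; exact: vge0.
have z1 : 1 - zt n != 0 by apply: (@zt_neq1 F K 242 isT erefl); lia.
have -> : \sum_(k <- iota 0 L) rterm (b + 11 * k)%N%:Z n = vterm b%:Z n * (1 - zt n ^+ L).
  elim: L {h1} => [|L' IHL]; first by rewrite big_nil expr0 subrr mulr0.
  rewrite sum_iotaS IHL; have -> : (b + 11 * L')%N%:Z = b%:Z + 11 * L'%:Z by lia.
  rewrite rtermD /vterm exprS; field; exact: z1.
have -> : vterm b%:Z n * (1 - zt n ^+ L) + -1 * vterm b%:Z n = - (zt n ^+ L * vterm b%:Z n) by ring.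
apply: vgeN; have le : L%:Z <= 22 * n * L%:Z + `|n| by nia.
apply: vgeW le _; apply: vgeM; last exact: vge_vterm.
by rewrite zt_mon -[_ ^+ L]/(_ ^ L%:Z) monX /Submission.mon mul0r expr0z mul1r; apply: vge_X.
Qed.

Lemma VV_TT b : VV b = TT b + VV (b + 11).
Proof.
apply: hassum_uniq (VVP b) _; apply: eq_hassum (hassumD (TTP b) (VVP (b + 11))) => n.
have -> : (b + 11)%N%:Z = b%:Z + 11 * 1%N%:Z by lia.
rewrite /vterm rtermD expr1; have [->|n0] := eqVneq n 0; first by rewrite /rterm !mul0r addr0.
have := @zt_neq1 F K 242 isT erefl n n0; move: (zt n) (rterm _ _) => z t h; field; exact: h.
Qed.

Definition NFp (b : int) : K := gfw (fun s => if (s != [::]) && (rank s == b %[mod 11])%Z then 1 else 0).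

(** The ranks in the class of [b] are $b+11l$ and $-(11-b+11l)$; by symmetry each contributes a
    difference of two consecutive [TT], and the sums over [l] are values of [VV]. *)
Lemma NFp_VV (b : nat) : (b <= 10)%N ->
  qq * NFp b%:Z = VV b - VV b.+1 + (VV (11 - b) - VV (12 - b)).
Proof.
move=> hb.
pose R L := [seq (b + 11 * l)%N%:Z | l <- iota 0 L] ++ [seq - (11 - b + 11 * l)%N%:Z | l <- iota 0 L].
have h := @gfw_stat F K _ (fun s => if (s != [::]) && (rank s == b%:Z %[mod 11])%Z then 1 else 0) rank R _ _.
have {}h := convM (conv_cst qq) (h _ _).
apply: conv_uniq (h _ _) _ => {h}.
- move=> L; rewrite cat_uniq !map_inj_uniq ?iota_uniq //; try by [move=> x y; lia].
  by rewrite andbT; apply/hasPn => r /mapP [l _ ->]; apply/mapP => -[l' _]; lia.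
- move=> L s hs hL; case: andP => [[_ hr] _|_]; last by rewrite eqxx.
  have h1 := ispart_size hs.
  have h2 : (largest s <= sumn s)%N.
    by rewrite largestE //; case: s {hs hL h1 hr} => //= a s; lia.
  have h3 : `|rank s| <= (sumn s)%:Z by rewrite /rank; lia.
  move/eqP: hr => hr.
  rewrite mem_cat; have [h|h] := lerP 0 (rank s); apply/orP; [left|right]; apply/mapP.
    by exists (absz (rank s) %/ 11)%N; rewrite ?mem_iota /=; move: h hr h3; move: (rank s) => r; lia.
  by exists ((absz (rank s) - (11 - b)) %/ 11)%N; rewrite ?mem_iota /=; move: h hr h3; move: (rank s) => r; lia.
have qN r : qq * Nr r%:Z = TT r - TT r.+1 by rewrite CC_Nr mulrBr !CC_TT.
have t L : qq * \sum_(r <- R L) gfw (fun s => if rank s == r then if (s != [::]) && (rank s == b%:Z %[mod 11])%Z then 1 else 0 else 0) =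
  (\sum_(k <- iota 0 L) TT (b + 11 * k) - \sum_(k <- iota 0 L) TT (b.+1 + 11 * k)) +
  (\sum_(k <- iota 0 L) TT (11 - b + 11 * k) - \sum_(k <- iota 0 L) TT (12 - b + 11 * k)).
  have -> : \sum_(r <- R L) gfw (fun s => if rank s == r then if (s != [::]) && (rank s == b%:Z %[mod 11])%Z then 1 else 0 else 0) =
     \sum_(r <- R L) Nr r.
    rewrite !big_cat !big_map; congr (_ + _); apply: eq_bigr => l _; apply: gfw_ext => s _.
      case: (rank s =P _) => [->|_]; rewrite ?andbF // andbT.
      by have -> : ((b + 11 * l)%N%:Z == b%:Z %[mod 11])%Z; [apply/eqP; lia | rewrite andbT].
    case: (rank s =P _) => [->|_]; rewrite ?andbF // andbT.
    by have -> : (- (11 - b + 11 * l)%N%:Z == b%:Z %[mod 11])%Z; [apply/eqP; lia | rewrite andbT].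
  rewrite big_cat !big_map mulrDr !mulr_sumr -!sumrB; congr (_ + _); apply: eq_bigr => l _.
    by rewrite qN addSn.
  by rewrite NrN qN; congr (_ - TT _); lia.
have c1 := convD (convB (VV_lim b) (VV_lim b.+1)) (convB (VV_lim (11 - b)) (VV_lim (12 - b))).
by apply: conv_near c1; exists 0%N => L _; rewrite t.
Qed.

(** The positive indices give [VV b.+1]. Reflecting the negative ones turns the denominator around,
    which replaces the parameter by [11 - b]. *)
Lemma SS_VV (M : int) (M_gt0 : 0 < M) (ME : M = 242) (b : nat) : (b <= 10)%N ->
  SS K M_gt0 ME b%:Z = - VV b.+1 + VV (11 - b).
Proof.
move=> hb; apply: hassum_uniq (SSP _ _ _ _) _.
have h := hassumD (hassumZ (-1) (VVP b.+1)) (hassum_opp (@vanishing_vterm (11 - b)) (VVP (11 - b))).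
rewrite mulN1r in h; apply: eq_hassum h => n; rewrite /vterm /rterm /st.
have [->|n0] := eqVneq n 0; first by rewrite oppr0 ltxx !mul0r mulr0 addr0.
have [lt|lt] := ltrP 0 n.
  have -> : (0 < - n) = false by lia.
  rewrite mul0r addr0 mulN1r mulNr opprK; congr (Submission.mon K _ _ / _); lia.
have -> : 0 < - n by lia.
rewrite mul0r mulr0 add0r.
have -> : Submission.mon K n (n * (3 * n + 1) + 2 * b%:Z * n) =
  Submission.mon K (- n) (- n * (3 * - n - 1) + 2 * - n * (11 - b)%N%:Z) * zt n.
  by rewrite zt_mon monM; apply: (@mon_eq F K _ _ _ _ n); lia.
have := @zt_neq1 F K 242 isT erefl n n0; have -> : zt (- n) = (zt n)^-1 by rewrite /Submission.zt mulrN invr_expz.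
move: (zt n) (zt_neq0 K n) (Submission.mon _ _ _) => z z0 m h1; field; rewrite z0 h1 /=.
by rewrite ?andbT; apply: contra h1 => /eqP h2; rewrite -(opprB z 1) h2 oppr0.
Qed.

Lemma rank_series (M : int) (M_gt0 : 0 < M) (ME : M = 242) (b : nat) : (1 <= b <= 5)%N ->
  qq * gfw (fun s => if (rank s == b%:Z %[mod 11])%Z then 1 else 0) =
  (if b == 5%N then 0 else SS K M_gt0 ME b%:Z) - SS K M_gt0 ME b.-1%:Z.
Proof.
move=> /andP [b1 b5].
have -> : gfw (fun s => if (rank s == b%:Z %[mod 11])%Z then 1 else 0) = NFp b%:Z.
  apply: gfw_ext => s _; case: s => [|a s] //=; case: eqP => // h; exfalso; move: h; rewrite /rank /=; lia.
case: b b1 b5 => // b _ b5; rewrite [b.+1.-1]/= NFp_VV; last by lia.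
have -> : (12 - b.+1 = 11 - b)%N by lia.
rewrite (SS_VV M_gt0 ME (b := b)); last by lia.
case: eqP => [[->]|_].
  rewrite (_ : (11 - 5)%N = 6%N) //; move: (VV 5) (VV 6) (VV (11 - 4)) => u v w; ring.
rewrite (SS_VV M_gt0 ME (b := b.+1)); last by lia.
by move: (VV b.+1) (VV b.+2) (VV (11 - b)) (VV (11 - b.+1)) => u v w x; ring.
Qed.

(** The empty partition has rank 0 and is added separately; its contribution is absorbed by writing
    1 as [qq + TT 0 + TT 1]. *)
Lemma rank_series0 (M : int) (M_gt0 : 0 < M) (ME : M = 242) :
  qq * gfw (fun s => if (rank s == 0 %[mod 11])%Z then 1 else 0) = 2 * SS K M_gt0 ME 0 + 1.
Proof.
have -> : gfw (fun s => if (rank s == 0 %[mod 11])%Z then 1 else 0) = 1 + NFp 0.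
  rewrite -[1 in RHS](cst1 K) -gfw_nil -gfwD; apply: gfw_ext => s _; case: s => [|a s] /=.
    by rewrite /rank /= addr0.
  by rewrite add0r.
have nf : qq * NFp 0 = VV 0 - VV 1 + (VV 11 - VV 12) := @NFp_VV 0 isT.
have ss : SS K M_gt0 ME 0 = - VV 1 + VV 11 := @SS_VV M M_gt0 ME 0 isT.
have e0 : VV 0 = TT 0 + VV 11 := VV_TT 0.
have e1 : VV 1 = TT 1 + VV 12 := VV_TT 1.
have p : 1 = qq + TT 0 + TT 1.
  by rewrite -PF_qq mulrC PF_CC !mulrDr mulr1 !CC_TT.
rewrite mulrDr mulr1 nf ss e0 e1 [X in _ = _ + X]p.
by move: qq (TT 0) (TT 1) (VV 11) (VV 12) => x u v w y; ring.
Qed.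

End RankSeries.

(** * The crank generating function *)

Section QBinomial.
Variables (F : fieldType) (K : lfield F) (M : int).
Hypothesis M_gt0 : 0 < M.
Local Notation B := (X K ^ M).
Local Notation poch := (@poch F K M).
Local Notation pinf := (Submission.pinf M_gt0).
Variables a t : K.
Hypotheses (va : vge 0 a) (vt : vge 1 t).

Definition qbc j : K := poch a j / poch B j.

Lemma qbcS j : qbc j.+1 * (1 - B ^+ j.+1) = qbc j * (1 - a * B ^+ j).
Proof.
have h1 := pochB_neq0 K M_gt0 j; have h2 := oneBX_neq0 K M_gt0 j.
rewrite /qbc !pochS -exprS; field; rewrite h1 h2 //.
Qed.

Definition qbF (u : K) L : K := \sum_(l <- iota 0 L) qbc l * u ^+ l.

Lemma qbF_step u L : (1 - u) * qbF u L.+1 - (1 - a * u) * qbF (u * B) L.+1 =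
  - (qbc L * (1 - a * B ^+ L) * u ^+ L.+1).
Proof.
elim: L => [|L IHL].
  by rewrite /qbF !sum_iota1 /qbc !poch0 !expr0 expr1; field; rewrite oner_neq0.
rewrite /qbF !(sum_iotaS _ L.+1) -/(qbF _ _) -/(qbF _ _) !(mulrDr (1 - _)) opprD addrACA IHL.
rewrite -qbcS exprMn [u ^+ L.+2]exprS.
by move: (qbc _) (B ^+ L.+1) (u ^+ L.+1) => c b v; ring.
Qed.

Lemma vge_qbc j : vge 0 (qbc j).
Proof.
rewrite -[0]addr0; apply: vgeM; first exact: vge_poch0.
exact: (pochB_unit K M_gt0 j).2.
Qed.

Lemma vge_B0 i : vge 0 (B ^+ i).
Proof. by apply: vgeW (vge_B K _ _); rewrite mulrn_wge0 // ltW. Qed.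

Lemma vge_tB n : vge 1 (t * B ^+ n).
Proof. by rewrite -[1]addr0; apply: vgeM (vge_B0 _). Qed.

Lemma vge_exp1 (u : K) n : vge 1 u -> vge n%:Z (u ^+ n).
Proof. by move=> /(vge_exp n); apply: vgeW; rewrite natz. Qed.

Lemma qbF_iter L n : vge L.+1%:Z (poch t n * qbF t L.+1 - poch (a * t) n * qbF (t * B ^+ n) L.+1).
Proof.
elim: n => [|n IHn]; first by rewrite !poch0 expr0 mulr1 subrr; apply: vge0.
rewrite !pochS.
have -> : poch t n * (1 - t * B ^+ n) * qbF t L.+1 -
    poch (a * t) n * (1 - a * t * B ^+ n) * qbF (t * B ^+ n.+1) L.+1 =
  (1 - t * B ^+ n) * (poch t n * qbF t L.+1 - poch (a * t) n * qbF (t * B ^+ n) L.+1) +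
  poch (a * t) n * ((1 - t * B ^+ n) * qbF (t * B ^+ n) L.+1 -
    (1 - a * (t * B ^+ n)) * qbF (t * B ^+ n * B) L.+1).
  rewrite exprSr [t * (_ * B)]mulrA.
  by move: (B ^+ n) (poch _ _) (poch _ _) (qbF (t * B ^+ n * B) _) (qbF (t * B ^+ n) _) (qbF t _) => u v w x y z; ring.
rewrite qbF_step; have v0 : vge 0 (poch (a * t) n).
  by apply: vge_poch0 => //; rewrite -[0]addr0; apply: vgeM va _; apply: vgeW vt.
apply: vgeD.
  rewrite -[_%:Z]add0r; apply: vgeM IHn; apply: vgeB; first exact: vge1.
  by apply: vgeW (vge_tB n).
rewrite -[_%:Z]add0r; apply: vgeM v0 _; apply: vgeN; rewrite -[_%:Z]add0r.
apply: vgeM (vge_exp1 _ (vge_tB n)); rewrite -[0]addr0; apply: vgeM (vge_qbc _) _.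
by apply: vgeB vge1 _ || apply: vgeB; [exact: vge1 | rewrite -[0]addr0; apply: vgeM va (vge_B0 _)].
Qed.

Lemma pinf_t_neq0 : pinf t != 0. Proof. exact: (vge_unit (vge_pinf1 M_gt0 vt)).1. Qed.

Theorem qbinomial : conv (fun L => \sum_(l <- iota 0 L) qbc l * t ^+ l) (pinf (a * t) / pinf t).
Proof.
have vF L : vge L%:Z (qbF (t * B ^+ L) L.+1 - 1).
  rewrite /qbF big_cons expr0 mulr1 {1}/qbc !poch0 divr1 addrAC subrr add0r big_seq.
  apply: vge_sum => j; rewrite mem_iota => /andP [j0 _]; rewrite -[L%:Z]add0r; apply: vgeM (vge_qbc j) _.
  have h : vge L%:Z (t * B ^+ L).
    have le : L%:Z <= 1 + M *+ L by rewrite -mulr_natr natz; nia.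
    by apply: vgeW le _; apply: vgeM vt (vge_B _ _ _).
  have le2 : L%:Z <= L%:Z *+ j by rewrite -mulr_natr natz; nia.
  exact: vgeW le2 (vge_exp j h).
have c1 : conv (fun L => poch t L * qbF t L.+1) (pinf (a * t)).
  rewrite -[pinf _]addr0 -[X in conv _ (_ + X)](subrr 0).
  have d1 : conv (fun L => poch t L * qbF t L.+1 - poch (a * t) L * qbF (t * B ^+ L) L.+1) 0.
    by move=> N; exists (absz N) => L le; rewrite subr0; apply: vgeW (qbF_iter L L); lia.
  have d2 : conv (fun L => qbF (t * B ^+ L) L.+1) 1.
    by move=> N; exists (absz N) => L le; apply: vgeW (vF L); lia.
  have := convD d1 (convM (pinfP M_gt0 (a * t)) d2); rewrite mulr1 add0r subrr addr0.
  by apply: conv_near; exists 0%N => L _; rewrite subrK.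
have c2 := convM c1 (convV pinf_t_neq0 (pinfP M_gt0 t)).
have c3 : conv (fun L => qbF t L.+1) (pinf (a * t) / pinf t).
  apply: conv_near c2; exists 0%N => L _; rewrite mulrC mulrA mulVf ?mul1r //.
  by have := pinf_t_neq0; rewrite (pinfD M_gt0 t L); apply: contra => /eqP ->; rewrite mul0r.
move=> N; have [L0 h] := c3 N; exists L0.+1 => -[|L] // le; exact: h.
Qed.

End QBinomial.

Section Crank.
Variables (F : fieldType) (K : lfield F) (x : F).
Hypothesis x0 : x != 0.
Local Notation gfw := (gfw K).
Local Notation B := (X K ^ 2).
Local Notation poch := (@poch F K 2).
Local Notation pinf := (Submission.pinf two_gt0).
Local Notation cx := (cst K x).

Lemma cx_neq0 : cx != 0.
Proof. by apply/eqP => h; have := cst1 K; rewrite -(mulfV x0) cstM h mul0r => /eqP; rewrite eq_sym oner_eq0. Qed.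

Lemma cstV : cst K x^-1 = cx^-1.
Proof. by apply: (mulfI cx_neq0); rewrite -cstM !mulfV ?cst1 ?cx_neq0. Qed.

Lemma cstX n : cst K (x ^+ n) = cx ^+ n.
Proof. by elim: n => [|n IHn]; rewrite ?expr0 ?cst1 // !exprS cstM IHn. Qed.

Definition ones j (u : seq nat -> F) s := if count_mem 1%N s == j then u s else 0.

Lemma gf_ones_only j : gfw (leparts 1 (ones j (fun=> 1))) = B ^+ j.
Proof.
elim: j => [|j IHj].
  rewrite expr0 -(cst1 K) -gfw_nil; apply: gfw_ext => s; case: s => [|a s] //.
  by rewrite ispart_cons; case: a => [|[|a]] // _; rewrite /leparts /ones /= ?if_same.
rewrite exprS -IHj -[B]/(X K ^ (2 * 1%N%:Z)) -(gfw_head K (ones j (fun=> 1))) //.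
apply: gfw_ext => s; case: s => [|a s] //; rewrite ispart_cons /leparts /ones /=.
by case: a => [|[|a]] //= /andP [h _]; rewrite h.
Qed.

Lemma gf_ones_from (w : seq nat -> F) (y : nat -> F) j m :
  (forall i s, (i <= m)%N -> ispart (i.+2 :: s) -> w (i.+2 :: s) = y i * w s) ->
  gfw (leparts m.+1 (ones j w)) * \prod_(0 <= i < m) (1 - cst K (y i) * B ^+ i.+2) =
  gfw (leparts 1 (ones j w)).
Proof.
elim: m => [|m IHm] hw; first by rewrite big_geq // mulr1.
rewrite -IHm; last by move=> i s hi; apply: hw; apply: leqW.
rewrite big_nat_recr //= [X in _ * X]mulrC mulrA -XB.
rewrite (@gfw_leparts_S F K (ones j w) m.+1 (y m)) // => s hs.
by rewrite /ones /= ?add0n hw //; case: eqP; rewrite ?mulr0.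
Qed.

Lemma prod_poch z m : \prod_(0 <= i < m) (1 - z * B ^+ i.+2) = poch (z * B ^+ 2) m.
Proof. by apply: eq_bigr => i _; rewrite -mulrA -exprD add2n. Qed.

Lemma count_gt_le j s : (0 < j)%N -> all (geq 1) s -> count (fun k => (j < k)%N) s = 0%N.
Proof.
move=> j0 h; apply/eqP; rewrite -leqn0 leqNgt -has_count; apply/negP => /hasP [i hi].
by have := allP h i hi; rewrite /=; lia.
Qed.

Definition wgt j (s : seq nat) : F := x ^+ count (fun k => (j < k)%N) s.

(** With [j] ones the parts 2 to [j] carry no weight and those above [j] carry [x], hence the two
    products. *)
Lemma gf_ones_wgt j p : (0 < j)%N ->
  gfw (leparts (j.-1 + p).+1 (ones j (wgt j))) *
    (poch (B ^+ 2) j.-1 * poch (cx * B ^+ j.+1) p) = B ^+ j.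
Proof.
move=> j0; rewrite -(gf_ones_only j).
transitivity (gfw (leparts 1 (ones j (wgt j)))); last first.
  apply: gfw_ext => s _; rewrite /leparts; case: ifP => // h; rewrite /ones /wgt.
  by rewrite (count_gt_le j0 h) expr0.
rewrite -(@gf_ones_from _ (fun i => if (j < i.+2)%N then x else 1) j (j.-1 + p)); last first.
  by move=> i s _ _; rewrite /wgt /=; case: ifP; rewrite ?exprS ?mul1r.
congr (_ * _); elim: p => [|p IHp].
  rewrite addn0 poch0 mulr1 -[B ^+ 2]mul1r -prod_poch; apply: eq_big_nat => i /andP [_ hi].
  by rewrite (_ : (j < i.+2)%N = false) ?cst1 //; lia.
rewrite addnS big_nat_recr //= -IHp pochS mulrA; congr (_ * (1 - _)).
have -> : (j < (j.-1 + p).+2)%N by lia.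
by rewrite -mulrA -exprD; congr (_ * _ ^+ _); lia.
Qed.

Lemma poch_split j : (0 < j)%N -> poch B j = (1 - B) * poch (B ^+ 2) j.-1.
Proof. by case: j => // j _; rewrite pochSl expr2. Qed.

Definition crk_part j : K := gfw (ones j (fun s => x ^ crank s)).

Lemma vge_cxB : vge 2 (cx * B).
Proof. by rewrite -[2]add0r; apply: vgeM (vge_cst _ _) (vge_X _ _). Qed.

Lemma pinf_cxB_neq0 j : pinf (cx * B ^+ j.+1) != 0.
Proof.
apply: (vge_unit (vge_pinf1 two_gt0 _)).1; apply: vgeW (_ : vge (0 + 2 * j.+1%:Z) _); first by lia.
by rewrite -XB; apply: vgeM (vge_cst _ _) (vge_X _ _).
Qed.

Lemma crk_part_pos j : (0 < j)%N ->
  crk_part j = (1 - B) / pinf (cx * B) * (qbc 2 (cx * B) j * (B / cx) ^+ j).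
Proof.
move=> j0; have e : crk_part j = cx ^- j * gfw (ones j (wgt j)).
  rewrite -cstX -[_^-1]/((cst K (x ^+ j))^-1).
  have xj : x ^+ j != 0 by rewrite expf_neq0.
  have cj : cst K (x ^+ j) != 0 by rewrite cstX expf_neq0 ?cx_neq0.
  apply: (mulfI cj); rewrite mulrA mulfV // mul1r -gfwZ; apply: gfw_ext => s _.
  rewrite /ones; case: eqP => hj; rewrite ?mulr0 //.
  rewrite /crank hj (gtn_eqF j0) /wgt expfzDr // mulrCA -[x ^+ j]/(x ^ j%:Z) -expfzDr //.
  by rewrite subrr expr0z mulr1.
have lim : gfw (ones j (wgt j)) * (poch (B ^+ 2) j.-1 * pinf (cx * B ^+ j.+1)) = B ^+ j.
  apply: (conv_uniq (u := fun p => gfw (leparts (j.-1 + p).+1 (ones j (wgt j))) *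
    (poch (B ^+ 2) j.-1 * poch (cx * B ^+ j.+1) p))).
    apply: convM; last by apply: convM (conv_cst _) (pinfP _ _).
    by move=> N; have [L0 h] := gfw_lim K (ones j (wgt j)) N; exists L0 => L le; apply: h; lia.
  by apply: conv_near (conv_cst _); exists 0%N => p _; rewrite gf_ones_wgt.
have pj := pochB_neq0 K two_gt0 j; rewrite (poch_split j0) in pj.
have [b1 pj'] : 1 - B != 0 /\ poch (B ^+ 2) j.-1 != 0 by apply/andP; rewrite -negb_or -mulf_eq0.
have p1 := pinf_cxB_neq0 j; have p0 := pinf_cxB_neq0 0; rewrite expr1 in p0.
have cj : cx ^+ j != 0 by rewrite expf_neq0 ?cx_neq0.
have pD : pinf (cx * B) = poch (cx * B) j * pinf (cx * B ^+ j.+1).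
  by rewrite (pinfD two_gt0 (cx * B) j) -mulrA -exprS.
have pc : poch (cx * B) j != 0 by apply: contra p0 => /eqP h; rewrite pD h mul0r.
rewrite e /qbc (poch_split j0) pD expr_div_n -lim.
by field; rewrite cj b1 pj' p1 pc.
Qed.

Lemma euler_sum : conv (fun L => \sum_(l <- iota 0 L) (cx * B) ^+ l / poch B l) (1 / pinf (cx * B)).
Proof.
have v1 : vge 1 (cx * B) by apply: vgeW vge_cxB.
have := @qbinomial F K 2 two_gt0 0 (cx * B) (vge0 _ _) v1; rewrite mul0r.
have p0 N : poch 0 N = 1 by rewrite /Submission.poch big1 // => i _; rewrite mul0r subr0.
have -> : pinf (0 : K) = 1.
  by apply: conv_uniq (pinfP _ _) _; apply: conv_near (conv_cst 1); exists 0%N => L _; rewrite p0.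
by apply: conv_near; exists 0%N => L _; apply: eq_bigr => l _; rewrite /qbc p0 mul1r mulrC.
Qed.

Lemma gf_largest m :
  gfw (fun s => if largest s == m.+2 then ones 0 (fun s => x ^ crank s) s else 0) * poch (B ^+ 2) m.+1 =
  (cx * B) ^+ m.+2.
Proof.
have e : gfw (fun s => if largest s == m.+2 then ones 0 (fun s => x ^ crank s) s else 0) =
    cx ^+ m.+2 * (B ^+ m.+2 * gfw (leparts m.+2 (ones 0 (fun=> 1)))).
  rewrite -cstX -XB -(gfw_head K (ones 0 (fun=> 1))) // -gfwZ; apply: gfw_ext => s hs.
  rewrite (largestE hs); case: s hs => [|a s] hs /=; first by rewrite mulr0.
  rewrite -[Some a == _]/(a == m.+2); case: eqP => [e|]; last by rewrite mulr0.
  rewrite /ones /crank /= e /= add0n; case: eqP => h; last by rewrite mulr0.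
  by rewrite -e -[maxn a _]/(largest (a :: s)) (largestE hs) mulr1.
have h : gfw (leparts m.+2 (ones 0 (fun=> 1))) * poch (B ^+ 2) m.+1 = 1.
  transitivity (gfw (leparts 1 (ones 0 (fun=> 1)))); last by rewrite gf_ones_only expr0.
  rewrite -[B ^+ 2]mul1r -(cst1 K) -prod_poch.
  by apply: (@gf_ones_from (fun=> 1) (fun=> 1)) => i s _ _; rewrite mul1r.
by rewrite e [RHS]exprMn -[RHS]mulr1 -[X in _ = _ * X]h; ring.
Qed.

(** Without ones the crank is the largest part, and the sum over it is Euler's sum except at 0 and
    1: the empty partition has weight 1, not $1-B$, and a largest part 1 cannot occur. *)
Lemma crk_part0 : crk_part 0 + (cx - 1) * B = (1 - B) / pinf (cx * B).
Proof.
pose w := ones 0 (fun s => x ^ crank s).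
have h := @gfw_stat F K nat w largest (fun L => iota 0 L) (iota_uniq 0).
have {}h : conv (fun L => \sum_(r <- iota 0 L) gfw (fun s => if largest s == r then w s else 0)) (crk_part 0).
  apply: h => L s hs hL _; rewrite mem_iota /= add0n (largestE hs); apply: leq_ltn_trans hL.
  by case: s {hs} => //= a s; lia.
have b1 : 1 - B != 0 by have := oneBX_neq0 K two_gt0 0; rewrite expr1.
have t0 : gfw (fun s => if largest s == 0%N then w s else 0) = 1.
  rewrite -(cst1 K) -gfw_nil; apply: gfw_ext => s hs; rewrite (largestE hs).
  case: s hs => [|a s]; first by rewrite /= /w /ones /crank /= expr0z.
  by rewrite ispart_cons => /andP [a0 _] /=; rewrite (gtn_eqF a0).
have t1 : gfw (fun s => if largest s == 1%N then w s else 0) = 0.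
  rewrite -(gfw0 K); apply: gfw_ext => s hs; rewrite (largestE hs); case: s hs => [|a s] hs //=.
  by case: eqP => // ->; rewrite /w /ones /=.
have part L : \sum_(r <- iota 0 L.+2) gfw (fun s => if largest s == r then w s else 0) =
    (1 - B) * \sum_(l <- iota 0 L.+2) (cx * B) ^+ l / poch B l + (B - cx * B).
  elim: L => [|L IHL].
    by rewrite !big_cons !big_nil t0 t1 poch0 expr0 expr1 poch1; field; rewrite b1 ?oner_neq0.
  rewrite !(sum_iotaS _ L.+2) IHL mulrDr.
  have -> : gfw (fun s => if largest s == L.+2 then w s else 0) = (1 - B) * ((cx * B) ^+ L.+2 / poch B L.+2);
    last by rewrite addrAC.
  have pj := pochB_neq0 K two_gt0 L.+2; rewrite (@poch_split L.+2) // in pj *.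
  have pj' : poch (B ^+ 2) L.+1 != 0 by move: pj; rewrite mulf_eq0 negb_or => /andP [].
  by rewrite -(gf_largest L) /=; field; rewrite b1 pj'.
have c := convD (convM (conv_cst (1 - B)) (convS (convS euler_sum))) (conv_cst (B - cx * B)).
have -> : crk_part 0 = (1 - B) * (1 / pinf (cx * B)) + (B - cx * B).
  by apply: conv_uniq (convS (convS h)) _; apply: conv_near c; exists 0%N => L _; rewrite part.
by rewrite mul1r; ring.
Qed.

(** Sum over the number of ones by [qbinomial] with [a = cx * B] and [t = B / cx]. The term
    [(cx - 1) * B] is the conventional correction of the crank numbers of $n=1$. *)
Theorem crank_product :
  (gfw (fun s => x ^ crank s) + (cx - 1) * B) * (pinf (cx * B) * pinf (B / cx)) = pinf B.
Proof.
pose w s := x ^ crank s.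
have h := @gfw_stat F K nat w (count_mem 1%N) (fun L => iota 0 L) (iota_uniq 0).
have {}h : conv (fun L => \sum_(r <- iota 0 L) crk_part r) (gfw w).
  apply: h => L s hs hL _; rewrite mem_iota /= add0n.
  by apply: leq_ltn_trans hL; apply: leq_trans (count_size _ _) (ispart_size hs).
have v0 : vge 0 (cx * B) by apply: vgeW vge_cxB.
have v1 : vge 1 (B / cx).
  rewrite -cstV; apply: vgeW (_ : vge (2 + 0) _); first by [].
  by apply: vgeM (vge_X _ _) (vge_cst _ _).
have q := @qbinomial F K 2 two_gt0 (cx * B) (B / cx) v0 v1.
have e1 : cx * B * (B / cx) = B ^+ 2.
  by rewrite expr2; have := cx_neq0; move: cx => c hc; field; rewrite hc.
rewrite e1 in q.
have part L : \sum_(r <- iota 0 L.+1) crk_part r + (cx - 1) * B =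
   (1 - B) / pinf (cx * B) * \sum_(l <- iota 0 L.+1) qbc 2 (cx * B) l * (B / cx) ^+ l.
  elim: L => [|L IHL].
    by rewrite !sum_iota1 crk_part0 /qbc !poch0 expr0 divr1 !mulr1.
  by rewrite !(sum_iotaS _ L.+1) mulrDr -IHL -crk_part_pos //; ring.
have c := convD (convS h) (conv_cst ((cx - 1) * B)).
have c' := convM (conv_cst ((1 - B) / pinf (cx * B))) (convS q).
have -> : gfw w + (cx - 1) * B = (1 - B) / pinf (cx * B) * (pinf (B ^+ 2) / pinf (B / cx)).
  by apply: conv_uniq c _; apply: conv_near c'; exists 0%N => L _; rewrite part.
have p0 := pinf_cxB_neq0 0; rewrite expr1 in p0.
have p1 := pinf_t_neq0 two_gt0 v1.
rewrite (pinfS two_gt0 B) -expr2.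
by move: (pinf (cx * B)) (pinf (B / cx)) p0 p1 (pinf (B ^+ 2)) => u v hu hv z; field; rewrite hu hv.
Qed.

End Crank.

(** * Positivity *)

Section Positivity.
Variables (F : fieldType) (K : lfield F).
Local Notation conv := (@conv F K).

Definition natural_coefs (f : fps F) := forall n, exists k : nat, coefs f n = k%:R.

Definition nn (z : K) := exists2 f, natural_coefs f & z = liota K f.

Lemma nn1 : nn 1.
Proof. by exists 1; rewrite ?rmorph1 // => n; rewrite coefs1; exists (n == 0%N). Qed.

Lemma nnD z w : nn z -> nn w -> nn (z + w).
Proof.
move=> [f hf ->] [g hg ->]; exists (f + g); rewrite ?rmorphD // => n.
by have [[k e] [l e']] := (hf n, hg n); exists (k + l)%N; rewrite coefsD e e' natrD.
Qed.

Lemma nnM z w : nn z -> nn w -> nn (z * w).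
Proof.
move=> [f hf ->] [g hg ->]; exists (f * g); rewrite ?rmorphM // => n; rewrite coefsM.
apply: (big_ind (fun x : F => exists k : nat, x = k%:R)); first by exists 0%N.
  by move=> x y [k ->] [l ->]; exists (k + l)%N; rewrite natrD.
by move=> i _; have [[k ->] [l ->]] := (hf i, hg (n - i)%N); exists (k * l)%N; rewrite natrM.
Qed.

Lemma nnX z n : nn z -> nn (z ^+ n).
Proof. by move=> h; elim: n => [|n IHn]; rewrite ?expr0 ?exprS; [exact: nn1 | exact: nnM]. Qed.

Lemma nn_prod (I : Type) (r : seq I) (P : pred I) (f : I -> K) :
  (forall i, P i -> nn (f i)) -> nn (\prod_(i <- r | P i) f i).
Proof. by move=> h; apply: (big_ind nn) => //; [exact: nn1 | exact: nnM]. Qed.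

Lemma nn_Xz (e : int) : 0 <= e -> nn (X K ^ e).
Proof.
case: e => // k _; exists (fX F ^+ k); last exact: XfX.
move=> n; rewrite -[fX F ^+ k]mulr1 coefsXnM coefs1; case: leqP => _; last by exists 0%N.
by exists (n - k == 0)%N.
Qed.

Lemma nn_conv u l : (forall L, nn (u L)) -> conv u l -> nn l.
Proof.
move=> hu hl; have v0 : vge 0 l.
  by apply: conv_vge hl; exists 0%N => L _; have [f _ ->] := hu L; exact: vge_tofrac.
have [f ef] := v0; rewrite expr0z mul1r in ef; exists f => // n.
have [L0 hL] := hl n.+1%:Z; have := hL L0 (leqnn _); have [g hg ->] := hu L0.
rewrite ef -rmorphB => /vge_coef0 /(_ n (ltnSn n)); rewrite coefsB => /eqP.
by rewrite subr_eq0 => /eqP <-.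
Qed.

Lemma one_sub_X_neq0 (e : int) : 0 < e -> 1 - X K ^ e != 0.
Proof.
move=> e0; rewrite subr_eq0 eq_sym -(expr0z (X K)); apply/eqP => /(X_expz_inj two_gt0); lia.
Qed.

Lemma nn_geom (e : int) : 0 < e -> nn (1 - X K ^ e)^-1.
Proof.
move=> e0; have h1 := one_sub_X_neq0 e0; apply: (@nn_conv (fun L => \sum_(l <- iota 0 L) (X K ^ e) ^+ l)).
  move=> L; apply: (big_ind nn); [|exact: nnD|].
    by exists 0; rewrite ?rmorph0 // => n; exists 0%N; rewrite coefs0.
  by move=> l _; apply/nnX/nn_Xz/ltW.
have s L : \sum_(l <- iota 0 L) (X K ^ e) ^+ l - (1 - X K ^ e)^-1 = - ((X K ^ e) ^+ L / (1 - X K ^ e)).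
  elim: L => [|L IHL]; first by rewrite big_nil expr0 sub0r mul1r.
  by rewrite sum_iotaS addrAC IHL exprS; field; exact: h1.
have v : vge 0 (1 - X K ^ e)^-1.
  by apply: (vge_unit _).2; rewrite addrAC subrr add0r; apply: vgeN; apply: vgeW (vge_X _ _); lia.
move=> N; exists (absz N) => L le; rewrite s; apply: vgeN.
have le2 : N <= e * L%:Z + 0 by nia.
have -> : (X K ^ e) ^+ L = X K ^ (e * L%:Z) by rewrite -exprz_exp.
by apply: vgeW le2 _; apply: vgeM (vge_X _ _) v.
Qed.

Lemma nn_pair (d e : int) : 0 < d -> 0 < e ->
  nn ((1 - X K ^ (d + e)) / ((1 - X K ^ d) * (1 - X K ^ e))).
Proof.
move=> d0 e0; have h1 := one_sub_X_neq0 d0; have h2 := one_sub_X_neq0 e0.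
have -> : (1 - X K ^ (d + e)) / ((1 - X K ^ d) * (1 - X K ^ e)) =
    (1 - X K ^ d)^-1 + X K ^ e / (1 - X K ^ e).
  by rewrite XD; field; rewrite h1 h2.
by apply: nnD (nn_geom d0) _; apply: nnM (nn_geom e0); apply: nn_Xz; lia.
Qed.

Variable M : int.
Hypotheses (M_gt0 : 0 < M).
Local Notation B := (X K ^ M).
Local Notation poch := (@poch F K M).
Local Notation theta := (Submission.theta M_gt0).
Local Notation J := (Submission.pinf M_gt0 B).

Variable d : int.
Hypotheses (d0 : 0 < d) (dM : d < M).
Local Notation y := (X K ^ d).

Lemma pochXE c L : poch (X K ^ c) L = \prod_(0 <= i < L) (1 - X K ^ (c + M * i%:Z)).
Proof. by apply: eq_bigr => i _; rewrite -XB -XD. Qed.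

Lemma BdivE : B / y = X K ^ (M - d). Proof. by rewrite XD -invr_expz. Qed.

Lemma pochX_neq0 c L : 0 < c -> poch (X K ^ c) L != 0.
Proof.
move=> c0; rewrite pochXE; apply: (big_ind (fun z : K => z != 0)) => [|z w|i _].
- exact: oner_neq0.
- exact: mulf_neq0.
by apply: one_sub_X_neq0; nia.
Qed.

Lemma thetaX_neq0 : theta y != 0.
Proof.
apply: theta_neq0; first by rewrite expfz_neq0 ?X_neq0.
by move=> n; apply/eqP => /(X_expz_inj M_gt0) e; have [h|h] := lerP n 0; nia.
Qed.

Lemma nn_thetaV : nn (theta y)^-1.
Proof.
apply: (nn_conv _ (convV thetaX_neq0 (conv_poch_theta M_gt0 y))) => L.
rewrite BdivE !pochXE invfM -!prodfV; apply: nnM; apply: nn_prod => i _; apply: nn_geom; nia.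
Qed.

Lemma poch_even_odd L : poch B (L + L) =
  \prod_(0 <= i < L) (1 - X K ^ (M * (2 * i%:Z + 1))) * \prod_(0 <= i < L) (1 - X K ^ (M * (2 * i%:Z + 2))).
Proof.
elim: L => [|L IHL]; first by rewrite poch0 !big_geq // mulr1.
rewrite addSn addnS !pochS IHL !big_nat_recr //= -!XB -!XD.
have -> : M + M * (L + L)%N%:Z = M * (2 * L%:Z + 1) by lia.
have -> : M + M * (L + L).+1%:Z = M * (2 * L%:Z + 2) by lia.
by rewrite -!mulrA; congr (_ * _); rewrite [RHS]mulrCA mulrA.
Qed.

Lemma nn_theta2 : nn (J / theta y ^+ 2).
Proof.
(* The exponents $M(2i+1)$ and $M(2i+2)$ of [J] are sums of one exponent from each half of [theta]:
   $(d+Mi)+(M-d+Mi)$ and $(d+M+Mi)+(M-d+Mi)$. The second copy has one factor more, leaving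
   [(1 - y)^-1]. *)
pose u L := poch B (L + L) / (poch y L * poch (B / y) L * (poch y L.+1 * poch (B / y) L)).
have c2 : conv (fun L => poch y L.+1 * poch (B / y) L) (theta y).
  by apply: convM (convS (pinfP M_gt0 _)) (pinfP M_gt0 _).
have c1 := conv_poch_theta M_gt0 y.
have t2 : theta y * theta y != 0 by rewrite mulf_neq0 ?thetaX_neq0.
have c3 : conv (fun L => poch B (L + L)) J.
  by move=> N; have [L0 h] := pinfP M_gt0 B N; exists L0 => L le; apply: h; rewrite (leq_trans le) ?leq_addr.
have cu : conv u (J / theta y ^+ 2) by rewrite expr2; apply: convM c3 (convV t2 (convM c1 c2)).
apply: (nn_conv _ cu) => L; rewrite /u poch_even_odd.
have d1 : 0 < M - d by lia.
have n1 := pochX_neq0 L d0; have n2 := pochX_neq0 L d1.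
have -> : \prod_(0 <= i < L) (1 - X K ^ (M * (2 * i%:Z + 1))) * \prod_(0 <= i < L) (1 - X K ^ (M * (2 * i%:Z + 2))) /
    (poch y L * poch (B / y) L * (poch y L.+1 * poch (B / y) L)) =
  (\prod_(0 <= i < L) ((1 - X K ^ ((d + M * i%:Z) + (M - d + M * i%:Z))) /
      ((1 - X K ^ (d + M * i%:Z)) * (1 - X K ^ (M - d + M * i%:Z))))) *
  ((\prod_(0 <= i < L) ((1 - X K ^ ((d + M + M * i%:Z) + (M - d + M * i%:Z))) /
      ((1 - X K ^ (d + M + M * i%:Z)) * (1 - X K ^ (M - d + M * i%:Z))))) * (1 - y)^-1).
  rewrite pochSl BdivE -XD !prodf_div !big_split /= -!pochXE.
  have -> : \prod_(0 <= i < L) (1 - X K ^ (d + M * i%:Z + (M - d + M * i%:Z))) =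
            \prod_(0 <= i < L) (1 - X K ^ (M * (2 * i%:Z + 1))).
    by apply: eq_bigr => i _; congr (1 - _ ^ _); lia.
  have -> : \prod_(0 <= i < L) (1 - X K ^ (d + M + M * i%:Z + (M - d + M * i%:Z))) =
            \prod_(0 <= i < L) (1 - X K ^ (M * (2 * i%:Z + 2))).
    by apply: eq_bigr => i _; congr (1 - _ ^ _); lia.
  have d2 : 0 < d + M by lia.
  have n3 := pochX_neq0 L d2; have n4 := one_sub_X_neq0 d0.
  move: (\prod_(0 <= i < L) _) (\prod_(0 <= i < L) _) (poch y L) (poch (X K ^ (M - d)) L)
    (poch (X K ^ (d + M)) L) (1 - y) n1 n2 n3 n4 => p q r s t v h1 h2 h3 h4.
  by field; rewrite h1 h2 h3 h4.
apply: nnM; first by apply: nn_prod => i _; apply: nn_pair; nia.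
by apply: nnM (nn_geom d0); apply: nn_prod => i _; apply: nn_pair; nia.
Qed.

End Positivity.

(** * Dissection of the crank series *)

Lemma listE_sum : collect (flatten [seq listE b%:Z | b <- iota 0 11]) = [::].
Proof. by apply/eqP; vm_compute. Qed.

Lemma cst_inj (F : fieldType) (K : lfield F) : injective (cst K).
Proof.
move=> x y /eqP; rewrite -subr_eq0 -rmorphB => /eqP /liota_eq0 h.
by have := congr1 (fun f => coefs f 0) h; rewrite coefsB coefs0 /= => /eqP; rewrite subr_eq0 => /eqP.
Qed.

Section CrankDissection.
Variables (F : fieldType) (K : lfield F) (M : int).
Hypotheses (M_gt0 : 0 < M) (ME : M = 242) (two0 : 2%:R != 0 :> F).
Variable zeta : F.
Hypothesis zetaP : 11.-primitive_root zeta.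
Local Notation B := (X K ^ M).
Local Notation B2 := (X K ^ 2).
Local Notation J := (Submission.pinf M_gt0 B).
Local Notation qq := (Submission.pinf two_gt0 B2).
Local Notation pt := (pt K M_gt0).
Local Notation gt := (gt K).
Local Notation WW := (WW K M_gt0).
Local Notation gfw := (gfw K).
Local Notation cst := (cst K).
Local Notation vl := (@vl F K M M_gt0).

Definition UU : K := X K ^ 20 * J ^+ 2.

(** The partition of 1 has crank $-1$; the two corrections install the conventional values
    $M(1,1)=1$ and $M(0,1)=-1$. *)
Definition MFp (b : nat) : K :=
  gfw (fun s => if (crank s == b%:Z %[mod 11])%Z then 1 else 0) +
  (if b == 1%N then B2 else 0) - (if b == 0%N then B2 else 0).

Definition Ex (n : int) : K := vl (listE n).

Lemma Ex_period n : Ex (n + 11) = Ex n.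
Proof.
by rewrite /Ex /listE (_ : residue (n + 11) = residue n) //; congr absz; rewrite modzDr.
Qed.

Lemma sum_period (G : int -> K) (a : nat) : (forall n, G (n + 11) = G n) ->
  \sum_(0 <= j < 11) G (j%:Z - a%:Z) = \sum_(0 <= j < 11) G j%:Z.
Proof.
move=> hG; elim: a => [|a IHa]; first by apply: eq_bigr => j _; rewrite subr0.
rewrite -IHa big_nat_recl // [RHS]big_nat_recr // addrC; congr (_ + _).
  by apply: eq_bigr => j _; congr G; lia.
by rewrite -hG; congr G; lia.
Qed.

Section Root.
Variable x : F.
Hypothesis x11 : x ^+ 11 = 1.
Local Notation cx := (cst x).

Lemma root_neq0 : x != 0.
Proof. by apply/eqP => h; move/eqP: x11; rewrite h expr0n /= eq_sym oner_eq0. Qed.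

Let cx0 : cx != 0 := cx_neq0 K root_neq0.

Lemma cx11 : cx ^+ 11 = 1. Proof. by rewrite -cstX // x11 cst1. Qed.

Lemma cx_mod (n k : int) : cx ^ (n + 11 * k) = cx ^ n.
Proof. by rewrite expfzDr // -exprz_exp -[cx ^ 11]/(cx ^+ 11) cx11 exp1rz mulr1. Qed.

(** Triple product in base $q$ at [cx], shifted by 5 to the exponents of [gt] and dissected modulo
    11; the powers of [cx] depend on the class only. *)
Lemma sum_pt_root : \sum_(0 <= a < 11) cx ^ a%:Z * pt a%:Z =
  (- cx) ^+ 5 * (1 - cx) * (Submission.pinf two_gt0 (cx * B2) * Submission.pinf two_gt0 (B2 / cx)) * qq.
Proof.
have h1 := hassum_shift (-5) (vanishing_jacobi two_gt0 cx0) (jacobi_triple two_gt0 cx0).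
have n0 : - cx != 0 by rewrite oppr_eq0.
have h2 : hassum (fun n : int => cx ^ n * gt n) ((- cx) ^+ 5 * (qq * Submission.theta two_gt0 cx)).
  apply: eq_hassum (hassumZ ((- cx) ^+ 5) h1) => n; rewrite /jterm mulrA.
  rewrite -[(- cx) ^+ 5]/((- cx) ^ 5%N%:Z) -expfzDr // (_ : 5%N%:Z + (n + -5) = n); last by lia.
  rewrite -[- cx]mulN1r expfzMl [_ * cx ^ n]mulrC -mulrA; congr (_ * _); rewrite /Submission.gt /Submission.mon; congr (_ * _ ^ _).
  by rewrite triE; lia.
have h3 (r : nat) : hassum (fun k => (fun n : int => cx ^ n * gt n) (11%N%:Z * k + r%:Z)) (cx ^ r%:Z * pt r%:Z).
  have [_ h] := pt_series K M_gt0 ME r%:Z.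
  apply: eq_hassum (hassumZ (cx ^ r%:Z) h) => k.
  by rewrite [11%N%:Z * k + _]addrC cx_mod.
rewrite -(@hassum_split F K 11 _ _ (fun r => cx ^ r%:Z * pt r%:Z) isT h2 h3).
by rewrite /Submission.theta (pinfS two_gt0 cx); ring.
Qed.

Definition crank_gf : K := gfw (fun s => x ^ crank s) + (cx - 1) * B2.

Lemma crank_gf_classes : crank_gf = \sum_(0 <= b < 11) cx ^ b%:Z * MFp b.
Proof.
have e : gfw (fun s => x ^ crank s) =
    \sum_(0 <= b < 11) cx ^ b%:Z * gfw (fun s => if (crank s == b%:Z %[mod 11])%Z then 1 else 0).
  have -> : \sum_(0 <= b < 11) cx ^ b%:Z * gfw (fun s => if (crank s == b%:Z %[mod 11])%Z then 1 else 0) =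
     \sum_(0 <= b < 11) gfw (fun s => x ^+ b * (if (crank s == b%:Z %[mod 11])%Z then 1 else 0)).
    by apply: eq_bigr => b _; rewrite gfwZ cstX.
  rewrite -gfw_sum; apply: gfw_ext => s _.
  pose r := absz (crank s %% 11)%Z.
  have hr : (r < 11)%N by rewrite /r; lia.
  rewrite (eq_big_nat _ _ (F2 := fun b => if r == b then x ^+ b else 0)); last first.
    move=> b /andP [_ hb]; have -> : (crank s == b%:Z %[mod 11])%Z = (r == b) by rewrite /r; lia.
    by case: ifP; rewrite ?mulr1 ?mulr0.
  rewrite (eq_bigr (fun b => if r == b then x ^+ r else 0)) => [|b _]; last by case: eqP => // ->.
  rewrite -big_mkcond sum_pick //.
  have -> : crank s = r%:Z + 11%N%:Z * (crank s %/ 11)%Z by rewrite /r; lia.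
  by rewrite expfzDr ?root_neq0 // -exprz_exp -[x ^ 11%N%:Z]/(x ^+ 11) x11 exp1rz mulr1.
have d : \sum_(0 <= b < 11) cx ^ b%:Z * ((if b == 1%N then B2 else 0) - (if b == 0%N then B2 else 0)) =
    (cx - 1) * B2.
  by rewrite sum11 /= expr0z expr1z !subrr !mulr0 !addr0 sub0r subr0; ring.
by rewrite /crank_gf e -d -big_split; apply: eq_bigr => b _; rewrite /MFp /=; ring.
Qed.

Lemma listC_vl (j : nat) : (j < 11)%N ->
  \sum_(0 <= a < 11) pt a%:Z * Ex (j%:Z - a%:Z) =
  (if j == 5%N then - (11%:R * WW ^+ 2) else 0) + (if j == 6%N then 11%:R * WW ^+ 2 else 0).
Proof.
move=> hj; have h0 : vl (listC j%:Z) = 0.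
  have hz (g : nat) : (g < 11)%N -> vl (grade_part g (listC j%:Z)) = 0.
    move=> hg; have /allP /(_ j%:Z) := check_crank.
    have -> : j%:Z \in [:: 0; 1; 2; 3; 4; 5; 6; 7; 8; 9; 10] by do 11! [case: j hj => // j hj].
    by move=> /(_ isT) /allP /(_ g); rewrite mem_iota => /(_ hg) /(curve_check_vl K M_gt0 ME two0).
  by rewrite (vl_grade K M_gt0 ME two0 (listC j%:Z)) sum11 !hz // !addr0.
move: h0; rewrite /listC vl_collect vl_cat => /eqP; rewrite addr_eq0 => /eqP h0.
have e1 : vl (flatten [seq mul_list [:: monomial [:: a%:Z] [::]] (listE (j%:Z - a%:Z)) | a <- iota 1 10]) =
    \sum_(0 <= a < 11) pt a%:Z * Ex (j%:Z - a%:Z).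
  rewrite big_ltn // (pt0 K M_gt0) mul0r add0r.
  have h (E : nat -> seq mitem) (l : seq nat) : all (fun a => ~~ (11 %| a%:Z)%Z) l ->
     vl (flatten [seq mul_list [:: monomial [:: a%:Z] [::]] (E a) | a <- l]) = \sum_(a <- l) pt a%:Z * vl (E a).
    elim: l => [|a l IHl]; first by rewrite vl_nil big_nil.
    rewrite [all _ _]/= => /andP [ha /IHl hl].
    have e : flatten [seq mul_list [:: monomial [:: a%:Z] [::]] (E a) | a <- a :: l] =
      mul_list [:: monomial [:: a%:Z] [::]] (E a) ++
      flatten [seq mul_list [:: monomial [:: a%:Z] [::]] (E a) | a <- l] by [].
    rewrite e vl_cat hl big_cons; congr (_ + _).
    have nj : all (fun t : mitem => ~~ t.2) [:: monomial [:: a%:Z] [::]].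
      by [].
    by rewrite (vl_mul K M_gt0 ME) // vl_seq1 (iv_monomial K M_gt0 ME) /= ?ha // big_seq1 big_nil divr1.
  exact: (h (fun a => listE (j%:Z - a%:Z)) (iota 1 10)).
rewrite -e1 h0; have w2 (z : Z) : vl (scale_list z (mul_list listW listW)) = ZE K z * WW ^+ 2.
  by rewrite vl_scale (vl_mul K M_gt0 ME) ?listW_nj // !(vl_listW K M_gt0 ME two0) expr2.
have -> : (j%:Z == 5) = (j == 5%N) by lia.
have -> : (j%:Z == 6) = (j == 6%N) by lia.
have [->|n5] := eqVneq j 5%N.
  transitivity (- (ZE K 11 * WW ^+ 2)); first by rewrite -w2.
  by rewrite [in RHS]/= addr0.
have [_|_] := eqVneq j 6%N.
  transitivity (- (ZE K (-11) * WW ^+ 2)); first by rewrite -w2.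
  by rewrite [in RHS]/= add0r -mulNr -[ZE K (-11)]/(- 11%:R) opprK.
by rewrite -[X in - X]/(vl [::]) vl_nil oppr0 addr0.
Qed.

Lemma sum_Ex_root : (\sum_(0 <= a < 11) cx ^ a%:Z * pt a%:Z) * (\sum_(0 <= b < 11) cx ^ b%:Z * Ex b%:Z) =
  - (11%:R * (cx ^+ 5 - cx ^+ 6) * WW ^+ 2).
Proof.
rewrite big_distrl /=.
have -> : \sum_(0 <= a < 11) cx ^ a%:Z * pt a%:Z * (\sum_(0 <= b < 11) cx ^ b%:Z * Ex b%:Z) =
   \sum_(0 <= a < 11) \sum_(0 <= j < 11) cx ^ j%:Z * (pt a%:Z * Ex (j%:Z - a%:Z)).
  apply: eq_bigr => a _; rewrite -(@sum_period (fun n => cx ^ n * Ex n) a); last first.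
    by move=> n; rewrite Ex_period -[n + 11]/(n + 11 * 1) cx_mod.
  rewrite big_distrr; apply: eq_bigr => j _ /=.
  have -> : cx ^ j%:Z = cx ^ a%:Z * cx ^ (j%:Z - a%:Z) by rewrite -expfzDr //; congr (_ ^ _); lia.
  by ring.
rewrite exchange_big /=.
rewrite (eq_big_nat _ _ (F2 := fun j => (if j == 5%N then - (11%:R * cx ^+ 5 * WW ^+ 2) else 0) +
   (if j == 6%N then 11%:R * cx ^+ 6 * WW ^+ 2 else 0))); last first.
  move=> j /andP [_ hj]; rewrite -big_distrr /= listC_vl // -[cx ^ j%:Z]/(cx ^+ j).
  by case: eqP => [->|_] /=; [ring | case: eqP => [->|_]; ring].
by rewrite sum11 /=; ring.
Qed.

(** Both sides are multiplied by the theta sum of [sum_pt_root], which is nonzero since [x != 1];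
    [crank_product] and [sum_Ex_root] then give the same multiple of $q^{10}J^2W^2$. *)
Lemma crank_root : x != 1 -> 11%:R * crank_gf = UU * \sum_(0 <= b < 11) cx ^ b%:Z * Ex b%:Z.
Proof.
move=> x1; have hp := crank_product K root_neq0; rewrite -/crank_gf in hp.
have q0 : qq != 0 by apply: pinfB_neq0.
have pp0 : Submission.pinf two_gt0 (cx * B2) * Submission.pinf two_gt0 (B2 / cx) != 0.
  by apply: contra q0 => /eqP h; rewrite -hp h mulr0.
have c1 : 1 - cx != 0.
  rewrite subr_eq0 eq_sym; apply: contra x1 => /eqP; rewrite -(cst1 K) => /eqP.
  by move=> /eqP /(@cst_inj F K) ->.
have z0 : \sum_(0 <= a < 11) cx ^ a%:Z * pt a%:Z != 0.
  rewrite sum_pt_root; apply: mulf_neq0 q0; apply: mulf_neq0 pp0; apply: mulf_neq0 c1.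
  by rewrite expf_neq0 // oppr_eq0.
apply: (mulfI z0); rewrite [RHS]mulrCA sum_Ex_root sum_pt_root.
have e : qq ^+ 2 = UU * WW ^+ 2.
  have x2 : (X K ^ 10) ^+ 2 = X K ^ 20 by rewrite expr2 -XD.
  by rewrite (euler_dissection K M_gt0 ME) exprMn exprMn x2.
transitivity (11%:R * ((- cx) ^+ 5 * (1 - cx)) * qq ^+ 2); first by rewrite expr2 -{2}hp; ring.
by rewrite e exprNn; ring.
Qed.

End Root.

Lemma sum_Ex : \sum_(0 <= b < 11) Ex b%:Z = 0.
Proof.
rewrite -[RHS](vl_nil K M_gt0) -listE_sum vl_collect /index_iota subn0.
elim: (iota 0 11) => [|b l IHl]; first by rewrite big_nil vl_nil.
have e : flatten [seq listE b%:Z | b <- b :: l] = listE b%:Z ++ flatten [seq listE b%:Z | b <- l] by [].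
by rewrite e big_cons vl_cat IHl.
Qed.

Lemma sum_MFp : \sum_(0 <= b < 11) MFp b = PF K.
Proof.
have e : (1 : F) ^+ 11 = 1 by rewrite expr1n.
have := crank_gf_classes e; rewrite /crank_gf cst1 subrr mul0r addr0 => h.
transitivity (\sum_(0 <= b < 11) (1 : K) ^ b%:Z * MFp b).
  by apply: eq_bigr => b _; rewrite exp1rz mul1r.
by rewrite -h; apply: gfw_ext => s _; rewrite exp1rz.
Qed.

(** The [D b] are coefficients of a polynomial of degree at most 10 with eleven roots. *)
Lemma fourier_inj (D : nat -> K) :
  (forall k : nat, (k < 11)%N -> \sum_(0 <= b < 11) cst (zeta ^+ k) ^ b%:Z * D b = 0) ->
  forall b, (b < 11)%N -> D b = 0.
Proof.
move=> h; pose p : {poly K} := \poly_(i < 11) D i.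
have p0 : p = 0.
  apply: (@roots_geq_poly_eq0 _ p [seq cst (zeta ^+ k) | k <- iota 0 11]).
  - apply/allP => y /mapP [k]; rewrite mem_iota => /andP [_ hk] ->.
    rewrite /root horner_poly; apply/eqP; rewrite -[RHS](h k hk) big_mkord.
    by apply: eq_bigr => i _; rewrite mulrC.
  - rewrite map_inj_in_uniq ?iota_uniq // => k l; rewrite !mem_iota => /andP [_ hk] /andP [_ hl] /(@cst_inj F K) /eqP.
    rewrite (eq_prim_root_expr zetaP).
    by rewrite !modn_small // => /eqP.
  by rewrite size_map size_iota size_poly.
by move=> b hb; have := congr1 (fun q : {poly K} => q`_b) p0; rewrite coef_poly hb coef0.
Qed.

(** Subtracting [PF K] removes the Fourier component at 1, the only one outside the scope of
    [crank_root]. *)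
Theorem crank_dissection b : (b < 11)%N -> 11%:R * MFp b - PF K = UU * Ex b%:Z.
Proof.
move=> hb; apply/eqP; rewrite -subr_eq0; apply/eqP.
apply: (@fourier_inj (fun b => 11%:R * MFp b - PF K - UU * Ex b%:Z)) => // k hk.
have e (x : K) : \sum_(0 <= b < 11) x ^ b%:Z * (11%:R * MFp b - PF K - UU * Ex b%:Z) =
   11%:R * (\sum_(0 <= b < 11) x ^ b%:Z * MFp b) - PF K * (\sum_(0 <= b < 11) x ^ b%:Z) -
   UU * (\sum_(0 <= b < 11) x ^ b%:Z * Ex b%:Z).
  by rewrite !big_distrr -!sumrB /=; apply: eq_bigr => i _; ring.
have z11 : (zeta ^+ k) ^+ 11 = 1 by rewrite exprAC (prim_expr_order zetaP) expr1n.
rewrite e -crank_gf_classes //; case: (eqVneq k 0%N) => [->|k0].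
  rewrite expr0 /crank_gf_classes; have e1 : (1 : F) ^+ 11 = 1 by rewrite expr1n.
  rewrite (crank_gf_classes e1) cst1.
  have -> : \sum_(0 <= b < 11) (1 : K) ^ b%:Z * MFp b = PF K.
    by rewrite -sum_MFp; apply: eq_bigr => i _; rewrite exp1rz mul1r.
  have -> : \sum_(0 <= b < 11) (1 : K) ^ b%:Z * Ex b%:Z = 0.
    by rewrite -[RHS]sum_Ex; apply: eq_bigr => i _; rewrite exp1rz mul1r.
  have -> : \sum_(0 <= b < 11) (1 : K) ^ b%:Z = 11%:R.
    by rewrite (eq_bigr (fun=> 1)) ?sumr_const_nat // => i _; rewrite exp1rz.
  by ring.
have z1 : zeta ^+ k != 1.
  rewrite -(expr0 zeta) (eq_prim_root_expr zetaP) mod0n modn_small //.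
rewrite (crank_root z11 z1).
have -> : \sum_(0 <= b < 11) cst (zeta ^+ k) ^ b%:Z = 0.
  have := subrX1 (cst (zeta ^+ k)) 11; rewrite -cstX // z11 cst1 subrr => /esym/eqP.
  rewrite mulf_eq0 => /orP [h|/eqP h]; last by rewrite -[RHS]h big_mkord.
  by exfalso; move: h z1; rewrite subr_eq0 -(cst1 K) => /eqP /(@cst_inj F K) ->; rewrite eqxx.
by ring.
Qed.

End CrankDissection.

(** * The residue classes of the combinations of rank and crank numbers *)

Definition full_list (lam mu : seq int) : seq mitem :=
  flatten [seq scale_list (Z_of_int al.1) (listT al.2) | al <- zip (row_A lam) multipliers] ++
  flatten [seq scale_list (Z_of_int (2 * ib.1)) (listE ib.2%:Z) | ib <- zip mu (iota 0 6)].

Lemma full_list_deg :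
  all (fun row => all (fun t => item_deg t == (-1)%ZZ) (full_list row.1.1.2 row.1.2)) rows.
Proof. by vm_compute. Qed.

Lemma rows_exponent : all (fun row => has (leq 2) row.2) rows.
Proof. by vm_compute. Qed.

Section Rows.
Variables (F : fieldType) (K : lfield F) (M : int).
Hypotheses (M_gt0 : 0 < M) (ME : M = 242) (nat_neq0 : forall n, n.+1%:R != 0 :> F).
Variable zeta : F.
Hypothesis zetaP : 11.-primitive_root zeta.
Local Notation B := (X K ^ M).
Local Notation B2 := (X K ^ 2).
Local Notation J := (Submission.pinf M_gt0 B).
Local Notation qq := (Submission.pinf two_gt0 B2).
Local Notation WW := (WW K M_gt0).
Local Notation zt := (@zt F K).
Local Notation gfw := (gfw K).
Local Notation cst := (cst K).
Local Notation vl := (@vl F K M M_gt0).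
Local Notation hom := (@hom F K).
Local Notation slice := (@slice F K).
Local Notation UU := (UU K M_gt0).
Local Notation Sp := (Sp K M_gt0 ME).
Local Notation SS := (SS K M_gt0 ME).
Local Notation PF := (PF K).
Local Notation Ex := (Ex K M_gt0).
Local Notation MFp := (MFp K).

Let two0 : 2%:R != 0 :> F := nat_neq0 1.

Lemma slice_geom (n : int) : n != 0 -> slice 0 0 (1 - zt n)^-1.
Proof.
have pos (p : int) : 0 < p -> slice 0 0 (1 - zt p)^-1.
  move=> p0; apply: slice_inv_pos; first by apply: vgeW (vge_X _ _); lia.
  by apply: slice_X; lia.
move=> n0; have [lt|le] := ltrP 0 n; first exact: pos.
have lt : 0 < - n by lia.
have -> : (1 - zt n)^-1 = - (zt (- n) * (1 - zt (- n))^-1).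
  have := @zt_neq1 F K M M_gt0 ME n n0; have m0 : - n != 0 by rewrite oppr_eq0.
  have := @zt_neq1 F K M M_gt0 ME _ m0; have -> : zt (- n) = (zt n)^-1 by rewrite /Submission.zt mulrN invr_expz.
  move: (zt n) (zt_neq0 K n) => z z0 h1 h2; field; rewrite z0 h2 /=.
  by rewrite ?andbT; apply: contra h2 => /eqP h; rewrite -(opprB z 1) h oppr0.
have sx : slice 0 0 (zt (- n)) by apply: slice_X; lia.
by have h := sliceM sx (pos _ lt); rewrite !addr0 in h; exact: sliceN h.
Qed.

Lemma hom_Sp b c : hom (c * (3 * c + 1) + 2 * b * c) (Sp b c).
Proof.
(* A crude lower bound for the exponents $3n^2+(2b+1)n$. *)
pose N : int := - (2 * `|b| + 1) ^+ 2.
have h : slice N (c * (3 * c + 1) + 2 * b * c - N) (Sp b c).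
  apply: hassum_slice (SpP K M_gt0 ME b c) => k; set n := c + 11 * k.
  rewrite /st; case: eqP => [_|/eqP n0]; first exact: slice0.
  rewrite -[N]addr0 -[_ - (N + 0)]addr0; apply: sliceM (slice_geom n0); rewrite addr0.
  apply: slice_mon; first by rewrite /N; nia.
  have -> : n * (3 * n + 1) + 2 * b * n - N - (c * (3 * c + 1) + 2 * b * c - N) =
     22 * (3 * c * k + 16 * k * k + b * k + tri (k + 1)).
    by have := triE (k + 1); rewrite /n; nia.
  exact: dvdz_mulr.
by have := slice_hom h; rewrite addrC subrK.
Qed.

Definition mult (b : nat) : int := nth 0 multipliers b.

(** The whole component of [QQ b] in the mock grade: the undetermined sum [Sp] together with
    [listM]. Both disappear at once when its coefficient is 0. *)
Definition mock (b : nat) : K := 22%:R * Sp b%:Z (mult b) / (X K ^ 10 * J) + UU * vl (listM (mult b)).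

Lemma hom_UU : hom 20 UU.
Proof. by have := homM (hom_X K 20) (homX_nat 2 (hom_J K M_gt0 ME two0)); rewrite mul0r addr0. Qed.

Lemma J_neq0 : J != 0. Proof. exact: pinfB_neq0. Qed.

Lemma listTM_deg c : c \in multipliers -> all (fun t => item_deg t == (-1)%ZZ) (listT c ++ listM c).
Proof. by move/(allP multipliers_mock) => /andP []. Qed.

Lemma mult_in b : (b < 5)%N -> mult b \in multipliers.
Proof. by move=> hb; apply: mem_nth. Qed.

Lemma hom_listM c : c \in multipliers -> hom (12 * (mock_grade c)%:Z + - 8) (vl (listM c)).
Proof.
move=> /listTM_deg; rewrite all_cat => /andP [_ h].
have := hom_vl K M_gt0 ME two0 (mock_grade c) h.
have -> : grade_part (mock_grade c) (listM c) = listM c; last by [].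
by rewrite /listM /grade_part filter_id.
Qed.

Lemma hom_mock b : (b < 5)%N -> hom (12 * (mock_grade (mult b))%:Z + 12) (mock b).
Proof.
move=> hb; apply: homD; last first.
  by apply: hom_eqc (homM hom_UU (hom_listM (mult_in hb))); lia.
have h := homM (homM (hom_nat K 22) (hom_Sp b%:Z (mult b))) (homV (homM (hom_X K 10) (hom_J K M_gt0 ME two0))).
apply: hom_eqc h; move: b hb; by do 5! [case=> [_|]; first by vm_compute].
Qed.

Definition QQ (b : nat) : K := mock b + UU * vl (listT (mult b)).

Lemma QQ_SS b : (b < 5)%N -> 22%:R * SS b%:Z + (2 * (5 - b%:Z))%:~R = qq * QQ b.
Proof.
move=> hb; have [kap hk] : exists kap : int, b%:Z = 27 - 3 * mult b - 11 * kap.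
  by exists ((27 - 3 * mult b - b%:Z) %/ 11)%Z; move: b hb; do 5! [case=> [_|]; first by vm_compute].
rewrite (rank_dissection K M_gt0 ME (mult_in hb) hk) (Gt_factor K M_gt0 ME two0 (mult_in hb)).
rewrite (euler_dissection K M_gt0 ME) /QQ /mock.
have x0 : X K ^ 10 != 0 by rewrite expfz_neq0 ?X_neq0.
have -> : X K ^ 30 = X K ^ 10 * X K ^ 20 by rewrite -XD.
rewrite /Submission.UU; move: (X K ^ 10) (X K ^ 20) x0 J J_neq0 WW (vl (listT _)) (vl (listM _)) (Sp _ _).
by move=> x y x0 j j0 w t m s; field; rewrite x0 j0.
Qed.

Definition NFp' (b : nat) : K := gfw (fun s => if (rank s == b%:Z %[mod 11])%Z then 1 else 0).

Lemma qq_neq0 : qq != 0. Proof. exact: pinfB_neq0. Qed.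

Lemma NF0 : 22%:R * NFp' 0 - 2%:R * PF = 2%:R * QQ 0.
Proof.
apply: (mulfI qq_neq0); have h := QQ_SS (isT : (0 < 5)%N).
have := rank_series0 K M_gt0 ME; have := PF_qq K; rewrite -/(NFp' 0) => p e.
transitivity (22%:R * (qq * NFp' 0) - 2%:R * (PF * qq)); first by ring.
transitivity (2%:R * (qq * QQ 0)); last by ring.
by rewrite e p -h; ring.
Qed.

(** The constants [2 * (5 - b)] of [QQ_SS] decrease by 2 at each step, which is the subtracted
    [2%:R * PF] after multiplication by the Euler product. *)
Lemma NFb b : (b.+1 < 5)%N -> 22%:R * NFp' b.+1 - 2%:R * PF = QQ b.+1 - QQ b.
Proof.
move=> hb; apply: (mulfI qq_neq0); have h := QQ_SS hb; have h' := QQ_SS (ltnW hb).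
have b5 : (1 <= b.+1 <= 5)%N by lia.
have := rank_series K M_gt0 ME b5; have -> : (b.+1 == 5%N) = false by lia.
rewrite -/(NFp' b.+1) [b.+1.-1]/= => e; have p := PF_qq K.
transitivity (22%:R * (qq * NFp' b.+1) - 2%:R * (PF * qq)); first by ring.
transitivity (qq * QQ b.+1 - qq * QQ b); last by ring.
rewrite e p -h -h'; have -> : b.+1%:Z = b%:Z + 1 by lia.
by rewrite !rmorphM !rmorphB !rmorphD /=; move: (SS _) (SS _) (b%:~R : K) => u v w; ring.
Qed.

Lemma NF5 : 22%:R * NFp' 5 - 2%:R * PF = - QQ 4.
Proof.
apply: (mulfI qq_neq0); have h := QQ_SS (isT : (4 < 5)%N).
have := @rank_series F K M M_gt0 ME 5 isT; rewrite -/(NFp' 5) /= sub0r => e; have p := PF_qq K.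
transitivity (22%:R * (qq * NFp' 5) - 2%:R * (PF * qq)); first by ring.
transitivity (- (qq * QQ 4)); last by ring.
by rewrite e p -h; ring.
Qed.

Lemma MFb b : (b < 11)%N -> 22%:R * MFp b - 2%:R * PF = 2%:R * (UU * Ex b%:Z).
Proof. by move=> hb; rewrite -(crank_dissection K M_gt0 ME two0 zetaP) //; ring. Qed.

Lemma cst_int (z : int) : cst z%:~R = z%:~R.
Proof.
have hn (n : nat) : cst n%:R = n%:R by elim: n => [|n IHn]; rewrite ?cst0 // -!natr1 cstD IHn cst1.
have hN x : cst (- x) = - cst x.
  by apply/eqP; rewrite -addr_eq0 -cstD addNr cst0.
by case: z => n; rewrite ?NegzE ?rmorphN /= ?hN /= ?pmulrn ?hn.
Qed.

Lemma ZE_int (z : int) : ZE K (Z_of_int z) = z%:~R.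
Proof. by rewrite /ZE Z_of_intK. Qed.

#[local] Opaque listT listE listM scale_list Z_of_int.

Lemma vl_flatten (T : Type) (l : seq T) (f : T -> int) (g : T -> seq mitem) :
  vl (flatten [seq scale_list (Z_of_int (f x)) (g x) | x <- l]) = \sum_(x <- l) (f x)%:~R * vl (g x).
Proof.
elim: l => [|x l IHl]; first by rewrite big_nil vl_nil.
have e : flatten [seq scale_list (Z_of_int (f y)) (g y) | y <- x :: l] =
  scale_list (Z_of_int (f x)) (g x) ++ flatten [seq scale_list (Z_of_int (f y)) (g y) | y <- l] by [].
by rewrite e big_cons vl_cat vl_scale ZE_int IHl.
Qed.

Lemma vl_full_list a0 a1 a2 a3 a4 a5 b0 b1 b2 b3 b4 b5 :
  let lam := [:: a0; a1; a2; a3; a4; a5] in let mu := [:: b0; b1; b2; b3; b4; b5] in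
  vl (full_list lam mu) = \sum_(b <- iota 0 5) ((row_A lam)`_b)%:~R * vl (listT (mult b)) +
    \sum_(b <- iota 0 6) 2%:R * (mu`_b)%:~R * Ex b%:Z.
Proof.
move=> lam mu; rewrite /full_list vl_cat.
rewrite (vl_flatten _ (fun x : int * int => x.1) (fun x => listT x.2)).
rewrite (vl_flatten _ (fun x : int * nat => 2 * x.1) (fun x => listE x.2%:Z)).
have -> : zip (row_A lam) multipliers = [seq ((row_A lam)`_b, mult b) | b <- iota 0 5] by [].
have -> : zip mu (iota 0 6) = [seq (mu`_b, b) | b <- iota 0 6] by [].
rewrite !big_map; congr (_ + _); apply: eq_bigr => b _.
by rewrite -[(_, _).1]/(mu`_b) -[(_, _).2]/b rmorphM.
Qed.

Definition LL (lam mu : seq int) : K :=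
  \sum_(b <- iota 0 6) (cst (lam`_b)%:~R * NFp' b + cst (mu`_b)%:~R * MFp b).

(** As the coefficients sum to 0, [2%:R * PF] may be subtracted from every series at no cost. *)
Lemma LL_QQ a0 a1 a2 a3 a4 a5 b0 b1 b2 b3 b4 b5 :
  let lam := [:: a0; a1; a2; a3; a4; a5] in let mu := [:: b0; b1; b2; b3; b4; b5] in
  foldr +%R 0 (lam ++ mu) = 0 ->
  22%:R * LL lam mu = \sum_(b <- iota 0 5) ((row_A lam)`_b)%:~R * mock b + UU * vl (full_list lam mu).
Proof.
move=> lam mu h0; rewrite vl_full_list -/lam -/mu.
have hs : \sum_(b <- iota 0 6) ((lam`_b)%:~R + (mu`_b)%:~R) = 0 :> K.
  have : (foldr +%R 0 (lam ++ mu))%:~R = 0 :> K by rewrite h0.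
  by rewrite /lam /mu /= !rmorphD /= rmorph0 !big_cons big_nil /= => h; rewrite -[RHS]h; ring.
have -> : 22%:R * LL lam mu = \sum_(b <- iota 0 6) ((lam`_b)%:~R * (22%:R * NFp' b - 2%:R * PF) +
    (mu`_b)%:~R * (22%:R * MFp b - 2%:R * PF)).
  transitivity (22%:R * LL lam mu - 2%:R * PF * \sum_(b <- iota 0 6) ((lam`_b)%:~R + (mu`_b)%:~R)).
    by rewrite hs mulr0 subr0.
  rewrite /LL !big_distrr -sumrB /=; apply: eq_bigr => b _; rewrite !cst_int.
  by move: (NFp' b) (MFp b) PF => u v w; ring.
rewrite big_split /=; have -> : \sum_(b <- iota 0 6) (mu`_b)%:~R * (22%:R * MFp b - 2%:R * PF) =
   UU * \sum_(b <- iota 0 6) 2%:R * (mu`_b)%:~R * Ex b%:Z.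
  rewrite big_distrr; apply: eq_big_seq => b; rewrite mem_iota => /andP [_ hb] /=.
  by rewrite MFb ?(leq_trans hb) //; ring.
rewrite mulrDr addrA; congr (_ + _).
have alg (p t : nat -> K) (u : K) :
    a0%:~R * (2%:R * (p 0%N + u * t 0%N)) + (a1%:~R * ((p 1%N + u * t 1%N) - (p 0%N + u * t 0%N)) +
    (a2%:~R * ((p 2%N + u * t 2%N) - (p 1%N + u * t 1%N)) +
    (a3%:~R * ((p 3%N + u * t 3%N) - (p 2%N + u * t 2%N)) +
    (a4%:~R * ((p 4%N + u * t 4%N) - (p 3%N + u * t 3%N)) + a5%:~R * - (p 4%N + u * t 4%N))))) =
   \sum_(b <- iota 0 5) ((row_A lam)`_b)%:~R * p b + u * \sum_(b <- iota 0 5) ((row_A lam)`_b)%:~R * t b.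
  by rewrite !big_cons !big_nil /lam /row_A /= !rmorphB !rmorphM /=; ring.
transitivity (a0%:~R * (2%:R * QQ 0) + (a1%:~R * (QQ 1 - QQ 0) + (a2%:~R * (QQ 2 - QQ 1) +
    (a3%:~R * (QQ 3 - QQ 2) + (a4%:~R * (QQ 4 - QQ 3) + a5%:~R * - QQ 4))))); last first.
  exact: (alg mock (fun b => vl (listT (mult b))) UU).
have gen (N : nat -> K) q0 q1 q2 q3 q4 q5 :
    N 0%N = q0 -> N 1%N = q1 -> N 2%N = q2 -> N 3%N = q3 -> N 4%N = q4 -> N 5%N = q5 ->
    \sum_(b <- iota 0 6) (lam`_b)%:~R * N b =
    a0%:~R * q0 + (a1%:~R * q1 + (a2%:~R * q2 + (a3%:~R * q3 + (a4%:~R * q4 + a5%:~R * q5)))).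
  by move=> <- <- <- <- <- <-; rewrite !big_cons big_nil addr0.
exact: (gen (fun b => 22%:R * NFp' b - 2%:R * PF) _ _ _ _ _ _ NF0 (@NFb 0 isT) (@NFb 1 isT) (@NFb 2 isT)
  (@NFb 3 isT) NF5).
Qed.

Definition nf (b n : nat) : F := \sum_(s <- parts n) (if (rank s == b%:Z %[mod 11])%Z then 1 else 0).
Definition mf (b n : nat) : F := \sum_(s <- parts n) (if (crank s == b%:Z %[mod 11])%Z then 1 else 0) +
  (if (b == 1%N) && (n == 1%N) then 1 else 0) - (if (b == 0%N) && (n == 1%N) then 1 else 0).
Definition cT (lam mu : seq int) (n : nat) : F :=
  \sum_(b <- iota 0 6) ((lam`_b)%:~R * nf b n + (mu`_b)%:~R * mf b n).

Lemma gfunZ a c : liota K (gfun (fun n => a * c n)) = cst a * liota K (gfun c).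
Proof.
rewrite -rmorphM; congr (liota K _); apply/fpsP => n; rewrite fpsCM /=.
by case: odd; rewrite ?mulr0.
Qed.

Lemma gfun_sum (I : Type) (r : seq I) (c : I -> nat -> F) :
  liota K (gfun (fun n => \sum_(i <- r) c i n)) = \sum_(i <- r) liota K (gfun (c i)).
Proof.
elim: r => [|i r IHr].
  rewrite big_nil -(rmorph0 (liota K)); congr (liota K _); apply/fpsP => n /=.
  by rewrite big_nil; case: odd.
rewrite big_cons -IHr -rmorphD -gfunD; congr (liota K (gfun _)); apply/funext => n.
by rewrite big_cons.
Qed.

Lemma MFp_mf b : MFp b = liota K (gfun (mf b)).
Proof.
have d (k : nat) : (if b == k then B2 else 0) =
    liota K (gfun (fun n => if (b == k) && (n == 1%N) then 1 else 0)).
  case: eqP => _ /=; first by rewrite (gfun_mono K 1 1) cst1 mul1r.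
  by rewrite -(rmorph0 (liota K)); congr (liota K _); apply/fpsP => n /=; case: odd.
rewrite /Submission.MFp (d 1%N) (d 0%N) /Submission.gfw -rmorphD -rmorphB -gfunD; congr (liota K _).
by apply/fpsP => n; rewrite coefsB /= /mf; case: odd; rewrite ?subr0.
Qed.

Lemma LL_cT lam mu : LL lam mu = liota K (gfun (cT lam mu)).
Proof.
rewrite /cT gfun_sum; apply: eq_bigr => b _.
by rewrite (gfunD (fun n => (lam`_b)%:~R * nf b n) (fun n => (mu`_b)%:~R * mf b n)) rmorphD !gfunZ MFp_mf.
Qed.

Definition LLr lam mu (r : nat) : K := liota K (gfun (fun n => if (n %% 11 == r)%N then cT lam mu n else 0)).

Lemma hom_LLr lam mu r : hom (2 * r%:Z) (LLr lam mu r).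
Proof.
apply: hom_supp => n /=; case: ifP => on; first by rewrite eqxx.
case: ((n./2 %% 11)%N =P r) => [e _|_]; last by rewrite eqxx.
have h1 := odd_double_half n; rewrite on in h1; have h2 := divn_eq n./2 11; rewrite e in h2.
have -> : n%:Z - 2 * r%:Z = 22 * (n./2 %/ 11)%N%:Z by move: h1 h2; move: (n./2 %/ 11)%N => q; lia.
exact: dvdz_mulr.
Qed.

Lemma LL_split lam mu : LL lam mu = \sum_(0 <= r < 11) LLr lam mu r.
Proof.
rewrite LL_cT -gfun_sum; congr (liota K (gfun _)); apply/funext => n.
by rewrite -big_mkcond sum_pick // ltn_mod.
Qed.

Definition gradeW (lam mu : seq int) (g : nat) : K :=
  \sum_(b <- iota 0 5) ((row_A lam)`_b)%:~R * (if mock_grade (mult b) == g then mock b else 0) +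
  UU * vl (grade_part g (full_list lam mu)).

Lemma mock_grade_lt c : (mock_grade c < 11)%N. Proof. by rewrite /mock_grade /residue; lia. Qed.

Lemma sum_gradeW lam mu : \sum_(0 <= g < 11) gradeW lam mu g =
  \sum_(b <- iota 0 5) ((row_A lam)`_b)%:~R * mock b + UU * vl (full_list lam mu).
Proof.
rewrite /gradeW big_split /= -big_distrr -(vl_grade K M_gt0 ME two0) /= exchange_big /=; congr (_ + _).
by apply: eq_bigr => b _; rewrite -big_distrr /= -big_mkcond sum_pick // mock_grade_lt.
Qed.

Lemma hom_gradeW lam mu g : all (fun t => item_deg t == (-1)%ZZ) (full_list lam mu) ->
  hom (12 * g%:Z + 12) (gradeW lam mu g).
Proof.
move=> hd; apply: homD.
  rewrite big_seq; apply: hom_sum => b; rewrite mem_iota => /andP [_ hb].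
  rewrite -[12 * _ + 12]add0r; apply: homM (hom_int K _) _.
  by case: eqP => [<-|_]; [exact: hom_mock | exact: hom0].
have h := homM hom_UU (hom_vl K M_gt0 ME two0 g hd).
apply: hom_eqc h; rewrite (_ : int_of_Z (-1)%ZZ = -1) //; lia.
Qed.

Lemma size_six (l : seq int) : size l == 6%N ->
  exists a0 a1 a2 a3 a4 a5, l = [:: a0; a1; a2; a3; a4; a5].
Proof.
by case: l => [|a0 [|a1 [|a2 [|a3 [|a4 [|a5 [|? ?]]]]]]] // _; exists a0, a1, a2, a3, a4, a5.
Qed.

Theorem row_series m lam mu e : (m, lam, mu, e) \in rows ->
  22%:R * LLr lam mu m = UU * iv K M_gt0 (row_target e).
Proof.
move=> hr; have := allP rows_ok _ hr; rewrite /row_ok => /and5P [/eqP h1 h2 /eqP h3 sl /and5P [sm _ _ m11 _]].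
have := allP full_list_deg _ hr; rewrite [(_, _, _, _).1.1.2]/= [(_, _, _, _).1.2]/= => hd.
set g0 := (2 * (m + 5) %% 11)%N in h1 h2 *.
have h22 : 22%:R * LL lam mu = \sum_(b <- iota 0 5) ((row_A lam)`_b)%:~R * mock b + UU * vl (full_list lam mu).
  have [a0 [a1 [a2 [a3 [a4 [a5 e1]]]]]] := size_six sl.
  have [b0 [b1 [b2 [b3 [b4 [b5 e2]]]]]] := size_six sm.
  by rewrite e1 e2 in h3 *; exact: LL_QQ h3.
rewrite -sum_gradeW LL_split in h22.
(* The class of grade [g] is $12g+12$ and that of the progression [r] is $2r$ modulo 22, so [r] is
   [6 * g + 6] modulo 11. *)
pose w g := gradeW lam mu g - 22%:R * LLr lam mu ((6 * g + 6) %% 11).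
have hw g : (g < 11)%N -> hom (12 * g%:Z + 2 * 6) (w g).
  move=> hg; apply: homD; first by have := hom_gradeW g hd.
  apply: homN; apply: hom_eqc (homM (hom_nat K 22) (hom_LLr lam mu _)); lia.
have sw : \sum_(0 <= g < 11) w g = 0.
  rewrite /w sumrB -h22 big_distrr /= -sumrB sum11; move: (LLr lam mu) => f.
  rewrite -[((6 * 0 + 6) %% 11)%N]/6%N -[((6 * 1 + 6) %% 11)%N]/1%N -[((6 * 2 + 6) %% 11)%N]/7%N -[((6 * 3 + 6) %% 11)%N]/2%N -[((6 * 4 + 6) %% 11)%N]/8%N -[((6 * 5 + 6) %% 11)%N]/3%N -[((6 * 6 + 6) %% 11)%N]/9%N -[((6 * 7 + 6) %% 11)%N]/4%N -[((6 * 8 + 6) %% 11)%N]/10%N -[((6 * 9 + 6) %% 11)%N]/5%N -[((6 * 10 + 6) %% 11)%N]/0%N.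
  ring.
have hg0 : (g0 < 11)%N by rewrite /g0 ltn_mod.
have wz : w g0 = 0 by solve [eapply hom_indep11; eassumption].
move: wz; rewrite /w => /eqP; rewrite subr_eq0 => /eqP.
have -> : ((6 * g0 + 6) %% 11)%N = m by rewrite /g0; lia.
move=> <-; rewrite /gradeW big1_seq ?add0r; last first.
  move=> b /andP [_]; rewrite mem_iota => /andP [_ hb].
  case: eqP => hg; rewrite ?mulr0 //.
  have hb5 : (b < size (zip (row_A lam) multipliers))%N by [].
  have := allP h2 _ (mem_nth (0, 0) hb5); rewrite nth_zip // [(_, _).2]/= [(_, _).1]/= -/(mult b) hg eqxx /=.
  by move=> /eqP ->; rewrite mul0r.
congr (_ * _); have := vl_collect K M_gt0 (scale_list (-1) [:: row_target e] ++ grade_part g0 (full_list lam mu)).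
rewrite -[grade_part g0 _]/(row_list (m, lam, mu, e)) h1 vl_nil vl_cat vl_scale vl_seq1.
have -> : ZE K (-1)%ZZ = - 1 by [].
by move/esym/eqP; rewrite mulN1r addrC subr_eq0 => /eqP.
Qed.

End Rows.

(** * The inequalities *)

Lemma target_algebra (R : comPzRingType)
    (x y a b y0 y1 y2 y3 y4 c0 c1 c2 c3 c4 t0 t1 t2 t3 t4 s0 s2 s4 : R) :
  s0 * s0 = 1 -> s2 * s2 = 1 -> s4 * s4 = 1 ->
  x * a * (242%:R * (s0 * s2 * s4) * (s0 * y0 * (c0 * t0) * (y1 * (c1 * t1) * (s2 * y2 * (c2 * t2) *
    (y3 * (c3 * t3) * (s4 * y4 * (c4 * t4)))))) * (y * b)) =
  242%:R * (x * y * (y0 * (y1 * (y2 * (y3 * y4)))) *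
    (a * (c0 * (c1 * (c2 * (c3 * c4)))) * b * (t0 * (t1 * (t2 * (t3 * t4)))))).
Proof.
move=> k0 k2 k4; rewrite -[RHS]mul1r -[X in X * _ = _]mulr1.
transitivity ((s0 * s0) * (s2 * s2) * (s4 * s4) * (242%:R * (x * y * (y0 * (y1 * (y2 * (y3 * y4)))) *
    (a * (c0 * (c1 * (c2 * (c3 * c4)))) * b * (t0 * (t1 * (t2 * (t3 * t4)))))))); first by ring.
by rewrite k0 k2 k4 !mul1r.
Qed.

Section Rows.
Variables (F : fieldType) (K : lfield F) (M : int).
Hypotheses (M_gt0 : 0 < M) (ME : M = 242) (nat_neq0 : forall n, n.+1%:R != 0 :> F).
Variable zeta : F.
Hypothesis zetaP : 11.-primitive_root zeta.
Local Notation B := (X K ^ M).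
Local Notation J := (Submission.pinf M_gt0 B).
Local Notation th a := (Submission.theta M_gt0 (X K ^ (22 * a))).
Local Notation pt := (pt K M_gt0).
Local Notation UU := (UU K M_gt0).

Let two0 : 2%:R != 0 :> F := nat_neq0 1.

Lemma nn_theta_prod (d : nat -> int) (e : nat -> nat) :
  (forall i, (i < 5)%N -> 0 < d i < M) -> has (fun i => (2 <= e i)%N) (iota 0 5) ->
  nn (J * \prod_(i <- iota 0 5) ((Submission.theta M_gt0 (X K ^ d i))^-1) ^+ e i).
Proof.
move=> hd /hasP [i hi ei]; rewrite (bigD1_seq i) ?iota_uniq //= mulrA.
have di j : j \in iota 0 5 -> (0 < d j) /\ (d j < M) by rewrite mem_iota => /andP [_ /hd /andP].
have [d0 d1] := di i hi; apply: nnM.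
  rewrite -(subnKC ei) exprD mulrA; apply: nnM; last by apply/nnX/nn_thetaV.
  by rewrite exprVn; exact: nn_theta2.
rewrite big_seq_cond; apply: nn_prod => j /andP [hj _]; have [? ?] := di j hj.
by apply/nnX/nn_thetaV.
Qed.

Lemma pt_pow (a : int) n : pt a ^+ n =
  ((- 1) ^ a) ^+ n * (X K ^ (a * (a - 11) + 30)) ^+ n * (J ^+ n * th a ^+ n).
Proof. by rewrite /Submission.pt /Submission.gt /Submission.mon !exprMn. Qed.

Lemma sgn_nat (a : nat) n : ((- 1) ^ a%:Z) ^+ n = (- 1) ^+ (odd a && odd n) :> K.
Proof. by rewrite -[(- 1) ^ _]/((- 1) ^+ a) -exprM -(signr_odd _ (a * n)) oddM. Qed.

Lemma zexpNn (x : K) n : zexp x (Z.opp (Z.of_nat n)) = (x ^+ n)^-1.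
Proof. by rewrite /zexp (_ : int_of_Z _ = - n%:Z) -?invr_expz //; lia. Qed.

Lemma target_value e0 e1 e2 e3 e4 : (e0 + e1 + e2 + e3 + e4 = 13)%N ->
  exists E : int, UU * iv K M_gt0 (row_target [:: e0; e1; e2; e3; e4]) =
    242%:R * (X K ^ E * (J * ((th 1)^-1 ^+ e0 * ((th 2)^-1 ^+ e1 * ((th 3)^-1 ^+ e2 * ((th 4)^-1 ^+ e3 * (th 5)^-1 ^+ e4)))))).
Proof.
move=> he; pose E : int := 138 - (20 * e0%:Z + 12 * e1%:Z + 6 * e2%:Z + 2 * e3%:Z); exists E.
have pw (a : nat) n : (0 < a < 6)%N -> zexp (pt a%:Z) (Z.opp (Z.of_nat n)) =
    (- 1) ^+ (odd a && odd n) * (X K ^ (- (a%:Z * (a%:Z - 11) + 30) * n%:Z)) * ((J ^+ n)^-1 * (th a%:Z)^-1 ^+ n).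
  move=> ha; rewrite zexpNn pt_pow; move: (th a%:Z) => t; rewrite sgn_nat !invfM exprVn; congr (_ * _ * _).
    by case: (_ && _); rewrite ?expr0 ?expr1 ?invrN1 ?invr1.
  by rewrite mulNr -invr_expz -exprz_exp.
rewrite iv5 /row_target; set z := (242 * _)%ZZ.
rewrite -[kth _ 0]/(Z.opp (Z.of_nat e0)) -[kth _ 1]/(Z.opp (Z.of_nat e1)) -[kth _ 2]/(Z.opp (Z.of_nat e2)).
rewrite -[kth _ 3]/(Z.opp (Z.of_nat e3)) -[kth _ 4]/(Z.opp (Z.of_nat e4)).
rewrite -[(_, _, true).2]/true -[(_, _, true).1.1]/z.
rewrite (pw 1%N) // (pw 2%N) // (pw 3%N) // (pw 4%N) // (pw 5%N) // !andTb !andFb expr0 !mul1r.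
have ez : ZE K z = 242%:R * ((- 1) ^+ odd e0 * (- 1) ^+ odd e2 * (- 1) ^+ odd e4).
  rewrite /z ZEM /row_sign -[(nth 0%N _ 0 + _ + _)%N]/(e0 + e2 + e4)%N !oddD.
  have z1 : ZE K (-1)%ZZ = - 1 by [].
  have z2 : ZE K 1%ZZ = 1 by [].
  have z3 : ZE K 242%ZZ = 242%:R by [].
  rewrite z3; congr (_ * _).
  by case: (odd e0); case: (odd e2); case: (odd e4); rewrite /= ?z1 ?z2 ?expr0 ?expr1; ring.
have s2 (b : bool) : (- 1) ^+ b * (- 1) ^+ b = 1 :> K by rewrite -expr2 sqrr_sign.
have xE : X K ^ E = X K ^ 138 * (X K ^ (- (1 * (1 - 11) + 30) * e0%:Z) * (X K ^ (- (2 * (2 - 11) + 30) * e1%:Z) *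
   (X K ^ (- (3 * (3 - 11) + 30) * e2%:Z) * (X K ^ (- (4 * (4 - 11) + 30) * e3%:Z) * X K ^ (- (5 * (5 - 11) + 30) * e4%:Z))))).
  by rewrite -!XD; congr (_ ^ _); rewrite /E; lia.
have x138 : X K ^ 138 = X K ^ 20 * X K ^ 118 by rewrite -XD.
have jE : J ^+ 2 * J ^+ 12 = J * (J ^+ e0 * (J ^+ e1 * (J ^+ e2 * (J ^+ e3 * J ^+ e4)))).
  by rewrite -!exprD -exprS; congr (_ ^+ _); lia.
have j0 n : J ^+ n != 0 by rewrite expf_neq0 // pinfB_neq0.
rewrite xE x138 ez /Submission.UU /D12.
have jE' : J ^+ 2 * ((J ^+ e0)^-1 * ((J ^+ e1)^-1 * ((J ^+ e2)^-1 * ((J ^+ e3)^-1 * (J ^+ e4)^-1)))) * J ^+ 12 = J.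
  rewrite mulrAC jE; move: (J ^+ e0) (J ^+ e1) (J ^+ e2) (J ^+ e3) (J ^+ e4) (j0 e0) (j0 e1) (j0 e2) (j0 e3) (j0 e4).
  by move=> u v w x y h1 h2 h3 h4 h5; field; rewrite h1 h2 h3 h4 h5.
rewrite -[X in _ = _ * (_ * (X * _))]jE'.
have k0 := s2 (odd e0); have k2 := s2 (odd e2); have k4 := s2 (odd e4).
exact: (target_algebra _ _ _ _ _ _ _ _ _ _ _ _ _ _ _ _ _ _ _ k0 k2 k4).
Qed.

(** [E] may be negative, so both sides are first multiplied by a power of [X] large enough to
    compare power series. *)
Lemma natural_extract (h f : fps F) (E : int) : natural_coefs f ->
  liota K h = X K ^ E * liota K f -> natural_coefs h.
Proof.
move=> hf e; pose N := `|E|%N.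
have e2 : fX F ^+ N * h = fX F ^+ absz (N%:Z + E) * f.
  apply: (tofrac_inj (K := K)); rewrite !rmorphM -!/(liota K _) e mulrA -!XfX -XD.
  by congr (_ ^ _ * _); rewrite /N; lia.
move=> n; have := congr1 (fun g => coefs g (n + N)) e2; rewrite !coefsXnM leq_addl addnK => ->.
by case: ifP => _; [exact: hf | exists 0%N].
Qed.

Theorem row_natural (m : nat) (lam mu : seq int) (e : seq nat) (n : nat) : (m, lam, mu, e) \in rows -> (n %% 11 = m)%N ->
  exists k : nat, cT F lam mu n = k%:R.
Proof.
move=> hr hn; have h := row_series K M_gt0 ME nat_neq0 zetaP hr.
have := allP rows_exponent _ hr; rewrite [(_, _, _, _).2]/= => h2.
have := allP rows_ok _ hr; rewrite /row_ok => /and5P [_ _ _ _ /and5P [_ se /eqP sn _ _]].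
have [e0 [e1 [e2 [e3 [e4 ee]]]]] : exists e0 e1 e2 e3 e4, e = [:: e0; e1; e2; e3; e4].
  by case: e se {hr h h2 sn} => [|e0 [|e1 [|e2 [|e3 [|e4 [|? ?]]]]]] // _; exists e0, e1, e2, e3, e4.
rewrite ee in h h2 sn; have {}sn : (e0 + e1 + e2 + e3 + e4 = 13)%N by rewrite -sn /=; lia.
have [E hE] := target_value sn; rewrite hE in h.
pose d (i : nat) : int := 22 * i.+1%:Z.
have hd i : (i < 5)%N -> 0 < d i < M by rewrite /d ME => hi; lia.
have he : has (fun i => (2 <= nth 0%N [:: e0; e1; e2; e3; e4] i)%N) (iota 0 5).
  by move: h2; rewrite /= !orbF.
have := nn_theta_prod hd he; rewrite !big_cons big_nil mulr1 => -[f hf ef].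
have ef' : J * ((th 1)^-1 ^+ e0 * ((th 2)^-1 ^+ e1 * ((th 3)^-1 ^+ e2 * ((th 4)^-1 ^+ e3 * (th 5)^-1 ^+ e4)))) =
  liota K f by exact: ef.
rewrite ef' in h.
have n22 : 22%:R != 0 :> K by exact: (K_nat_neq0 K (nat_neq0 21)).
have hl : LLr K lam mu m = X K ^ E * liota K (11%:R * f).
  by apply: (mulfI n22); rewrite h rmorphM rmorph_nat; move: (X K ^ E) (liota K f) => x y; ring.
have hf' : natural_coefs (11%:R * f).
  elim: 11%N => [|j IHj] i; first by exists 0%N; rewrite mul0r coefs0.
  by rewrite -natr1 mulrDl mul1r coefsD; have [[a ->] [b ->]] := (IHj i, hf i); exists (a + b)%N; rewrite natrD.
have [k hk] := natural_extract hf' hl (2 * n)%N.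
exists k; rewrite -hk /= mul2n odd_double doubleK hn eqxx //.
Qed.

End Rows.

(** * Return to the integer rank and crank numbers *)

Lemma count_sum (R : pzRingType) (T : Type) (P : pred T) (l : seq T) :
  \sum_(s <- l) (if P s then 1 else 0) = (count P l)%:R :> R.
Proof. by elim: l => [|s l IHl]; rewrite ?big_nil // big_cons IHl /= natrD; case: (P s). Qed.

Lemma parts0 : perm_eq (parts 0) [:: [::]].
Proof.
apply: uniq_perm; rewrite ?uniq_parts // => s; rewrite mem_parts inE; case: s => [|a s] //=.
by rewrite ispart_cons; case: a => //= a; rewrite andbF.
Qed.

Lemma parts1 : perm_eq (parts 1) [:: [:: 1%N]].
Proof.
apply: uniq_perm; rewrite ?uniq_parts // => s; rewrite mem_parts inE; case: s => [|a [|b s]] //=.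
  by rewrite ispart_cons /=; case: a => [|[|a]] //; rewrite addn0.
have -> : ([:: a, b & s] == [:: 1%N]) = false by case: eqP.
by apply/negbTE/negP; rewrite !ispart_cons => /andP [/and3P [a0 _ /and3P [b0 _ _]] /eqP]; rewrite /=; lia.
Qed.

Lemma nf_Nrk (F : fieldType) (b n : nat) : nf F b n = (Nrk b%:Z 11 n)%:~R.
Proof.
by rewrite /nf count_sum /Nrk (card_ptuple (fun s => (rank s == b%:Z %[mod 11%N%:Z])%Z)) -pmulrn.
Qed.

Lemma mf_Mrk (F : fieldType) (b n : nat) : (b < 6)%N -> mf F b n = (Mrk b%:Z 11 n)%:~R.
Proof.
move=> hb; rewrite /mf count_sum; case: n => [|[|n]].
- rewrite (permP parts0) !andbF addr0 subr0 /Mrk /= !big_cons big_nil.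
  by case: b hb => [|[|[|[|[|[|b]]]]]].
- rewrite (permP parts1) !andbT /Mrk /= !big_cons big_nil.
  by case: b hb => [|[|[|[|[|[|b]]]]]] // _; rewrite /= ?addr0 ?subr0 ?add0r ?sub0r.
rewrite !andbF addr0 subr0 /Mrk [(2 <= _)%N]/=.
by rewrite (card_ptuple (fun s => (crank s == b%:Z %[mod 11%N%:Z])%Z)) -pmulrn.
Qed.

Definition row_value (n : nat) (row : nat * seq int * seq int * seq nat) : int :=
  let: (m, lam, mu, _) := row in let N := NN n m in let M := MM n m in
  lam`_0 * N 0 + lam`_1 * N 1 + lam`_2 * N 2 + lam`_3 * N 3 + lam`_4 * N 4 + lam`_5 * N 5 +
  (mu`_0 * M 0 + mu`_1 * M 1 + mu`_2 * M 2 + mu`_3 * M 3 + mu`_4 * M 4 + mu`_5 * M 5).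

Lemma row_value_ge0 n row : row \in rows -> 0 <= row_value n row.
Proof.
case: row => [[[m lam] mu] e] hr.
(* The algebraic numbers provide characteristic 0 and the root of unity; 242 makes [B] equal to
   $q^{121}$. *)
have [zeta hz] := C_prim_root_exists (isT : (0 < 11)%N).
have nat0 (k : nat) : k.+1%:R != 0 :> algC by rewrite pnatr_eq0.
have m11 : (m < 11)%N.
  by have := allP rows_ok _ hr; rewrite /row_ok => /and5P [_ _ _ _ /and5P [_ _ _]].
have hn : ((11 * n + m) %% 11 = m)%N by rewrite mulnC modnMDl modn_small.
have [k hk] := @row_natural algC (fraclfield algC) 242 isT erefl nat0 zeta hz m lam mu e _ hr hn.
have e2 : cT algC lam mu (11 * n + m) = (row_value n (m, lam, mu, e))%:~R.
  rewrite /cT (eq_big_seq (fun b : nat => (lam`_b * NN n m b%:Z + mu`_b * MM n m b%:Z)%:~R)); last first.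
    by move=> b; rewrite mem_iota => /andP [_ hb]; rewrite nf_Nrk mf_Mrk // -!rmorphM -rmorphD.
  rewrite -rmorph_sum; congr (_%:~R); rewrite !big_cons big_nil /row_value.
  set N := NN n m; set M := MM n m.
  rewrite -[N 0%N%:Z]/(N 0) -[N 1%N%:Z]/(N 1) -[N 2%N%:Z]/(N 2) -[N 3%N%:Z]/(N 3) -[N 4%N%:Z]/(N 4) -[N 5%N%:Z]/(N 5).
  rewrite -[M 0%N%:Z]/(M 0) -[M 1%N%:Z]/(M 1) -[M 2%N%:Z]/(M 2) -[M 3%N%:Z]/(M 3) -[M 4%N%:Z]/(M 4) -[M 5%N%:Z]/(M 5).
  move: (N 0) (N 1) (N 2) (N 3) (N 4) (N 5) (M 0) (M 1) (M 2) (M 3) (M 4) (M 5) => *; ring.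
by move: hk; rewrite e2 pmulrn => /intr_inj ->.
Qed.

Theorem theorem2p1 (n : nat) :
  (let N := NN n 0 in let M := MM n 0 in
   [/\ N 0 + 2 * N 1 + M 1 >= 2 * N 2 + N 4 + M 0,
       N 0 + 2 * N 1 + 3 * N 2 + M 1 >= 3 * N 3 + 3 * N 5 + M 0,
       2 * N 2 + N 3 + N 5 >= 4 * N 4 &
       N 2 + 5 * N 3 + 3 * N 4 + M 0 >= N 0 + 2 * N 1 + 6 * N 5 + M 1]) /\
  (let N := NN n 1 in let M := MM n 1 in
   [/\ N 0 + 4 * N 2 + N 4 + M 0 >= 2 * N 1 + 3 * N 3 + N 5 + M 2,
       N 0 + 3 * N 1 + 6 * N 3 + M 0 >= 4 * N 2 + 6 * N 4 + M 2,
       2 * N 1 + 6 * N 4 >= N 2 + 3 * N 3 + 4 * N 5,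
       N 1 + 2 * N 2 + 3 * N 5 + 3 * M 2 >= N 0 + N 3 + 4 * N 4 + 2 * M 0 + M 1 &
       3 * N 2 + 2 * N 3 + N 4 + 3 * M 2 >= N 0 + N 1 + 4 * N 5 + 2 * M 0 + M 1]) /\
  (let N := NN n 2 in let M := MM n 2 in
   [/\ 3 * N 2 + N 4 >= 2 * N 0 + 2 * N 5,
       2 * N 1 + 2 * N 3 + N 5 + 2 * M 0 >= 2 * N 2 + 3 * N 4 + 2 * M 2,
       3 * N 0 + 2 * N 2 + M 2 >= N 1 + N 3 + 3 * N 5 + M 0,
       2 * N 0 + N 1 + N 3 + 3 * N 4 + M 0 >= 4 * N 2 + 3 * N 5 + M 2 &
       N 0 + 3 * N 1 + N 2 + 8 * N 5 + 3 * M 0 >= 8 * N 3 + 5 * N 4 + 3 * M 2]) /\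
  (let N := NN n 3 in let M := MM n 3 in
   [/\ N 0 + 2 * N 3 + M 1 >= N 1 + 2 * N 5 + M 0,
       5 * N 1 + 2 * N 2 + 2 * N 4 >= 2 * N 0 + 4 * N 3 + 3 * N 5,
       2 * N 0 + 4 * N 3 + N 5 + M 0 >= N 1 + 3 * N 2 + 3 * N 4 + M 1,
       6 * N 2 + 3 * N 5 + 5 * M 1 >= N 0 + N 1 + 2 * N 3 + 5 * N 4 + 5 * M 0 &
       4 * N 0 + 2 * N 1 + 4 * N 4 + 3 * M 0 >= 7 * N 2 + 3 * N 3 + 3 * M 1]) /\
  (let N := NN n 4 in let M := MM n 4 in
   [/\ 4 * N 1 + 3 * N 3 + 5 * M 1 >= 2 * N 0 + 3 * N 2 + N 4 + N 5 + 5 * M 0,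
       4 * N 0 + 5 * N 2 + 3 * M 0 >= 5 * N 1 + 2 * N 3 + N 4 + N 5 + 3 * M 1,
       3 * N 1 + N 2 + M 0 >= 2 * N 0 + 2 * N 3 + M 1 &
       3 * N 0 + N 4 + N 5 + M 1 >= 3 * N 2 + 2 * N 3 + M 0]) /\
  (let N := NN n 5 in let M := MM n 5 in
   [/\ 3 * N 0 + N 2 + N 5 + 2 * M 2 >= 2 * N 1 + 3 * N 3 + 2 * M 0,
       7 * N 1 + N 4 + 3 * M 2 >= 3 * N 0 + 2 * N 2 + N 3 + 2 * N 5 + 3 * M 0,
       2 * N 0 + N 2 + 3 * N 3 + N 5 + 4 * M 0 >= 3 * N 1 + 4 * N 4 + 4 * M 2,
       4 * N 2 + 7 * N 3 + 2 * N 4 >= 4 * N 0 + 2 * N 1 + 7 * N 5 &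
       4 * N 1 + N 2 + 2 * N 4 + N 5 + 5 * M 2 >= 2 * N 0 + 6 * N 3 + 5 * M 0]) /\
  (let N := NN n 7 in let M := MM n 7 in
   [/\ N 0 + 2 * N 4 + 2 * M 0 >= 2 * N 3 + N 5 + 2 * M 1,
       3 * N 0 + N 1 + N 2 + 7 * N 3 + 4 * N 5 >= 5 * N 4 + 4 * M 0 + 7 * M 1,
       4 * N 1 + 4 * N 2 + 3 * N 4 + 4 * M 1 >= 4 * N 0 + 6 * N 3 + N 5 + 4 * M 0 &
       N 0 + 5 * N 3 + 2 * N 4 >= 2 * N 1 + 2 * N 2 + 4 * N 5]) /\
  (let N := NN n 8 in let M := MM n 8 in
   [/\ N 0 + 2 * N 2 + 3 * N 4 + 5 * M 0 >= 3 * N 1 + 3 * N 5 + 5 * M 1,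
       2 * N 1 + 4 * N 3 + 2 * N 5 + 3 * M 1 >= N 0 + 2 * N 2 + 5 * N 4 + 3 * M 0,
       2 * N 1 + 5 * N 2 + 2 * N 5 + M 1 >= 3 * N 0 + 5 * N 3 + N 4 + M 0,
       7 * N 0 + 4 * N 1 + 5 * N 4 + 4 * N 5 >= 8 * N 2 + N 3 + 4 * M 0 + 7 * M 1 &
       5 * N 0 + 6 * N 1 + 4 * N 3 + 2 * N 4 >= N 2 + 5 * N 5 + 6 * M 0 + 5 * M 1]) /\
  (let N := NN n 9 in let M := MM n 9 in
   [/\ 4 * N 2 + M 0 >= 2 * N 1 + N 3 + N 4 + M 1,
       4 * N 1 + N 3 + N 4 >= N 0 + 3 * N 2 + 2 * N 5,
       4 * N 0 + 3 * N 3 + 3 * N 4 + 4 * M 0 >= 2 * N 1 + 5 * N 2 + 3 * N 5 + 4 * M 1 &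
       3 * N 1 + 4 * N 2 + 7 * N 5 + 3 * M 1 >= 2 * N 0 + 6 * N 3 + 6 * N 4 + 3 * M 0]) /\
  (let N := NN n 10 in let M := MM n 10 in
   [/\ 3 * N 1 + 2 * N 5 + 2 * M 3 >= 2 * N 2 + 2 * N 3 + N 4 + 2 * M 0,
       3 * N 0 + N 2 + N 3 + M 0 >= 3 * N 1 + 2 * N 4 + M 3,
       2 * N 1 + 4 * N 4 + M 3 >= N 0 + N 2 + N 3 + 3 * N 5 + M 0 &
       6 * N 2 + 6 * N 3 + 6 * M 0 + 5 * M 3 >= 6 * N 0 + 6 * N 1 + 3 * N 4 + 8 * N 5]).
Proof.
(* Each inequality is the nonnegativity of one entry of [rows], taken in order. *)
have r (k : nat) : (k < 45)%N -> 0 <= row_value n (nth (0%N, [::], [::], [::]) rows k).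
  by move=> hk; apply: row_value_ge0; apply: mem_nth.
Ltac row r k := let h := fresh in have h := r k isT; rewrite /row_value /= in h; lia.
split; first by split; [row r 0%N | row r 1%N | row r 2%N | row r 3%N].
split; first by split; [row r 4%N | row r 5%N | row r 6%N | row r 7%N | row r 8%N].
split; first by split; [row r 9%N | row r 10%N | row r 11%N | row r 12%N | row r 13%N].
split; first by split; [row r 14%N | row r 15%N | row r 16%N | row r 17%N | row r 18%N].
split; first by split; [row r 19%N | row r 20%N | row r 21%N | row r 22%N].
split; first by split; [row r 23%N | row r 24%N | row r 25%N | row r 26%N | row r 27%N].
split; first by split; [row r 28%N | row r 29%N | row r 30%N | row r 31%N].
split; first by split; [row r 32%N | row r 33%N | row r 34%N | row r 35%N | row r 36%N].
split; first by split; [row r 37%N | row r 38%N | row r 39%N | row r 40%N].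
by split; [row r 41%N | row r 42%N | row r 43%N | row r 44%N].
Qed.
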